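(* Let $\check J^{(N)}_{\rm soc}$ be the functional of $\sigma_0\in\mathcal U_c^n$ defined in the context (with $u_1,\dots,u_N\in\mathcal U_c^r$ fixed). The following statements are equivalent: (i) $\check J^{(N)}_{\rm soc}(\sigma_0)$ is uniformly convex in $\sigma_0$; (ii) $\bar J_i'(\sigma_0)$ is uniformly convex in $\sigma_0\in\mathcal U_c^n$, where $$\bar J_i'(\sigma_0)=\mathbb E\int_0^T\Big\{-\big|(I-\Gamma)z_i\big|_Q^2+|\sigma_0|^2_{R_0}\Big\}dt-\mathbb E|(I-\Gamma_0)z_i(T)|_G^2$$ subject to $dz_i(t)=Az_i(t)dt+[C_0z_i(t)+\sigma_0(t)]dW_0(t)$, $z_i(0)=0$; (iii) the Riccati equation on $[0,T]$ $$\dot K+KA+A^TK+C_0^TKC_0-C_0^TK(K+R_0)^{-1}KC_0+\Xi_1-Q=0,\qquad K(T)=\Xi_1^G-G,$$ admits a solution such that $K+R_0>0$.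
   Context: Fix $T>0$ and positive integers $n,r,N$. On a complete probability space $(\Omega,\mathcal F,\mathbb P)$ let $W_0,W_1,\dots,W_N$ be independent one-dimensional Brownian motions and $\mathbb F=\{\mathcal F_t\}_{0\le t\le T}$ their natural filtration augmented by the null sets. $L^2_{\mathbb F}(0,T;\mathbb R^\ell)$ is the space of $\mathbb F$-progressively measurable $\mathbb R^\ell$-valued processes $s$ with $\|s\|^2_{L^2}=\mathbb E\int_0^T|s|^2dt<\infty$; $\mathcal U_c^\ell=L^2_{\mathbb F}(0,T;\mathbb R^\ell)$. For symmetric $Q$, $|z|_Q^2=z^TQz$. A functional $J$ on $\mathcal U_c^n$ is uniformly convex if for some $\delta>0$, $J(\lambda a+(1-\lambda)b)\le\lambda J(a)+(1-\lambda)J(b)-\delta\lambda(1-\lambda)\|a-b\|_{L^2}^2$ for all $a,b\in\mathcal U_c^n$, $\lambda\in[0,1]$. Data: $A,C_0,\Gamma,\Gamma_0\in\mathbb R^{n\times n}$; $B,D,D_0\in\mathbb R^{n\times r}$; symmetric constant matrices $Q\ge0$, $G\ge 0$, $R>0$, $R_0>0$; $f,\sigma,\eta\in L^2_{\mathbb F}(0,T;\mathbb R^n)$; $\eta_0$ a square-integrable $\mathcal F_T$-measurable $\mathbb R^n$-valued random vector; $x_0\in\mathbb R^n$. For given $u_i\in\mathcal U_c^r$ and $\sigma_0\in\mathcal U_c^n$ the states are, for $i=1,\dots,N$, $$dx_i=[Ax_i+Bu_i+f]dt+[Du_i+\sigma]dW_i+[C_0x_i+D_0u_i+\sigma_0]dW_0,\quad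 x_i(0)=x_0,$$ $x^{(N)}=\frac1N\sum_{j=1}^Nx_j$, and $$\check J^{(N)}_{\rm soc}(\sigma_0)=\frac12\sum_{i=1}^N\Big(\mathbb E\int_0^T\Big\{-\big|x_i-\Gamma x^{(N)}-\eta\big|_Q^2+|\sigma_0|^2_{R_0}\Big\}dt-\mathbb E\big|x_i(T)-\Gamma_0x^{(N)}(T)-\eta_0\big|_G^2\Big).$$ Put $\Xi_1=\Gamma^TQ+Q\Gamma-\Gamma^TQ\Gamma$ and $\Xi_1^G=\Gamma_0^TG+G\Gamma_0-\Gamma_0^TG\Gamma_0$. *)

(* Defs.v *)
From HB Require Import structures.
From mathcomp Require Import all_boot all_order all_algebra.
From mathcomp Require Import all_classical all_reals all_analysis.

Set Implicit Arguments.
Unset Strict Implicit.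
Unset Printing Implicit Defensive.

Import Order.TTheory GRing.Theory Num.Theory.
Import numFieldNormedType.Exports.

Local Open Scope classical_set_scope.
Local Open Scope ring_scope.

Section Matrices.
Context {R : realType}.

Definition qform n (Q : 'M[R]_n) (z : 'cV[R]_n) : R := (z^T *m Q *m z) 0 0.

(* The analysis library norms matrices by the sup norm; this is the square of
   the Euclidean norm. *)
Definition sqnorm n (z : 'cV[R]_n) : R := \sum_j z j 0 ^+ 2.

Definition psdef n (Q : 'M[R]_n) : Prop :=
  Q^T = Q /\ forall z : 'cV[R]_n, 0 <= qform Q z.

Definition pdef n (Q : 'M[R]_n) : Prop :=
  Q^T = Q /\ forall z : 'cV[R]_n, z != 0 -> 0 < qform Q z.

End Matrices.

(* Processes are functions on R x Om; only their values at times in [0, T]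
   are ever constrained or used. *)
Definition process (R : realType) d (Om : measurableType d) (l : nat) : Type :=
  R -> Om -> 'cV[R]_l.

Section BrownianMotions.
Context {R : realType} {d : measure_display} {Om : measurableType d}.
Variables (P : probability Om R) (T : R).

Definition past (X : R -> Om -> R) (t : R) : set (set Om) :=
  [set A | exists s, 0 <= s <= t /\
                     preimage_set_system setT (X s) measurable A].

Definition brownian (X : R -> Om -> R) : Prop :=
  [/\ forall t, 0 <= t <= T -> measurable_fun setT (X t),
      {ae P, forall w, X 0 w = 0},
      {ae P, forall w, {within `[0, T], continuous (fun t => X t w)}},
      forall s t (B : set R), 0 <= s -> s < t -> t <= T -> measurable B ->
        P [set w | B (X t w - X s w)] = normal_prob 0 (Num.sqrt (t - s)) B &
      forall s t (A : set Om) (B : set R), 0 <= s -> s < t -> t <= T ->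
        <<s past X s >> A -> measurable B ->
        P (A `&` [set w | B (X t w - X s w)]) =
        (P A * P [set w | B (X t w - X s w)%R])%E].

(* Each family <<s past (X k) T >> contains setT, so the product rule over all
   indices covers that over subfamilies. *)
Definition independent_processes (I : finType) (X : I -> R -> Om -> R) : Prop :=
  forall A : I -> set Om, (forall k, <<s past (X k) T >> (A k)) ->
    P (\bigcap_k A k) = (\prod_k P (A k))%E.

Definition independent_brownians (I : finType) (X : I -> R -> Om -> R) : Prop :=
  (forall k, brownian (X k)) /\ independent_processes X.

End BrownianMotions.

Section StochasticCalculus.
Context {R : realType} {d : measure_display} {Om : measurableType d}.
Context {I : finType}.
Variables (P : probability Om R) (T : R) (W : I -> R -> Om -> R).

Notation mu := (@lebesgue_measure R).

Definition filtration_gen (t : R) : set (set Om) :=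
  (\bigcup_k past (W k) t) `|` P.-negligible.

(* Om equipped with the sigma-algebra F_t. *)
Local Notation Ft t := (g_sigma_algebraType (filtration_gen t)).

Definition Ft_measurable (t : R) (xi : Om -> R) : Prop :=
  measurable_fun setT (xi : Ft t -> R).

Definition progressive (X : R -> Om -> R) : Prop :=
  forall t, 0 <= t <= T ->
    measurable_fun (`[0, t] `*` setT) (fun p : R * Ft t => X p.1 p.2).

Definition L2norm2 l (s : process R Om l) : \bar R :=
  (\int[P]_w \int[mu]_(t in `[0%R, T]) (sqnorm (s t w))%:E)%E.

Definition L2F l (s : process R Om l) : Prop :=
  (forall j, progressive (fun t w => s t w j 0)) /\ (L2norm2 s < +oo)%E.

Definition L2_FT l (xi : Om -> 'cV[R]_l) : Prop :=
  (forall j, Ft_measurable T (fun w => xi w j 0)) /\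
  (\int[P]_w (sqnorm (xi w))%:E < +oo)%E.

Definition uniformly_convex l (J : process R Om l -> R) : Prop :=
  exists2 delta : R, 0 < delta &
    forall (a b : process R Om l) (lam : R),
      L2F a -> L2F b -> 0 <= lam <= 1 ->
      J (fun t w => lam *: a t w + (1 - lam) *: b t w) <=
      lam * J a + (1 - lam) * J b
      - delta * lam * (1 - lam) * fine (L2norm2 (fun t w => a t w - b t w)).

Record simple_process := SimpleProcess {
  sp_size : nat;
  sp_time : nat -> R;
  sp_coef : nat -> Om -> R;
  sp_time_itv : forall j, (j <= sp_size)%N -> 0 <= sp_time j <= T;
  sp_time_nd : forall j, (j < sp_size)%N -> sp_time j <= sp_time j.+1;
  sp_coef_meas : forall j, (j < sp_size)%N ->
    Ft_measurable (sp_time j) (sp_coef j);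
  sp_coef_bounded : forall j, (j < sp_size)%N ->
    exists M, forall w, `|sp_coef j w| <= M }.

Definition simple_val (S : simple_process) (t : R) (w : Om) : R :=
  \sum_(j < sp_size S)
    sp_coef S j w * \1_(`]sp_time S j, sp_time S j.+1]) t.

Definition simple_int (k : I) (S : simple_process) (t : R) (w : Om) : R :=
  \sum_(j < sp_size S)
    sp_coef S j w * (W k (Num.min (sp_time S j.+1) t) w
                     - W k (Num.min (sp_time S j) t) w).

(* Y is (a continuous version of) the Ito integral process of H against W k.
   Adaptedness of Y makes the integrands below measurable, so that the second
   limit is genuine L^2 convergence. *)
Definition ito_integral (k : I) (H Y : R -> Om -> R) : Prop :=
  [/\ forall t, 0 <= t <= T -> Ft_measurable t (Y t),
      {ae P, forall w, {within `[0, T], continuous (fun t => Y t w)}} &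
      exists S : nat -> simple_process,
        (\int[P]_w \int[mu]_(t in `[0%R, T])
           ((H t w - simple_val (S m) t w) ^+ 2)%:E)%E @[m --> \oo] --> 0%E /\
        forall t, 0 <= t <= T ->
          (\int[P]_w ((Y t w - simple_int k (S m) t w) ^+ 2)%:E)%E
            @[m --> \oo] --> 0%E].

(* dx = b dt + \sum_k g_k dW_k on [0, T], x(0) = x0. *)
Definition ito_process l (x0 : 'cV[R]_l) (b : process R Om l)
    (g : I -> process R Om l) (x : process R Om l) : Prop :=
  exists2 Y : I -> process R Om l,
    forall k j, ito_integral k (fun t w => g k t w j 0) (fun t w => Y k t w j 0) &
    {ae P, forall w, forall t, 0 <= t <= T -> forall j,
       x t w j 0 = x0 j 0 + \int[mu]_(s in `[0, t]) b s w j 0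
                   + \sum_k Y k t w j 0}.

(* dx = b(x) dt + \sum_k g_k(x) dW_k, x(0) = x0; for the Lipschitz equations
   below a solution exists and is unique up to indistinguishability. *)
Definition sde_solution l (x0 : 'cV[R]_l)
    (b : process R Om l -> process R Om l)
    (g : process R Om l -> I -> process R Om l) : process R Om l :=
  xget (fun _ _ => 0) [set x | L2F x /\ ito_process x0 (b x) (g x) x].

End StochasticCalculus.

Section Game.
Context {R : realType} {d : measure_display} {Om : measurableType d}.
Context {n r N : nat}.
Variables (P : probability Om R) (T : R) (W : 'I_N.+1 -> R -> Om -> R).

Notation mu := (@lebesgue_measure R).

Definition E_int (g : R -> Om -> R) : R :=
  \int[P]_w \int[mu]_(t in `[0, T]) g t w.

(* Agent i : 'I_N is driven by W (lift ord0 i), the common noise is W ord0. *)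
Definition agent_state (A C0 : 'M[R]_n) (B D D0 : 'M[R]_(n, r))
    (f sigma : process R Om n) (x0 : 'cV[R]_n) (u : 'I_N -> process R Om r)
    (sigma0 : process R Om n) (i : 'I_N) : process R Om n :=
  sde_solution P T W x0
    (fun x t w => A *m x t w + B *m u i t w + f t w)
    (fun x k t w =>
       if k == ord0 then C0 *m x t w + D0 *m u i t w + sigma0 t w
       else if k == lift ord0 i then D *m u i t w + sigma t w
       else 0).

Definition mean_state (x : 'I_N -> process R Om n) : process R Om n :=
  fun t w => N%:R^-1 *: \sum_i x i t w.

Definition J_soc (A C0 Gam Gam0 : 'M[R]_n) (B D D0 : 'M[R]_(n, r))
    (Q G R0 : 'M[R]_n) (f sigma eta : process R Om n) (eta0 : Om -> 'cV[R]_n)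
    (x0 : 'cV[R]_n) (u : 'I_N -> process R Om r)
    (sigma0 : process R Om n) : R :=
  let x := agent_state A C0 B D D0 f sigma x0 u sigma0 in
  let xN := mean_state x in
  2^-1 * \sum_i
    (E_int (fun t w => - qform Q (x i t w - Gam *m xN t w - eta t w)
                       + qform R0 (sigma0 t w))
     - \int[P]_w qform G (x i T w - Gam0 *m xN T w - eta0 w)).

Definition hom_state (A C0 : 'M[R]_n) (sigma0 : process R Om n) : process R Om n :=
  sde_solution P T W 0
    (fun z t w => A *m z t w)
    (fun z k t w => if k == ord0 then C0 *m z t w + sigma0 t w else 0).

Definition J_hom (A C0 Gam Gam0 Q G R0 : 'M[R]_n)
    (sigma0 : process R Om n) : R :=
  let z := hom_state A C0 sigma0 in
  E_int (fun t w => - qform Q ((1%:M - Gam) *m z t w) + qform R0 (sigma0 t w))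
  - \int[P]_w qform G ((1%:M - Gam0) *m z T w).

End Game.

Section Riccati.
Context {R : realType} {n : nat}.

Definition Xi (Gam Q : 'M[R]_n) : 'M[R]_n :=
  Gam^T *m Q + Q *m Gam - Gam^T *m Q *m Gam.

(* Continuity on [0, T] together with the equation on ]0, T[ gives the equation,
   with one-sided derivatives, at the end points as well. *)
Definition riccati_solution (T : R) (A C0 Gam Gam0 Q G R0 : 'M[R]_n)
    (K : R -> 'M[R]_n) : Prop :=
  [/\ forall i j, {within `[0, T], continuous (fun t => K t i j)},
      forall t, 0 < t < T -> forall i j, derivable (fun s => K s i j) t 1,
      forall t, 0 < t < T ->
        \matrix_(i, j) (fun s => K s i j)^`()%classic t
        + K t *m A + A^T *m K t + C0^T *m K t *m C0
        - C0^T *m K t *m invmx (K t + R0) *m K t *m C0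
        + Xi Gam Q - Q = 0 &
      K T = Xi Gam0 G - G].

End Riccati.

(* Main.v *)
(* J_soc and J_hom are quadratic in sigma0. By linearity of the state equation the
   difference of the states of agent i under two controls is the state z of
   J_hom driven by their difference, hence so is the difference of the means, and
   the second-order part of J_soc is N/2 * J_hom. Both functionals are therefore
   uniformly convex exactly when J_hom c >= delta |c|^2 for some delta > 0.

   If K is C^1 with K(T) = Xi_1^G - G, the Ito formula for z^T K z writes J_hom c
   as the integral of a quadratic form in (z, c); if K solves the Riccati
   equation, this form is |c + L z|^2_(K + R0) with L = (K + R0)^-1 K C0. Since
   z solves a linear equation driven by v = c + L z, |c| is bounded by |v|, so
   K + R0 > 0 implies coercivity.

   Conversely, replace (K + R0)^-1 by a bounded Lipschitz function: the resulting
   equation has a solution K on [0, T], bounded independently of the truncation.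
   If the truncation is inactive on ]s, T], testing coercivity with a short pulse
   v before time s followed by the feedback c = -L z gives
   K(s) + R0 >= (3/4) delta, a margin which keeps the truncation inactive slightly
   before s; hence it is inactive on all of [0, T].

   The states exist by Picard iteration: an adapted square-integrable integrand is
   approximated by its averages over the preceding grid cell, and the integrals of
   the approximations converge uniformly in time by Kolmogorov's inequality. *)

Require Import Defs.
From mathcomp Require Import all_boot all_order all_algebra.
From mathcomp Require Import all_classical all_reals all_analysis.
From mathcomp Require Import perm measurable_realfun ring lra.

Set Implicit Arguments.
Unset Strict Implicit.
Unset Printing Implicit Defensive.

Import Order.TTheory GRing.Theory Num.Theory.
Import numFieldNormedType.Exports.

Local Open Scope classical_set_scope.
Local Open Scope ring_scope.

(** * Square-integrable functions *)

Section SquareIntegrable.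
Context {d : measure_display} {T : measurableType d} {R : realType}.
Variable mu : {measure set T -> \bar R}.
Implicit Types f g h : T -> R.

(** The states are chosen by [xget] with default 0, so the functionals say something about the
    equation only once solutions exist, and are unique, in the exact sense of [ito_process]. This
    forces the construction of the Ito integral in mean square. Ito's formula is needed only in
    expectation and for a deterministic weight [K]. It therefore reduces to a product rule for
    second moments: processes are split into time integrals and martingales, and the products are
    treated by integration by parts (Fubini on the two triangles of the time square), by the
    martingale property in the form of orthogonality, and by the isometry. Quadratic variations and
    conditional expectations do not occur. The Riccati equation has a quadratic right-hand side, so
    its solution might explode before coercivity can be used. Rewritten with the resolvent
    [(K + R0)^-1], it is affine in [K] up to a term which is bounded as soon as the resolvent is.
    The a priori bound is thus known before the truncation is fixed, and the truncation can be
    adapted to it. *)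

Definition sq f : Prop :=
  measurable_fun setT f /\ (\int[mu]_x (f x ^+ 2)%:E < +oo)%E.

Definition ip f g : R := \int[mu]_x (f x * g x).

(** The extended integral is used because [Rintegral] sends an infinite norm to 0, which would pass
    for convergence. *)
Definition cvg2 (u : nat -> T -> R) f : Prop :=
  (\int[mu]_x ((f x - u m x) ^+ 2)%:E)%E @[m --> \oo] --> 0%E.

Lemma measurable_sqr f : measurable_fun setT f ->
  measurable_fun setT (fun x => (f x ^+ 2)%:E).
Proof. by move=> mf; apply/measurable_EFinP; exact: measurable_funX. Qed.

Lemma sq_integrable f : sq f -> mu.-integrable setT (fun x => (f x ^+ 2)%:E).
Proof.
move=> [mf foo]; apply/integrableP; split; first exact: measurable_sqr.
by under eq_integral do rewrite gee0_abs ?lee_fin ?sqr_ge0//.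
Qed.

Lemma sq_le f g : measurable_fun setT f -> sq g ->
  (forall x, f x ^+ 2 <= g x ^+ 2) -> sq f.
Proof.
move=> mf [mg goo] fg; split => //; apply: le_lt_trans goo.
apply: ge0_le_integral => //; try exact: measurable_sqr.
- by move=> x _; rewrite lee_fin sqr_ge0.
- by move=> x _; rewrite lee_fin fg.
Qed.

Lemma sqr_add_le (a b : R) : (a + b) ^+ 2 <= 2 * a ^+ 2 + 2 * b ^+ 2.
Proof. by rewrite -subr_ge0 (_ : _ - _ = (a - b) ^+ 2) ?sqr_ge0//; ring. Qed.

Lemma sqZ (c : R) f : sq f -> sq (fun x => c * f x).
Proof.
move=> [mf foo]; split; first exact: measurable_funM.
under eq_integral do rewrite exprMn EFinM.
rewrite ge0_integralZl_EFin ?sqr_ge0//; last exact: measurable_sqr.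
- by rewrite lte_mul_pinfty// lee_fin sqr_ge0.
- by move=> x _; rewrite lee_fin sqr_ge0.
Qed.

Lemma int_sqrD_le f g : measurable_fun setT f -> measurable_fun setT g ->
  (\int[mu]_x ((f x + g x) ^+ 2)%:E <=
   2%:E * \int[mu]_x (f x ^+ 2)%:E + 2%:E * \int[mu]_x (g x ^+ 2)%:E)%E.
Proof.
move=> mf mg.
rewrite -!ge0_integralZl_EFin//; try exact: measurable_sqr;
  try by move=> x _; rewrite lee_fin sqr_ge0.
rewrite -ge0_integralD//; last 4 first.
- by move=> x _; rewrite -EFinM lee_fin mulr_ge0 ?sqr_ge0.
- by apply: measurable_funeM; exact: measurable_sqr.
- by move=> x _; rewrite -EFinM lee_fin mulr_ge0 ?sqr_ge0.
- by apply: measurable_funeM; exact: measurable_sqr.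
apply: ge0_le_integral => //.
- by move=> x _; rewrite lee_fin sqr_ge0.
- by apply: measurable_sqr; exact: measurable_funD.
- by apply: emeasurable_funD; apply: measurable_funeM; exact: measurable_sqr.
- by move=> x _; rewrite -!EFinM -EFinD lee_fin sqr_add_le.
Qed.

Lemma sqD f g : sq f -> sq g -> sq (fun x => f x + g x).
Proof.
move=> [mf foo] [mg goo]; split; first exact: measurable_funD.
apply: le_lt_trans (int_sqrD_le mf mg) _.
by rewrite lte_add_pinfty// lte_mul_pinfty.
Qed.

Lemma eq_sq f g : f =1 g -> sq f -> sq g.
Proof. by move=> /funext ->. Qed.

Lemma sqN f : sq f -> sq (fun x => - f x).
Proof. by move/(sqZ (-1)); apply: eq_sq => x; rewrite mulN1r. Qed.

Lemma sqB f g : sq f -> sq g -> sq (fun x => f x - g x).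
Proof. by move=> sf sg; apply: sqD => //; exact: sqN. Qed.

Lemma sq0 : sq (fun=> 0).
Proof.
split; first exact: measurable_cst.
by under eq_integral do rewrite expr0n/=; rewrite integral0.
Qed.

Lemma sq_sum (I : Type) (s : seq I) (P : pred I) (F : I -> T -> R) :
  (forall i, P i -> sq (F i)) -> sq (fun x => \sum_(i <- s | P i) F i x).
Proof.
move=> sF; elim: s => [|i s ih].
  by apply: eq_sq sq0 => x; rewrite big_nil.
have [Pi|Pi] := boolP (P i).
  by apply: eq_sq (sqD (sF i Pi) ih) => x; rewrite big_cons Pi.
by apply: eq_sq ih => x; rewrite big_cons (negbTE Pi).
Qed.

Lemma sq_bdM f h (M : R) : measurable_fun setT h -> (forall x, `|h x| <= M) ->
  sq f -> sq (fun x => h x * f x).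
Proof.
move=> mh hM sf; apply: (@sq_le _ (fun x => M * f x)).
- by apply: measurable_funM => //; case: sf.
- exact: sqZ.
- move=> x; rewrite !exprMn ler_wpM2r ?sqr_ge0//.
  by rewrite -real_normK ?num_real// ler_sqr ?nnegrE// (le_trans _ (hM x)).
Qed.

Lemma integrable_mulsq f g : sq f -> sq g ->
  mu.-integrable setT (fun x => (f x * g x)%:E).
Proof.
move=> sf sg; apply: (@le_integrable _ _ _ _ _ _ _
    (fun x => (f x ^+ 2)%:E + (g x ^+ 2)%:E)%E) => //.
- by apply/measurable_EFinP/measurable_funM; [case: sf|case: sg].
- move=> x _; rewrite -EFinD !abse_EFin lee_fin [leRHS]ger0_norm; last first.
    by rewrite addr_ge0 ?sqr_ge0.
  rewrite normrM -(real_normK (num_real (f x))) -(real_normK (num_real (g x))).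
  have := sqr_ge0 (`|f x| - `|g x|).
  have := mulr_ge0 (normr_ge0 (f x)) (normr_ge0 (g x)); nra.
- by apply: integrableD => //; exact: sq_integrable.
Qed.

Lemma ipC f g : ip f g = ip g f.
Proof. by rewrite /ip; under eq_Rintegral do rewrite mulrC. Qed.

Lemma eq_ip f f' g g' : f =1 f' -> g =1 g' -> ip f g = ip f' g'.
Proof. by move=> /funext -> /funext ->. Qed.

Lemma ipDl f g h : sq f -> sq g -> sq h ->
  ip (fun x => f x + g x) h = ip f h + ip g h.
Proof.
move=> sf sg sh; rewrite /ip; under eq_Rintegral do rewrite mulrDl.
by rewrite RintegralD//; exact: integrable_mulsq.
Qed.

Lemma ipZl (c : R) f h : sq f -> sq h -> ip (fun x => c * f x) h = c * ip f h.
Proof.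
move=> sf sh; rewrite /ip; under eq_Rintegral do rewrite -mulrA.
by rewrite RintegralZl//; exact: integrable_mulsq.
Qed.

Lemma ipDr f g h : sq f -> sq g -> sq h ->
  ip h (fun x => f x + g x) = ip h f + ip h g.
Proof. by move=> *; rewrite ipC ipDl// !(ipC h). Qed.

Lemma ipZr (c : R) f h : sq f -> sq h -> ip h (fun x => c * f x) = c * ip h f.
Proof. by move=> *; rewrite ipC ipZl// ipC. Qed.

Lemma ipNl f h : sq f -> sq h -> ip (fun x => - f x) h = - ip f h.
Proof.
move=> sf sh; rewrite -mulN1r -ipZl//; apply: eq_ip => // x.
by rewrite mulN1r.
Qed.

Lemma ipBl f g h : sq f -> sq g -> sq h ->
  ip (fun x => f x - g x) h = ip f h - ip g h.
Proof. by move=> sf sg sh; rewrite ipDl ?ipNl//; exact: sqN. Qed.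

Lemma ipBr f g h : sq f -> sq g -> sq h ->
  ip h (fun x => f x - g x) = ip h f - ip h g.
Proof. by move=> sf sg sh; rewrite ipC ipBl// !(ipC h). Qed.

Lemma ip0l f g : (forall x, f x = 0) -> ip f g = 0.
Proof.
move=> f0; rewrite /ip; under eq_Rintegral do rewrite f0 mul0r.
by rewrite /Rintegral integral0.
Qed.

Lemma ip0r f g : (forall x, g x = 0) -> ip f g = 0.
Proof. by move=> g0; rewrite ipC ip0l. Qed.

Lemma ip_ge0 f : 0 <= ip f f.
Proof. by apply: Rintegral_ge0 => x _; rewrite -expr2 sqr_ge0. Qed.

Lemma ip_bdM f g h : ip (fun x => h x * f x) g = ip f (fun x => h x * g x).
Proof. by rewrite /ip; apply: eq_Rintegral => x _; ring. Qed.

Lemma ipE f : sq f -> (\int[mu]_x (f x ^+ 2)%:E)%E = (ip f f)%:E.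
Proof.
move=> sf; rewrite /ip /Rintegral; under [in RHS]eq_integral do rewrite -expr2.
by rewrite fineK// integrable_fin_num//; exact: sq_integrable.
Qed.

Lemma le_ip f g : sq f -> sq g -> (forall x, f x ^+ 2 <= g x ^+ 2) ->
  ip f f <= ip g g.
Proof.
move=> sf sg fg; rewrite -lee_fin -!ipE//; apply: ge0_le_integral => //.
- by move=> x _; rewrite lee_fin sqr_ge0.
- by apply: measurable_sqr; case: sf.
- by apply: measurable_sqr; case: sg.
- by move=> x _; rewrite lee_fin.
Qed.

Lemma ipDD_le f g : sq f -> sq g ->
  ip (fun x => f x + g x) (fun x => f x + g x) <= 2 * ip f f + 2 * ip g g.
Proof.
move=> sf sg; rewrite -lee_fin EFinD !EFinM -!ipE//; last exact: sqD.
by apply: int_sqrD_le; [case: sf|case: sg].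
Qed.

Lemma ip_CS f g : sq f -> sq g -> ip f g ^+ 2 <= ip f f * ip g g.
Proof.
move=> sf sg.
have [f0|f0] := eqVneq (ip f f) 0; last first.
  have f1 : 0 < ip f f by rewrite lt_neqAle eq_sym f0 ip_ge0.
  have sf' := sqZ (ip f g) sf; have sg' := sqZ (ip f f) sg.
  have := ip_ge0 (fun x => ip f f * g x - ip f g * f x).
  rewrite ipBl ?ipBr//; try exact: sqB.
  rewrite !ipZl// !ipZr// (ipC g f) => h.
  have : 0 <= ip f f * (ip f f * ip g g - ip f g ^+ 2) by nra.
  by rewrite pmulr_rge0// subr_ge0.
rewrite f0 mul0r.
(* With [ip f f = 0] the norm of [s f + g] is affine in [s]. It is nonnegative for all [s], so its
   slope vanishes; otherwise the [s] chosen below would make it equal to -1. *)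
have h s : 0 <= 2 * s * ip f g + ip g g.
  have sf' := sqZ s sf.
  have := ip_ge0 (fun x => s * f x + g x).
  rewrite ipDl ?ipDr//; try exact: sqD.
  by rewrite !ipZl// !ipZr// (ipC g f) f0; congr (0 <= _); ring.
have [->|n0] := eqVneq (ip f g) 0; first by rewrite expr0n.
have := h (- (ip g g + 1) / (2 * ip f g)).
rewrite (_ : 2 * _ * _ = - (ip g g + 1)); last by field.
lra.
Qed.

Lemma ip_eq0_ae f : sq f -> ip f f = 0 -> {ae mu, forall x, f x = 0}.
Proof.
move=> sf f0; have := ipE sf; rewrite f0.
under eq_integral do rewrite -[(_ ^+ 2)%:E]gee0_abs ?lee_fin ?sqr_ge0//.
move/(ae_eq_integral_abs _ measurableT); case.
  by apply: measurable_sqr; case: sf.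
move=> A [mA A0 sA]; exists A; split => // x /= fx; apply: sA => /= /(_ I).
by move=> [] /eqP; rewrite sqrf_eq0 => /eqP.
Qed.

Lemma ip_ae f g h : measurable_fun setT f -> measurable_fun setT g ->
  measurable_fun setT h -> {ae mu, forall x, f x = g x} -> ip f h = ip g h.
Proof.
move=> mf mg mh fg; rewrite /ip /Rintegral; congr fine.
apply: ae_eq_integral => //; try exact/measurable_EFinP/measurable_funM.
by apply: filterS fg => x + _ => /= ->.
Qed.

Lemma sq_ae f g : measurable_fun setT g -> {ae mu, forall x, f x = g x} ->
  sq f -> sq g.
Proof.
move=> mg fg [mf foo]; split => //; apply: le_lt_trans foo.
rewrite le_eqVlt; apply/orP; left; apply/eqP; apply: ae_eq_integral => //;
  try exact: measurable_sqr.
by apply: filterS fg => x + _ => /= ->.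
Qed.

Lemma cvg2_sq u f : (forall m, sq (u m)) -> measurable_fun setT f ->
  cvg2 u f -> sq f.
Proof.
move=> su mf cf; split => //.
have : \forall m \near \oo, (\int[mu]_x ((f x - u m x) ^+ 2)%:E < 1%:E)%E.
  have /fine_cvgP[h1 /cvgr0_norm_lt/(_ 1 ltr01)] := cf.
  apply: filterS2 h1 => m h1 /(le_lt_trans (ler_norm _)) h2.
  by rewrite -(fineK h1) lte_fin.
move=> [m _ /(_ m (leqnn m))] h.
have -> : f = fun x => (f x - u m x) + u m x by apply/funext => x; rewrite subrK.
apply: (proj2 (sqD _ (su m))); split.
  by apply: measurable_funB => //; case: (su m).
exact: lt_trans h (ltry _).
Qed.

Lemma cvg2P u f : (forall m, sq (u m)) -> sq f ->
  cvg2 u f <-> (ip (fun x => f x - u m x) (fun x => f x - u m x)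
                @[m --> \oo] --> 0).
Proof.
move=> su sf; rewrite /cvg2.
have -> : (fun m => \int[mu]_x ((f x - u m x) ^+ 2)%:E)%E =
    fun m => (ip (fun x => f x - u m x) (fun x => f x - u m x))%:E.
  by apply/funext => m; rewrite ipE//; exact: sqB.
by split => [/fine_cvgP[_]//|h]; apply/fine_cvgP; split => //; exact: nearW.
Qed.

(** The error is split as [f (g - v) + g (f - u) - (f - u) (g - v)], so that Cauchy-Schwarz involves
    only the norms of the limits and of the differences. *)
Lemma cvg_ip u v f g : (forall m, sq (u m)) -> (forall m, sq (v m)) ->
  measurable_fun setT f -> measurable_fun setT g ->
  cvg2 u f -> cvg2 v g -> ip (u m) (v m) @[m --> \oo] --> ip f g.
Proof.
move=> su sv mf mg uf vg.
have sf := cvg2_sq su mf uf; have sg := cvg2_sq sv mg vg.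
move/(cvg2P su sf) : uf => uf; move/(cvg2P sv sg) : vg => vg.
have bnd m : `|ip f g - ip (u m) (v m)| <=
    Num.sqrt (ip f f) * Num.sqrt (ip (fun x => g x - v m x) (fun x => g x - v m x))
  + Num.sqrt (ip g g) * Num.sqrt (ip (fun x => f x - u m x) (fun x => f x - u m x))
  + Num.sqrt (ip (fun x => f x - u m x) (fun x => f x - u m x)) *
    Num.sqrt (ip (fun x => g x - v m x) (fun x => g x - v m x)).
  have cs h k : sq h -> sq k -> `|ip h k| <= Num.sqrt (ip h h) * Num.sqrt (ip k k).
    move=> sh sk; rewrite -sqrtrM ?ip_ge0// -sqrtr_sqr ler_sqrt; first exact: ip_CS.
    by rewrite mulr_ge0 ?ip_ge0.
  have sfu : sq (fun x => f x - u m x) by exact: sqB.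
  have sgv : sq (fun x => g x - v m x) by exact: sqB.
  rewrite (_ : _ - _ = ip f (fun x => g x - v m x) + ip g (fun x => f x - u m x)
    - ip (fun x => f x - u m x) (fun x => g x - v m x)).
    apply: le_trans (ler_normB _ _) _; apply: lerD; last exact: cs.
    by apply: le_trans (ler_normD _ _) _; apply: lerD; exact: cs.
  rewrite !ipBr// !ipBl// (ipC g f) (ipC g (u m)); ring.
apply/cvgrPdist_le => e e0; near=> m; apply: le_trans (bnd m) _.
set a := Num.sqrt (ip f f); set b := Num.sqrt (ip g g).
apply: le_trans (ler_norm _) _; near: m; apply: cvgr0_norm_le e e0.
rewrite [X in _ --> X](_ : _ = a * Num.sqrt 0 + b * Num.sqrt 0 + Num.sqrt 0 * Num.sqrt 0).
  by apply: cvgD; [apply: cvgD; apply: cvgM; [exact: cvg_cst| |exact: cvg_cst|]|apply: cvgM];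
    apply: continuous_cvg => //; exact: sqrt_continuous.
by rewrite sqrtr0 !mulr0 !addr0.
Unshelve. all: by end_near. Qed.

Lemma cvg_ip1 v f g : (forall m, sq (v m)) -> sq f ->
  measurable_fun setT g ->
  cvg2 v g -> ip f (v m) @[m --> \oo] --> ip f g.
Proof.
move=> sv sf mg vg; apply: (@cvg_ip (fun=> f)) => //; first by case: sf.
rewrite /cvg2 [X in X @ _](_ : _ = fun=> 0%E); first exact: cvg_cst.
apply/funext => m; rewrite integral0_eq// => x _.
by rewrite subrr expr0n.
Qed.

Lemma cvg2D u v f g : (forall m, measurable_fun setT (u m)) ->
  (forall m, measurable_fun setT (v m)) ->
  measurable_fun setT f -> measurable_fun setT g ->
  cvg2 u f -> cvg2 v g -> cvg2 (fun m x => u m x + v m x) (fun x => f x + g x).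
Proof.
move=> mu_ mv mf mg uf vg; rewrite /cvg2.
apply: (@squeeze_cvge _ _ _ _ (fun=> 0%E) _ (fun m =>
  2%:E * \int[mu]_x ((f x - u m x) ^+ 2)%:E +
  2%:E * \int[mu]_x ((g x - v m x) ^+ 2)%:E)%E); last 2 first.
- exact: cvg_cst.
- rewrite [X in _ --> X](_ : _ = 2%:E * 0 + 2%:E * 0)%E; last by rewrite !mule0 adde0.
  by apply: cvgeD; rewrite ?mule0//; rewrite -[X in _ --> X](mule0 2%:E);
    apply: cvgeZl.
apply: nearW => m; rewrite integral_ge0/=; last by move=> x _; rewrite lee_fin sqr_ge0.
under eq_integral do rewrite opprD addrACA.
by apply: int_sqrD_le; exact: measurable_funB.
Qed.

Lemma cvg2Z (c : R) u f : (forall m, measurable_fun setT (u m)) ->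
  measurable_fun setT f ->
  cvg2 u f -> cvg2 (fun m x => c * u m x) (fun x => c * f x).
Proof.
move=> mu_ mf uf; rewrite /cvg2.
have -> : (fun m => \int[mu]_x ((c * f x - c * u m x) ^+ 2)%:E)%E =
    fun m => ((c ^+ 2)%:E * \int[mu]_x ((f x - u m x) ^+ 2)%:E)%E.
  apply/funext => m; rewrite -ge0_integralZl_EFin ?sqr_ge0//.
  - by apply: eq_integral => x _; rewrite -mulrBr exprMn EFinM.
  - by move=> x _; rewrite lee_fin sqr_ge0.
  - by apply: measurable_sqr; exact: measurable_funB.
by rewrite -[X in _ --> X](mule0 (c ^+ 2)%:E); apply: cvgeZl.
Qed.

End SquareIntegrable.

(** * Brownian increments *)

Section GaussianMoments.
Context {R : realType}.
Notation mu := (@lebesgue_measure R).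

(** [normal_prob] is dominated by Lebesgue measure; its Radon-Nikodym derivative equals the density
    almost everywhere, since both have the same integral over every measurable set. *)
Lemma ge0_integral_normal_prob (s : R) (f : R -> \bar R) :
  measurable_fun setT f -> (forall x, 0 <= f x)%E ->
  (\int[normal_prob 0 s]_x f x = \int[mu]_x (f x * (normal_pdf 0 s x)%:E))%E.
Proof.
move=> mf f0; have dom := normal_prob_dominates (0 : R) s.
rewrite -(Radon_Nikodym_SigmaFinite.change_of_variables dom f0 measurableT mf).
have iRN := Radon_Nikodym_SigmaFinite.f_integrable dom.
have mpdf : measurable_fun setT (fun x : R => (normal_pdf 0 s x)%:E).
  by apply/measurable_EFinP; exact: measurable_normal_pdf.
apply: ae_eq_integral => //.
- by apply: emeasurable_funM => //; exact: measurable_int iRN.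
- exact: emeasurable_funM.
- apply: ae_eqe_mul2l; apply: integral_ae_eq => //= E _ mE.
  by rewrite -Radon_Nikodym_SigmaFinite.f_integral.
Qed.

Lemma normal_pdf_gauss (s : R) : 0 < s -> normal_pdf 0 s =
  fun x => normal_peak s * gauss_fun ((Num.sqrt (s ^+ 2 *+ 2))^-1 * x).
Proof.
move=> s0; apply/funext => x; rewrite normal_pdfE ?gt_eqF// /normal_fun /gauss_fun.
rewrite subr0 exprMn exprVn sqr_sqrtr ?mulrn_wge0 ?sqr_ge0//.
by rewrite mulNr (mulrC (x ^+ 2)).
Qed.

(** An explicit antiderivative of [x p(x)], which makes the tail integrals behind the second moment
    computable. *)
Lemma is_derive_normal_pdf (s x : R) : 0 < s ->
  is_derive x 1 (fun y : R^o => - s ^+ 2 * normal_pdf 0 s y) (x * normal_pdf 0 s x).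
Proof.
move=> s0; rewrite normal_pdf_gauss//.
set k := (Num.sqrt _)^-1; set c := normal_peak s.
have k2 : k ^+ 2 = (s ^+ 2 *+ 2)^-1.
  by rewrite exprVn sqr_sqrtr// mulrn_wge0// sqr_ge0.
have dk : is_derive x (1:R^o) (fun y : R^o => - (k * y) ^+ 2) (- (2 * k ^+ 2 * x)).
  by apply: is_derive_eq; rewrite /GRing.scale/=; ring.
have dg : is_derive x (1:R^o) (fun y : R^o => gauss_fun (k * y))
    (- (2 * k ^+ 2 * x) * gauss_fun (k * x)).
  apply: (@is_derive_eq _ _ _ _ _ _ _ _ (is_derive1_comp (is_derive_expR _) dk)).
  by rewrite /GRing.scale/= mulrC.
apply: is_derive_eq.
have s20 : s ^+ 2 *+ 2 != 0 by rewrite mulrn_eq0/= sqrf_eq0 gt_eqF.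
by rewrite k2 /GRing.scale/=; field; rewrite gt_eqF.
Qed.

Lemma cvgy_normal_pdf (s : R) : 0 < s ->
  normal_pdf 0 s x @[x --> +oo%R] --> 0%R.
Proof.
move=> s0; rewrite normal_pdf_gauss// -[X in _ --> X](mulr0 (normal_peak s)).
apply: cvgM; first exact: cvg_cst.
apply: (cvg_comp _ (@gauss_fun R)); last exact: cvg_gauss_fun.
rewrite (_ : *%R _ = (fun x => x * (Num.sqrt (s ^+ 2 *+ 2))^-1)); last first.
  by apply/funext => x; rewrite mulrC.
apply: gt0_cvgMly; last exact: cvg_id.
by rewrite invr_gt0 sqrtr_gt0 mulrn_wgt0// exprn_gt0.
Qed.

Lemma integral_tail_normal_pdf (s y : R) : 0 < s -> 0 <= y ->
  (\int[mu]_(x in `[y, +oo[) (x * normal_pdf 0 s x)%:E =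
   (s ^+ 2 * normal_pdf 0 s y)%:E)%E.
Proof.
move=> s0 y0.
have cp : continuous (normal_pdf 0 s) by apply: continuous_normal_pdf; rewrite gt_eqF.
have cF : continuous (fun y : R => - s ^+ 2 * normal_pdf 0 s y).
  by move=> z; apply: cvgM; [exact: cvg_cst|exact: cp].
rewrite (@ge0_continuous_FTC2y _ _ (fun y => - s ^+ 2 * normal_pdf 0 s y) y 0).
- by rewrite mulNr EFinN oppeK add0e.
- by move=> x yx; rewrite mulr_ge0 ?normal_pdf_ge0// (le_trans y0).
- apply: continuous_subspaceT => x; apply: cvgM; [exact: cvg_id|exact: cp].
- rewrite -[X in _ --> X](mulr0 (- s ^+ 2)); apply: cvgM; first exact: cvg_cst.
  exact: cvgy_normal_pdf.
- by move=> x _; case: (is_derive_normal_pdf x s0).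
- by apply: cvg_at_right_filter; exact: cF.
- by move=> x _; rewrite derive1E; case: (is_derive_normal_pdf x s0).
Qed.

(* Tonelli on [0 <= y <= x], using the explicit tail integrals. *)
Lemma half_second_moment_normal (s : R) : 0 < s ->
  (\int[mu]_(x in `[0%R, +oo[) (x ^+ 2 * normal_pdf 0 s x)%:E =
   (s ^+ 2)%:E * \int[mu]_(x in `[0%R, +oo[) (normal_pdf 0 s x)%:E)%E.
Proof.
move=> s0.
have mp := measurable_normal_pdf (0 : R) s.
pose f (z : R * R) : \bar R :=
  (if (0 <= z.2) && (z.2 <= z.1) then z.1 * normal_pdf 0 s z.1 else 0)%:E.
have mf : measurable_fun setT f.
  apply/measurable_EFinP; apply: measurable_fun_ifT => //.
  - by apply: measurable_and; apply: measurable_fun_ler.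
  - apply: measurable_funM => //; exact: measurableT_comp.
have f0 z : (0 <= f z)%E.
  rewrite lee_fin; case: ifPn => // /andP[h1 h2].
  by rewrite mulr_ge0 ?normal_pdf_ge0// (le_trans h1).
have := @fubini_tonelli _ _ _ _ _ mu mu f mf f0.
rewrite (_ : (\int[mu]_x \int[mu]_y f (x, y) = \int[mu]_(x in `[0%R, +oo[)
    (x ^+ 2 * normal_pdf 0 s x)%:E)%E); last first.
  rewrite [RHS]integral_mkcond; apply: eq_integral => x _.
  rewrite patchE mem_setE/= in_itv/= andbT /f/=; case: ifPn => x0.
    transitivity (\int[mu]_(y in `[0%R, x]) (x * normal_pdf 0 s x)%:E)%E.
      rewrite [RHS]integral_mkcond; apply: eq_integral => y _.
      by rewrite patchE mem_setE/= in_itv/=; case: ifP.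
    rewrite integral_cst//= lebesgue_measure_itv/= lte_fin.
    case: ltgtP x0 => // [x0 _|<- _]; last by rewrite mule0 expr0n/= mul0r.
    by rewrite oppr0 adde0 -EFinM; congr EFin; ring.
  rewrite integral0_eq// => y _; case: ifPn => // /andP[h1 h2].
  by rewrite (le_trans h1 h2) in x0.
rewrite (_ : (\int[mu]_y \int[mu]_x f (x, y) = \int[mu]_(y in `[0%R, +oo[)
    (s ^+ 2 * normal_pdf 0 s y)%:E)%E); last first.
  rewrite [RHS]integral_mkcond; apply: eq_integral => y _.
  rewrite patchE mem_setE/= in_itv/= andbT /f/=; case: ifPn => y0.
    rewrite -integral_tail_normal_pdf// [RHS]integral_mkcond.
    apply: eq_integral => x _.
    by rewrite patchE mem_setE/= in_itv/= andbT; case: ifP.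
  by rewrite integral0_eq// => x _.
move=> ->; under eq_integral do rewrite EFinM.
rewrite ge0_integralZl_EFin//; last exact: sqr_ge0.
- by move=> x _; rewrite lee_fin normal_pdf_ge0.
- by apply/measurable_EFinP/measurable_funTS.
Qed.

Lemma second_moment_normal (s : R) : 0 < s ->
  (\int[normal_prob 0 s]_x (x ^+ 2)%:E = (s ^+ 2)%:E)%E.
Proof.
move=> s0.
have cp : continuous (normal_pdf 0 s) by apply: continuous_normal_pdf; rewrite gt_eqF.
have even : normal_pdf 0 s =1 normal_pdf 0 s \o -%R.
  by move=> x; rewrite /= normal_pdf_gauss// /gauss_fun mulrN sqrrN.
rewrite ge0_integral_normal_prob//; last 2 first.
- by apply/measurable_EFinP; exact: measurable_funX.
- by move=> x; rewrite lee_fin sqr_ge0.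
under eq_integral do rewrite -EFinM.
have dom : [set x : R | (0 <= x)%R] = `[0%R, +oo[%classic by rewrite set_itvcy.
rewrite (@ge0_symfun_integralT _ (fun x => x ^+ 2 * normal_pdf 0 s x)); last 3 first.
- by move=> x; rewrite mulr_ge0 ?sqr_ge0 ?normal_pdf_ge0.
- by move=> x; apply: cvgM; [exact: exprn_continuous|exact: cp].
- by move=> x /=; rewrite sqrrN even.
rewrite dom half_second_moment_normal// muleCA.
have := integral_normal_pdf (0 : R) s.
rewrite (@ge0_symfun_integralT _ (normal_pdf 0 s))//; last exact: normal_pdf_ge0.
by rewrite dom => ->; rewrite mule1.
Qed.

Lemma normal_probN (s : R) (B : set R) : 0 < s -> measurable B ->
  normal_prob 0 s (-%R @^-1` B) = normal_prob 0 s B.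
Proof.
move=> s0 mB; rewrite /normal_prob [RHS]integral_mkcond.
have mpB : measurable_fun setT (((fun x : R => (normal_pdf 0 s x)%:E) \_ B)).
  apply/(measurable_restrictT _ mB); apply/measurable_funTS/measurable_EFinP.
  exact: measurable_normal_pdf.
transitivity (\int[pushforward mu (-%R : _ -> measurableTypeR R)]_x
    ((fun x : R => (normal_pdf 0 s x)%:E) \_ B) x)%E; last first.
  by apply: eq_measure_integral => A mA _; exact: lebesgue_measureN.
rewrite ge0_integral_pushforward//; last first.
  by move=> x _; rewrite patchE; case: ifP => // _; rewrite lee_fin normal_pdf_ge0.
rewrite preimage_setT [LHS]integral_mkcond; apply: eq_integral => x _ /=.
rewrite !patchE (_ : (x \in _) = (- x \in B)); last by apply/idP/idP; rewrite !inE.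
by case: ifP => // _; rewrite normal_pdf_gauss// /gauss_fun mulrN sqrrN.
Qed.

End GaussianMoments.

Definition mfun_of {d d' : measure_display} {T1 : measurableType d}
  {T2 : measurableType d'} (f : T1 -> T2) (mf : measurable_fun setT f) :
  {mfun T1 >-> T2} :=
  MeasurableFun.Pack (MeasurableFun.Class (isMeasurableFun.Build _ _ _ _ _ mf)).

(** * The augmented filtration and the independence of increments from it *)

Section Filtration.
Context {R : realType} {d : measure_display} {Om : measurableType d} {J : finType}.
Variables (P : probability Om R) (T : R) (W : J -> R -> Om -> R).
Hypothesis P_complete : measure_is_complete P.
Hypothesis W_bm : independent_brownians P T W.

Local Notation F t := (filtration_gen P W t).
Local Notation Ft t := (g_sigma_algebraType (filtration_gen P W t)).

Lemma past_mono (X : R -> Om -> R) s t : s <= t -> past X s `<=` past X t.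
Proof.
move=> st A [r [/andP[r0 rs] Ar]]; exists r; split => //.
by rewrite r0 (le_trans rs).
Qed.

Lemma filtration_mono s t : s <= t -> <<s F s >> `<=` <<s F t >>.
Proof.
move=> st; apply: sub_sigma_algebra2 => A [[k _ pA]|nA]; last by right.
by left; exists k => //; exact: past_mono pA.
Qed.

Lemma Ft_measurable_mono s t xi : s <= t ->
  Ft_measurable P W s xi -> Ft_measurable P W t xi.
Proof. by move=> st mxi mD B mB; apply: (filtration_mono st); exact: mxi. Qed.

Lemma past_measurable k t : t <= T -> past (W k) t `<=` measurable.
Proof.
move=> tT A [s [/andP[s0 st] [B mB <-]]].
have [bk _] := W_bm; have [mW _ _ _ _] := bk k.
by apply: mW => //; rewrite s0 (le_trans st).
Qed.

(** Completeness of [P] is what makes the adjoined null sets events. *)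
Lemma filtration_measurable t : t <= T -> <<s F t >> `<=` measurable.
Proof.
move=> tT; apply: smallest_sub; first exact: sigma_algebra_measurable.
move=> A [[k _ pA]|nA]; first exact: past_measurable pA.
exact: P_complete.
Qed.

Lemma Ft_measurable_measurable t xi : t <= T -> Ft_measurable P W t xi ->
  measurable_fun setT xi.
Proof. by move=> tT mxi _ B mB; apply: (filtration_measurable tT); exact: mxi. Qed.

Lemma brownian_Ft k s t : 0 <= s -> s <= t -> Ft_measurable P W t (W k s).
Proof.
move=> s0 st _ B mB; apply: sub_sigma_algebra; left; exists k => //.
by exists s; rewrite s0 st; split => //; exists B.
Qed.

Lemma negligible_Ft t A : P.-negligible A -> <<s F t >> A.
Proof. by move=> nA; apply: sub_sigma_algebra; right. Qed.

(** Every F_t contains all null sets, so altering an adapted process on a null set keeps it adapted.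
    Limits and primitives can thus be set to 0 on exceptional paths. *)
Lemma Ft_measurable_ae t (xi xi' : Om -> R) : {ae P, forall w, xi w = xi' w} ->
  Ft_measurable P W t xi -> Ft_measurable P W t xi'.
Proof.
move=> [N [mN N0 sN]] mxi _ B mB.
have -> : setT `&` xi' @^-1` B =
    ((setT `&` xi @^-1` B) `\` N) `|` (xi' @^-1` B `&` N).
  rewrite !setTI; apply/seteqP; split => w /=.
    have [Nw|Nw] := pselect (N w); first by right.
    by move=> Bw; left; split => //; have /contrapT -> : ~ ~ xi w = xi' w by move/sN.
  move=> [[Bw Nw]|[]//]; have /contrapT <- // : ~ ~ xi w = xi' w by move/sN.
have nN : P.-negligible N by exists N; split.
apply: (@measurableU _ (Ft t)); last first.
  by apply: negligible_Ft; apply: negligibleS nN; exact: subIsetr.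
apply: (@measurableD _ (Ft t)); last exact: negligible_Ft.
exact: mxi.
Qed.

Lemma increment_past k s t : 0 <= s -> s <= t -> t <= T ->
  measurable_fun setT ((fun w => W k t w - W k s w) : g_sigma_algebraType (past (W k) T) -> R).
Proof.
move=> s0 st tT.
have h r : 0 <= r <= T ->
    measurable_fun setT (W k r : g_sigma_algebraType (past (W k) T) -> R).
  by move=> rT _ B mB; apply: sub_sigma_algebra; exists r; split => //; exists B.
apply: measurable_funB; apply: h; first by rewrite (le_trans s0 st).
by rewrite s0 (le_trans st).
Qed.

Lemma increment_measurable k s t : 0 <= s -> s <= t -> t <= T ->
  measurable_fun setT (fun w => W k t w - W k s w).
Proof.
move=> s0 st tT; have [bk _] := W_bm; have [mW _ _ _ _] := bk k.
by apply: measurable_funB; apply: mW; rewrite ?s0 ?(le_trans s0 st) ?(le_trans st).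
Qed.

(** The generators of F_s come from several motions and from null sets, and are not stable under
    intersection. The pi-system [G] contains them: events that agree, off a null set, with an
    intersection of one past event per motion. The two finite measures compared below agree on [G],
    hence on F_s. *)
Lemma increment_indep k s t (A : set Om) (B : set R) :
  0 <= s -> s < t -> t <= T -> <<s F s >> A -> measurable B ->
  P (A `&` [set w | B (W k t w - W k s w)]) =
  (P A * P [set w | B (W k t w - W k s w)%R])%E.
Proof.
move=> s0 st tT FA mB; set D := [set w | _].
have sT : s <= T by rewrite (le_trans _ tT)// ltW.
have mD : measurable D.
  by have := increment_measurable k s0 (ltW st) tT measurableT mB; rewrite setTI.
have [bk ind] := W_bm; have [_ _ _ _ bindep] := bk k.
pose G : set (set Om) := [set A' | measurable A' /\ exists2 a : J -> set Om,
  (forall j, <<s past (W j) s >> (a j)) & exists2 N, P.-negligible N &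
  (A' `\` N = (\bigcap_j a j) `\` N)].
have mpast j r X : r <= T -> <<s past (W j) r >> X -> measurable X.
  move=> rT; apply: smallest_sub; first exact: sigma_algebra_measurable.
  exact: past_measurable.
have GI : setI_closed G.
  move=> X Y [mX [a pa [N1 nN1 e1]]] [mY [b pb [N2 nN2 e2]]]; split.
    exact: measurableI.
  exists (fun j => a j `&` b j).
    by move=> j; exact: (@measurableI _ (g_sigma_algebraType (past (W j) s)) _ _ (pa j) (pb j)).
  exists (N1 `|` N2); first exact: negligibleU.
  move: e1 e2 => /seteqP[e11 e12] /seteqP[e21 e22]; apply/seteqP; split => w /=.
    move=> [[Xw Yw] /not_orP[n1 n2]]; split; last by case.
    have [ha _] := e11 w (conj Xw n1); have [hb _] := e21 w (conj Yw n2).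
    by move=> j _; split; [exact: ha|exact: hb].
  move=> [h /not_orP[n1 n2]]; split; last by case.
  have [ha _] := e12 w (conj (fun j _ => proj1 (h j I)) n1).
  by have [hb _] := e22 w (conj (fun j _ => proj2 (h j I)) n2).
have Gm : G `<=` measurable by move=> X [].
have FG : F s `<=` G.
  move=> X [[j _ pX]|nX].
    split; first exact: past_measurable pX.
    exists (fun i => if i == j then X else setT).
      move=> i; case: eqP => [->|_]; first exact: sub_sigma_algebra.
      exact: (@measurableT _ (g_sigma_algebraType (past (W i) s))).
    exists set0; first exact: negligible_set0.
    rewrite !setD0; apply/seteqP; split => [w Xw i _|w /(_ j I)]; last by rewrite eqxx.
    by case: ifP.
  split; first exact: P_complete.
  exists (fun=> set0); first by move=> j; exact: sigma_algebra0.
  exists X => //; rewrite setDv; apply/seteqP; split => // w [/(_ k I)] //.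
have GT : G setT.
  split => //; exists (fun=> setT).
    by move=> j; exact: (@measurableT _ (g_sigma_algebraType (past (W j) s))).
  exists set0; first exact: negligible_set0.
  by congr (_ `\` _); apply/seteqP; split.
have fPD : P D \is a fin_num by rewrite fin_num_measure.
have PD0 : (0 <= fine (P D))%R by rewrite fine_ge0.
pose m1 : {measure set Om -> \bar R} := mrestr P mD.
pose m2 : {measure set Om -> \bar R} := mscale (NngNum PD0) P.
have PE X : measurable X -> forall N Y, P.-negligible N -> measurable Y ->
    X `\` N = Y `\` N -> forall Z, measurable Z -> P (X `&` Z) = P (Y `&` Z).
  move=> mX N Y [N' [mN' N0 sN]] mY e Z mZ.
  have h U : measurable U -> P U = P (U `\` N').
    move=> mU; apply/esym; rewrite measureD//; last by rewrite ltey_eq fin_num_measure.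
    rewrite [X in (_ - X)%E](_ : _ = 0%E) ?sube0//.
    by apply/eqP; rewrite -measure_le0 -N0 le_measure ?inE//; exact: measurableI.
  rewrite (h (X `&` Z)) ?(h (Y `&` Z)); try exact: measurableI.
  congr (P _); move: e => /seteqP[e1 e2]; apply/seteqP; split => w [[h1 h2] h3].
    by split => //; split => //; case: (e1 w) => //; split => //; move/sN.
  by split => //; split => //; case: (e2 w) => //; split => //; move/sN.
suff : m1 A = m2 A by rewrite /m1 /m2 /= /mrestr /mscale/= fineK// muleC.
apply: (@g_sigma_algebra_measure_unique _ _ _ G Gm (fun=> setT)) => //.
- by rewrite bigcup_const.
- move=> X [mX [a pa [N nN e]]].
  have ma j : measurable (a j) by exact: mpast (pa j).
  have maI : measurable (\bigcap_j a j) by apply: fin_bigcap_measurable.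
  rewrite /m1 /m2 /= /mrestr /mscale/= fineK//.
  rewrite (PE _ mX _ _ nN maI e)//.
  rewrite -[in RHS](setIT X) (PE _ mX _ _ nN maI e)// setIT.
  have pT j : <<s past (W j) T >> (a j).
    by apply: sub_sigma_algebra2 (pa j); exact: past_mono.
  rewrite (ind _ pT).
  (* The increment event is absorbed into the factor of the motion [k]. Independence of the motions
     then splits the intersection, and inside the [k]-th factor the increment is independent of its
     own past. *)
  have -> : \bigcap_j a j `&` D = \bigcap_j (if j == k then a j `&` D else a j).
    apply/seteqP; split => w /=.
      by move=> [h Dw] j _; case: eqP => // _; [split|] => //; exact: h.
    move=> h; split; last by have := h k I; rewrite eqxx => -[].
    by move=> j _; have := h j I; case: ifP => // _ [].
  rewrite (ind (fun j => if j == k then a j `&` D else a j)); last first.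
    move=> j; case: eqP => // ->.
    apply: (@measurableI _ (g_sigma_algebraType (past (W k) T))); first exact: pT.
    have := @increment_past k s t s0 (ltW st) tT.
    by move=> /(_ (@measurableT _ (g_sigma_algebraType (past (W k) T))) B mB); rewrite setTI.
  rewrite (bigD1 k)//= eqxx [in RHS](bigD1 k)//= bindep//.
  rewrite (muleC (P (a k))) -muleA; congr (_ * (_ * _))%E.
  by apply: eq_bigr => j /negPf ->.
- move=> n /=; rewrite /m1 /= /mrestr setTI.
  by rewrite (le_lt_trans (probability_le1 _ mD)) ?ltry.
- by apply: sub_sigma_algebra2 FA.
Qed.

End Filtration.

Section Increments.
Context {R : realType} {d : measure_display} {Om : measurableType d} {J : finType}.
Variables (P : probability Om R) (T : R) (W : J -> R -> Om -> R).
Hypothesis P_complete : measure_is_complete P.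
Hypothesis W_bm : independent_brownians P T W.
Implicit Types (k : J) (s t : R) (xi eta : Om -> R).

(** By independence the pair of [xi] and the increment has a product law, and Tonelli integrates the
    normal factor first. *)
Lemma increment_law k s t xi (h : R * R -> \bar R) :
  0 <= s -> s < t -> t <= T -> Ft_measurable P W s xi ->
  measurable_fun setT h -> (forall z, 0 <= h z)%E ->
  (\int[P]_w h (xi w, W k t w - W k s w)%R =
   \int[P]_w \int[normal_prob 0 (Num.sqrt (t - s))]_y h (xi w, y))%E.
Proof.
move=> s0 st tT Fxi mh h0.
have sT : s <= T by rewrite (le_trans (ltW st)).
have mxi := Ft_measurable_measurable P_complete W_bm sT Fxi.
have mD := @increment_measurable _ _ _ _ _ _ _ W_bm k s t s0 (ltW st) tT.
set X := @mfun_of _ _ _ (measurableTypeR R) _ mxi.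
pose N : probability (measurableTypeR R) R := normal_prob 0 (Num.sqrt (t - s)).
have mPhi : measurable_fun setT ((fun w => (xi w, W k t w - W k s w)) :
    Om -> measurableTypeR R * measurableTypeR R).
  exact: measurable_fun_pair.
pose F x := (\int[N]_y h (x, y))%E.
have mF : measurable_fun setT F.
  exact: (@measurable_fun_fubini_tonelli_F _ _ _ _ _ N h mh h0).
have F0 x : (0 <= F x)%E by apply: integral_ge0.
transitivity (\int[distribution P X]_x F x)%E; last first.
  by rewrite (@ge0_integral_distribution _ _ _ _ _ P X F mF F0).
transitivity (\int[distribution P (mfun_of mPhi)]_z h z)%E.
  by rewrite ge0_integral_distribution.
rewrite -(@fubini_tonelli1 _ _ _ _ _ (distribution P X) N h mh h0).
apply: eq_measure_integral => A mA _; apply/esym.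
apply: product_measure_unique => // A1 B1 mA1 mB1.
rewrite /distribution /pushforward /=.
have [bk _] := W_bm; have [_ _ _ gauss _] := bk k.
rewrite -(gauss s t B1 s0 st tT mB1).
transitivity (P ((xi @^-1` A1) `&` [set w | B1 (W k t w - W k s w)])) => //.
rewrite (increment_indep P_complete W_bm k s0 st tT _ mB1)//.
by have := Fxi measurableT _ mA1; rewrite setTI.
Qed.

Lemma increment_sqr_law k s t xi : 0 <= s -> s < t -> t <= T ->
  Ft_measurable P W s xi ->
  (\int[P]_w ((xi w * (W k t w - W k s w)) ^+ 2)%:E =
   (t - s)%:E * \int[P]_w (xi w ^+ 2)%:E)%E.
Proof.
move=> s0 st tT Fxi.
have sT : s <= T by rewrite (le_trans (ltW st)).
have mxi := Ft_measurable_measurable P_complete W_bm sT Fxi.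
have st0 : 0 < Num.sqrt (t - s) by rewrite sqrtr_gt0 subr_gt0.
rewrite (@increment_law k s t xi (fun z => ((z.1 * z.2) ^+ 2)%:E))//; last 2 first.
- by apply/measurable_EFinP/measurable_funX/measurable_funM.
- by move=> z; rewrite lee_fin sqr_ge0.
rewrite -ge0_integralZl_EFin ?subr_ge0 ?(ltW st)//; last 2 first.
- by move=> x _; rewrite lee_fin sqr_ge0.
- exact: measurable_sqr.
apply: eq_integral => w _ /=; under eq_integral do rewrite exprMn EFinM.
rewrite ge0_integralZl_EFin ?sqr_ge0//; last 2 first.
- by move=> x _; rewrite lee_fin sqr_ge0.
- by apply/measurable_EFinP; exact: measurable_funX.
by rewrite second_moment_normal// sqr_sqrtr ?subr_ge0 ?(ltW st)// muleC.
Qed.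

Lemma increment_sqM k s t xi : 0 <= s -> s <= t -> t <= T ->
  Ft_measurable P W s xi -> sq P xi ->
  sq P (fun w => xi w * (W k t w - W k s w)).
Proof.
move=> s0; rewrite le_eqVlt => /predU1P[<-|st] tT Fxi sxi.
  by apply: eq_sq (sq0 P) => w; rewrite subrr mulr0.
split; last by rewrite increment_sqr_law// lte_mul_pinfty ?lee_fin ?subr_ge0 ?(ltW st)//; case: sxi.
apply: measurable_funM; first by case: sxi.
exact: (increment_measurable W_bm k s0 (ltW st) tT).
Qed.

Lemma sq_cst (c : R) : sq P (fun=> c).
Proof.
split; first exact: measurable_cst.
by have /= -> := @integral_cst _ _ _ P setT measurableT (c ^+ 2)%:E; rewrite probability_setT mule1 ltry.
Qed.

Lemma increment_sq k s t : 0 <= s -> s <= t -> t <= T ->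
  sq P (fun w => W k t w - W k s w).
Proof.
move=> s0 st tT; apply: eq_sq (@increment_sqM k s t (fun=> 1) s0 st tT _ (sq_cst 1)).
  by move=> w; rewrite mul1r.
exact: measurable_cst.
Qed.

(** Polarization of the identity for squares. *)
Lemma increment_ipM k s t xi eta : 0 <= s -> s <= t -> t <= T ->
  Ft_measurable P W s xi -> Ft_measurable P W s eta -> sq P xi -> sq P eta ->
  ip P (fun w => xi w * (W k t w - W k s w)) (fun w => eta w * (W k t w - W k s w)) =
  (t - s) * ip P xi eta.
Proof.
move=> s0 st tT Fxi Feta sxi seta.
have key z : Ft_measurable P W s z -> sq P z ->
    ip P (fun w => z w * (W k t w - W k s w)) (fun w => z w * (W k t w - W k s w)) =
    (t - s) * ip P z z.
  move=> Fz sz; have sz' := increment_sqM k s0 st tT Fz sz.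
  move: st; rewrite le_eqVlt => /predU1P[st|st].
    by rewrite -st subrr mul0r ip0l// => w; rewrite subrr mulr0.
  apply: EFin_inj; rewrite EFinM -!ipE//; exact: increment_sqr_law.
have s1 := increment_sqM k s0 st tT Fxi sxi.
have s2 := increment_sqM k s0 st tT Feta seta.
have := key _ (measurable_funD Fxi Feta) (sqD sxi seta).
rewrite (eq_ip P (f' := fun w => xi w * (W k t w - W k s w) + eta w * (W k t w - W k s w))
  (g' := fun w => xi w * (W k t w - W k s w) + eta w * (W k t w - W k s w)));
  try by move=> w; rewrite mulrDl.
rewrite !ipDl ?ipDr//; try exact: sqD.
rewrite !key// [ip P (fun w => eta w * _) _]ipC (ipC P eta xi) => h.
lra.
Qed.

Lemma normal_sym (s : R) (h : R -> \bar R) : 0 < s -> measurable_fun setT h ->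
  (forall y, 0 <= h y)%E ->
  (\int[normal_prob 0 s]_y h (- y)%R = \int[normal_prob 0 s]_y h y)%E.
Proof.
move=> s0 mh h0; pose N : probability (measurableTypeR R) R := normal_prob 0 s.
have mopp : measurable_fun setT (-%R : R -> R) by exact: oppr_measurable.
transitivity (\int[distribution N (@mfun_of _ _ (measurableTypeR R) (measurableTypeR R) _ mopp)]_y h y)%E.
  by rewrite ge0_integral_distribution.
by apply: eq_measure_integral => A mA _; exact: normal_probN.
Qed.

(** The normal law is symmetric, so the positive and the negative part of the product have the same
    integral. *)
Lemma increment_orth k s t xi : 0 <= s -> s <= t -> t <= T ->
  Ft_measurable P W s xi -> ip P xi (fun w => W k t w - W k s w) = 0.
Proof.
move=> s0; rewrite le_eqVlt => /predU1P[<-|st] tT Fxi.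
  by rewrite ip0r// => w; rewrite subrr.
have st0 : 0 < Num.sqrt (t - s) by rewrite sqrtr_gt0 subr_gt0.
rewrite /ip /Rintegral integralE.
pose h (z : R * R) : \bar R := maxe (z.1 * z.2)%:E 0%E.
have mh : measurable_fun setT h.
  apply: measurable_maxe => //; apply/measurable_EFinP; exact: measurable_funM.
have h0 z : (0 <= h z)%E by rewrite le_max lexx orbT.
pose h' (z : R * R) := h (z.1, - z.2).
have mh' : measurable_fun setT h'.
  apply: measurableT_comp => //; apply: measurable_fun_pair => //.
  by apply: measurableT_comp => //; exact: oppr_measurable.
rewrite (_ : (\int[P]_x _^\+ x)%E = \int[P]_w h (xi w, W k t w - W k s w)%R)%E; last first.
  by apply: eq_integral => w _; rewrite /h [@funepos]unlock.
rewrite (_ : (\int[P]_x _^\- x)%E = \int[P]_w h' (xi w, W k t w - W k s w)%R)%E; last first.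
  by apply: eq_integral => w _; rewrite /h' /h [@funeneg]unlock /= mulrN.
rewrite !increment_law//; last by move=> z; exact: h0.
set a := (X in (X - _)%E); set b := (X in (_ - X)%E).
have -> : b = a.
  apply: eq_integral => w _; rewrite -(@normal_sym _ (fun y => h (xi w, y)))//.
  by apply: measurableT_comp => //; exact: measurable_fun_pair.
(* When the common value is infinite, the difference is infinite as well and [fine] sends it to
   0. *)
by case: a => [r||]//=; rewrite subrr.
Qed.

End Increments.

(** * Stochastic integrals of elementary processes *)

Section TimeSpace.
Context {R : realType} {d : measure_display} {Om : measurableType d}.
Variable P : probability Om R.

Definition timespace : {measure set (measurableTypeR R * Om)%type -> \bar R} :=
  (@lebesgue_measure R \x P)%E.

(** Restriction to [[0, t]], uncurried: norms over different horizons become norms of functions on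
    the one measure space [timespace]. *)
Definition win (t : R) (X : R -> Om -> R) (z : R * Om) : R :=
  X z.1 z.2 * \1_(`[0, t]%classic) z.1.

Implicit Types c : Om -> R.

Lemma measurable_rect c (A : set R) : measurable_fun setT c -> measurable A ->
  measurable_fun setT
    ((fun z => c z.2 * \1_A z.1) : measurableTypeR R * Om -> R).
Proof.
move=> mc mA; apply: measurable_funM; first exact: measurableT_comp.
apply: (@measurableT_comp _ _ _ _ _ _ (\1_A : measurableTypeR R -> R) _ fst) => //.
Qed.

Lemma integral_rect c (A : set R) : measurable_fun setT c -> measurable A ->
  (\int[timespace]_z ((c z.2 * \1_A z.1) ^+ 2)%:E =
   @lebesgue_measure R A * \int[P]_w (c w ^+ 2)%:E)%E.
Proof.
move=> mc mA.
rewrite (@fubini_tonelli1 _ _ _ _ _ (@lebesgue_measure R) P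
  (fun z => ((c z.2 * \1_A z.1) ^+ 2)%:E)); last 2 first.
- by apply: measurable_sqr; exact: measurable_rect.
- by move=> z; rewrite lee_fin sqr_ge0.
rewrite /fubini_F /=.
under eq_integral => s _.
  under eq_integral do rewrite exprMn mulrC EFinM.
  rewrite ge0_integralZl_EFin ?sqr_ge0//; last 2 first.
  - by move=> w _; rewrite lee_fin sqr_ge0.
  - exact: measurable_sqr.
  rewrite muleC (_ : \1_A s ^+ 2 = \1_A s); last first.
    by rewrite indicE; case: (_ \in _); rewrite ?expr1n// expr0n.
  over.
rewrite ge0_integralZl//.
- by rewrite integral_indic// setIT muleC.
- by apply/measurable_EFinP; exact: measurable_indic.
- by apply: integral_ge0 => w _; rewrite lee_fin sqr_ge0.
Qed.

Lemma sq_rect c (A : set R) : sq P c -> measurable A ->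
  (@lebesgue_measure R A < +oo)%E ->
  sq timespace (fun z => c z.2 * \1_A z.1).
Proof.
move=> [mc coo] mA Aoo; split; first exact: measurable_rect.
rewrite integral_rect// lte_mul_pinfty//.
by rewrite ge0_fin_numE.
Qed.

(** Only the intersection of the two time sets counts; on it, polarization reduces the claim to a
    single coefficient. *)
Lemma ip_rect c c' (A B : set R) : sq P c -> sq P c' ->
  measurable A -> measurable B ->
  (@lebesgue_measure R A < +oo)%E -> (@lebesgue_measure R B < +oo)%E ->
  ip timespace (fun z => c z.2 * \1_A z.1) (fun z => c' z.2 * \1_B z.1) =
  fine (@lebesgue_measure R (A `&` B)) * ip P c c'.
Proof.
move=> sc sc' mA mB Aoo Boo.
have mAB : measurable (A `&` B) by exact: measurableI.
have ABoo : (@lebesgue_measure R (A `&` B) < +oo)%E.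
  by apply: le_lt_trans Aoo; apply: le_measure; rewrite ?inE//; exact: subIsetl.
transitivity (ip timespace (fun z => c z.2 * \1_(A `&` B) z.1)
    (fun z => c' z.2 * \1_(A `&` B) z.1)).
  rewrite /ip; apply: eq_Rintegral => z _; rewrite indicI /=.
  rewrite !indicE; do 2 case: (_ \in _) => /=; ring.
have key z : sq P z -> ip timespace (fun x => z x.2 * \1_(A `&` B) x.1)
    (fun x => z x.2 * \1_(A `&` B) x.1) = fine (@lebesgue_measure R (A `&` B)) * ip P z z.
  move=> sz; apply: EFin_inj; rewrite EFinM -!ipE//; last exact: sq_rect.
  by rewrite integral_rect ?fineK ?ge0_fin_numE//; case: sz.
have s1 := sq_rect sc mAB ABoo; have s2 := sq_rect sc' mAB ABoo.
have := key _ (sqD sc sc').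
rewrite (eq_ip timespace
  (f' := fun z => c z.2 * \1_(A `&` B) z.1 + c' z.2 * \1_(A `&` B) z.1)
  (g' := fun z => c z.2 * \1_(A `&` B) z.1 + c' z.2 * \1_(A `&` B) z.1));
  try by move=> z; rewrite mulrDl.
rewrite !ipDl ?ipDr//; try exact: sqD.
rewrite !key// [ip timespace (fun z => c' z.2 * _) _]ipC (ipC P c' c) => h.
lra.
Qed.

End TimeSpace.

Section Elementary.
Context {R : realType} {d : measure_display} {Om : measurableType d} {J : finType}.
Variables (P : probability Om R) (T : R) (W : J -> R -> Om -> R).
Hypothesis P_complete : measure_is_complete P.
Hypothesis W_bm : independent_brownians P T W.
Implicit Types (k : J) (s t a b : R) (c xi : Om -> R).

Definition bounded_coef a c : Prop :=
  Ft_measurable P W a c /\ exists M, forall w, `|c w| <= M.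

(* [elementary k S X]: S is a finite sum of adapted rectangles (not
   necessarily disjoint, so that sums need no common refinement) and X is its
   stochastic integral against W k. *)
Inductive elementary k : (R -> Om -> R) -> (R -> Om -> R) -> Prop :=
| Elementary0 : elementary k (fun _ _ => 0) (fun _ _ => 0)
| ElementaryS a b c S X : 0 <= a -> a <= b -> b <= T -> bounded_coef a c ->
    elementary k S X ->
    elementary k (fun t w => c w * \1_(`]a, b]%classic) t + S t w)
      (fun t w => c w * (W k (Num.min b t) w - W k (Num.min a t) w) + X t w).

Lemma elementaryD k S X S' X' : elementary k S X -> elementary k S' X' ->
  elementary k (fun t w => S t w + S' t w) (fun t w => X t w + X' t w).
Proof.
move=> e e'; elim: e => [|a b c S1 X1 a0 ab bT hc _ ih].
  have -> : (fun t w => 0 + S' t w) = S'.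
    by apply/funext => t; apply/funext => w; rewrite add0r.
  have -> // : (fun t w => 0 + X' t w) = X'.
  by apply/funext => t; apply/funext => w; rewrite add0r.
have := ElementaryS a0 ab bT hc ih.
under eq_fun do under eq_fun do rewrite addrA.
by under [X in elementary _ _ X]eq_fun do under eq_fun do rewrite addrA.
Qed.

Lemma bounded_coefZ (r : R) a c : bounded_coef a c ->
  bounded_coef a (fun w => r * c w).
Proof.
move=> [mc [M cM]]; split.
  by apply: measurable_funM => //; exact: measurable_cst.
by exists (`|r| * M) => w; rewrite normrM ler_wpM2l.
Qed.

Lemma elementaryZ (r : R) k S X : elementary k S X ->
  elementary k (fun t w => r * S t w) (fun t w => r * X t w).
Proof.
elim=> [|a b c S1 X1 a0 ab bT hc _ ih].
  under eq_fun do under eq_fun do rewrite mulr0.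
  exact: Elementary0.
have := ElementaryS a0 ab bT (bounded_coefZ r hc) ih.
under eq_fun do under eq_fun do rewrite -mulrA -mulrDr.
by under [X in elementary _ _ X]eq_fun do under eq_fun do rewrite -mulrA -mulrDr.
Qed.

Lemma bounded_coef_sq a c : a <= T -> bounded_coef a c -> sq P c.
Proof.
move=> aT [mc [M cM]].
have := sq_bdM (Ft_measurable_measurable P_complete W_bm aT mc) cM (sq_cst P 1).
by apply: eq_sq => w; rewrite mulr1.
Qed.

Lemma bounded_coef_sqM a c f : a <= T -> bounded_coef a c -> sq P f ->
  sq P (fun w => c w * f w).
Proof.
move=> aT [mc [M cM]]; apply: (sq_bdM _ cM).
exact: (Ft_measurable_measurable P_complete W_bm aT mc).
Qed.

Lemma brownianB_Ft k s t u : 0 <= s -> s <= t -> t <= u ->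
  Ft_measurable P W u (fun w => W k t w - W k s w).
Proof.
move=> s0 st tu; apply: measurable_funB; apply: brownian_Ft => //.
- exact: le_trans st.
- exact: le_trans tu.
Qed.

Lemma ip_rect_disjoint k a b c a' b' c' :
  0 <= a -> a <= b -> b <= a' -> a' <= b' -> b' <= T ->
  bounded_coef a c -> bounded_coef a' c' ->
  ip P (fun w => c w * (W k b w - W k a w))
       (fun w => c' w * (W k b' w - W k a' w)) = 0.
Proof.
move=> a0 ab ba' a'b' b'T hc hc'.
have a'0 : 0 <= a' by rewrite (le_trans a0)// (le_trans ab).
rewrite -ip_bdM; apply: (increment_orth P_complete W_bm k a'0 a'b' b'T).
case: hc hc' => mc _ [mc' _]; apply: measurable_funM => //.
apply: measurable_funM; last exact: brownianB_Ft.
by apply: Ft_measurable_mono mc; exact: le_trans ba'.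
Qed.

Lemma brownian_incr_sq k a b c : 0 <= a -> a <= b -> b <= T ->
  bounded_coef a c -> sq P (fun w => c w * (W k b w - W k a w)).
Proof.
move=> a0 ab bT hc; apply: (bounded_coef_sqM (le_trans ab bT) hc).
exact: (increment_sq P_complete W_bm k a0 ab bT).
Qed.

Lemma bounded_coef_mono a b c : a <= b -> bounded_coef a c -> bounded_coef b c.
Proof. by move=> ab [mc hM]; split => //; exact: Ft_measurable_mono mc. Qed.

Let ip_incr_same k a b b' c c' : 0 <= a -> a <= b -> b <= b' -> b' <= T ->
  bounded_coef a c -> bounded_coef a c' ->
  ip P (fun w => c w * (W k b w - W k a w))
       (fun w => c' w * (W k b' w - W k a w)) = (b - a) * ip P c c'.
Proof.
move=> a0 ab bb' b'T hc hc'; have bT := le_trans bb' b'T.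
have aT := le_trans ab bT.
rewrite (eq_ip P (f' := fun w => c w * (W k b w - W k a w)) (g' := fun w =>
  c' w * (W k b w - W k a w) + c' w * (W k b' w - W k b w))) //; last first.
  by move=> w; ring.
have hb := bounded_coef_mono ab hc'.
rewrite ipDr; try by apply: brownian_incr_sq => //; exact: le_trans ab.
rewrite [X in _ + X]ip_rect_disjoint// addr0.
apply: (increment_ipM P_complete W_bm k a0 ab bT).
- by case: hc.
- by case: hc'.
- exact: bounded_coef_sq hc.
- exact: bounded_coef_sq hc'.
Qed.

(** Both increments are cut at the ends of the overlap. Pieces over disjoint intervals are
    orthogonal, and the overlap contributes its length. *)
Let ip_incr_le k a b c a' b' c' : 0 <= a -> a <= b -> b <= T ->
  a <= a' -> a' <= b' -> b' <= T -> bounded_coef a c -> bounded_coef a' c' ->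
  ip P (fun w => c w * (W k b w - W k a w))
       (fun w => c' w * (W k b' w - W k a' w)) =
  Num.max 0 (Num.min b b' - a') * ip P c c'.
Proof.
move=> a0 ab bT aa' a'b' b'T hc hc'.
have a'0 := le_trans a0 aa'.
have [ba'|a'b] := leP b a'.
  rewrite ip_rect_disjoint//; rewrite max_l ?mul0r// subr_le0.
  by rewrite ge_min ba'.
have hca' := bounded_coef_mono aa' hc.
rewrite (eq_ip P (f' := fun w => c w * (W k a' w - W k a w) + c w * (W k b w - W k a' w))
  (g' := fun w => c' w * (W k b' w - W k a' w))) //; last by move=> w; ring.
have a'T := le_trans a'b' b'T.
rewrite ipDl; try by apply: brownian_incr_sq => //; exact: ltW.
rewrite ip_rect_disjoint// add0r.
have [bb'|b'b] := leP b b'.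
  by rewrite ip_incr_same ?(ltW a'b)// max_r// subr_ge0 ltW.
rewrite ipC ip_incr_same// ?(ltW b'b)// ipC max_r//.
by rewrite subr_ge0.
Qed.

Lemma ip_incr k a b c a' b' c' : 0 <= a -> a <= b -> b <= T ->
  0 <= a' -> a' <= b' -> b' <= T -> bounded_coef a c -> bounded_coef a' c' ->
  ip P (fun w => c w * (W k b w - W k a w))
       (fun w => c' w * (W k b' w - W k a' w)) =
  Num.max 0 (Num.min b b' - Num.max a a') * ip P c c'.
Proof.
move=> a0 ab bT a'0 a'b' b'T hc hc'.
have [aa'|a'a] := leP a a'; first exact: ip_incr_le.
by rewrite ipC ip_incr_le ?(ltW a'a)// ipC minC.
Qed.

Lemma lebesgue_cap_itv a b a' b' t : 0 <= a -> 0 <= a' ->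
  fine (@lebesgue_measure R ((`]a, b] `&` `[0, t]) `&` (`]a', b'] `&` `[0, t])))
  = Num.max 0 (Num.min (Num.min b t) (Num.min b' t) - Num.max a a').
Proof.
move=> a0 a'0.
have -> : (`]a, b] `&` `[0, t]) `&` (`]a', b'] `&` `[0, t]) =
   `]Num.max a a', Num.min (Num.min b t) (Num.min b' t)]%classic.
  apply/seteqP; split => x /=; rewrite !in_itv/= gt_max !le_min.
    by move=> [[/andP[-> ->] /andP[_ ->]] [/andP[-> ->] _]].
  move=> /andP[/andP[ax a'x] /andP[/andP[-> ->] /andP[-> _]]].
  by rewrite ax a'x (le_trans a0 (ltW ax)).
rewrite lebesgue_measure_itv/= lte_fin; case: ltP => h.
  by rewrite -EFinD /= [RHS]max_r// subr_ge0 ltW.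
by rewrite [RHS]max_l// subr_le0.
Qed.

Let rect_finite a b t :
  (@lebesgue_measure R (`]a, b] `&` `[0%R, t]) < +oo)%E.
Proof.
apply: (@le_lt_trans _ _ (@lebesgue_measure R `]a, b])).
  by apply: le_measure; rewrite ?inE//; exact: measurableI.
by rewrite lebesgue_measure_itv/=; case: ifP; rewrite -?EFinD ltry.
Qed.

Let win_rectE a b c t : win t (fun t w => c w * \1_(`]a, b]%classic) t) =
  fun z : R * Om => c z.2 * \1_(`]a, b] `&` `[0, t]) z.1.
Proof. by apply/funext => z; rewrite /win indicI/= mulrA. Qed.

Let term_sq k a b c t : 0 <= a -> a <= b -> b <= T -> bounded_coef a c ->
  0 <= t <= T ->
  sq P (fun w => c w * (W k (Num.min b t) w - W k (Num.min a t) w)).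
Proof.
move=> a0 ab bT hc /andP[t0 tT].
have [ta|a_t] := leP t a.
  rewrite ?(min_r (le_trans ta ab)) ?(min_r ta).
  by apply: eq_sq (sq0 P) => w; rewrite subrr mulr0.
rewrite ?(min_l (ltW a_t)); apply: brownian_incr_sq => //.
- by rewrite le_min ab ltW.
- by rewrite ge_min bT.
Qed.

Let win_rect_sq a b c t : 0 <= a -> a <= b -> b <= T -> bounded_coef a c ->
  sq (timespace P) (win t (fun t w => c w * \1_(`]a, b]%classic) t)).
Proof.
move=> a0 ab bT hc; rewrite win_rectE; apply: sq_rect => //.
- exact: bounded_coef_sq (le_trans ab bT) hc.
- exact: measurableI.
Qed.

Let term_ip k a b c a' b' c' t : 0 <= a -> a <= b -> b <= T ->
  0 <= a' -> a' <= b' -> b' <= T -> bounded_coef a c -> bounded_coef a' c' ->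
  0 <= t <= T ->
  ip P (fun w => c w * (W k (Num.min b t) w - W k (Num.min a t) w))
    (fun w => c' w * (W k (Num.min b' t) w - W k (Num.min a' t) w)) =
  ip (timespace P) (win t (fun t w => c w * \1_(`]a, b]%classic) t))
     (win t (fun t w => c' w * \1_(`]a', b']%classic) t)).
Proof.
move=> a0 ab bT a'0 a'b' b'T hc hc' /andP[t0 tT].
have aT := le_trans ab bT; have a'T := le_trans a'b' b'T.
have sc := bounded_coef_sq aT hc; have sc' := bounded_coef_sq a'T hc'.
rewrite !win_rectE ip_rect//; try exact: measurableI; try exact: rect_finite.
rewrite lebesgue_cap_itv//.
have [ta|a_t] := leP t a.
  rewrite ip0l; last by move=> w; rewrite (min_r (le_trans ta ab)) subrr mulr0.
  rewrite max_l ?mul0r// subr_le0 ge_min (min_r (le_trans ta ab)).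
  by rewrite le_max ta.
have [ta'|a't] := leP t a'.
  rewrite ip0r; last by move=> w; rewrite (min_r (le_trans ta' a'b')) subrr mulr0.
  rewrite max_l ?mul0r// subr_le0 ge_min (min_r (le_trans ta' a'b')).
  by rewrite !le_max ta' !orbT.
by apply: ip_incr => //; rewrite ?ge_min ?bT ?b'T// le_min ?ab ?a'b' ltW.
Qed.

Lemma elementary_sq k S X t : elementary k S X -> 0 <= t <= T -> sq P (X t).
Proof.
move=> e tT; elim: e => [|a b c S1 X1 a0 ab bT hc _ ih]; first exact: sq0.
by apply: sqD => //; exact: term_sq.
Qed.

Lemma winD t (S S' : R -> Om -> R) : win t (fun t w => S t w + S' t w) =
  fun z => win t S z + win t S' z.
Proof. by apply/funext => z; rewrite /win mulrDl. Qed.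

Lemma winZ t (r : R) (S : R -> Om -> R) : win t (fun t w => r * S t w) =
  fun z => r * win t S z.
Proof. by apply/funext => z; rewrite /win mulrA. Qed.

Lemma elementary_win_sq k S X t : elementary k S X ->
  sq (timespace P) (win t S).
Proof.
elim=> [|a b c S1 X1 a0 ab bT hc _ ih].
  by apply: eq_sq (sq0 _) => z; rewrite /win mul0r.
by rewrite winD; apply: sqD => //; exact: win_rect_sq.
Qed.

(** Both sides are bilinear, so a double induction reduces the claim to two rectangles. Their
    intervals may overlap in any way, which is why [term_ip] treats arbitrary pairs. *)
Lemma elementary_isometry k S X S' X' t : elementary k S X ->
  elementary k S' X' -> 0 <= t <= T ->
  ip P (X t) (X' t) = ip (timespace P) (win t S) (win t S').
Proof.
move=> e e' tT; elim: e => [|a b c S1 X1 a0 ab bT hc e ih].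
  by rewrite ip0l// ip0l// => z; rewrite /win mul0r.
have cS1 := elementary_win_sq t e; have cS' := elementary_win_sq t e'.
have sX1 := elementary_sq e tT; have sX' := elementary_sq e' tT.
rewrite winD !ipDl//; try exact: win_rect_sq; try exact: term_sq.
rewrite ih; congr (_ + _).
elim: e' {ih cS' sX'} => [|a' b' c' S1' X1' a'0 a'b' b'T hc' e' ih].
  by rewrite ip0r// ip0r// => z; rewrite /win mul0r.
have cS1' := elementary_win_sq t e'; have sX1' := elementary_sq e' tT.
rewrite winD !ipDr//; try exact: win_rect_sq; try exact: term_sq.
by rewrite ih; congr (_ + _); exact: term_ip.
Qed.

Lemma elementary_Ft k S X t : elementary k S X -> 0 <= t <= T ->
  Ft_measurable P W t (X t).
Proof.
move=> e /andP[t0 tT]; elim: e => [|a b c S1 X1 a0 ab bT hc _ ih].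
  exact: measurable_cst.
apply: measurable_funD => //.
have [ta|a_t] := leP t a.
  rewrite ?(min_r (le_trans ta ab)) ?(min_r ta).
  under eq_fun do rewrite subrr mulr0; exact: measurable_cst.
rewrite ?(min_l (ltW a_t)); apply: measurable_funM.
  by apply: Ft_measurable_mono (proj1 hc); exact: ltW.
apply: brownianB_Ft => //; first by rewrite le_min ab ltW.
by rewrite ge_min lexx orbT.
Qed.

(** The martingale property as orthogonality of later increments to the square-integrable
    F_s-measurable variables; this form passes to mean-square limits at once. *)
Lemma elementary_martingale k S X s t xi : elementary k S X ->
  0 <= s -> s <= t -> t <= T -> Ft_measurable P W s xi -> sq P xi ->
  ip P xi (fun w => X t w - X s w) = 0.
Proof.
move=> e s0 st tT Fxi sxi; have sT := le_trans st tT.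
have t0 := le_trans s0 st.
elim: e => [|a b c S1 X1 a0 ab bT hc e ih].
  by rewrite ip0r// => w; rewrite subrr.
have sX r : 0 <= r <= T -> sq P (X1 r) by move=> rT; exact: elementary_sq e rT.
have hc' r : 0 <= r <= T ->
    sq P (fun w => c w * (W k (Num.min b r) w - W k (Num.min a r) w)).
  by move=> rT; exact: term_sq.
rewrite (eq_ip P (f' := xi) (g' := fun w => (c w * (W k (Num.min b t) w - W k (Num.min a t) w)
  - c w * (W k (Num.min b s) w - W k (Num.min a s) w)) + (X1 t w - X1 s w)))//; last first.
  by move=> w; ring.
have tT' : 0 <= t <= T by rewrite t0.
have sT' : 0 <= s <= T by rewrite s0.
rewrite ipDr//; [|apply: sqB; exact: hc'|apply: sqB; exact: sX].
rewrite ih addr0.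
have aT := le_trans ab bT.
have key u v : 0 <= u -> u <= v -> v <= T -> a <= u -> s <= u ->
    ip P xi (fun w => c w * (W k v w - W k u w)) = 0.
  move=> u0 uv vT au su; rewrite -ip_bdM.
  apply: (increment_orth P_complete W_bm k u0 uv vT).
  apply: measurable_funM; first exact: Ft_measurable_mono (proj1 hc).
  exact: Ft_measurable_mono Fxi.
(* Between [s] and [t] a rectangle on []a, b]] adds either nothing or a single increment that starts
   at the larger of [a] and [s]. The cases are the positions of [s] and [t] relative to the
   interval. *)
have [ta|a_t] := leP t a.
  have sa := le_trans st ta.
  rewrite ip0r// => w; rewrite ?(min_r (le_trans ta ab)) ?(min_r ta).
  by rewrite ?(min_r (le_trans sa ab)) ?(min_r sa) !subrr ?mulr0 ?subrr.
have [sa|a_s] := leP s a.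
  rewrite (eq_ip P (f' := xi) (g' := fun w => c w * (W k (Num.min b t) w - W k a w)))//.
    by apply: key => //; rewrite ?le_min ?ab ?(ltW a_t)// ge_min bT.
  move=> w; rewrite ?(min_r (le_trans sa ab)); ring.
have [bs|s_b] := leP b s.
  rewrite ip0r// => w; rewrite (min_l (le_trans bs st)).
  by rewrite subrr.
rewrite (eq_ip P (f' := xi) (g' := fun w => c w * (W k (Num.min b t) w - W k s w)))//.
  by apply: key => //; rewrite ?le_min ?(ltW s_b)// ?ge_min ?bT// ltW.
move=> w; rewrite ?(min_l (le_trans (ltW a_s) st)); ring.
Qed.

End Elementary.

(** * Isometry and martingale property of mean-square limits *)

Section GeneralizedIto.
Context {R : realType} {d : measure_display} {Om : measurableType d} {J : finType}.
Variables (P : probability Om R) (T : R) (W : J -> R -> Om -> R).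
Hypothesis T_gt0 : 0 < T.
Hypothesis P_complete : measure_is_complete P.
Hypothesis W_bm : independent_brownians P T W.
Implicit Types (k : J) (s t a b : R) (c xi : Om -> R) (X Y H : R -> Om -> R).

Local Notation mu := (@lebesgue_measure R).
Local Notation TS := (timespace P).
Local Notation Ft t := (g_sigma_algebraType (filtration_gen P W t)).

Lemma progressive_Ft X t : progressive P T W X -> 0 <= t <= T ->
  Ft_measurable P W t (X t).
Proof.
move=> pX tT; have h := pX t tT.
have -> : X t = (fun p : R * Ft t => X p.1 p.2) \o (pair t) by [].
apply: (@measurable_comp _ _ _ _ _ _ (`[0, t] `*` setT)) => //.
- by apply: measurableX => //; exact: measurable_itv.
- by move=> _ [w _ <-]; split => //=; rewrite in_itv/= lexx andbT; case/andP: tT.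
Qed.

Lemma measurable_win X : progressive P T W X -> measurable_fun setT (win T X : (measurableTypeR R * Om)%type -> R).
Proof.
move=> pX; have T0 : 0 <= T <= T by rewrite ltW//=.
have h := pX T T0.
pose D : set (measurableTypeR R * Om) := `[0, T]%classic `*` setT.
have mD : measurable D by apply: measurableX => //; exact: measurable_itv.
have -> : win T X = (fun p : R * Om => X p.1 p.2) \_ D.
  apply/funext => -[s w]; rewrite /win patchE indicE /=.
  have -> : ((s, w) \in D) = (s \in `[0, T]%classic).
    by apply/idP/idP; rewrite !inE => //; case.
  by case: (_ \in _); rewrite ?mulr1 ?mulr0.
apply/(measurable_restrictT _ mD).
(* The identity, read as a map into [Om] with the sigma-algebra F_T; it is measurable because F_T
   consists of events. *)
pose phi (z : measurableTypeR R * Om) : R * Ft T := (z.1, z.2).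
have mphi : measurable_fun D phi.
  apply: measurable_funTS; apply: measurable_fun_pair; first exact: measurable_fst.
  move=> _ B mB; rewrite setTI.
  have mB' : measurable (B : set Om).
    exact: (filtration_measurable P_complete W_bm (lexx T) mB).
  by have := @measurable_snd _ _ (measurableTypeR R) Om measurableT _ mB'; rewrite setTI.
have -> : (fun p : R * Om => X p.1 p.2) = (fun p : R * Ft T => X p.1 p.2) \o phi by [].
apply: (@measurable_comp _ _ _ _ _ _ (`[0, T] `*` setT) _ D phi _ _ h mphi) => //.
  by apply: measurableX => //; exact: measurable_itv.
by move=> _ [z Dz <-].
Qed.

Lemma winE t X s w : 0 <= s <= t -> win t X (s, w) = X s w.
Proof. by move=> st; rewrite /win indicE/= mem_setE in_itv/= st mulr1. Qed.

Lemma win0E t X s w : ~~ (0 <= s <= t) -> win t X (s, w) = 0.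
Proof. by move=> st; rewrite /win indicE/= mem_setE in_itv/= (negPf st) mulr0. Qed.

Lemma integral_win (g : R -> Om -> R) t :
  measurable_fun setT (win t g : (measurableTypeR R * Om)%type -> R) ->
  (forall s w, 0 <= g s w) ->
  (\int[P]_w \int[mu]_(s in `[0%R, t]) (g s w)%:E = \int[TS]_z (win t g z)%:E)%E.
Proof.
move=> mg g0.
rewrite (@fubini_tonelli2 _ _ _ _ _ (@lebesgue_measure R) P
  (fun z => (win t g z)%:E)); last 2 first.
- exact/measurable_EFinP.
- by move=> z; rewrite lee_fin mulr_ge0.
apply: eq_integral => w _; rewrite /fubini_G [LHS]integral_mkcond; apply: eq_integral => s _.
rewrite patchE mem_setE in_itv/=; case: ifPn => h; first by rewrite winE.
by rewrite win0E.
Qed.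

Lemma win_sqr t X : win t (fun s w => X s w ^+ 2) = fun z => win t X z ^+ 2.
Proof.
apply/funext => z; rewrite /win exprMn indicE.
by case: (_ \in _); rewrite ?expr1n// expr0n.
Qed.

Lemma integral_win_sqr X t :
  measurable_fun setT (win t X : (measurableTypeR R * Om)%type -> R) ->
  (\int[P]_w \int[mu]_(s in `[0%R, t]) (X s w ^+ 2)%:E =
   \int[TS]_z (win t X z ^+ 2)%:E)%E.
Proof.
move=> mX; rewrite (@integral_win (fun s w => X s w ^+ 2)).
- by rewrite win_sqr.
- by rewrite win_sqr; exact: measurable_funX.
- by move=> s w; exact: sqr_ge0.
Qed.

Lemma win_win s t X : s <= t -> win s X =
  fun z => \1_(`[0, s]%classic) z.1 * win t X z.
Proof.
move=> st; apply/funext => z; rewrite /win mulrC !indicE !mem_setE !in_itv/=.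
case: (boolP (0 <= z.1 <= s)) => [/andP[-> zs]|_]; last by rewrite !mul0r.
by rewrite (le_trans zs st) /= !mul1r mulr1.
Qed.

Lemma measurable_ind s : measurable_fun setT
  ((fun z => \1_(`[0, s]%classic) z.1) : (measurableTypeR R * Om)%type -> R).
Proof.
have /= := @measurable_rect R d Om (fun=> 1) `[0, s]%classic (measurable_cst _) (measurable_itv _).
by under eq_fun do rewrite mul1r.
Qed.

Lemma measurable_win_le s t X : s <= t ->
  measurable_fun setT (win t X : (measurableTypeR R * Om)%type -> R) ->
  measurable_fun setT (win s X : (measurableTypeR R * Om)%type -> R).
Proof.
move=> st mX; rewrite (win_win _ st); apply: measurable_funM => //.
exact: measurable_ind.
Qed.

Lemma win_sqr_le s t X z : s <= t -> win s X z ^+ 2 <= win t X z ^+ 2.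
Proof.
move=> st; rewrite (win_win _ st) exprMn ler_piMl ?sqr_ge0//.
Qed.

Lemma sq_win_le s t X : s <= t -> sq TS (win t X) -> sq TS (win s X).
Proof.
move=> st sX; have mX := proj1 sX; apply: sq_le sX _.
  exact: measurable_win_le st mX.
by move=> z; exact: win_sqr_le.
Qed.

Lemma winB t X Y : win t (fun t w => X t w - Y t w) =
  fun z => win t X z - win t Y z.
Proof. by apply/funext => z; rewrite /win mulrBl. Qed.

(* [ito_integral] without path continuity: Y t is determined only almost surely
   for each t, which makes the relation linear and stable under L^2 limits. *)
Definition gito k H Y : Prop :=
  [/\ measurable_fun setT (win T H : (measurableTypeR R * Om)%type -> R),
      forall t, 0 <= t <= T -> Ft_measurable P W t (Y t) &
      exists S X : nat -> R -> Om -> R,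
      [/\ forall m, elementary P T W k (S m) (X m),
          cvg2 TS (fun m => win T (S m)) (win T H) &
          forall t, 0 <= t <= T -> cvg2 P (fun m => X m t) (Y t)]].

Lemma gito_measurable k H Y t : gito k H Y -> 0 <= t <= T ->
  measurable_fun setT (Y t).
Proof.
move=> [_ FY _] tT; apply: (Ft_measurable_measurable P_complete W_bm _ (FY t tT)).
by case/andP: tT.
Qed.

Lemma gito_sq k H Y t : gito k H Y -> 0 <= t <= T -> sq P (Y t).
Proof.
move=> g tT; have mY := gito_measurable g tT; case: g => _ _ [S [X [e _ cX]]].
apply: cvg2_sq mY (cX t tT) => m.
exact: (elementary_sq P_complete W_bm (e m) tT).
Qed.

Lemma gito_win_sq k H Y t : gito k H Y -> t <= T -> sq TS (win t H).
Proof.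
move=> [mH _ [S [X [e cS _]]]] tT; apply: sq_win_le tT _.
apply: cvg2_sq mH cS => m.
exact: (elementary_win_sq P_complete W_bm T (e m)).
Qed.

Lemma cvg2_win_le s t (S : nat -> R -> Om -> R) H : s <= t ->
  measurable_fun setT (win t H : (measurableTypeR R * Om)%type -> R) ->
  (forall m, measurable_fun setT (win t (S m) : (measurableTypeR R * Om)%type -> R)) ->
  cvg2 TS (fun m => win t (S m)) (win t H) ->
  cvg2 TS (fun m => win s (S m)) (win s H).
Proof.
move=> st mH mS; rewrite /cvg2 => cS.
apply: (@squeeze_cvge _ _ _ _ (fun=> 0%E) _
  (fun m => \int[TS]_z ((win t H z - win t (S m) z) ^+ 2)%:E)%E) => //; last first.
  exact: cvg_cst.
apply: nearW => m; apply/andP; split.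
  by apply: integral_ge0 => z _; rewrite lee_fin sqr_ge0.
apply: ge0_le_integral => //.
- by move=> z _; rewrite lee_fin sqr_ge0.
- by apply: measurable_sqr; apply: measurable_funB; exact: measurable_win_le st _.
- by apply: measurable_sqr; exact: measurable_funB.
- move=> z _; rewrite lee_fin.
  rewrite -[X in X ^+ 2 <= _]/((fun z => win s H z - win s (S m) z) z) -winB.
  by rewrite -[X in _ <= X ^+ 2]/((fun z => win t H z - win t (S m) z) z) -winB win_sqr_le.
Qed.

Lemma gito_isometry k H Y H' Y' t : gito k H Y -> gito k H' Y' -> 0 <= t <= T ->
  ip P (Y t) (Y' t) = ip TS (win t H) (win t H').
Proof.
move=> g g' tT; have mY := gito_measurable g tT; have mY' := gito_measurable g' tT.
case: g g' => mH _ [S [X [e cS cX]]] [mH' _ [S' [X' [e' cS' cX']]]].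
have [_ t_T] := andP tT.
have h1 : ip P (X m t) (X' m t) @[m --> \oo] --> ip P (Y t) (Y' t).
  exact: (cvg_ip (fun m => elementary_sq P_complete W_bm (e m) tT)
    (fun m => elementary_sq P_complete W_bm (e' m) tT) mY mY' (cX t tT) (cX' t tT)).
have sS u m := elementary_win_sq P_complete W_bm u (e m).
have sS' u m := elementary_win_sq P_complete W_bm u (e' m).
have h2 : ip TS (win t (S m)) (win t (S' m)) @[m --> \oo] --> ip TS (win t H) (win t H').
  have cS2 := cvg2_win_le t_T mH (fun m => proj1 (sS T m)) cS.
  have cS2' := cvg2_win_le t_T mH' (fun m => proj1 (sS' T m)) cS'.
  exact: (cvg_ip (sS t) (sS' t) (measurable_win_le t_T mH) (measurable_win_le t_T mH')
    cS2 cS2').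
have e12 : (fun m => ip P (X m t) (X' m t)) = fun m => ip TS (win t (S m)) (win t (S' m)).
  by apply/funext => m; exact: (elementary_isometry P_complete W_bm (e m) (e' m) tT).
rewrite e12 in h1.
exact: (cvg_unique _ h1 h2).
Qed.

Lemma gito_martingale k H Y s t xi : gito k H Y -> 0 <= s -> s <= t -> t <= T ->
  Ft_measurable P W s xi -> sq P xi -> ip P xi (Y t) = ip P xi (Y s).
Proof.
move=> g s0 st tT Fxi sxi.
have tT' : 0 <= t <= T by rewrite (le_trans s0).
have sT' : 0 <= s <= T by rewrite s0 (le_trans st).
have mY := gito_measurable g tT'; have mY' := gito_measurable g sT'.
case: g => mH _ [S [X [e cS cX]]].
have sX r m : 0 <= r <= T -> sq P (X m r).
  by move=> rT; exact: (elementary_sq P_complete W_bm (e m) rT).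
have h r : 0 <= r <= T -> measurable_fun setT (Y r) ->
    ip P xi (X m r) @[m --> \oo] --> ip P xi (Y r).
  by move=> rT mYr; apply: cvg_ip1 => //; [move=> m; exact: sX|exact: cX].
have h1 := h t tT' mY; have h2 := h s sT' mY'.
have e12 : (fun m => ip P xi (X m t)) = fun m => ip P xi (X m s).
  apply/funext => m; apply/eqP; rewrite -subr_eq0 -ipBr//; try exact: sX.
  by rewrite (elementary_martingale P_complete W_bm (e m)).
rewrite e12 in h1.
exact: (cvg_unique _ h1 h2).
Qed.

Lemma gitoD k H Y H' Y' : gito k H Y -> gito k H' Y' ->
  gito k (fun t w => H t w + H' t w) (fun t w => Y t w + Y' t w).
Proof.
move=> g g'.
have mY t tT := @gito_measurable _ _ _ t g tT.
have mY' t tT := @gito_measurable _ _ _ t g' tT.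
case: g g' => mH FY [S [X [e cS cX]]] [mH' FY' [S' [X' [e' cS' cX']]]].
have sS u m := elementary_win_sq P_complete W_bm u (e m).
have sS' u m := elementary_win_sq P_complete W_bm u (e' m).
split.
- by rewrite winD; exact: measurable_funD.
- by move=> t tT; apply: measurable_funD; [exact: FY|exact: FY'].
exists (fun m t w => S m t w + S' m t w), (fun m t w => X m t w + X' m t w); split.
- by move=> m; exact: elementaryD.
- rewrite winD; under eq_fun do rewrite winD.
  exact: (cvg2D (fun m => proj1 (sS T m)) (fun m => proj1 (sS' T m)) mH mH' cS cS').
- move=> t tT.
  exact: (cvg2D (fun m => proj1 (elementary_sq P_complete W_bm (e m) tT))
    (fun m => proj1 (elementary_sq P_complete W_bm (e' m) tT))
    (mY t tT) (mY' t tT) (cX t tT) (cX' t tT)).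
Qed.

Lemma gitoZ k (r : R) H Y : gito k H Y ->
  gito k (fun t w => r * H t w) (fun t w => r * Y t w).
Proof.
move=> g; have mY t tT := @gito_measurable _ _ _ t g tT.
case: g => mH FY [S [X [e cS cX]]].
have sS u m := elementary_win_sq P_complete W_bm u (e m).
split.
- by rewrite winZ; exact: measurable_funM.
- by move=> t tT; apply: measurable_funM; [exact: measurable_cst|exact: FY].
exists (fun m t w => r * S m t w), (fun m t w => r * X m t w); split.
- by move=> m; exact: elementaryZ.
- rewrite winZ; under eq_fun do rewrite winZ.
  by apply: cvg2Z => // m; case: (sS T m).
- move=> t tT; apply: cvg2Z; try by [exact: mY|exact: cX].
  by move=> m; case: (elementary_sq P_complete W_bm (e m) tT).
Qed.

Lemma simple_elementary k (S : simple_process P T W) :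
  elementary P T W k (simple_val S) (simple_int k S).
Proof.
suff h m : (m <= sp_size S)%N -> elementary P T W k
    (fun t w => \sum_(j < m) sp_coef S j w * \1_(`]sp_time S j, sp_time S j.+1]) t)
    (fun t w => \sum_(j < m) sp_coef S j w * (W k (Num.min (sp_time S j.+1) t) w
                     - W k (Num.min (sp_time S j) t) w)) by exact: h.
elim: m => [|m ih] mS.
  under eq_fun do under eq_fun do rewrite big_ord0.
  under [X in elementary _ _ _ _ _ X]eq_fun do under eq_fun do rewrite big_ord0.
  exact: Elementary0.
have [t0 tT] := andP (sp_time_itv (ltnW mS)).
have [_ tT'] := andP (sp_time_itv mS).
have hc : bounded_coef P W (sp_time S m) (sp_coef S m).
  by split; [exact: sp_coef_meas|exact: sp_coef_bounded].
have := ElementaryS t0 (sp_time_nd mS) tT' hc (ih (ltnW mS)).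
set A := (X in elementary _ _ _ _ X _); set B := (X in elementary _ _ _ _ _ X) => eAB.
rewrite (_ : (fun t w => _) = A); last first.
  by apply/funext => t; apply/funext => w; rewrite big_ord_recr/= addrC.
rewrite (_ : (fun t w => \sum_(j < m.+1) _) = B)//.
by apply/funext => t; apply/funext => w; rewrite big_ord_recr/= addrC.
Qed.

Lemma ito_gito k H Y :
  measurable_fun setT (win T H : (measurableTypeR R * Om)%type -> R) ->
  ito_integral P T W k H Y -> gito k H Y.
Proof.
move=> mH [FY _ [S [cS cX]]]; split => //.
exists (fun m => simple_val (S m)), (fun m => simple_int k (S m)); split.
- by move=> m; exact: simple_elementary.
- have mS m : measurable_fun setT (win T (simple_val (S m)) : (measurableTypeR R * Om)%type -> R).
    by case: (elementary_win_sq P_complete W_bm T (simple_elementary k (S m))).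
  move: cS; rewrite /cvg2; set A := (X in X @ _ --> _); set B := (X in _ -> X @ _ --> _).
  suff -> : A = B by [].
  apply/funext => m; rewrite /A /B (@integral_win_sqr (fun t w => H t w - simple_val (S m) t w)).
    by rewrite winB.
  by rewrite winB; exact: measurable_funB.
- by move=> t tT; exact: cX.
Qed.

End GeneralizedIto.

(** * Existence of the Ito integral *)

Lemma within_itv_continuousP {R : realType} (a b : R) (f : R -> R) :
  {within `[a, b], continuous f} <->
  forall t, a <= t <= b -> forall e, 0 < e ->
    exists2 dl, 0 < dl & forall s, a <= s <= b -> `|t - s| < dl -> `|f t - f s| < e.
Proof.
apply: iff_trans; first exact: subspace_continuousP.
split => [h t tab e e0|h t].
  have := h t; rewrite /= in_itv/= => /(_ tab)/cvgrPdist_lt/(_ e e0).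
  move=> /nbhs_ballP[dl /= dl0 hdl]; exists dl => // s sab ts.
  by apply: (hdl s) => //=; rewrite in_itv.
rewrite /= in_itv/= => tab; apply/cvgrPdist_lt => e e0.
have [dl dl0 hdl] := h t tab e e0.
apply/nbhs_ballP; exists dl => //= s ts; rewrite /= in_itv/= => sab.
exact: hdl.
Qed.

Lemma fatou_le {d} {T : measurableType d} {R : realType}
  (mu : {measure set T -> \bar R}) (f : nat -> T -> \bar R) (g : T -> \bar R)
  (C : \bar R) : (forall n, measurable_fun setT (f n)) ->
  (forall n x, 0 <= f n x)%E -> (forall x, f n x @[n --> \oo] --> g x) ->
  (forall n, \int[mu]_x f n x <= C)%E -> (\int[mu]_x g x <= C)%E.
Proof.
move=> mf f0 fg fC.
have -> : g = fun x => limn_einf (f^~ x).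
  by apply/funext => x; case: (cvg_limn_einf_sup (fg x)).
apply: le_trans (fatou mu measurableT mf (fun n x _ => f0 n x)) _.
rewrite limn_einf_lim; apply: lime_le; first exact: is_cvg_einfs.
apply: nearW => n; apply: le_trans (fC n); apply: ereal_inf_lbound.
by exists n => /=.
Qed.

(** * A maximal inequality for elementary integrals *)

Section Maximal.
Context {R : realType} {d : measure_display} {Om : measurableType d} {J : finType}.
Variables (P : probability Om R) (T : R) (W : J -> R -> Om -> R).
Hypothesis T_gt0 : 0 < T.
Hypothesis P_complete : measure_is_complete P.
Hypothesis W_bm : independent_brownians P T W.
Implicit Types (k : J) (s t a b : R) (S X : R -> Om -> R).

Lemma elementary_continuous k S X w : elementary P T W k S X ->
  {within `[0, T], continuous (fun t => W k t w)} ->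
  {within `[0, T], continuous (fun t => X t w)}.
Proof.
move=> e /within_itv_continuousP cW; apply/within_itv_continuousP => t tT.
elim: e => [|a b c S1 X1 a0 ab bT hc e ih] eps eps0.
  by exists 1 => // s _ _; rewrite subrr normr0.
have [C C0 cC] : exists2 C, 0 < C & `|c w| <= C.
  by exists (`|c w| + 1); rewrite ?ltr_wpDl// lerDl.
have key a' : 0 <= a' <= T -> forall e', 0 < e' -> exists2 dl, 0 < dl &
    forall s, 0 <= s <= T -> `|t - s| < dl ->
    `|W k (Num.min a' t) w - W k (Num.min a' s) w| < e'.
  move=> /andP[a'0 a'T] e' e'0.
  have minT r : 0 <= r <= T -> 0 <= Num.min a' r <= T.
    by move=> /andP[r0 rT]; rewrite le_min a'0 r0 ge_min rT orbT.
  have [dl dl0 h] := cW (Num.min a' t) (minT t tT) e' e'0.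
  exists dl => // s sT ts; apply: h; first exact: minT.
  apply: le_lt_trans ts; rewrite /Num.min.
  by case: (ltP a' t) => h1; case: (ltP a' s) => h2; rewrite ?subrr ?normr0//;
    rewrite real_ler_norml ?num_real//; case: (lerP t s) => h3; lra.
have e4 : 0 < eps / 4 / C by rewrite !divr_gt0.
have [d1 d10 h1] := key b (introT andP (conj (le_trans a0 ab) bT)) _ e4.
have [d2 d20 h2] := key a (introT andP (conj a0 (le_trans ab bT))) _ e4.
have e2 : 0 < eps / 2 by rewrite divr_gt0.
have [d3 d30 h3] := ih _ e2.
exists (Num.min d1 (Num.min d2 d3)); first by rewrite !lt_min d10 d20 d30.
move=> s sT; rewrite !lt_min => /and3P[t1 t2 t3].
have := h1 s sT t1; have := h2 s sT t2; have := h3 s sT t3.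
set u1 := W k (Num.min b t) w - _; set u2 := W k (Num.min a t) w - _.
move=> g3 g2 g1.
rewrite (_ : _ - _ = c w * (u1 - u2) + (X1 t w - X1 s w)); last by rewrite /u1 /u2; ring.
apply: le_lt_trans (ler_normD _ _) _.
have : `|c w * (u1 - u2)| <= eps / 2.
  rewrite normrM; apply: le_trans (ler_pM _ _ cC (ler_normB _ _)) _ => //.
  have -> : eps / 2 = C * (eps / 4 / C + eps / 4 / C) by field; rewrite gt_eqF.
  by rewrite ler_pM2l// lerD// ltW.
lra.
Qed.

Let ip_indic (A : set Om) : measurable A -> ip P \1_A \1_A = fine (P A).
Proof.
move=> mA; have sA : sq P \1_A.
  apply: (@eq_sq _ _ _ _ (fun w => \1_A w * 1)); first by move=> x; rewrite mulr1.
  apply: (@sq_bdM _ _ _ _ _ _ 1) => //; [|exact: sq_cst].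
  by move=> x; rewrite indicE; case: (_ \in _); rewrite ?normr1 ?normr0.
have := ipE sA; under eq_integral => x _.
  rewrite (_ : \1_A x ^+ 2 = \1_A x); last first.
    by rewrite indicE; case: (_ \in _); rewrite ?expr1n// expr0n.
  over.
by rewrite integral_indic// setIT => ->.
Qed.

Let grid (N j : nat) : R := T * j%:R / N%:R.

Let grid_itv N j : (0 < N)%N -> (j <= N)%N -> 0 <= grid N j <= T.
Proof.
move=> N0 jN; rewrite /grid divr_ge0 ?mulr_ge0// ?(ltW T_gt0)//=.
by rewrite ler_pdivrMr ?ltr0n// ler_pM2l// ler_nat.
Qed.

(** The events are cumulative in [i], so that they increase along the grid and no stopping time has
    to be introduced. *)
Let hit (X : R -> Om -> R) (l : R) N i : set Om :=
  [set w | exists2 j, (j <= i)%N & l <= `|X (grid N j) w|].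

Let hitS X l N i : hit X l N i.+1 =
  hit X l N i `|` [set w | l <= `|X (grid N i.+1) w|].
Proof.
apply/seteqP; split => w /=.
  move=> [j]; rewrite leq_eqVlt => /predU1P[->|ji]; first by right.
  by left; exists j.
by move=> [[j ji h]|h]; [exists j => //; exact: leqW|exists i.+1].
Qed.

Let hit_Ft k S X l N i t : elementary P T W k S X -> (0 < N)%N -> (i <= N)%N ->
  t = grid N i -> measurable_fun setT (\1_(hit X l N i) : g_sigma_algebraType (filtration_gen P W t) -> R).
Proof.
move=> e N0; elim: i t => [|i ih] t iN tE.
  apply: measurable_indic.
  have -> : hit X l N 0 = setT `&` (fun w => `|X t w|) @^-1` `[l, +oo[%classic.
    apply/seteqP; split => w /=.
      by move=> [j]; rewrite leqn0 => /eqP -> h; rewrite in_itv/= tE andbT.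
    by rewrite in_itv/= andbT => -[_ h]; exists 0 => //; rewrite -tE.
  have := elementary_Ft e (grid_itv N0 iN); rewrite -tE => mX.
  have mX' : measurable_fun setT ((fun w => `|X t w|) : g_sigma_algebraType (filtration_gen P W t) -> R).
    by apply: measurableT_comp => //.
  exact: mX'.
apply: measurable_indic; rewrite hitS; apply: measurableU.
  have st : grid N i <= t.
    by rewrite tE /grid ler_pM2r ?invr_gt0 ?ltr0n// ler_pM2l// ler_nat.
  have := ih (grid N i) (ltnW iN) erefl => h.
  have := Ft_measurable_mono st h.
  move=> /(_ (@measurableT _ (g_sigma_algebraType (filtration_gen P W t))) [set 1%R] (measurable_set1 1%R)).
  rewrite setTI (_ : _ @^-1` _ = hit X l N i)//.
  apply/seteqP; split => w /=; rewrite indicE.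
    by case: (boolP (w \in hit X l N i)) => [/set_mem//|_ /esym/eqP]; rewrite oner_eq0.
  by move/mem_set => ->.
have -> : [set w | l <= `|X (grid N i.+1) w|] = setT `&` (fun w => `|X t w|) @^-1` `[l, +oo[%classic.
  by apply/seteqP; split => w /=; rewrite in_itv/= tE andbT => // -[].
have := elementary_Ft e (grid_itv N0 iN); rewrite -tE => mX.
have mX' : measurable_fun setT ((fun w => `|X t w|) : g_sigma_algebraType (filtration_gen P W t) -> R).
  by apply: measurableT_comp => //.
exact: mX'.
Qed.

Let hit_measurable k S X l N i : elementary P T W k S X -> (0 < N)%N -> (i <= N)%N ->
  measurable (hit X l N i).
Proof.
move=> e N0 iN; have /andP[_ gT] := grid_itv N0 iN.
have := Ft_measurable_measurable P_complete W_bm gT (hit_Ft l e N0 iN erefl).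
move=> /(_ measurableT [set 1%R] (measurable_set1 1%R)).
rewrite setTI (_ : _ @^-1` _ = hit X l N i)//.
apply/seteqP; split => w /=; rewrite indicE.
  by case: (boolP (w \in hit X l N i)) => [/set_mem//|_ /esym/eqP]; rewrite oner_eq0.
by move/mem_set => ->.
Qed.

Let norm_indic (A : set Om) w : `|\1_A w : R| <= 1.
Proof. by rewrite indicE; case: (_ \in _); rewrite ?normr1 ?normr0. Qed.

Let sq_indicM (A : set Om) f : measurable A -> sq P f -> sq P (fun w => \1_A w * f w).
Proof. by move=> mA; apply: (@sq_bdM _ _ _ _ _ _ 1) => //; exact: measurable_indic. Qed.

(* Kolmogorov's inequality, by induction on the grid: when passing to the next
   grid point the second moment over the event already hit does not decrease. *)
Let kolmogorov_step k S X l N i : elementary P T W k S X -> (0 < N)%N ->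
  0 <= l -> (i <= N)%N ->
  l ^+ 2 * fine (P (hit X l N i)) <=
  ip P (fun w => \1_(hit X l N i) w * X (grid N i) w)
       (fun w => \1_(hit X l N i) w * X (grid N i) w).
Proof.
move=> e N0 l0 iN.
have sX j : (j <= N)%N -> sq P (X (grid N j)).
  by move=> jN; exact: (elementary_sq P_complete W_bm e (grid_itv N0 jN)).
have low (A : set Om) t : measurable A -> sq P (X t) -> (forall w, A w -> l <= `|X t w|) ->
    l ^+ 2 * fine (P A) <= ip P (fun w => \1_A w * X t w) (fun w => \1_A w * X t w).
  move=> mA sXt AX; rewrite -ip_indic//.
  have sA : sq P \1_A.
    by apply: eq_sq (sq_indicM mA (sq_cst P 1)) => w; rewrite mulr1.
  have -> : l ^+ 2 * ip P \1_A \1_A = ip P (fun w => l * \1_A w) (fun w => l * \1_A w).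
    by rewrite ipZl ?ipZr// ?mulrA//; exact: sqZ.
  apply: le_ip; [exact: sqZ|exact: sq_indicM|].
  move=> w; rewrite indicE; case: (boolP (w \in A)) => [/set_mem Aw|_].
    by rewrite mulr1 mul1r -(real_normK (num_real (X t w))) ler_sqr ?nnegrE// AX.
  by rewrite mulr0 mul0r.
elim: i iN => [|i ih] iN.
  apply: low; [exact: hit_measurable e N0 iN|exact: sX|].
  by move=> w [j]; rewrite leqn0 => /eqP ->.
set B := hit X l N i; set t := grid N i.+1; set s := grid N i.
have mB : measurable B by exact: hit_measurable e N0 (ltnW iN).
(* [C] is the event of reaching the level for the first time at [i.+1], where the bound is
   immediate; on [B] the induction hypothesis serves. *)
pose C := hit X l N i.+1 `\` B.
have mC : measurable C by apply: measurableD => //; exact: hit_measurable e N0 iN.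
have sXt : sq P (X t) := sX _ iN; have sXs : sq P (X s) := sX _ (ltnW iN).
have BC : hit X l N i.+1 = B `|` C.
  by rewrite /C setDUK// hitS; exact: subsetUl.
have BC0 : [disjoint B & C].
  by apply/disj_setPS => w [Bw [_]].
have /andP[s0 sT] := grid_itv N0 (ltnW iN); have /andP[t0 tT] := grid_itv N0 iN.
have st : s <= t by rewrite /s /t /grid ler_pM2r ?invr_gt0 ?ltr0n// ler_pM2l// ler_nat.
have indE w : \1_(B `|` C) w = \1_B w + \1_C w :> R.
  rewrite !indicE in_setU; case: (boolP (w \in B)) => [/set_mem Bw|_] /=.
  - rewrite memNset ?addr0// => Cw.
    by move/disj_setPS: BC0 => /(_ w); apply.
  - by rewrite add0r.
have -> : P (hit X l N i.+1) = (P B + P C)%E by rewrite BC measureU//; exact/disj_set2P.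
rewrite fineD ?fin_num_measure// mulrDr.
have -> : ip P (fun w => \1_(hit X l N i.+1) w * X t w)
               (fun w => \1_(hit X l N i.+1) w * X t w) =
    ip P (fun w => \1_B w * X t w) (fun w => \1_B w * X t w) +
    ip P (fun w => \1_C w * X t w) (fun w => \1_C w * X t w).
  have sB := sq_indicM mB sXt; have sC := sq_indicM mC sXt.
  rewrite (eq_ip P (f' := fun w => \1_B w * X t w + \1_C w * X t w)
    (g' := fun w => \1_B w * X t w + \1_C w * X t w));
    try by move=> w; rewrite BC indE mulrDl.
  rewrite !ipDl ?ipDr//; try exact: sqD.
  rewrite [ip P (fun w => \1_C w * X t w) (fun w => \1_B w * X t w)]ipC.
  suff -> : ip P (fun w => \1_B w * X t w) (fun w => \1_C w * X t w) = 0 by ring.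
  rewrite -ip_bdM ip0l// => w; rewrite !indicE.
  case: (boolP (w \in B)) => [/set_mem Bw|_]; last by rewrite mul0r mulr0.
  rewrite memNset ?mul0r// => Cw.
  by move/disj_setPS: BC0 => /(_ w); apply.
apply: lerD; last first.
  apply: low => // w [[j ji h] nB].
  move: ji; rewrite leq_eqVlt => /predU1P[ji|ji]; first by rewrite /t -ji.
  by exfalso; apply: nB; exists j.
apply: le_trans (ih (ltnW iN)) _; rewrite -/B -/s.
have sD : sq P (fun w => X t w - X s w) by exact: sqB.
have sB1 := sq_indicM mB sXs; have sB2 := sq_indicM mB sD.
rewrite [leRHS](eq_ip P (f' := fun w => \1_B w * X s w + \1_B w * (X t w - X s w))
    (g' := fun w => \1_B w * X s w + \1_B w * (X t w - X s w)));
    try by move=> w; ring.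
rewrite !ipDl ?ipDr//; try exact: sqD.
rewrite [ip P (fun w => \1_B w * (X t w - X s w)) (fun w => \1_B w * X s w)]ipC.
rewrite -[ip P (fun w => \1_B w * X s w) (fun w => \1_B w * (X t w - X s w))]ip_bdM.
rewrite (elementary_martingale P_complete W_bm e s0 st tT); last 2 first.
- apply: measurable_funM; first exact: hit_Ft e N0 (ltnW iN) erefl.
  apply: measurable_funM; first exact: hit_Ft e N0 (ltnW iN) erefl.
  by apply: elementary_Ft e _; rewrite s0.
- exact: sq_indicM.
by rewrite addr0 add0r lerDl ip_ge0.
Qed.

Lemma kolmogorov k S X l N : elementary P T W k S X -> (0 < N)%N -> 0 < l ->
  (P [set w | exists2 j, (j <= N)%N & (l <= `|X (T * j%:R / N%:R) w|)%R] <=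
   (ip P (X T) (X T) / l ^+ 2)%:E)%E.
Proof.
move=> e N0 l0; have := kolmogorov_step e N0 (ltW l0) (leqnn N).
rewrite -/(hit X l N N); set B := hit X l N N => h.
have mB : measurable B by exact: hit_measurable e N0 (leqnn N).
have gN : grid N N = T by rewrite /grid mulfK// pnatr_eq0 -lt0n.
rewrite -(fineK (fin_num_measure P _ mB)) lee_fin ler_pdivlMr ?exprn_gt0// mulrC.
apply: le_trans h _; rewrite gN.
have sXT : sq P (X T).
  by apply: (elementary_sq P_complete W_bm e); rewrite lexx (ltW T_gt0).
apply: le_ip => //; first exact: sq_indicM.
move=> w; rewrite exprMn ler_piMl ?sqr_ge0//.
Qed.

(** Dyadic grids are nested, so the hitting events increase and Kolmogorov's bound passes to their
    union. Off the union, continuity of the path carries the bound from the dyadic times to all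
    times. *)
Lemma elementary_maximal_inequality k S X l : elementary P T W k S X -> 0 < l ->
  exists A, [/\ measurable A, (P A <= (ip P (X T) (X T) / l ^+ 2)%:E)%E &
    forall w, ~ A w -> {within `[0, T], continuous (fun t => W k t w)} ->
      forall t, 0 <= t <= T -> `|X t w| <= l].
Proof.
move=> e l0; pose F n := hit X l (2 ^ n) (2 ^ n).
have N0 n : (0 < 2 ^ n)%N by rewrite expn_gt0.
have mF n : measurable (F n) by exact: hit_measurable e (N0 n) (leqnn _).
have mU : measurable (\bigcup_n F n) by exact: bigcupT_measurable.
exists (\bigcup_n F n); split => //.
- have ndF : nondecreasing_seq F.
    apply/nondecreasing_seqP => n; apply/subsetPset => w [j jn h].
    exists (2 * j)%N; first by rewrite expnS leq_pmul2l.
    rewrite (_ : grid _ _ = grid (2 ^ n) j)// /grid expnS !natrM; field.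
    by rewrite pnatr_eq0 -lt0n N0.
  have cv := nondecreasing_cvg_mu (mu := P) mF mU ndF.
  rewrite -(cvg_lim _ cv)//; apply: lime_le; first by apply/cvg_ex; eexists; exact: cv.
  by apply: nearW => n; exact: kolmogorov e (N0 n) l0.
- move=> w nA cW t tT; have /within_itv_continuousP cX := elementary_continuous e cW.
  rewrite leNgt; apply/negP => lt.
  have e0 : 0 < `|X t w| - l by rewrite subr_gt0.
  have [dl dl0 h] := cX t tT _ e0.
  have [n hn] : exists n : nat, T / (2 ^ n)%:R < dl.
    have z1 : `|2^-1 : R| < 1 by rewrite ger0_norm ?invr_ge0// invf_lt1// ltr1n.
    have := @cvg_geometric R T (2^-1) z1.
    move=> /cvgrPdist_lt /(_ dl dl0) [n _ /(_ n (leqnn n))].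
    rewrite sub0r normrN /= => hh; exists n.
    by rewrite natrX -exprVn; exact: le_lt_trans (ler_norm _) hh.
  (* [grid (2 ^ n) j] is the last grid point up to [t]; it lies within one mesh, hence within [dl],
     of [t]. *)
  pose j := Num.truncn (t / T * (2 ^ n)%:R).
  have Nn0 : 0 < (2 ^ n)%:R :> R by rewrite ltr0n.
  have /andP[t0 t_T] := tT.
  have tT0 : 0 <= t / T * (2 ^ n)%:R by rewrite mulr_ge0// divr_ge0// ltW.
  have /andP[j1 j2] := truncn_itv tT0.
  have jn : (j <= 2 ^ n)%N.
    rewrite -(ler_nat R); apply: le_trans j1 _.
    by apply: ler_piMl; [exact: ltW|rewrite ler_pdivrMr// mul1r].
  have g1 : grid (2 ^ n) j <= t.
    move: j1; rewrite -/j /grid ler_pdivrMr// => h1.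
    by rewrite mulrC -ler_pdivlMr// mulrAC.
  have g2 : t < grid (2 ^ n) j + T / (2 ^ n)%:R.
    rewrite /grid -mulrDl -[X in _ + X]mulr1 -mulrDr natr1.
    rewrite ltr_pdivlMr// (_ : t * _ = T * (t / T * (2 ^ n)%:R)); last first.
      by field; rewrite gt_eqF.
    by rewrite ltr_pM2l.
  have := h (grid (2 ^ n) j) (grid_itv (N0 n) jn).
  rewrite ger0_norm ?subr_ge0// => /(_ _)/wrap[]; first by lra.
  have : `|X (grid (2 ^ n) j) w| < l.
    by rewrite ltNge; apply/negP => hh; apply: nA; exists n => //; exists j.
  have := ler_normB (X t w) (X (grid (2 ^ n) j) w).
  have := lerB_normD (X t w - X (grid (2 ^ n) j) w) (- X (grid (2 ^ n) j) w).
  have := ler_normD (X t w - X (grid (2 ^ n) j) w) (X (grid (2 ^ n) j) w).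
  rewrite subrK; lra.
Qed.

End Maximal.

(** The error bound depends on [m] alone; for paths whose steps are small from a common [m0] on, it
    makes the convergence uniform in time. *)
Lemma geometric_steps_cvg {R : realType} (u : nat -> R) (m0 : nat) :
  (forall m, (m0 <= m)%N -> `|u m.+1 - u m| <= 2^-1 ^+ m) ->
  exists l, u @ \oo --> l /\ forall m, (m0 <= m)%N -> `|l - u m| <= 2 * 2^-1 ^+ m.
Proof.
move=> h.
have step m p : (m0 <= m)%N -> `|u (m + p)%N - u m| <= 2 * 2^-1 ^+ m.
  move=> mm; suff : `|u (m + p)%N - u m| <= 2 * 2^-1 ^+ m * (1 - 2^-1 ^+ p).
    move=> h1; apply: le_trans h1 _; apply: ler_piMr.
      by rewrite mulr_ge0// exprn_ge0// invr_ge0.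
    by rewrite lerBlDr lerDl exprn_ge0// invr_ge0.
  elim: p => [|p ih]; first by rewrite addn0 subrr normr0 expr0 subrr mulr0.
  have h1 := h (m + p)%N (leq_trans mm (leq_addr _ _)).
  rewrite addnS (_ : _ - _ = (u (m + p).+1 - u (m + p)%N) + (u (m + p)%N - u m)); last by ring.
  apply: le_trans (ler_normD _ _) _; apply: le_trans (lerD h1 ih) _.
  rewrite exprD exprS le_eqVlt; apply/orP; left; apply/eqP; by field.
have g0 : geometric 2 2^-1 @ \oo --> (0 : R).
  by apply: cvg_geometric; rewrite ger0_norm ?invr_ge0// invf_lt1// ltr1n.
have cu : cvg (u @ \oo).
  apply: cauchy_cvg; apply/cauchy_ballP => e e0.
  have e2 : 0 < e / 2 by rewrite divr_gt0.
  move/cvgrPdist_lt : g0 => /(_ _ e2) [n1 _ hn1].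
  pose n := maxn m0 n1.
  have hn : 2 * 2^-1 ^+ n < e / 2.
    have := hn1 n (leq_maxr _ _); rewrite sub0r normrN /=.
    exact: le_lt_trans (ler_norm _).
  have near_n a : (n <= a)%N -> `|u a - u n| < e / 2.
    move=> na; have := step n (a - n)%N (leq_maxl _ _).
    by rewrite subnKC// => /le_lt_trans; apply.
  exists ([set x : R | `|x - u n| < e / 2], [set x : R | `|x - u n| < e / 2]) => /=.
    by split; exists n => //= a; exact: near_n.
  move=> [a b] /= [na nb]; rewrite /ball/=.
  rewrite (_ : a - b = (a - u n) - (b - u n)); last by ring.
  apply: le_lt_trans (ler_normB _ _) _; lra.
move/cvg_ex : cu => [l cl]; exists l; split => // m mm.
have cn : `|u (m + p)%N - u m| @[p --> \oo] --> `|l - u m|.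
  apply: cvg_norm; apply: cvgB; last exact: cvg_cst.
  rewrite (_ : (fun p => u (m + p)%N) = fun p => u (p + m)%N); last first.
    by apply/funext => p; rewrite addnC.
  by rewrite (cvg_shiftn m u).
rewrite -(cvg_lim _ cn)//; apply: limr_le; first by apply/cvg_ex; eexists; exact: cn.
by apply: nearW => p; exact: step.
Qed.

Section ItoLimit.
Context {R : realType} {d : measure_display} {Om : measurableType d} {J : finType}.
Variables (P : probability Om R) (T : R) (W : J -> R -> Om -> R).
Hypothesis T_gt0 : 0 < T.
Hypothesis P_complete : measure_is_complete P.
Hypothesis W_bm : independent_brownians P T W.
Local Notation TS := (timespace P).

Lemma ito_limit k (S X : nat -> R -> Om -> R) (H : R -> Om -> R) :
  (forall m, elementary P T W k (S m) (X m)) ->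
  measurable_fun setT (win T H : (measurableTypeR R * Om)%type -> R) ->
  (forall m, \int[TS]_z ((win T H z - win T (S m) z) ^+ 2)%:E <= (8^-1 ^+ m)%:E)%E ->
  exists Y, [/\ forall t, 0 <= t <= T -> Ft_measurable P W t (Y t),
    forall w, {within `[0, T], continuous (fun t => Y t w)} &
    forall t, 0 <= t <= T -> cvg2 P (fun m => X m t) (Y t)].
Proof.
move=> e mH hS.
have T0 : 0 <= T <= T by rewrite lexx ltW.
have mS m := proj1 (elementary_win_sq P_complete W_bm T (e m)).
have sS t m := elementary_win_sq P_complete W_bm t (e m).
have sX t m tT := @elementary_sq _ _ _ _ _ _ _ P_complete W_bm _ _ _ t (e m) tT.
pose Z n m t w := X n t w + (-1) * X m t w.
pose D n m t w := S n t w + (-1) * S m t w.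
have eZ n m : elementary P T W k (D n m) (Z n m).
  exact: elementaryD (e n) (elementaryZ (-1) (e m)).
have q8 (m n : nat) : (m <= n)%N -> (8^-1 : R) ^+ n <= 8^-1 ^+ m.
  by move=> mn; apply: ler_wiXn2l => //; rewrite ?invr_ge0// invf_le1// ler1n.
have dZ n m t : (m <= n)%N -> 0 <= t <= T ->
    ip P (Z n m t) (Z n m t) <= 4 * 8^-1 ^+ m.
  move=> mn tT; have [_ t_T] := andP tT.
  rewrite (elementary_isometry P_complete W_bm (eZ n m) (eZ n m) tT).
  have sD := elementary_win_sq P_complete W_bm T (eZ n m).
  apply: le_trans (le_ip (sq_win_le t_T sD) sD _) _.
    by move=> z; exact: win_sqr_le.
  rewrite -lee_fin -(ipE sD).
  have -> : win T (D n m) = fun z => (win T H z - win T (S m) z) + (-1) * (win T H z - win T (S n) z).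
    by apply/funext => z; rewrite /win /D; ring.
  apply: le_trans (int_sqrD_le TS _ _) _.
  - exact: measurable_funB.
  - by apply: measurable_funM => //; exact: measurable_funB.
  under [X in (_ + _ * X)%E]eq_integral do rewrite mulN1r sqrrN.
  rewrite (_ : (4 * 8^-1 ^+ m)%:E = 2%:E * (8^-1 ^+ m)%:E + 2%:E * (8^-1 ^+ m)%:E)%E; last first.
    by rewrite -!EFinM -EFinD; congr EFin; ring.
  apply: leeD; apply: lee_wpmul2l => //.
  by apply: le_trans (hS n) _; rewrite lee_fin q8.
have l0 (m : nat) : 0 < (2^-1 : R) ^+ m by rewrite exprn_gt0// invr_gt0.
have /choice [A hA] : forall m : nat, exists A, [/\ measurable A,
    (P A <= (ip P (Z m.+1 m T) (Z m.+1 m T) / (2^-1 ^+ m) ^+ 2)%:E)%E &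
    forall w, ~ A w -> {within `[0, T], continuous (fun t => W k t w)} ->
      forall t, 0 <= t <= T -> `|Z m.+1 m t w| <= 2^-1 ^+ m].
  move=> m.
  have [A0 [h1 h2 h3]] := elementary_maximal_inequality T_gt0 P_complete W_bm (eZ m.+1 m) (l0 m).
  by exists A0; split.
(* Here the rate 1/8 originates. The level 2^-m costs a factor 4^m in Kolmogorov's inequality;
   against second moments of order 8^-m this leaves four times 2^-m, which is summable, and
   Borel-Cantelli applies. *)
have PA m : (P (A m) <= (8 / (2 ^ m.+1)%:R)%:E)%E.
  have [_ PA _] := hA m; apply: le_trans PA _; rewrite lee_fin ler_pdivrMr ?exprn_gt0//.
  apply: le_trans (dZ _ _ _ (leqnSn m) T0) _.
  rewrite natrX exprS -[(2 ^+ m)]invrK -exprVn.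
  have -> : (8^-1 : R) ^+ m = (2^-1 ^+ m) ^+ 3.
    by rewrite -exprM mulnC exprM; congr (_ ^+ _); rewrite exprVn -natrX.
  move: (2^-1 ^+ m) (l0 m) => q q0.
  rewrite le_eqVlt; apply/orP; left; apply/eqP; field.
  by rewrite gt_eqF.
have mA m : measurable (A m) by case: (hA m).
have N0 : P (lim_sup_set A) = 0%E.
  apply: lim_sup_set_cvg0 => //.
  have h8 : (0 <= 8 :> R) by [].
  apply: le_lt_trans (ltry 8); apply: le_trans _ (epsilon_trick0 xpredT h8).
  by apply: lee_nneseries => // m _; exact: PA.
have mN : measurable (lim_sup_set A).
  by apply: bigcapT_measurable => n; apply: bigcup_measurable.
pose good := [set w | ~ lim_sup_set A w /\ {within `[0, T], continuous (fun t => W k t w)}].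
have good_ae : {ae P, forall w, good w}.
  have [bk _] := W_bm; have [_ _ cW _ _] := bk k.
  have nN : {ae P, forall w, ~ lim_sup_set A w}.
    by exists (lim_sup_set A); split => // w /= /contrapT.
  by apply: filterS2 nN cW => w h1 h2; split.
have goodP w : good w -> exists m0, forall t, 0 <= t <= T -> forall m, (m0 <= m)%N ->
    `|X m.+1 t w - X m t w| <= 2^-1 ^+ m.
  move=> [nA cW]; move: nA => /existsNP[m0 /not_implyP[_ nA]].
  exists m0 => t tT m mm; have [_ _ hm] := hA m.
  rewrite -[X in _ - X]mul1r -mulNr; apply: hm => // Am; apply: nA; by exists m.
(* Paths outside [good] are set to 0: [Y] is then continuous for every [w], and still adapted since
   [good] has full measure. *)
pose Y t w : R := if w \in good then lim (X m t w @[m --> \oo]) else 0.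
have XY t w : 0 <= t <= T -> \1_good w * X m t w @[m --> \oo] --> Y t w.
  move=> tT; rewrite /Y indicE; case: (boolP (w \in good)) => [/set_mem gw|_] /=.
    under eq_fun do rewrite mul1r.
    have [m0 h] := goodP w gw.
    by have [l [cl _]] := @geometric_steps_cvg R (fun m => X m t w) m0 (h t tT);
      apply/cvg_ex; exists l.
  by under eq_fun do rewrite mul0r; exact: cvg_cst.
have gX t m : {ae P, forall w, X m t w = \1_good w * X m t w}.
  by apply: filterS good_ae => w gw; rewrite indicE mem_set// mul1r.
have FgX t m : 0 <= t <= T -> Ft_measurable P W t (fun w => \1_good w * X m t w).
  by move=> tT; apply: (Ft_measurable_ae (gX t m)); exact: elementary_Ft (e m) tT.
have FY t : 0 <= t <= T -> Ft_measurable P W t (Y t).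
  move=> tT; apply: (@measurable_fun_cvg _ (g_sigma_algebraType (filtration_gen P W t)) _ setT (fun m w => \1_good w * X m t w)).
    by move=> m; exact: FgX.
  by move=> w _; exact: XY.
exists Y; split => //.
- move=> w; apply/within_itv_continuousP => t tT eps eps0.
  rewrite /Y; case: (boolP (w \in good)) => [/set_mem gw|_]; last first.
    by exists 1 => // s _ _; rewrite subrr normr0.
  have [m0 h] := goodP w gw.
  have lim_le s m : 0 <= s <= T -> (m0 <= m)%N ->
      `|lim (X m s w @[m --> \oo]) - X m s w| <= 2 * 2^-1 ^+ m.
    move=> sT mm; have [l [cl hl]] := @geometric_steps_cvg R (fun m => X m s w) m0 (h s sT).
    by rewrite (cvg_lim _ cl)//; exact: hl.
  have e3 : 0 < eps / 3 by rewrite divr_gt0.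
  have g0 : geometric 2 2^-1 @ \oo --> (0 : R).
    by apply: cvg_geometric; rewrite ger0_norm ?invr_ge0// invf_lt1// ltr1n.
  move/cvgrPdist_lt : g0 => /(_ _ e3) [n1 _ hn1].
  pose n := maxn m0 n1.
  have hn : 2 * 2^-1 ^+ n < eps / 3.
    have := hn1 n (leq_maxr _ _); rewrite sub0r normrN /=.
    exact: le_lt_trans (ler_norm _).
  have [_ cW] := gw.
  have /within_itv_continuousP/(_ t tT _ e3)[dl dl0 hdl] := elementary_continuous (e n) cW.
  exists dl => // s sT ts; have h1 := hdl s sT ts.
  have h2 := lim_le t n tT (leq_maxl _ _); have h3 := lim_le s n sT (leq_maxl _ _).
  set a := lim _ in h2 *; set b := lim _ in h3 *.
  rewrite (_ : a - b = (a - X n t w) - (b - X n s w) + (X n t w - X n s w)); last by ring.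
  apply: le_lt_trans (ler_normD _ _) _.
  have := ler_normB (a - X n t w) (b - X n s w); lra.
- move=> t tT; have [_ t_T] := andP tT.
  have mX m : measurable_fun setT (X m t) by case: (sX t m tT).
  have mY : measurable_fun setT (Y t) := Ft_measurable_measurable P_complete W_bm t_T (FY t tT).
  have mgX m : measurable_fun setT (fun w => \1_good w * X m t w).
    exact: (Ft_measurable_measurable P_complete W_bm t_T (FgX t m tT)).
  have bnd m : (\int[P]_w ((Y t w - X m t w) ^+ 2)%:E <= (4 * 8^-1 ^+ m)%:E)%E.
    (* Fatou's lemma is applied to [\1_good * X n], which converges at every point. *)
    rewrite (_ : (\int[P]_w _ = \int[P]_w ((Y t w - \1_good w * X m t w) ^+ 2)%:E)%E); last first.
      apply: ae_eq_integral => //; try by apply: measurable_sqr; exact: measurable_funB.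
      by apply: filterS (gX t m) => w + _ => /= <-.
    apply: (@fatou_le _ _ _ _ (fun n w =>
        ((\1_good w * X (n + m)%N t w - \1_good w * X m t w) ^+ 2)%:E)).
    + by move=> n; apply: measurable_sqr; exact: measurable_funB.
    + by move=> n w; rewrite lee_fin sqr_ge0.
    + move=> w; apply: cvg_EFin; first exact: nearW.
      rewrite /comp/=; apply: cvgM; (apply: cvgB; last exact: cvg_cst).
        by rewrite (cvg_shiftn m (fun n => \1_good w * X n t w)); exact: XY.
      by rewrite (cvg_shiftn m (fun n => \1_good w * X n t w)); exact: XY.
    + move=> n; have sZ := elementary_sq P_complete W_bm (eZ (n + m)%N m) tT.
      apply: (@le_trans _ _ (\int[P]_w (Z (n + m)%N m t w ^+ 2)%:E)%E).
        apply: ge0_le_integral => //.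
        * by move=> w _; rewrite lee_fin sqr_ge0.
        * by apply: measurable_sqr; exact: measurable_funB.
        * by apply: measurable_sqr; case: sZ.
        * move=> w _; rewrite lee_fin /Z mulN1r -mulrBr exprMn ler_piMl ?sqr_ge0//.
      by rewrite (ipE sZ) lee_fin; apply: dZ => //; exact: leq_addl.
  apply: (@squeeze_cvge _ _ _ _ (fun=> 0%E) _ (fun m => (4 * 8^-1 ^+ m)%:E)) => //.
  + apply: nearW => m; rewrite bnd andbT.
    by apply: integral_ge0 => w _; rewrite lee_fin sqr_ge0.
  + exact: cvg_cst.
  + apply: cvg_EFin; first exact: nearW.
    have : geometric 4 8^-1 @ \oo --> (0 : R); last by [].
    by apply: cvg_geometric; rewrite ger0_norm ?invr_ge0// invf_lt1// ltr1n.
Qed.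

End ItoLimit.

(** Truncation to [[-M, M]]. Written with absolute values, its measurability and its Lipschitz bound
    follow from those of the norm. *)
Definition clip {R : realType} (M x : R) : R := (`|x + M| - `|x - M|) / 2.

Lemma clip_le {R : realType} (M x : R) : 0 <= M -> `|clip M x| <= M.
Proof.
by move=> M0; rewrite /clip ler_norml; case: (ger0P (x + M)); case: (ger0P (x - M)) => *; lra.
Qed.

Lemma clip_id {R : realType} (M x : R) : `|x| <= M -> clip M x = x.
Proof.
rewrite ler_norml /clip => /andP[h1 h2]; rewrite ger0_norm ?ler0_norm; lra.
Qed.

Lemma clip_lip {R : realType} (M x y : R) : `|clip M x - clip M y| <= `|x - y|.
Proof.
have h1 := lerB_dist (x + M) (y + M); have h2 := lerB_dist (y + M) (x + M).
have h3 := lerB_dist (x - M) (y - M); have h4 := lerB_dist (y - M) (x - M).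
move: h1 h2 h3 h4; rewrite (distrC (y + M)) (distrC (y - M)).
rewrite (_ : x + M - (y + M) = x - y); last by ring.
rewrite (_ : x - M - (y - M) = x - y); last by ring.
by rewrite /clip ler_norml => *; lra.
Qed.

Lemma clip_sqr_le {R : realType} (M x : R) : 0 <= M -> (x - clip M x) ^+ 2 <= x ^+ 2.
Proof.
move=> M0; rewrite -(real_normK (num_real x)) -(real_normK (num_real (_ - _))).
rewrite ler_sqr ?nnegrE//; rewrite /clip.
by case: (ger0P (x + M)); case: (ger0P (x - M)); case: (ger0P x) => *;
  rewrite ler_norml; lra.
Qed.

Lemma measurable_clip {R : realType} {d} {T : measurableType d} (D : set T)
  (M : R) (f : T -> R) : measurable_fun D f -> measurable_fun D (fun x => clip M (f x)).
Proof.
move=> mf; apply: measurable_funM => //.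
by apply: measurable_funB; apply: measurableT_comp => //;
  [apply: measurable_funD|apply: measurable_funB].
Qed.

Lemma bounded_cvg0 {d} {T : measurableType d} {R : realType}
  (nu : {measure set T -> \bar R}) (D : set T) (f : nat -> T -> \bar R) (C : R) :
  measurable D -> (nu D < +oo)%E -> (forall n, measurable_fun D (f n)) ->
  (forall n x, D x -> `|f n x| <= C%:E)%E ->
  {ae nu, forall x, D x -> f n x @[n --> \oo] --> 0%E} ->
  (\int[nu]_(x in D) f n x)%E @[n --> \oo] --> 0%E.
Proof.
move=> mD nuD mf fC f0.
have iC : nu.-integrable D (fun=> C%:E).
  rewrite (_ : (fun=> C%:E) = EFin \o (fun=> C))//.
  apply: measurable_bounded_integrable => //.
  by exists `|C|; split; [exact: num_real|move=> y Cy x _ /=; exact: ltW].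
have [_ _] := @dominated_convergence _ _ _ nu D mD f (fun=> 0%E) (fun=> C%:E) mf
  (measurable_cst _) f0 iC (nearW _ (fun x n Dx => fC n x Dx)).
by rewrite integral0.
Qed.

Lemma derivable_approx {R : realType} (F : R -> R) (t g : R) :
  derivable F t 1 -> F^`()%classic t = g -> forall e, 0 < e ->
  exists2 dl, 0 < dl & forall s, `|s - t| < dl -> `|F s - F t - (s - t) * g| <= e * `|s - t|.
Proof.
move=> dF; rewrite derive1E => Fg e e0.
have : (fun h => h^-1 *: (F (h *: 1 + t) - F t)) @ 0^' --> g by rewrite -Fg; exact: dF.
move/cvgrPdist_le => /(_ e e0)/nbhs_ballP[dl /= dl0 h].
exists dl => // s st.
have [->|ts] := eqVneq s t; first by rewrite !subrr mul0r normr0 mulr0 subr0 normr0.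
have st0 : s - t != 0 by rewrite subr_eq0.
have := h (s - t); rewrite /ball/= sub0r normrN => /(_ st st0).
rewrite -[(_ *: 1)]/((s - t) * 1) mulr1 subrK -[_ *: _]/((s - t)^-1 * (F s - F t)) => h1.
rewrite (_ : _ - _ - _ = - ((g - (s - t)^-1 * (F s - F t)) * (s - t))); last by field.
by rewrite normrN normrM ler_wpM2r.
Qed.

(* A cell ]s - dl, s] that lies shortly before t need not contain t; averages
   over it still converge because F(s) and F(s - dl) are both compared with F(t). *)
Lemma shifted_average {R : realType} (F : R -> R) (t g : R) :
  derivable F t 1 -> F^`()%classic t = g -> forall e, 0 < e ->
  exists2 r, 0 < r & forall s dl, 0 < dl -> dl < r -> s < t -> t <= s + dl ->
    `|(F s - F (s - dl)) / dl - g| <= e.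
Proof.
move=> dF Fg e e0; have e3 : 0 < e / 3 by rewrite divr_gt0.
have [r r0 h] := derivable_approx dF Fg e3.
exists (r / 2) => [|s dl dl0 dlr st tsdl]; first by rewrite divr_gt0.
have h1 : `|s - t| = t - s by rewrite ler0_norm; lra.
have h2 : `|s - dl - t| = t - s + dl by rewrite ler0_norm; lra.
have := h s; rewrite h1 => /(_ _)/wrap[|g1]; first by lra.
have := h (s - dl); rewrite h2 => /(_ _)/wrap[|g2]; first by lra.
rewrite (_ : _ / dl - g = ((F s - F t - (s - t) * g) - (F (s - dl) - F t - (s - dl - t) * g)) / dl);
  last by field; rewrite gt_eqF.
rewrite normrM [X in _ * X]ger0_norm ?invr_ge0 ?(ltW dl0)// ler_pdivrMr//.
apply: le_trans (ler_normB _ _) _; nra.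
Qed.

Lemma locate {R : realType} (u : nat -> R) (N : nat) (t : R) : u 0%N < t -> t <= u N ->
  exists2 j, (j < N)%N & u j < t <= u j.+1.
Proof.
elim: N => [|N ih] u0 tN; first by have := lt_le_trans u0 tN; rewrite ltxx.
have [tuN|uNt] := leP t (u N).
  by have [j jN h] := ih u0 tuN; exists j => //; exact: leqW.
by exists N => //; rewrite uNt.
Qed.

Lemma sum_cells {R : realType} (u c : nat -> R) (N j : nat) (t : R) :
  (forall i, u i <= u i.+1) -> (j < N)%N -> u j < t <= u j.+1 ->
  \sum_(i < N) c i * \1_(`]u i, u i.+1]) t = c j.
Proof.
move=> uS jN /andP[h1 h2].
have u_le a b : (a <= b)%N -> u a <= u b.
  by move=> /subnKC <-; elim: (b - a)%N => [|p ih]; rewrite ?addn0// addnS (le_trans ih).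
rewrite (bigD1 (Ordinal jN))//= indicE mem_set/=; last by rewrite in_itv/= h1 h2.
rewrite mulr1 big1 ?addr0// => i /eqP ij; rewrite indicE memNset ?mulr0//=.
rewrite in_itv/= => /andP[g1 g2]; apply: ij; apply/val_inj/eqP => /=.
rewrite eqn_leq; apply/andP; split; rewrite leqNgt; apply/negP => hh.
  by have := le_lt_trans h2 (le_lt_trans (u_le _ _ hh) g1); rewrite ltxx.
by have := le_lt_trans g2 (le_lt_trans (u_le _ _ hh) h1); rewrite ltxx.
Qed.

(** * Density of simple processes and existence of the integral *)

Section Density.
Context {R : realType} {d : measure_display} {Om : measurableType d} {J : finType}.
Variables (P : probability Om R) (T : R) (W : J -> R -> Om -> R).
Hypothesis T_gt0 : 0 < T.
Hypothesis P_complete : measure_is_complete P.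
Hypothesis W_bm : independent_brownians P T W.
Local Notation mu := (@lebesgue_measure R).
Local Notation TS := (timespace P).
Local Notation Ft t := (g_sigma_algebraType (filtration_gen P W t)).

Definition prim (X : R -> Om -> R) (t : R) (w : Om) : R := \int[mu]_(s in `[0, t]) X s w.

(** Progressive measurability makes the integrand jointly measurable on [[0, t]] with respect to
    F_t, so Tonelli, applied to the positive and the negative part, stays inside F_t. *)
Lemma prim_Ft X t : progressive P T W X -> 0 <= t <= T -> Ft_measurable P W t (prim X t).
Proof.
move=> pX tT; have mX := pX t tT.
pose D : set (measurableTypeR R * Ft t) := `[0, t]%classic `*` setT.
have mD : measurable D by apply: measurableX => //; exact: measurable_itv.
pose g : measurableTypeR R * Ft t -> \bar R := (fun p => (X p.1 p.2)%:E) \_ D.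
have mg : measurable_fun setT g.
  by apply/(measurable_restrictT _ mD); apply/measurable_EFinP; exact: mX.
have gE s w : g (s, w) = ((fun s => (X s w)%:E) \_ `[0, t]) s.
  rewrite /g !patchE; have -> // : ((s, w) \in D) = (s \in `[0, t]%classic).
  by apply/idP/idP; rewrite !inE => //; case.
have mI (h : measurableTypeR R * Ft t -> \bar R) : measurable_fun setT h ->
    (forall p, 0 <= h p)%E ->
    measurable_fun setT (fun w : Ft t => \int[mu]_s h (s, w))%E.
  move=> mh h0.
  exact: (@measurable_fun_fubini_tonelli_G _ _ (measurableTypeR R) (Ft t) R (@lebesgue_measure R) h mh h0).
rewrite /Ft_measurable /prim /Rintegral.
apply: measurableT_comp; first exact: fine_measurable.
have -> : (fun w => \int[mu]_(s in `[0%R, t]) (X s w)%:E)%E =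
   (fun w => (\int[mu]_s (funepos g (s, w))) - (\int[mu]_s (funeneg g (s, w))))%E.
  apply/funext => w; rewrite integral_mkcond integralE; congr (_ - _)%E; apply: eq_integral => s _.
    by rewrite [@funepos]unlock /= gE.
  by rewrite [@funeneg]unlock /= gE.
apply: emeasurable_funB; apply: mI => //.
- exact: measurable_funepos.
- exact: measurable_funeneg.
Qed.

Let grid (N j : nat) : R := T / N%:R * j%:R.

Let grid_itv N j : (0 < N)%N -> (j <= N)%N -> 0 <= grid N j <= T.
Proof.
move=> N0 jN; rewrite /grid mulr_ge0 ?divr_ge0// ?(ltW T_gt0)//=.
by rewrite -mulrA ler_piMr ?(ltW T_gt0)// mulrC ler_pdivrMr ?ltr0n// mul1r ler_nat.
Qed.

Let grid_mono N i j : (i <= j)%N -> grid N i <= grid N j.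
Proof. by move=> ij; rewrite /grid ler_wpM2l ?divr_ge0 ?(ltW T_gt0)// ler_nat. Qed.

(** The value used on the cell that starts at [grid N j]; averaging backwards keeps it measurable at
    that time. For [j = 0] the predecessor is 0 again and the value is 0. *)
Let avg M (X : R -> Om -> R) N j w : R :=
  clip M ((prim X (grid N j) w - prim X (grid N j.-1) w) / (T / N%:R)).

Let avg_Ft M X N j : progressive P T W X -> (0 < N)%N -> (j <= N)%N ->
  Ft_measurable P W (grid N j) (avg M X N j).
Proof.
move=> pX N0 jN; apply: measurable_clip; apply: measurable_funM; last exact: measurable_cst.
apply: measurable_funB; first by apply: prim_Ft => //; exact: grid_itv.
have h := grid_mono N (leq_pred j).
apply: Ft_measurable_mono h _; apply: prim_Ft => //; apply: grid_itv => //.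
exact: leq_trans (leq_pred _) jN.
Qed.

Definition average_process M X (pX : progressive P T W X) (M0 : 0 <= M) N :
  simple_process P T W := @SimpleProcess R d Om J P T W N.+1 (grid N.+1)
    (avg M X N.+1) (fun j jN => grid_itv (ltn0Sn N) jN)
    (fun j _ => grid_mono N.+1 (leqnSn j))
    (fun j jN => avg_Ft M pX (ltn0Sn N) (ltnW jN))
    (fun j _ => ex_intro _ M (fun w => clip_le _ M0)).

Let average_val M X (pX : progressive P T W X) (M0 : 0 <= M) N j t w :
  (j < N.+1)%N -> grid N.+1 j < t <= grid N.+1 j.+1 ->
  simple_val (average_process pX M0 N) t w = avg M X N.+1 j w.
Proof.
move=> jN h; rewrite /simple_val /=.
exact: (@sum_cells _ (grid N.+1) (fun j => avg M X N.+1 j w) _ _ _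
  (fun i => grid_mono N.+1 (leqnSn i)) jN h).
Qed.

Let average_le M X (pX : progressive P T W X) (M0 : 0 <= M) N t w :
  `|simple_val (average_process pX M0 N) t w| <= M.
Proof.
have [tT|tT] := leP t (grid N.+1 N.+1); last first.
  rewrite /simple_val big1 ?normr0// => i _; rewrite indicE memNset ?mulr0//=.
  rewrite in_itv/= => /andP[_ h]; have := le_lt_trans (grid_mono N.+1 (ltn_ord i)) tT.
  by rewrite ltNge h.
have [t0|t0] := ltP (grid N.+1 0) t.
  have [j jN h] := locate t0 tT.
  by rewrite (average_val pX M0 w jN h); exact: clip_le.
rewrite /simple_val big1 ?normr0// => i _; rewrite indicE memNset ?mulr0//=.
rewrite in_itv/= => /andP[h _]; have := le_lt_trans (grid_mono N.+1 (leq0n i)) h.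
by rewrite ltNge t0.
Qed.

Let measurable_section X w : progressive P T W X ->
  measurable_fun setT ((fun s => win T X (s, w)) : measurableTypeR R -> R).
Proof.
by move=> pX; apply: measurableT_comp (measurable_win T_gt0 P_complete W_bm pX) _.
Qed.

Let integrable_section M X w : progressive P T W X -> (forall t w, `|X t w| <= M) ->
  mu.-integrable setT (EFin \o (fun s => win T X (s, w))).
Proof.
move=> pX XM; have mX := measurable_section w pX.
have -> : EFin \o (fun s => win T X (s, w)) = (EFin \o (fun s => win T X (s, w))) \_ `[0, T].
  apply/funext => s; rewrite patchE mem_setE in_itv/=; case: ifPn => // h.
  by rewrite win0E.
apply/(@integrable_mkcond _ (measurableTypeR R) R mu `[0, T]%classic _ (measurable_itv _)).
apply: measurable_bounded_integrable; first exact: measurable_itv.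
- by rewrite /= lebesgue_measure_itv/=; case: ifP; rewrite -?EFinD ltry.
- exact: measurable_funTS.
- exists M; split; first exact: num_real.
  move=> y My s _ /=; apply: le_trans _ (ltW My); rewrite /win normrM.
  rewrite -[leRHS]mulr1 ler_pM//.
  by rewrite indicE; case: (_ \in _); rewrite ?normr1 ?normr0.
Qed.

(** Lebesgue differentiation along a fixed path: at almost every [t] the primitive is derivable with
    derivative [X t w]. *)
Let average_cvg M X (pX : progressive P T W X) (M0 : 0 <= M) w :
  (forall t w, `|X t w| <= M) ->
  {ae mu, forall t, `[0, T]%classic t ->
    simple_val (average_process pX M0 N) t w @[N --> \oo] --> X t w}.
Proof.
move=> XM; pose g s := win T X (s, w).
have ig := integrable_section w pX XM.
have ig' y : mu.-integrable `]-oo, y] (EFin \o g).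
  by apply: integrableS ig => //; exact: measurable_itv.
have lg : locally_integrable [set: R] g by apply: open_integrable_locally => //; exact: openT.
(* Time 0 is discarded, so that for a fine mesh [t] lies beyond the first cell, whose value carries
   no information. *)
have n0 : {ae mu, forall t : R, t <> 0}.
  exists [set 0]; split => //; first by rewrite lebesgue_measure_set1.
  by move=> t /= /contrapT.
apply: (@filterS2 _ _ (ae_filter_ringOfSetsType mu) _ _ _ _ n0 (FTC1Ny ig' lg)) => t t0 hF; rewrite /= in_itv/= => /andP[t_0 tT].
have t1 : 0 < t by rewrite lt_neqAle t_0 andbT eq_sym; apply/eqP.
have [] := hF; set F := (fun x : R => _) => dF Fg.
have FE s : 0 <= s <= T -> F s = prim X s w.
  move=> /andP[s0 sT]; rewrite /F /prim Rintegral_mkcond [RHS]Rintegral_mkcond.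
  apply: eq_Rintegral => r _; rewrite !patchE !mem_setE !in_itv/=.
  case: (leP r s) => rs; last by rewrite andbF.
  case: (leP 0 r) => r0 /=; first by rewrite /g winE// r0 (le_trans rs).
  by rewrite /g win0E// leNgt r0.
have gt : g t = X t w by rewrite /g winE// t_0.
apply/cvgrPdist_le => e e0; have [r r0 hr] := shifted_average dF Fg e0.
have r1 : 0 < Num.min r t by rewrite lt_min r0.
have := near_infty_natSinv_lt (PosNum (divr_gt0 r1 T_gt0)).
apply: filterS => N /= hN.
have dN : T / N.+1%:R < Num.min r t.
  by move: hN; rewrite ltr_pdivlMr// mulrC.
move: dN; rewrite lt_min => /andP[dr dt].
have d0 : 0 < T / N.+1%:R by rewrite divr_gt0.
have gN : t <= grid N.+1 N.+1 by rewrite /grid divfK.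
have g0 : grid N.+1 0 < t by rewrite /grid mulr0.
have [j jN /andP[h1 h2]] := locate g0 gN.
rewrite (average_val pX M0 w jN) ?h1// /avg.
case: j => [|j] in jN h1 h2 *.
  by move: h2; rewrite /grid mulr1 leNgt dt.
have gj := grid_itv (ltn0Sn N) (ltnW jN).
have gj' := grid_itv (ltn0Sn N) (ltnW (ltnW jN)).
have gS i : grid N.+1 i.+1 = grid N.+1 i + T / N.+1%:R.
  by rewrite /grid -[i.+1%:R]natr1 mulrDr mulr1.
rewrite -(FE _ gj) -(FE _ gj') -[X t w](@clip_id _ M)//.
apply: le_trans (clip_lip _ _ _) _; rewrite -gt distrC.
have -> : grid N.+1 j.+1.-1 = grid N.+1 j.+1 - T / N.+1%:R by rewrite /= gS addrK.
by apply: hr => //; rewrite -gS.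
Qed.

Lemma win_section (g : R -> Om -> R) t w :
  (\int[mu]_s (win t g (s, w))%:E = \int[mu]_(s in `[0%R, t]) (g s w)%:E)%E.
Proof.
rewrite [RHS]integral_mkcond; apply: eq_integral => s _.
rewrite patchE mem_setE in_itv/=; case: ifPn => h; first by rewrite winE.
by rewrite win0E.
Qed.

(** Bounded convergence twice, in time for each path and then over [Om], because the exceptional
    times depend on the path. *)
Let average_dense M X (pX : progressive P T W X) (M0 : 0 <= M) (k : J) :
  (forall t w, `|X t w| <= M) ->
  cvg2 TS (fun N => win T (simple_val (average_process pX M0 N))) (win T X).
Proof.
move=> XM; pose S N := simple_val (average_process pX M0 N).
have mX := measurable_win T_gt0 P_complete W_bm pX.
pose D N t w := (X t w - S N t w) ^+ 2.
have DE N : win T (D N) = fun z => (win T X z - win T (S N) z) ^+ 2.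
  by rewrite win_sqr winB.
have mD N : measurable_fun setT (fun z : measurableTypeR R * Om => (win T (D N) z)%:E).
  apply/measurable_EFinP; rewrite DE; apply: measurable_funX; apply: measurable_funB => //.
  by case: (elementary_win_sq P_complete W_bm T (simple_elementary k (average_process pX M0 N))).
have D0 N z : (0 <= (win T (D N) z)%:E)%E by rewrite DE lee_fin sqr_ge0.
have D_le N t w : D N t w <= (M + M) ^+ 2.
  rewrite /D -(real_normK (num_real (_ - _))) ler_sqr ?nnegrE ?addr_ge0//.
  by apply: le_trans (ler_normB _ _) _; apply: lerD => //; exact: average_le.
have muT : (mu `[0%R, T] < +oo)%E.
  by rewrite lebesgue_measure_itv/=; case: ifP; rewrite -?EFinD ltry.
have TSE : (fun N => \int[TS]_z ((win T X z - win T (simple_val (average_process pX M0 N)) z) ^+ 2)%:E)%E =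
    fun N => (\int[P]_w fubini_G mu (fun z => (win T (D N) z)%:E) w)%E.
  apply/funext => N; transitivity (\int[TS]_z (win T (D N) z)%:E)%E; first by rewrite DE.
  by rewrite (@fubini_tonelli2 _ _ _ _ _ (@lebesgue_measure R) P).
rewrite /cvg2 TSE.
have fE N w : fubini_G mu (fun z => (win T (D N) z)%:E) w =
    (\int[mu]_(s in `[0%R, T]) (D N s w)%:E)%E by exact: win_section.
have mDw N w : measurable_fun `[0, T]%classic (fun s : measurableTypeR R => (D N s w)%:E).
  apply/(@measurable_restrictT _ _ (measurableTypeR R) _ _ _ (measurable_itv _)).
  rewrite (_ : _ \_ _ = fun s : measurableTypeR R => (win T (D N) (s, w))%:E).
    by apply: measurableT_comp (mD N) _.
  apply/funext => s; rewrite patchE mem_setE in_itv/=; case: ifPn => h; first by rewrite winE.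
  by rewrite win0E.
apply: (@bounded_cvg0 _ _ _ _ _ _ ((M + M) ^+ 2 * T)) => //.
- by apply: le_lt_trans (probability_le1 P measurableT) _; rewrite ltry.
- move=> N; exact: (@measurable_fun_fubini_tonelli_G _ _ (measurableTypeR R) Om R (@lebesgue_measure R) _ (mD N)).
- move=> N w _; rewrite gee0_abs; last by apply: integral_ge0.
  rewrite fE; apply: (@le_trans _ _ (\int[mu]_(s in `[0%R, T]) ((M + M) ^+ 2)%:E)%E).
    apply: ge0_le_integral => //.
    + by move=> s _; rewrite lee_fin sqr_ge0.
    + exact: mDw.
    + by move=> s _; rewrite lee_fin.
  rewrite integral_cst//=.
  by rewrite lebesgue_measure_itv/= lte_fin T_gt0 oppr0 adde0 -EFinM.
- apply: nearW => w _; under eq_fun do rewrite fE.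
  apply: (@bounded_cvg0 _ (measurableTypeR R) _ _ _ _ ((M + M) ^+ 2)) => //.
    by move=> N; exact: mDw.
    by move=> N s _; rewrite gee0_abs ?lee_fin ?sqr_ge0.
  apply: (@filterS _ _ (ae_filter_ringOfSetsType mu) _ _ _ (average_cvg pX M0 w XM)) => s hs sT.
  apply: cvg_EFin; first exact: nearW.
  rewrite /comp/= /D [X in _ --> X](_ : _ = (X s w - X s w) * (X s w - X s w)); last by rewrite subrr mulr0.
  by apply: cvgM; apply: cvgB; [exact: cvg_cst|exact: hs|exact: cvg_cst|exact: hs].
Qed.

Let clip_dense X : progressive P T W X -> sq TS (win T X) ->
  cvg2 TS (fun N => win T (fun t w => clip N%:R (X t w))) (win T X).
Proof.
move=> pX sX; have mX := proj1 sX.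
have winC N z : win T (fun t w => clip N%:R (X t w)) z = clip N%:R (win T X z).
  rewrite /win indicE; case: (_ \in _); rewrite ?mulr1// !mulr0.
  by rewrite (clip_id (x := 0)) ?normr0.
have mD N : measurable_fun setT (fun z : measurableTypeR R * Om =>
    ((win T X z - win T (fun t w => clip N%:R (X t w)) z) ^+ 2)%:E).
  apply: measurable_sqr; apply: measurable_funB => //.
  rewrite (_ : win T _ = fun z => clip N%:R (win T X z)); last exact/funext/winC.
  exact: measurable_clip.
have [] := @dominated_convergence _ _ _ TS setT measurableT (fun N z =>
  ((win T X z - win T (fun t w => clip N%:R (X t w)) z) ^+ 2)%:E) (fun=> 0%E)
  (fun z => (win T X z ^+ 2)%:E) mD (measurable_cst _) _ (sq_integrable sX) _.
- apply: nearW => z _; apply: (@cvg_near_cst _ _ 0%E).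
  exists (Num.truncn `|win T X z|).+1 => // N /= hN; rewrite winC clip_id ?subrr ?expr0n//.
  apply: le_trans (ltW (Num.Theory.truncnS_gt _)) _; by rewrite ler_nat.
- apply: nearW => z N _; rewrite gee0_abs ?lee_fin ?sqr_ge0// winC.
  exact: clip_sqr_le.
by move=> _ _; rewrite integral0.
Qed.

Let cvg2_lt (u : nat -> R * Om -> R) f e : cvg2 TS u f -> 0 < e ->
  exists N, (\int[TS]_z ((f z - u N z) ^+ 2)%:E <= e%:E)%E.
Proof.
move=> /fine_cvgP[h1 /cvgr0_norm_lt h2] e0.
have := filterI h1 (h2 e e0) => -[N _ /(_ N (leqnn N))] [h3 h4]; exists N.
rewrite -(fineK h3) lee_fin; apply: le_trans (ler_norm _) _; exact: ltW.
Qed.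

Lemma simple_dense X e (k : J) : progressive P T W X -> sq TS (win T X) -> 0 < e ->
  exists S : simple_process P T W,
    (\int[TS]_z ((win T X z - win T (simple_val S) z) ^+ 2)%:E <= e%:E)%E.
Proof.
(* Two approximation errors of size [e / 4], each doubled when the square of their sum is split. *)
move=> pX sX e0; have e4 : 0 < e / 4 by rewrite divr_gt0.
have [M hM] := cvg2_lt (clip_dense pX sX) e4.
pose Y t w := clip M%:R (X t w).
have pY : progressive P T W Y by move=> t tT; apply: measurable_clip; exact: pX.
have YM t w : `|Y t w| <= M%:R by exact: clip_le.
have [N hN] := cvg2_lt (average_dense pY (ler0n _ M) k YM) e4.
exists (average_process pY (ler0n _ M) N); set S := average_process _ _ _ in hN *.
have mX := proj1 sX; have mY := measurable_win T_gt0 P_complete W_bm pY.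
have mS : measurable_fun setT (win T (simple_val S) : (measurableTypeR R * Om)%type -> R).
  by case: (elementary_win_sq P_complete W_bm T (simple_elementary k S)).
rewrite (_ : (\int[TS]_z _ = \int[TS]_z (((win T X z - win T Y z) + (win T Y z - win T (simple_val S) z)) ^+ 2)%:E)%E); last first.
  by apply: eq_integral => z _; rewrite addrA subrK.
apply: le_trans (int_sqrD_le _ _ _) _; try exact: measurable_funB.
rewrite (_ : e%:E = 2%:E * (e / 4)%:E + 2%:E * (e / 4)%:E)%E; last first.
  by rewrite -!EFinM -EFinD; congr EFin; field.
by apply: leeD; apply: lee_wpmul2l.
Qed.

Lemma ito_integral_exists k H : progressive P T W H -> sq TS (win T H) ->
  exists2 Y, ito_integral P T W k H Y &
    forall w, {within `[0, T], continuous (fun t => Y t w)}.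
Proof.
move=> pH sH; have q0 m : 0 < (8^-1 : R) ^+ m by rewrite exprn_gt0// invr_gt0.
have /choice[S hS] := fun m => simple_dense k pH sH (q0 m).
have mH := proj1 sH; have eS m := simple_elementary k (S m).
have [Y [FY cY XY]] := ito_limit T_gt0 P_complete W_bm eS mH hS.
exists Y => //; split => //; first exact: nearW.
exists S; split => //.
have mS m : measurable_fun setT (win T (simple_val (S m)) : (measurableTypeR R * Om)%type -> R).
  by case: (elementary_win_sq P_complete W_bm T (eS m)).
have -> : (fun m => \int[P]_w \int[mu]_(t in `[0%R, T]) ((H t w - simple_val (S m) t w) ^+ 2)%:E)%E =
    fun m => (\int[TS]_z ((win T H z - win T (simple_val (S m)) z) ^+ 2)%:E)%E.
  apply/funext => m; rewrite (@integral_win_sqr _ _ _ _ (fun t w => H t w - simple_val (S m) t w)).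
    by rewrite winB.
  by rewrite winB; exact: measurable_funB.
apply: (@squeeze_cvge _ _ _ _ (fun=> 0%E) _ (fun m => (8^-1 ^+ m)%:E)) => //.
+ apply: nearW => m; rewrite hS andbT.
  by apply: integral_ge0 => w _; rewrite lee_fin sqr_ge0.
+ exact: cvg_cst.
+ apply: cvg_EFin; first exact: nearW.
  by apply: cvg_expr; rewrite ger0_norm ?invr_ge0// invf_lt1// ltr1n.
Qed.

End Density.

Lemma indic_sqr {R : realType} {T : Type} (A : set T) (x : T) : (\1_A x : R) ^+ 2 = \1_A x.
Proof. by rewrite indicE; case: (_ \in _); rewrite ?expr1n// expr0n. Qed.

(** * Square-integrable progressive processes and their time integrals *)

Section Processes.
Context {R : realType} {d : measure_display} {Om : measurableType d} {J : finType}.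
Variables (P : probability Om R) (T : R) (W : J -> R -> Om -> R).
Hypothesis T_gt0 : 0 < T.
Hypothesis P_complete : measure_is_complete P.
Hypothesis W_bm : independent_brownians P T W.
Local Notation mu := (@lebesgue_measure R).
Local Notation TS := (timespace P).
Local Notation Ft t := (g_sigma_algebraType (filtration_gen P W t)).
Implicit Types (X Y b : R -> Om -> R) (w : Om) (s t : R).

Definition L2p X : Prop := progressive P T W X /\ sq TS (win T X).

Lemma L2p_win X t : L2p X -> t <= T -> sq TS (win t X).
Proof. by move=> [_ sX] tT; exact: sq_win_le sX. Qed.

Lemma L2pD X Y : L2p X -> L2p Y -> L2p (fun t w => X t w + Y t w).
Proof.
move=> [pX sX] [pY sY]; split; last by rewrite winD; exact: sqD.
by move=> t tT; apply: measurable_funD; [exact: pX|exact: pY].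
Qed.

Lemma L2pM (c : R -> R) (M : R) X : measurable_fun setT (c : measurableTypeR R -> R) ->
  (forall t, `|c t| <= M) -> L2p X -> L2p (fun t w => c t * X t w).
Proof.
move=> mc cM [pX sX]; split.
  move=> t tT; apply: measurable_funM; last exact: pX.
  by apply: measurable_funTS; exact: measurableT_comp mc measurable_fst.
have -> : win T (fun t w => c t * X t w) = fun z => c z.1 * win T X z.
  by apply/funext => z; rewrite /win mulrA.
have mc1 : measurable_fun setT (fun z : (measurableTypeR R * Om)%type => c z.1).
  by apply: measurableT_comp mc _; exact: measurable_fst.
exact: (@sq_bdM _ _ _ TS (win T X) (fun z => c z.1) M mc1 (fun z => cM z.1) sX).
Qed.

Lemma L2pZ (r : R) X : L2p X -> L2p (fun t w => r * X t w).
Proof. exact: (@L2pM (fun=> r) `|r|). Qed.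

Lemma L2pB X Y : L2p X -> L2p Y -> L2p (fun t w => X t w - Y t w).
Proof.
move=> pX /(L2pZ (-1)) pY; have := L2pD pX pY.
by under eq_fun do under eq_fun do rewrite mulN1r.
Qed.

Lemma L2p0 : L2p (fun _ _ => 0).
Proof.
split; first by move=> t tT; exact: measurable_cst.
by apply: eq_sq (sq0 _) => z; rewrite /win mul0r.
Qed.

Lemma L2p_sum (I : Type) (r : seq I) (F : I -> R -> Om -> R) :
  (forall i, L2p (F i)) -> L2p (fun t w => \sum_(i <- r) F i t w).
Proof.
move=> pF; elim: r => [|i r ih].
  by under eq_fun do under eq_fun do rewrite big_nil; exact: L2p0.
by under eq_fun do under eq_fun do rewrite big_cons; exact: L2pD.
Qed.

Lemma measurable_win_section X w : progressive P T W X -> forall t, t <= T ->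
  measurable_fun setT ((fun s => win t X (s, w)) : measurableTypeR R -> R).
Proof.
move=> pX t tT; have mX := measurable_win T_gt0 P_complete W_bm pX.
by apply: measurableT_comp (measurable_win_le tT mX) _.
Qed.

(** Paths of finite energy. On these [prim] is a genuine Lebesgue integral and is additive; for a
    square-integrable process the other paths form a null set. *)
Definition good X w : Prop := (\int[mu]_s (win T X (s, w) ^+ 2)%:E < +oo)%E.

Lemma good_ae X : L2p X -> {ae P, forall w, good X w}.
Proof.
move=> [pX [mX foo]]; have m2 := measurable_sqr mX.
have n0 z : (0 <= (win T X z ^+ 2)%:E)%E by rewrite lee_fin sqr_ge0.
rewrite (@fubini_tonelli2 _ _ _ _ _ (@lebesgue_measure R) P _ m2 n0) in foo.
have mG := @measurable_fun_fubini_tonelli_G _ _ (measurableTypeR R) Om R (@lebesgue_measure R) _ m2 n0.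
have iG : P.-integrable setT (fubini_G mu (fun z => (win T X z ^+ 2)%:E)).
  apply/integrableP; split => //; apply: le_lt_trans foo.
  apply: ge0_le_integral => //.
  - by apply: measurableT_comp => //; exact: measurable_abse.
  - by move=> w _; rewrite gee0_abs//; apply: integral_ge0.
have := integrable_ae measurableT iG; apply: filterS => w /(_ I).
by rewrite fin_numElt => /andP[].
Qed.

Lemma good_sq X w : progressive P T W X -> good X w ->
  sq (mu : {measure set (measurableTypeR R) -> \bar R}) (fun s => win T X (s, w)).
Proof. by move=> pX gX; split => //; exact: measurable_win_section pX _ (lexx T). Qed.

Lemma sq_indic t : sq (mu : {measure set (measurableTypeR R) -> \bar R}) (\1_(`[0, t]%classic) : R -> R).
Proof.
split; first exact: measurable_indic.
under eq_integral do rewrite indic_sqr.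
rewrite integral_indic//= setIT lebesgue_measure_itv/=.
by case: ifP; rewrite -?EFinD ltry.
Qed.

Let ip_ind t : 0 <= t -> ip (mu : {measure set (measurableTypeR R) -> \bar R})
  (\1_(`[0, t]%classic) : R -> R) (\1_(`[0, t]%classic) : R -> R) = t.
Proof.
move=> t0; apply: EFin_inj; rewrite -ipE; last exact: sq_indic.
under eq_integral do rewrite indic_sqr.
rewrite integral_indic//= setIT lebesgue_measure_itv/= lte_fin.
by case: ltP => h; rewrite ?oppr0 ?adde0//; congr EFin; apply/eqP; rewrite eq_le t0 h.
Qed.

Lemma primE X t w : t <= T -> prim X t w =
  ip (mu : {measure set (measurableTypeR R) -> \bar R}) (fun s => win T X (s, w)) (\1_(`[0, t]%classic) : R -> R).
Proof.
move=> tT; rewrite /prim /ip Rintegral_mkcond; apply: eq_Rintegral => s _.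
rewrite patchE indicE mem_setE in_itv/=; case: ifPn => h; last by rewrite mulr0.
by rewrite mulr1 winE//; case/andP: h => -> /le_trans; apply.
Qed.

(** Cauchy-Schwarz in time. In extended reals it makes sense for every path; if the energy is
    infinite, so is the right-hand side. *)
Lemma prim_sqr_le X w t : progressive P T W X -> 0 <= t <= T ->
  ((prim X t w ^+ 2)%:E <= T%:E * \int[mu]_s (win t X (s, w) ^+ 2)%:E)%E.
Proof.
move=> pX /andP[t0 tT]; have [tp|] := ltP 0 t; last first.
  move=> t_0; have -> : prim X t w = 0.
    rewrite /prim; have -> : t = 0 by apply/eqP; rewrite eq_le t0 t_0.
    by rewrite set_itv1 Rintegral_set1.
  rewrite expr0n/= mule_ge0 ?lee_fin ?(ltW T_gt0)//.
  by apply: integral_ge0 => s _; rewrite lee_fin sqr_ge0.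
set I := (\int[mu]_s _)%E; have I0 : (0 <= I)%E.
  by apply: integral_ge0 => s _; rewrite lee_fin sqr_ge0.
have [|Ioo] := ltP I +oo%E; last first.
  by move: Ioo; rewrite leye_eq => /eqP ->; rewrite mulry gtr0_sg// mul1e leey.
move=> Ioo; have mX := measurable_win_section w pX tT.
have sX : sq (mu : {measure set (measurableTypeR R) -> \bar R}) (fun s => win t X (s, w)) by split.
have -> : prim X t w = ip (mu : {measure set (measurableTypeR R) -> \bar R})
    (fun s => win t X (s, w)) (\1_(`[0, t]%classic) : R -> R).
  rewrite primE//; apply: eq_Rintegral => s _.
  rewrite indicE mem_setE in_itv/=; case: (boolP (0 <= s <= t)) => h; last by rewrite !mulr0.
  by rewrite !winE//; case/andP: h => -> /le_trans; apply.
have := ip_CS sX (sq_indic t); rewrite ip_ind// => h.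
rewrite /I (ipE sX) -EFinM lee_fin; apply: le_trans h _.
by rewrite mulrC ler_wpM2r// ip_ge0.
Qed.

Lemma primD X Y w t : progressive P T W X -> progressive P T W Y -> t <= T ->
  good X w -> good Y w ->
  prim (fun t w => X t w + Y t w) t w = prim X t w + prim Y t w.
Proof.
move=> pX pY tT gX gY; rewrite !primE// winD ipDl//; by [exact: good_sq|exact: sq_indic].
Qed.

Lemma primZ (r : R) X w t : progressive P T W X -> t <= T -> good X w ->
  prim (fun t w => r * X t w) t w = r * prim X t w.
Proof.
by move=> pX tT gX; rewrite !primE// winZ ipZl//; by [exact: good_sq|exact: sq_indic].
Qed.

Lemma good_integrable X w : progressive P T W X -> good X w ->
  mu.-integrable `[0, T] (EFin \o (fun s => X s w)).
Proof.
move=> pX gX.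
have iX := integrable_mulsq (good_sq pX gX) (sq_indic T).
apply/(@integrable_mkcond _ (measurableTypeR R) R mu `[0, T]%classic _ (measurable_itv _)).
apply: eq_integrable iX => // s _.
rewrite patchE indicE mem_setE in_itv/=; case: ifPn => h; last by rewrite mulr0.
by rewrite mulr1 winE.
Qed.

Lemma prim_continuous X w : progressive P T W X -> good X w ->
  {within `[0, T], continuous (fun t => prim X t w)}.
Proof.
move=> pX gX; apply: parameterized_integral_continuous; first exact: ltW.
exact: good_integrable.
Qed.

Lemma prim_sq X t : L2p X -> 0 <= t <= T -> sq P (prim X t) /\
  (\int[P]_w (prim X t w ^+ 2)%:E <= T%:E * \int[TS]_z (win t X z ^+ 2)%:E)%E.
Proof.
move=> [pX sX] tT; have [t0 t_T] := andP tT.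
have mP : measurable_fun setT (prim X t).
  exact: (Ft_measurable_measurable P_complete W_bm t_T (prim_Ft pX tT)).
have sXt := sq_win_le t_T sX; have m2 := measurable_sqr (proj1 sXt).
have n0 z : (0 <= (win t X z ^+ 2)%:E)%E by rewrite lee_fin sqr_ge0.
have h : (\int[P]_w (prim X t w ^+ 2)%:E <= T%:E * \int[TS]_z (win t X z ^+ 2)%:E)%E.
  rewrite (@fubini_tonelli2 _ _ _ _ _ (@lebesgue_measure R) P _ m2 n0).
  have mG := @measurable_fun_fubini_tonelli_G _ _ (measurableTypeR R) Om R (@lebesgue_measure R) _ m2 n0.
  have G0 w : (0 <= fubini_G mu (fun z => (win t X z ^+ 2)%:E) w)%E.
    by apply: integral_ge0 => s _.
  rewrite -ge0_integralZl_EFin//; last exact: ltW.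
  apply: ge0_le_integral => //.
  - by move=> w _; rewrite lee_fin sqr_ge0.
  - exact: measurable_sqr.
  - by apply: measurable_funeM.
  - by move=> w _; exact: prim_sqr_le.
split => //; split => //; apply: le_lt_trans h _.
by rewrite lte_mul_pinfty ?lee_fin ?(ltW T_gt0)//; case: sXt.
Qed.

(** By Tonelli almost every path of the difference has zero energy, and [prim_sqr_le] then
    annihilates its primitive at all times at once; the exceptional set does not depend on [t]. *)
Lemma prim_ae X Y : L2p X -> L2p Y -> {ae TS, forall z, win T X z = win T Y z} ->
  {ae P, forall w, forall t, 0 <= t <= T -> prim X t w = prim Y t w}.
Proof.
move=> lX lY XY; have lD := L2pB lX lY.
have [pX sX] := lX; have [pY sY] := lY; have [pD sD] := lD.
have m2 := measurable_sqr (proj1 sD).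
have n0 z : (0 <= (win T (fun t w => X t w - Y t w) z ^+ 2)%:E)%E by rewrite lee_fin sqr_ge0.
have : (\int[TS]_z (win T (fun t w => X t w - Y t w) z ^+ 2)%:E = 0)%E.
  transitivity (\int[TS]_z (cst 0 z))%E; last exact: integral0.
  apply: ae_eq_integral => //.
  apply: (@filterS _ _ (ae_filter_ringOfSetsType TS) _ _ _ XY) => z XYz _ /=.
  by rewrite winB XYz subrr expr0n.
rewrite (@fubini_tonelli2 _ _ _ _ _ (@lebesgue_measure R) P _ m2 n0) => h.
have mG := @measurable_fun_fubini_tonelli_G _ _ (measurableTypeR R) Om R (@lebesgue_measure R) _ m2 n0.
have /(ae_eq_integral_abs _ measurableT mG) : (\int[P]_w `|fubini_G mu (fun z => (win T (fun t w => X t w - Y t w) z ^+ 2)%:E) w| = 0)%E.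
  rewrite -h; apply: eq_integral => w _; rewrite gee0_abs//.
  by apply: integral_ge0 => s _.
move=> G0; have := @filterI _ _ (ae_filter_ringOfSetsType P) _ _ G0
  (@filterI _ _ (ae_filter_ringOfSetsType P) _ _ (good_ae lX) (good_ae lY)).
apply: filterS => w [/(_ I) Gw [gX gY]] t tT.
have [t0 t_T] := andP tT.
have := prim_sqr_le w pD tT.
have -> : prim (fun t w => X t w - Y t w) t w = prim X t w - prim Y t w.
  by rewrite !primE// winB ipBl//; by [exact: good_sq|exact: sq_indic].
move=> hle; suff : ((prim X t w - prim Y t w) ^+ 2)%:E = 0%E.
  by case => /eqP; rewrite sqrf_eq0 subr_eq0 => /eqP.
apply/eqP; rewrite eq_le; apply/andP; split; last by rewrite lee_fin sqr_ge0.
apply: le_trans hle _.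
rewrite -[X in (_ <= X)%E](mule0 T%:E); apply: lee_wpmul2l; first by rewrite lee_fin ltW.
apply: (@le_trans _ _ (fubini_G mu (fun z => (win T (fun t w => X t w - Y t w) z ^+ 2)%:E) w)).
  2: by rewrite Gw.
apply: ge0_le_integral => //.
- by move=> s _; rewrite lee_fin sqr_ge0.
- by apply: measurable_sqr; exact: measurable_win_section pD _ t_T.
- by apply: measurable_sqr; exact: measurable_win_section pD _ (lexx T).
- by move=> s _; rewrite lee_fin; exact: win_sqr_le.
Qed.

Let pgrid (t : R) (n j : nat) : R := t / n.+1%:R * j%:R.

Let pgrid_mono t n i j : 0 <= t -> (i <= j)%N -> pgrid t n i <= pgrid t n j.
Proof. by move=> t0 ij; rewrite /pgrid ler_wpM2l ?divr_ge0// ler_nat. Qed.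

Let pgrid_max t n : pgrid t n n.+1 = t.
Proof. by rewrite /pgrid divfK. Qed.

Let pgrid0 t n : pgrid t n 0 = 0.
Proof. by rewrite /pgrid mulr0. Qed.

(* On [0, t] the process is the limit of X sampled at the next grid point. *)
Lemma continuous_progressive X :
  (forall t, 0 <= t <= T -> Ft_measurable P W t (X t)) ->
  (forall w, {within `[0, T], continuous (fun t => X t w)}) ->
  progressive P T W X.
Proof.
move=> FX cX t tT; have [t0 t_T] := andP tT.
(* The cells are left-open, so time 0 needs a term of its own. *)
pose A n (p : measurableTypeR R * Ft t) := X 0 p.2 * \1_[set 0%R] p.1 +
  \sum_(j < n.+1) X (pgrid t n j.+1) p.2 * \1_(`]pgrid t n j, pgrid t n j.+1]) p.1.
have mXs s : 0 <= s <= t -> measurable_fun setT (fun p : measurableTypeR R * Ft t => X s p.2).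
  move=> /andP[s0 st]; apply: measurableT_comp (measurable_snd) => //.
  by apply: (Ft_measurable_mono st); apply: FX; rewrite s0 (le_trans st).
have m1 (B : set R) : measurable B ->
    measurable_fun setT (fun p : measurableTypeR R * Ft t => (\1_B p.1 : R)).
  by move=> mB; apply: measurableT_comp (measurable_fst) => //; exact: measurable_indic.
apply: (@measurable_fun_cvg _ (measurableTypeR R * Ft t)%type R _ A).
  move=> n; apply: measurable_funTS; apply: measurable_funD.
    by apply: measurable_funM; [apply: mXs; rewrite lexx|exact: m1].
  apply: measurable_sum => j; apply: measurable_funM; last exact: m1.
  apply: mXs; rewrite -(pgrid0 t n) pgrid_mono//=.
  by rewrite -[leRHS](pgrid_max t n) pgrid_mono.
move=> [s w] [/= st _]; move: st; rewrite in_itv/= => /andP[s0 st].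
have [->|s_ne0] := eqVneq s 0.
  rewrite (_ : (fun n => A n (0, w)) = fun=> X 0 w); first exact: cvg_cst.
  apply/funext => n; rewrite /A /= indicE mem_set// mulr1 big1 ?addr0// => i _.
  rewrite indicE memNset ?mulr0//= in_itv/= => /andP[+ _].
  by rewrite ltNge -(pgrid0 t n) pgrid_mono.
have sp : 0 < s by rewrite lt_neqAle eq_sym s_ne0.
have sT : 0 <= s <= T by rewrite s0 (le_trans st).
have /within_itv_continuousP/(_ s sT) hX := cX w.
apply/cvgrPdist_lt => e e0; have [dl dl0 hdl] := hX e e0.
have tp : 0 < t by exact: lt_le_trans st.
have := near_infty_natSinv_lt (PosNum (divr_gt0 dl0 tp)).
apply: filterS => n /= hn.
have dn : t / n.+1%:R < dl by move: hn; rewrite ltr_pdivlMr// mulrC.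
have g1 : pgrid t n 0 < s by rewrite pgrid0.
have g2 : s <= pgrid t n n.+1 by rewrite pgrid_max.
have [j jn hj] := locate g1 g2.
rewrite /A /= indicE memNset/=; last by move=> /eqP; exact/negP.
rewrite mulr0 add0r (@sum_cells _ (pgrid t n) (fun j => X (pgrid t n j.+1) w) _ j)//; last first.
  by move=> i; exact: pgrid_mono.
have [h1 h2] := andP hj; apply: hdl.
  rewrite (le_trans s0 h2)/=; apply: le_trans t_T.
  by rewrite -[leRHS](pgrid_max t n) pgrid_mono.
rewrite ler0_norm ?subr_le0// opprB; apply: le_lt_trans dn.
rewrite lerBlDr; have -> : pgrid t n j.+1 = t / n.+1%:R + pgrid t n j.
  by rewrite /pgrid -[j.+1%:R]natr1 mulrDr mulr1 addrC.
by rewrite lerD2l ltW.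
Qed.

Lemma integral_win_sqrB X Y :
  measurable_fun setT (win T X : (measurableTypeR R * Om)%type -> R) ->
  measurable_fun setT (win T Y : (measurableTypeR R * Om)%type -> R) ->
  (\int[P]_w \int[mu]_(t in `[0%R, T]) ((X t w - Y t w) ^+ 2)%:E =
   \int[TS]_z ((win T X z - win T Y z) ^+ 2)%:E)%E.
Proof.
move=> mX mY; rewrite (@integral_win_sqr _ _ _ _ (fun t w => X t w - Y t w)).
  by rewrite winB.
by rewrite winB; exact: measurable_funB.
Qed.

Lemma ito_integral_ae k H H' Y : ito_integral P T W k H Y ->
  measurable_fun setT (win T H : (measurableTypeR R * Om)%type -> R) ->
  measurable_fun setT (win T H' : (measurableTypeR R * Om)%type -> R) ->
  {ae TS, forall z, win T H z = win T H' z} -> ito_integral P T W k H' Y.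
Proof.
move=> [FY cY [S [cS cX]]] mH mH' HH'; split; [exact: FY|exact: cY|].
exists S; split; last exact: cX.
move: cS; set u := (X in X @ _ --> _ -> _) => cS; set v := (X in X @ _ --> _).
suff -> : v = u by [].
apply/funext => m; rewrite /u /v.
have mS : measurable_fun setT (win T (simple_val (S m)) : (measurableTypeR R * Om)%type -> R).
  by case: (elementary_win_sq P_complete W_bm T (simple_elementary k (S m))).
rewrite (integral_win_sqrB mH mS) (integral_win_sqrB mH' mS).
apply: ae_eq_integral => //; try by apply: measurable_sqr; exact: measurable_funB.
by apply: (@filterS _ _ (ae_filter_ringOfSetsType TS) _ _ _ HH') => z + _ => /= ->.
Qed.

End Processes.

Lemma sqr_sum_le {R : realDomainType} (I : finType) (a : I -> R) :
  (\sum_i a i) ^+ 2 <= #|I|%:R * \sum_i a i ^+ 2.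
Proof.
have h : 0 <= \sum_i \sum_j (a i - a j) ^+ 2.
  by apply: sumr_ge0 => i _; apply: sumr_ge0 => j _; exact: sqr_ge0.
suff : \sum_i \sum_j (a i - a j) ^+ 2 =
    2 * (#|I|%:R * (\sum_i a i ^+ 2) - (\sum_i a i) ^+ 2).
  by move=> e; move: h; rewrite e pmulr_rge0// subr_ge0.
have -> : (\sum_i a i) ^+ 2 = \sum_i \sum_j a i * a j.
  by rewrite expr2 mulr_suml; apply: eq_bigr => i _; rewrite mulr_sumr.
have s1 : \sum_(i : I) \sum_(j : I) a i ^+ 2 = #|I|%:R * \sum_i a i ^+ 2.
  by rewrite mulr_sumr; apply: eq_bigr => i _; rewrite sumr_const mulr_natl.
have s2 : \sum_(i : I) \sum_(j : I) a j ^+ 2 = #|I|%:R * \sum_i a i ^+ 2.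
  by rewrite sumr_const mulr_natl.
transitivity (\sum_(i : I) \sum_(j : I) a i ^+ 2 - 2 * (\sum_i \sum_j a i * a j) + \sum_(i : I) \sum_(j : I) a j ^+ 2).
  rewrite mulr_sumr -sumrB -big_split/=; apply: eq_bigr => i _.
  rewrite mulr_sumr -sumrB -big_split/=; apply: eq_bigr => j _; ring.
rewrite s1 s2; ring.
Qed.

Lemma integral_expR_le {R : realType} (B l t : R) : 0 <= B -> 0 < l -> 0 <= t ->
  (\int[@lebesgue_measure R]_(s in `[0%R, t]) (B * expR (l * s))%:E <=
   (B / l * expR (l * t))%:E)%E.
Proof.
move=> B0 l0; rewrite le_eqVlt => /predU1P[<-|t0].
  by rewrite set_itv1 integral_set1 lee_fin !mulr_ge0// ?expR_ge0// invr_ge0 ltW.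
pose F s := B / l * expR (l * s).
have dF s : is_derive s (1 : R) F (B * expR (l * s)).
  rewrite /F; have := @is_derive1_comp _ expR (fun s => l * s) s _ _ (is_derive_expR (l * s)).
  move=> h; have hl : is_derive s (1:R) (fun s : R => l * s) l.
    have := is_deriveZ l (is_derive_id s (1 : R)).
    by rewrite /GRing.scale /= mulr1.
  have := is_deriveZ (B / l) (h _ hl).
  rewrite /GRing.scale /= => hh; rewrite (_ : B * expR (l * s) = B / l * (expR (l * s) * l)) //.
  by field; rewrite gt_eqF.
have cF : continuous F.
  by move=> s; apply: differentiable_continuous; apply/derivable1_diffP; case: (dF s).
have cf : continuous (fun s => B * expR (l * s)).
  move=> s; apply: cvgM; first exact: cvg_cst.
  apply: continuous_comp; last exact: continuous_expR.
  by apply: cvgM; [exact: cvg_cst|exact: cvg_id].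
rewrite (@continuous_FTC2 _ _ F _ _ t0).
- rewrite -EFinB lee_fin /F lerBlDr lerDl !mulr_ge0 ?expR_ge0//.
  by rewrite invr_ge0 ltW.
- exact: continuous_subspaceT.
- split.
  + by move=> s _; case: (dF s).
  + by apply: cvg_at_right_filter; exact: cF.
  + by apply: cvg_at_left_filter; exact: cF.
- by move=> s _; rewrite derive1E; case: (dF s).
Qed.

(** * Mean-square limits and Gronwall's inequality *)

Section L2Limit.
Context {d : measure_display} {T : measurableType d} {R : realType}.
Variable nu : {measure set T -> \bar R}.

(* A measurable version of the pointwise limit, with junk values where there is
   no limit. *)
Definition rlim (u : nat -> T -> R) (x : T) : R := fine (limn_esup (fun m => (u m x)%:E)).

Lemma measurable_rlim (D : set T) u : (forall m, measurable_fun D (u m)) ->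
  measurable_fun D (rlim u).
Proof.
move=> mu_; apply: measurableT_comp; first exact: fine_measurable.
by apply: measurable_fun_limn_esup => m; apply/measurable_EFinP.
Qed.

Lemma rlimE u x l : u m x @[m --> \oo] --> l -> rlim u x = l.
Proof.
move=> ul; have ul' : (u m x)%:E @[m --> \oo] --> l%:E.
  by apply: cvg_EFin => //; exact: nearW.
by rewrite /rlim; have [_ ->] := cvg_limn_einf_sup ul'.
Qed.

(** The factor 4 reproduces itself: splitting off one step costs 2 * 4 / 8 + 2, which is at most
    4. *)
Lemma L2_step_bound (u : nat -> T -> R) (B : R) : (forall m, measurable_fun setT (u m)) -> 0 <= B ->
  (forall m, \int[nu]_x ((u m.+1 x - u m x) ^+ 2)%:E <= (B * 8^-1 ^+ m)%:E)%E ->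
  forall p m, (\int[nu]_x ((u (p + m)%N x - u m x) ^+ 2)%:E <= (4 * B * 8^-1 ^+ m)%:E)%E.
Proof.
move=> mu_ B0 h; elim=> [|p ih] m.
  under eq_integral do rewrite add0n subrr expr0n/=.
  by rewrite integral0 lee_fin !mulr_ge0// exprn_ge0// invr_ge0.
rewrite (_ : \int[nu]_x _ = \int[nu]_x (((u (p + m.+1)%N x - u m.+1 x) + (u m.+1 x - u m x)) ^+ 2)%:E)%E; last first.
  by apply: eq_integral => x _; rewrite addrA subrK addnS.
apply: le_trans (int_sqrD_le _ _ _) _; try exact: measurable_funB.
apply: (@le_trans _ _ (2%:E * (4 * B * 8^-1 ^+ m.+1)%:E + 2%:E * (B * 8^-1 ^+ m)%:E)%E).
  by apply: leeD; apply: lee_wpmul2l.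
rewrite -!EFinM -EFinD lee_fin exprS; set q := 8^-1 ^+ m.
have : 0 <= B * q by rewrite mulr_ge0// exprn_ge0// invr_ge0.
rewrite (_ : 2 * (4 * B * (8^-1 * q)) = B * q); last by field.
rewrite -!mulrA; lra.
Qed.

(** Steps exceed 2^-m on a set of measure at most [B] times 2^-m, so by Borel-Cantelli the sequence
    converges almost everywhere, and Fatou's lemma transfers the step bound to the limit. *)
Lemma L2_limit (u : nat -> T -> R) (B : R) : (forall m, measurable_fun setT (u m)) -> 0 <= B ->
  (forall m, \int[nu]_x ((u m.+1 x - u m x) ^+ 2)%:E <= (B * 8^-1 ^+ m)%:E)%E ->
  forall m, (\int[nu]_x ((rlim u x - u m x) ^+ 2)%:E <= (4 * B * 8^-1 ^+ m)%:E)%E.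
Proof.
move=> mu_ B0 h; have mr := measurable_rlim mu_.
pose A m := [set x | 2^-1 ^+ m <= `|u m.+1 x - u m x|].
have mA m : measurable (A m).
  rewrite (_ : A m = (fun x => `|u m.+1 x - u m x|) @^-1` `[2^-1 ^+ m, +oo[%classic).
    rewrite -[X in measurable X]setTI.
    have mf : measurable_fun setT (fun x => `|u m.+1 x - u m x|).
      by apply: measurableT_comp => //; exact: measurable_funB.
    by apply: mf => //; exact: measurable_itv.
  by apply/seteqP; split => x /=; rewrite in_itv/= andbT.
have l0 m : 0 < (2^-1 : R) ^+ m by rewrite exprn_gt0// invr_gt0.
have nuA m : (nu (A m) <= (2 * B / (2 ^ m.+1)%:R)%:E)%E.
  have h1 : (((2^-1 ^+ m) ^+ 2)%:E * nu (A m) <= (B * 8^-1 ^+ m)%:E)%E.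
    apply: le_trans _ (h m); rewrite -integral_cst//.
    rewrite integral_mkcond; apply: ge0_le_integral => //.
    - by move=> x _; rewrite erestrict_ge0// => y _; rewrite lee_fin sqr_ge0.
    - by apply/(measurable_restrictT _ (mA m)); exact: measurable_cst.
    - by apply: measurable_sqr; exact: measurable_funB.
    - move=> x _; rewrite patchE; case: ifPn => [/set_mem Ax|_]; rewrite lee_fin ?sqr_ge0//.
      by rewrite -[leRHS]real_normK ?num_real// ler_sqr ?nnegrE// ltW.
  have q0 : 0 < ((2^-1 : R) ^+ m) ^+ 2 by rewrite exprn_gt0.
  rewrite -(@lee_pmul2l _ ((2^-1 ^+ m) ^+ 2)%:E) ?lte_fin//.
  apply: le_trans h1 _; rewrite -EFinM lee_fin.
  rewrite natrX [2 ^+ m.+1]exprS -[(2 ^+ m)]invrK -exprVn.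
  have -> : (8^-1 : R) ^+ m = (2^-1 ^+ m) ^+ 3.
    by rewrite -exprM mulnC exprM; congr (_ ^+ _); rewrite exprVn -natrX.
  move: (2^-1 ^+ m) (l0 m) => q q1.
  rewrite le_eqVlt; apply/orP; left; apply/eqP; field.
  by rewrite gt_eqF.
have N0 : nu (lim_sup_set A) = 0%E.
  apply: lim_sup_set_cvg0 => //.
  have h8 : (0 <= 2 * B) by rewrite mulr_ge0.
  apply: le_lt_trans (ltry (2 * B)); apply: le_trans _ (epsilon_trick0 xpredT h8).
  by apply: lee_nneseries => // m _; exact: nuA.
have mN : measurable (lim_sup_set A).
  by apply: bigcapT_measurable => n; apply: bigcup_measurable.
have cvg_u x : ~ lim_sup_set A x -> u m x @[m --> \oo] --> rlim u x.
  move=> /existsNP[m0 /not_implyP[_ nA]].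
  have [|l [cl _]] := @geometric_steps_cvg R (fun m => u m x) m0.
    move=> m mm; rewrite leNgt; apply/negP => hh; apply: nA; exists m => //=.
    exact: ltW.
  by rewrite (rlimE cl).
pose B' := ~` lim_sup_set A.
have mB : measurable B' by exact: measurableC.
have ind_cvg m x : \1_B' x * (u (n + m)%N x - u m x) @[n --> \oo] --> \1_B' x * (rlim u x - u m x).
  rewrite indicE; case: (boolP (x \in B')) => [/set_mem Bx|_]; last first.
    by under eq_fun do rewrite mul0r; rewrite mul0r; exact: cvg_cst.
  apply: cvgM; first exact: cvg_cst.
  apply: cvgB; last exact: cvg_cst.
  by rewrite (cvg_shiftn m (fun n => u n x)); exact: cvg_u.
have mI : measurable_fun setT (\1_B' : T -> R) by exact: measurable_indic.
move=> m.
rewrite (_ : \int[nu]_x _ = \int[nu]_x ((\1_B' x * (rlim u x - u m x)) ^+ 2)%:E)%E; last first.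
  apply: ae_eq_integral => //.
  - by apply: measurable_sqr; exact: measurable_funB.
  - by apply: measurable_sqr; apply: measurable_funM => //; exact: measurable_funB.
  - exists (lim_sup_set A); split => // x /= /not_implyP[_]; apply: contra_notP => nx.
    by rewrite indicE mem_set// mul1r.
apply: (@fatou_le _ _ _ _ (fun n x => ((\1_B' x * (u (n + m)%N x - u m x)) ^+ 2)%:E)).
- by move=> n; apply: measurable_sqr; apply: measurable_funM => //; exact: measurable_funB.
- by move=> n x; rewrite lee_fin sqr_ge0.
- by move=> x; apply: cvg_EFin; [exact: nearW|apply: cvgM; exact: ind_cvg].
- move=> n; apply: le_trans (L2_step_bound mu_ B0 h n m); apply: ge0_le_integral => //.
  + by move=> x _; rewrite lee_fin sqr_ge0.
  + by apply: measurable_sqr; apply: measurable_funM => //; exact: measurable_funB.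
  + by apply: measurable_sqr; exact: measurable_funB.
  + by move=> x _; rewrite lee_fin exprMn indic_sqr ler_piMl ?sqr_ge0.
Qed.

End L2Limit.

Section WindowNorm.
Context {R : realType} {d : measure_display} {Om : measurableType d}.
Variables (P : probability Om R) (T : R).
Hypothesis T_gt0 : 0 < T.
Local Notation mu := (@lebesgue_measure R).
Local Notation TS := (timespace P).

Definition wnorm t (X : R -> Om -> R) : R := ip TS (win t X) (win t X).

Lemma wnorm_ge0 t X : 0 <= wnorm t X.
Proof. exact: ip_ge0. Qed.

Lemma wnorm_mono s t X : s <= t -> sq TS (win t X) -> wnorm s X <= wnorm t X.
Proof.
by move=> st sX; apply: le_ip => // [|z]; [exact: sq_win_le sX|exact: win_sqr_le].
Qed.

Lemma wnormD_le t X Y : sq TS (win t X) -> sq TS (win t Y) ->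
  wnorm t (fun t w => X t w + Y t w) <= 2 * wnorm t X + 2 * wnorm t Y.
Proof. by move=> sX sY; rewrite /wnorm winD; exact: ipDD_le. Qed.

(** Tonelli turns a bound at each time into a bound over the window. The components are summed
    before integrating, since a coupled linear system controls only their sum. *)
Lemma sum_win_sq_bound n (X : 'I_n -> R -> Om -> R) t (K : R -> R) :
  (forall j, measurable_fun setT (win t (X j) : (measurableTypeR R * Om)%type -> R)) ->
  measurable_fun setT (K : measurableTypeR R -> R) ->
  (forall s, 0 <= s <= t -> (\sum_j \int[P]_w (X j s w ^+ 2)%:E <= (K s)%:E)%E) ->
  (\sum_j \int[TS]_z (win t (X j) z ^+ 2)%:E <= \int[mu]_(s in `[0%R, t]) (K s)%:E)%E.
Proof.
move=> mX mK hK; have m2 j := measurable_sqr (mX j).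
have n0 j z : (0 <= (win t (X j) z ^+ 2)%:E)%E by rewrite lee_fin sqr_ge0.
have mF j := @measurable_fun_fubini_tonelli_F _ _ (measurableTypeR R) Om R P _ (m2 j) (n0 j).
have F0 j s : (0 <= fubini_F P (fun z => (win t (X j) z ^+ 2)%:E) s)%E.
  by apply: integral_ge0 => w _.
under eq_bigr do rewrite (@fubini_tonelli1 _ _ _ _ _ (@lebesgue_measure R) P _ (m2 _) (n0 _)).
rewrite -(@ge0_integral_sum _ (measurableTypeR R) R mu _ measurableT)//; last by move=> j s _; exact: F0.
rewrite [leRHS]integral_mkcond; apply: ge0_le_integral => //.
- by move=> s _; apply: sume_ge0 => j _; exact: F0.
- by apply: emeasurable_sum => j; exact: mF.
- apply/(@measurable_restrictT _ _ (measurableTypeR R) _ _ _ (measurable_itv _)).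
  by apply: measurable_funTS; exact/measurable_EFinP.
- move=> s _; rewrite patchE mem_setE in_itv/= /fubini_F; case: ifPn => h.
    apply: le_trans (hK s h); apply: lee_sum => j _.
    by under eq_integral do rewrite winE//.
  by rewrite big1// => j _; under eq_integral do rewrite win0E// expr0n/=; rewrite integral0.
Qed.

Lemma win_exp_bound n (X : 'I_n -> R -> Om -> R) t (B l : R) :
  0 <= t -> 0 <= B -> 0 < l -> (forall j, sq TS (win t (X j))) ->
  (forall s, 0 <= s <= t -> forall j, sq P (X j s)) ->
  (forall s, 0 <= s <= t -> \sum_j ip P (X j s) (X j s) <= B * expR (l * s)) ->
  \sum_j wnorm t (X j) <= B / l * expR (l * t).
Proof.
move=> t0 B0 l0 sW sX h; rewrite -lee_fin -sumEFin.
under eq_bigr do rewrite -ipE//.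
apply: le_trans (integral_expR_le B0 l0 t0).
apply: (@sum_win_sq_bound _ _ _ (fun s => B * expR (l * s))).
- by move=> j; case: (sW j).
- by apply: measurable_funM => //; apply: measurableT_comp.
- move=> s st; rewrite (eq_bigr (fun j => (ip P (X j s) (X j s))%:E)); last first.
    by move=> j _; rewrite -ipE//; exact: sX.
  by rewrite sumEFin lee_fin h.
Qed.

(** Proved by iteration. If the sum is at most k exp(2 C s), integration divides the bound by 2 C,
    and the hypothesis improves k to g + k / 2. The fixed point of this map is 2 g, which the
    iteration approaches from a crude initial constant. *)
Lemma gronwall n (X : 'I_n -> R -> Om -> R) (g C : R) : 0 <= g -> 0 < C ->
  (forall j, sq TS (win T (X j))) ->
  (forall s, 0 <= s <= T -> forall j, sq P (X j s)) ->
  (forall s, 0 <= s <= T ->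
    \sum_j ip P (X j s) (X j s) <= g + C * \sum_j wnorm s (X j)) ->
  forall s, 0 <= s <= T ->
    \sum_j ip P (X j s) (X j s) <= 2 * g * expR (2 * C * s).
Proof.
move=> g0 C0 sW sX h s sT.
have l0 : 0 < 2 * C by rewrite mulr_gt0.
pose B := C * \sum_j wnorm T (X j).
have B0 : 0 <= B by apply: mulr_ge0; [exact: ltW|apply: sumr_ge0 => j _; exact: wnorm_ge0].
have key m r : 0 <= r <= T ->
    \sum_j ip P (X j r) (X j r) <= (2 * g + B * 2^-1 ^+ m) * expR (2 * C * r).
  elim: m r => [|m ih] r rT; have [r0 r_T] := andP rT.
    have e1 : 1 <= expR (2 * C * r) by rewrite -[X in X <= _]expR0 ler_expR; apply: mulr_ge0 => //; exact: ltW.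
    apply: (@le_trans _ _ (g + B)).
      apply: le_trans (h r rT) _; rewrite lerD2l ler_pM2l//.
      by apply: ler_sum => j _; exact: wnorm_mono.
    rewrite expr0 mulr1; apply: (@le_trans _ _ (2 * g + B)); first lra.
    have gB : 0 <= 2 * g + B by lra.
    exact: ler_peMr.
  have BB : 0 <= 2 * g + B * 2^-1 ^+ m.
    have q0 : 0 <= (2^-1 : R) ^+ m by rewrite exprn_ge0// invr_ge0.
    have := mulr_ge0 B0 q0; lra.
  have := @win_exp_bound _ X r _ _ r0 BB l0 (fun j => sq_win_le r_T (sW j)) _ _.
  move=> /(_ _ _)/wrap[] => [q qr|q qr|hw].
  - by apply: sX; case/andP: qr => -> /le_trans; apply.
  - by apply: ih; case/andP: qr => -> /le_trans; apply.
  apply: le_trans (h r rT) _; move: hw; set e := expR _; set S := \sum_j _ => hw.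
  have e1 : 1 <= e by rewrite /e -[X in X <= _]expR0 ler_expR; apply: mulr_ge0 => //; exact: ltW.
  have : C * S <= (2 * g + B * 2^-1 ^+ m) / 2 * e.
    rewrite (_ : _ * e = C * ((2 * g + B * 2^-1 ^+ m) / (2 * C) * e)) ?ler_pM2l//.
    by field; rewrite gt_eqF.
  rewrite exprS; set q := 2^-1 ^+ m; nra.
apply/ler_addgt0Pr => e e0.
have cv : geometric (B * expR (2 * C * s)) 2^-1 @ \oo --> (0 : R).
  by apply: cvg_geometric; rewrite ger0_norm ?invr_ge0// invf_lt1// ltr1n.
move/cvgrPdist_lt : cv => /(_ e e0) [m _ /(_ m (leqnn m))].
rewrite sub0r normrN => /(le_lt_trans (ler_norm _)) hm.
apply: le_trans (key m s sT) _; rewrite mulrDl lerD2l.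
by apply: ltW; move: hm; rewrite /geometric/= mulrAC.
Qed.

End WindowNorm.

(** * Linear stochastic differential equations *)

Lemma within_continuous_sum {R : realType} (D : set R) (I : Type) (r : seq I) (F : I -> R -> R) :
  (forall i, {within D, continuous (F i)}) ->
  {within D, continuous (fun t => \sum_(i <- r) F i t)}.
Proof.
move=> cF; elim: r => [|i r ih] t.
  by rewrite (_ : (fun t => _) = fun=> 0); [exact: cvg_cst|apply/funext => s; rewrite big_nil].
rewrite (_ : (fun t => _) = fun t => F i t + \sum_(j <- r) F j t).
  by apply: cvgD; [exact: cF|exact: ih].
by apply/funext => s; rewrite big_cons.
Qed.

Lemma le_geometric0 {R : realType} (c C : R) : (forall m, c <= C * 8^-1 ^+ m) -> c <= 0.
Proof.
move=> h; have cv : geometric C 8^-1 @ \oo --> (0 : R).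
  by apply: cvg_geometric; rewrite ger0_norm ?invr_ge0// invf_lt1// ltr1n.
rewrite -(cvg_lim _ cv)//; apply: limr_ge; first by apply/cvg_ex; exists 0.
by apply: nearW => m; exact: h.
Qed.

Lemma ae_foralln_fin {R : realType} {d} {T : measurableType d}
  (nu : {measure set T -> \bar R}) (I : finType) (Q : I -> T -> Prop) :
  (forall i, {ae nu, forall w, Q i w}) -> {ae nu, forall w, forall i, Q i w}.
Proof.
move=> h; have : {ae nu, forall w, forall i, i \in enum I -> Q i w}.
  elim: (enum I) => [|i s ih]; first exact: (@filterE _ _ (ae_filter_ringOfSetsType nu)).
  have := @filterI _ _ (ae_filter_ringOfSetsType nu) _ _ (h i) ih.
  apply: (@filterS _ _ (ae_filter_ringOfSetsType nu)) => w [hi hs] j.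
  by rewrite in_cons => /predU1P[->|/hs].
apply: (@filterS _ _ (ae_filter_ringOfSetsType nu)) => w hw i.
by apply: hw; rewrite mem_enum.
Qed.

Section LinearSDE.
Context {R : realType} {d : measure_display} {Om : measurableType d} {J : finType}.
Variables (P : probability Om R) (T : R) (W : J -> R -> Om -> R).
Hypothesis T_gt0 : 0 < T.
Hypothesis P_complete : measure_is_complete P.
Hypothesis W_bm : independent_brownians P T W.
Local Notation mu := (@lebesgue_measure R).
Local Notation TS := (timespace P).
Local Notation L2p := (L2p P T W).
Implicit Types (X Y b : R -> Om -> R) (h : J -> R -> Om -> R).

(* dX = b dt + \sum_k h_k dW_k, X 0 = x0, almost surely at each fixed time. *)
Definition sproc (x0 : R) b h X : Prop :=
  L2p b /\ exists2 Y : J -> R -> Om -> R, forall k, gito P T W k (h k) (Y k) &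
    forall t, 0 <= t <= T ->
      {ae P, forall w, X t w = x0 + prim b t w + \sum_k Y k t w}.

Lemma cst_Ft t (c : R) : Ft_measurable P W t (fun=> c).
Proof. exact: measurable_cst. Qed.

Lemma sproc_Ft x0 b h X t : sproc x0 b h X -> 0 <= t <= T -> Ft_measurable P W t (X t).
Proof.
move=> [[pb _] [Y gY XY]] tT.
apply: (@Ft_measurable_ae _ _ _ _ P W t (fun w => x0 + prim b t w + \sum_k Y k t w)).
  by apply: filterS (XY t tT) => w ->.
apply: measurable_funD; first by apply: measurable_funD; [exact: cst_Ft|exact: (prim_Ft pb tT)].
by apply: measurable_sum => k; have [_ FY _] := gY k; exact: FY.
Qed.

Lemma sproc_measurable x0 b h X t : sproc x0 b h X -> 0 <= t <= T -> measurable_fun setT (X t).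
Proof.
move=> pX tT; have [_ t_T] := andP tT.
exact: (Ft_measurable_measurable P_complete W_bm t_T (sproc_Ft pX tT)).
Qed.

Let sq_prim b t : L2p b -> 0 <= t <= T -> sq P (prim b t).
Proof. by move=> lb tT; have [] := prim_sq T_gt0 P_complete W_bm lb tT. Qed.

Lemma sproc_sq x0 b h X t : sproc x0 b h X -> 0 <= t <= T -> sq P (X t).
Proof.
move=> pX tT; have mX := sproc_measurable pX tT; case: pX => lb [Y gY XY].
apply: (sq_ae mX (f := fun w => x0 + prim b t w + \sum_k Y k t w)).
  by apply: filterS (XY t tT) => w ->.
apply: sqD; last by apply: sq_sum => k _; exact: (gito_sq P_complete W_bm (gY k) tT).
by apply: sqD; [exact: sq_cst|exact: sq_prim].
Qed.

Lemma sprocD x0 b h X x0' b' h' X' : sproc x0 b h X -> sproc x0' b' h' X' ->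
  sproc (x0 + x0') (fun t w => b t w + b' t w) (fun k t w => h k t w + h' k t w)
    (fun t w => X t w + X' t w).
Proof.
move=> [lb [Y gY XY]] [lb' [Y' gY' XY']]; split; first exact: L2pD.
exists (fun k t w => Y k t w + Y' k t w); first by move=> k; exact: gitoD.
move=> t tT; have [_ t_T] := andP tT.
have gg := @filterI _ _ (ae_filter_ringOfSetsType P) _ _
  (good_ae lb) (good_ae lb').
have := @filterI _ _ (ae_filter_ringOfSetsType P) _ _ gg
  (@filterI _ _ (ae_filter_ringOfSetsType P) _ _ (XY t tT) (XY' t tT)).
apply: (@filterS _ _ (ae_filter_ringOfSetsType P)) => w [[gb gb'] [-> ->]].
rewrite (primD T_gt0 P_complete W_bm (proj1 lb) (proj1 lb') t_T gb gb') big_split/=; ring.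
Qed.

Lemma sprocZ (r : R) x0 b h X : sproc x0 b h X ->
  sproc (r * x0) (fun t w => r * b t w) (fun k t w => r * h k t w) (fun t w => r * X t w).
Proof.
move=> [lb [Y gY XY]]; split; first exact: L2pZ.
exists (fun k t w => r * Y k t w); first by move=> k; exact: gitoZ.
move=> t tT; have [_ t_T] := andP tT.
apply: filterS2 (good_ae lb) (XY t tT) => w gb ->.
by rewrite (primZ T_gt0 P_complete W_bm _ (proj1 lb) t_T gb) !mulrDr mulr_sumr.
Qed.

Lemma sprocB x0 b h X x0' b' h' X' : sproc x0 b h X -> sproc x0' b' h' X' ->
  sproc (x0 - x0') (fun t w => b t w - b' t w) (fun k t w => h k t w - h' k t w)
    (fun t w => X t w - X' t w).
Proof.
move=> pX /(sprocZ (-1)) pX'; have := sprocD pX pX'.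
rewrite mulN1r; under eq_fun do under eq_fun do rewrite mulN1r.
under [X in sproc _ _ X]eq_fun do under eq_fun do under eq_fun do rewrite mulN1r.
by under [X in sproc _ _ _ X]eq_fun do under eq_fun do rewrite mulN1r.
Qed.

Lemma sproc_congr x0 b h X x0' b' h' X' : x0 = x0' ->
  (forall t w, b t w = b' t w) -> (forall k t w, h k t w = h' k t w) ->
  (forall t w, X t w = X' t w) -> sproc x0 b h X -> sproc x0' b' h' X'.
Proof.
move=> -> eb eh eX.
have -> : b = b' by apply/funext => t; apply/funext => w.
have -> : h = h' by apply/funext => k; apply/funext => t; apply/funext => w.
by have -> : X = X' by apply/funext => t; apply/funext => w.
Qed.

(** The 2 comes from separating drift and noise, [T] from Cauchy-Schwarz for the time integral, and
    the number of motions from squaring the sum of their integrals. *)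
Definition sprocK : R := 2 * T + 2 * #|J|%:R.

Lemma sprocK_ge0 : 0 <= sprocK.
Proof. by rewrite /sprocK addr_ge0// mulr_ge0// ltW. Qed.

Lemma sproc_le b h X t : sproc 0 b h X -> 0 <= t <= T ->
  ip P (X t) (X t) <= sprocK * (wnorm P t b + \sum_k wnorm P t (h k)).
Proof.
move=> pX tT; have sX := sproc_sq pX tT; have [_ t_T] := andP tT.
case: pX => lb [Y gY XY].
have sY k : sq P (Y k t) := gito_sq P_complete W_bm (gY k) tT.
have sp := sq_prim lb tT.
have sS : sq P (fun w => \sum_k Y k t w) by apply: sq_sum => k _; exact: sY.
have -> : ip P (X t) (X t) = ip P (fun w => prim b t w + \sum_k Y k t w) (fun w => prim b t w + \sum_k Y k t w).
  have e : {ae P, forall w, X t w = prim b t w + \sum_k Y k t w}.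
    by apply: filterS (XY t tT) => w; rewrite add0r.
  have sR := sqD sp sS.
  rewrite (ip_ae (proj1 sX) (proj1 sR) (proj1 sX) e) ipC.
  by rewrite (ip_ae (proj1 sX) (proj1 sR) (proj1 sR) e).
apply: le_trans (ipDD_le sp sS) _; rewrite /sprocK mulrDl !mulrDr.
have h1 : ip P (prim b t) (prim b t) <= T * wnorm P t b.
  have [_] := prim_sq T_gt0 P_complete W_bm lb tT.
  by rewrite (ipE sp) (ipE (L2p_win lb t_T)) -EFinM lee_fin.
have h2 : ip P (fun w => \sum_k Y k t w) (fun w => \sum_k Y k t w) <=
    #|J|%:R * \sum_k wnorm P t (h k).
  rewrite /wnorm (eq_bigr (fun k => ip P (Y k t) (Y k t))); last first.
    by move=> k _; rewrite (gito_isometry P_complete W_bm (gY k) (gY k) tT).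
  rewrite -lee_fin -ipE// EFinM -sumEFin.
  rewrite (eq_bigr (fun k => \int[P]_w (Y k t w ^+ 2)%:E)%E); last first.
    by move=> k _; rewrite ipE.
  rewrite -ge0_integral_sum//; last 2 first.
  - by move=> k; apply: measurable_sqr; case: (sY k).
  - by move=> k w _; rewrite lee_fin sqr_ge0.
  rewrite -ge0_integralZl_EFin//; last 2 first.
  - by move=> w _; apply: sume_ge0 => k _; rewrite lee_fin sqr_ge0.
  - by apply: emeasurable_sum => k; apply: measurable_sqr; case: (sY k).
  apply: ge0_le_integral => //.
  - by move=> w _; rewrite lee_fin sqr_ge0.
  - by apply: measurable_sqr; case: sS.
  - apply: measurable_funeM; apply: emeasurable_sum => k; apply: measurable_sqr.
    by case: (sY k).
  - by move=> w _; rewrite sumEFin -EFinM lee_fin sqr_sum_le.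
have w0 := wnorm_ge0 P t b.
have W0 : 0 <= \sum_k wnorm P t (h k) by apply: sumr_ge0 => k _; exact: wnorm_ge0.
have a1 : 0 <= 2 * T * (\sum_k wnorm P t (h k)).
  by rewrite !mulr_ge0// ltW.
have a2 : 0 <= 2 * #|J|%:R * wnorm P t b by rewrite !mulr_ge0.
by move: h1 h2 a1 a2; rewrite -!mulrA; lra.
Qed.

Lemma ito_sproc (x0 : R) b h (Y : J -> R -> Om -> R) X : L2p b ->
  (forall k, measurable_fun setT (win T (h k) : (measurableTypeR R * Om)%type -> R)) ->
  (forall k, ito_integral P T W k (h k) (Y k)) ->
  {ae P, forall w, forall t, 0 <= t <= T ->
    X t w = x0 + prim b t w + \sum_k Y k t w} -> sproc x0 b h X.
Proof.
move=> lb mh iY XY; split => //; exists Y => [k|t tT]; first exact: ito_gito.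
by apply: filterS XY => w; apply.
Qed.

Variable n : nat.
Implicit Types (x y beta : 'I_n -> R -> Om -> R) (gam : J -> 'I_n -> R -> Om -> R).

Lemma L2p_lin (c : 'I_n -> R -> R) (m : R) x beta :
  (forall l, measurable_fun setT (c l : measurableTypeR R -> R)) ->
  (forall l t, `|c l t| <= m) -> (forall l, L2p (x l)) ->
  forall j, L2p (beta j) -> L2p (fun t w => \sum_l c l t * x l t w + beta j t w).
Proof.
move=> mc cm lx j lb; apply: L2pD => //; apply: L2p_sum => l.
exact: (L2pM (mc l) (cm l) (lx l)).
Qed.

Lemma lin_wnorm_le (c : 'I_n -> R -> R) (m : R) x (b : R -> Om -> R) t :
  (forall l, measurable_fun setT (c l : measurableTypeR R -> R)) ->
  (forall l t, `|c l t| <= m) -> (forall l, sq TS (win t (x l))) -> sq TS (win t b) ->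
  wnorm P t (fun t w => \sum_l c l t * x l t w + b t w) <=
    2 * (n%:R * m ^+ 2) * (\sum_l wnorm P t (x l)) + 2 * wnorm P t b.
Proof.
move=> mc cm sx sb.
have winS : win t (fun t w => \sum_l c l t * x l t w) = fun z => \sum_l c l z.1 * win t (x l) z.
  by apply/funext => z; rewrite /win mulr_suml; apply: eq_bigr => l _; rewrite mulrA.
have mc1 l : measurable_fun setT (fun z : (measurableTypeR R * Om)%type => c l z.1).
  by apply: measurableT_comp (mc l) _; exact: measurable_fst.
have sc l : sq TS (fun z => c l z.1 * win t (x l) z).
  exact: (@sq_bdM _ _ _ TS (win t (x l)) (fun z => c l z.1) m (mc1 l) (fun z => cm l z.1) (sx l)).
have sS : sq TS (win t (fun t w => \sum_l c l t * x l t w)).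
  by rewrite winS; apply: sq_sum => l _; exact: sc.
apply: le_trans (wnormD_le sS sb) _; rewrite lerD2r -mulrA ler_pM2l//.
rewrite /wnorm winS -lee_fin -ipE//; last by rewrite -winS.
rewrite EFinM -sumEFin (eq_bigr (fun l => \int[TS]_z (win t (x l) z ^+ 2)%:E)%E); last first.
  by move=> l _; rewrite ipE.
have m2 l : measurable_fun setT (fun z => (win t (x l) z ^+ 2)%:E).
  by apply: measurable_sqr; case: (sx l).
rewrite -ge0_integral_sum//; last by move=> l z _; rewrite lee_fin sqr_ge0.
have nm0 : 0 <= n%:R * m ^+ 2 by rewrite mulr_ge0 ?sqr_ge0.
rewrite -ge0_integralZl_EFin//; last 2 first.
- by move=> w _; apply: sume_ge0 => k _; rewrite lee_fin sqr_ge0.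
- by apply: emeasurable_sum => k; exact: m2.
apply: ge0_le_integral => //.
- by move=> w _; rewrite lee_fin sqr_ge0.
- by apply: measurable_sqr; rewrite -winS; case: sS.
- by apply: measurable_funeM; apply: emeasurable_sum => k; exact: m2.
- move=> z _; rewrite sumEFin -EFinM lee_fin.
  apply: le_trans (sqr_sum_le _) _; rewrite card_ord -mulrA ler_wpM2l// mulr_sumr.
  apply: ler_sum => l _; rewrite exprMn ler_wpM2r ?sqr_ge0//.
  rewrite -[leLHS]real_normK ?num_real// ler_sqr ?nnegrE//.
  exact: le_trans (cm l z.1).
Qed.

Variables (A : 'I_n -> 'I_n -> R) (C : J -> 'I_n -> 'I_n -> R -> R) (cmax : R).
Hypothesis Am : forall j l, `|A j l| <= cmax.
Hypothesis Cm : forall k j l t, `|C k j l t| <= cmax.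
Hypothesis mC : forall k j l, measurable_fun setT (C k j l : measurableTypeR R -> R).

(** The noise coefficients [C] depend on time while [A] does not, because a feedback control enters
    the closed loop through the noise only. *)
Definition drift x beta j t w : R := \sum_l A j l * x l t w + beta j t w.
Definition diffu x gam k j t w : R := \sum_l C k j l t * x l t w + gam k j t w.

Definition lin_sproc (x0 : 'I_n -> R) beta gam x : Prop :=
  forall j, sproc (x0 j) (drift x beta j) (fun k => diffu x gam k j) (x j).

Lemma drift_L2p x beta : (forall l, L2p (x l)) -> (forall l, L2p (beta l)) ->
  forall j, L2p (drift x beta j).
Proof. by move=> lx lb j; apply: (@L2p_lin (fun l _ => A j l) cmax x beta). Qed.

Lemma diffu_L2p x gam : (forall l, L2p (x l)) -> (forall k l, L2p (gam k l)) ->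
  forall k j, L2p (diffu x gam k j).
Proof.
by move=> lx lg k j; apply: (@L2p_lin (C k j) cmax x (gam k) _ _ lx j (lg k j)).
Qed.

(** One term for the drift and one for each motion, over [n] components; adding 1 makes the rate
    positive, so that it can be divided by. *)
Definition lin_rate : R := sprocK * (n%:R * (2 * (n%:R * cmax ^+ 2) * (1 + #|J|%:R))) + 1.

Lemma lin_rate_gt0 : 0 < lin_rate.
Proof.
have h1 : 0 <= n%:R * cmax ^+ 2 by rewrite mulr_ge0 ?sqr_ge0.
have h2 : 0 <= 1 + #|J|%:R :> R by rewrite addr_ge0.
rewrite /lin_rate ltr_wpDl//; apply: mulr_ge0; first exact: sprocK_ge0.
by apply: mulr_ge0 => //; apply: mulr_ge0 => //; apply: mulr_ge0.
Qed.

(* The inequality is phrased with separate coefficient and solution processes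
   since Picard's iteration puts the previous iterate in the coefficients. *)
Lemma lin_sproc_le x y beta gam t : (forall l, L2p (x l)) ->
  (forall l, L2p (beta l)) -> (forall k l, L2p (gam k l)) -> 0 <= t <= T ->
  (forall j, sproc 0 (drift x beta j) (fun k => diffu x gam k j) (y j)) ->
  \sum_j ip P (y j t) (y j t) <=
    2 * sprocK * (\sum_j wnorm P t (beta j) + \sum_j \sum_k wnorm P t (gam k j)) +
    lin_rate * \sum_l wnorm P t (x l).
Proof.
move=> lx lb lg tT py; have [_ t_T] := andP tT.
set Nx := \sum_l wnorm P t (x l).
have Nx0 : 0 <= Nx by apply: sumr_ge0 => l _; exact: wnorm_ge0.
have step j : ip P (y j t) (y j t) <= sprocK * ((2 * (n%:R * cmax ^+ 2) * (1 + #|J|%:R)) * Nx) +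
    2 * sprocK * (wnorm P t (beta j) + \sum_k wnorm P t (gam k j)).
  apply: le_trans (sproc_le (py j) tT) _.
  rewrite (_ : _ + _ = sprocK * ((2 * (n%:R * cmax ^+ 2) * Nx + 2 * wnorm P t (beta j)) +
     \sum_k (2 * (n%:R * cmax ^+ 2) * Nx + 2 * wnorm P t (gam k j)))); last first.
    rewrite big_split/= sumr_const -[_ *+ #|J|]mulr_natl -mulr_sumr; ring.
  apply: ler_wpM2l; first exact: sprocK_ge0.
  apply: lerD.
    apply: (@lin_wnorm_le (fun l _ => A j l) cmax x (beta j)) => //.
    - by move=> l; exact: L2p_win.
    - exact: L2p_win.
  apply: ler_sum => k _; apply: (@lin_wnorm_le (C k j) cmax x (gam k j)) => //.
  - by move=> l; exact: L2p_win.
  - exact: L2p_win.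
apply: le_trans (ler_sum _ (fun j _ => step j)) _.
rewrite big_split/= sumr_const card_ord -[_ *+ n]mulr_natl -mulr_sumr big_split/= addrC lerD2l.
rewrite /lin_rate [leRHS]mulrDl mul1r -subr_ge0.
rewrite (_ : _ - _ = Nx)//; ring.
Qed.

Lemma lin_sproc_bound beta gam x : lin_sproc (fun=> 0) beta gam x ->
  (forall l, L2p (x l)) -> (forall l, L2p (beta l)) -> (forall k l, L2p (gam k l)) ->
  forall t, 0 <= t <= T -> \sum_j ip P (x j t) (x j t) <=
    4 * sprocK * expR (2 * lin_rate * T) *
    (\sum_j wnorm P t (beta j) + \sum_j \sum_k wnorm P t (gam k j)).
Proof.
move=> px lx lb lg t tT; have [t0 t_T] := andP tT.
set G := (\sum_j _ + _).
have G0 : 0 <= G.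
  apply: addr_ge0; apply: sumr_ge0 => j _; first exact: wnorm_ge0.
  by apply: sumr_ge0 => k _; exact: wnorm_ge0.
have K0 := sprocK_ge0.
have g0 : 0 <= 2 * sprocK * G by rewrite !mulr_ge0.
have t1 : 0 <= t <= t by rewrite t0 lexx.
(* Gronwall's inequality is run with horizon [t] instead of [T], so the bound sees the inputs up to
   time [t] only. The pulse estimate depends on this. *)
have h := @gronwall R d Om P t n x _ _ g0 lin_rate_gt0 _ _ _ t t1.
have sub s : 0 <= s <= t -> 0 <= s <= T.
  by move=> /andP[s0 st]; rewrite s0 (le_trans st t_T).
apply: le_trans (h _ _ _) _.
- by move=> j; exact: (L2p_win (lx j) t_T).
- by move=> s sT j; exact: sproc_sq (px j) (sub _ sT).
- move=> s st; have [_ s_t] := andP st; have sT := sub s st.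
  apply: le_trans (lin_sproc_le lx lb lg sT px) _; rewrite lerD2r.
  apply: ler_wpM2l; first by rewrite mulr_ge0.
  apply: lerD; apply: ler_sum => j _; first by apply: wnorm_mono => //; exact: (L2p_win (lb j) t_T).
  by apply: ler_sum => k _; apply: wnorm_mono => //; exact: (L2p_win (lg k j) t_T).
rewrite (_ : 2 * (2 * sprocK * G) * expR _ = 4 * sprocK * G * expR (2 * lin_rate * t)); last by ring.
rewrite [leRHS](_ : _ = 4 * sprocK * G * expR (2 * lin_rate * T)); last by ring.
apply: ler_wpM2l; first by rewrite !mulr_ge0.
rewrite ler_expR; apply: ler_wpM2l => //; rewrite mulr_ge0// ltW//.
exact: lin_rate_gt0.
Qed.

Lemma lin_sprocD (x0 x0' : 'I_n -> R) beta gam x beta' gam' x' :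
  lin_sproc x0 beta gam x -> lin_sproc x0' beta' gam' x' ->
  lin_sproc (fun j => x0 j + x0' j) (fun j t w => beta j t w + beta' j t w)
    (fun k j t w => gam k j t w + gam' k j t w) (fun j t w => x j t w + x' j t w).
Proof.
move=> px px' j; apply: sproc_congr (sprocD (px j) (px' j)) => // [t w|k t w].
  by rewrite /drift addrACA -big_split/=; congr (_ + _); apply: eq_bigr => l _; rewrite mulrDr.
by rewrite /diffu addrACA -big_split/=; congr (_ + _); apply: eq_bigr => l _; rewrite mulrDr.
Qed.

Lemma lin_sprocZ (r : R) (x0 : 'I_n -> R) beta gam x : lin_sproc x0 beta gam x ->
  lin_sproc (fun j => r * x0 j) (fun j t w => r * beta j t w)
    (fun k j t w => r * gam k j t w) (fun j t w => r * x j t w).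
Proof.
move=> px j; apply: sproc_congr (sprocZ r (px j)) => // [t w|k t w].
  by rewrite /drift mulrDr mulr_sumr; congr (_ + _); apply: eq_bigr => l _; rewrite mulrCA.
by rewrite /diffu mulrDr mulr_sumr; congr (_ + _); apply: eq_bigr => l _; rewrite mulrCA.
Qed.

Lemma lin_sprocB (x0 x0' : 'I_n -> R) beta gam x beta' gam' x' :
  lin_sproc x0 beta gam x -> lin_sproc x0' beta' gam' x' ->
  lin_sproc (fun j => x0 j - x0' j) (fun j t w => beta j t w - beta' j t w)
    (fun k j t w => gam k j t w - gam' k j t w) (fun j t w => x j t w - x' j t w).
Proof.
move=> px px' j; apply: sproc_congr (lin_sprocD px (lin_sprocZ (-1) px') j).
- by rewrite mulN1r.
- by move=> t w; congr (_ + _); [apply: eq_bigr => l _|]; rewrite mulN1r.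
- by move=> k t w; congr (_ + _); [apply: eq_bigr => l _|]; rewrite mulN1r.
- by move=> t w; rewrite mulN1r.
Qed.

Lemma lin_sproc_congr (x0 x0' : 'I_n -> R) beta gam x beta' gam' x' :
  (forall j, x0 j = x0' j) -> (forall j t w, beta j t w = beta' j t w) ->
  (forall k j t w, gam k j t w = gam' k j t w) -> (forall j t w, x j t w = x' j t w) ->
  lin_sproc x0 beta gam x -> lin_sproc x0' beta' gam' x'.
Proof.
move=> /funext -> eb eg ex.
have -> : beta = beta' by apply/funext => j; apply/funext => t; apply/funext => w.
have -> : gam = gam' by apply/funext => k; apply/funext => j; apply/funext => t; apply/funext => w.
by have -> : x = x' by apply/funext => j; apply/funext => t; apply/funext => w.
Qed.

Let zero_data t : \sum_(j < n) wnorm P t (fun _ _ => 0) +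
  \sum_(j < n) \sum_(k : J) wnorm P t (fun _ _ => 0) = 0.
Proof.
have w0 : wnorm P t (fun _ _ => 0) = 0 by apply: ip0l => z; rewrite /win mul0r.
by rewrite !big1 ?addr0// => i _; rewrite ?big1.
Qed.

Lemma lin_sproc_unique (x0 : 'I_n -> R) beta gam x y :
  (forall l, L2p (x l)) -> (forall l, L2p (y l)) ->
  lin_sproc x0 beta gam x -> lin_sproc x0 beta gam y ->
  forall t, 0 <= t <= T -> forall j, {ae P, forall w, x j t w = y j t w}.
Proof.
move=> lx ly px py t tT j; pose z j t w := x j t w - y j t w.
have lz l : L2p (z l) by exact: L2pB.
have l0 : L2p (fun _ _ => 0) := L2p0 P T W.
have pz : lin_sproc (fun=> 0) (fun _ _ _ => 0) (fun _ _ _ _ => 0) z.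
  by apply: lin_sproc_congr (lin_sprocB px py) => // *; exact: subrr.
have := lin_sproc_bound pz lz (fun=> l0) (fun _ _ => l0) tT.
rewrite zero_data mulr0 => h.
have zj : ip P (z j t) (z j t) = 0.
  apply/eqP; rewrite eq_le ip_ge0 andbT; apply: le_trans h.
  by rewrite (bigD1 j)//= lerDl sumr_ge0// => i _; exact: ip_ge0.
have sz : sq P (z j t) := sproc_sq (pz j) tT.
apply: filterS (ip_eq0_ae sz zj) => w /eqP.
by rewrite subr_eq0 => /eqP.
Qed.

Lemma L2p_of_bound X (K : R) : progressive P T W X ->
  (forall t, 0 <= t <= T -> (\int[P]_w (X t w ^+ 2)%:E <= K%:E)%E) -> L2p X.
Proof.
move=> pX hK; split => //; have mX := measurable_win T_gt0 P_complete W_bm pX.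
split => //; have := @sum_win_sq_bound R d Om P 1 (fun=> X) T (fun=> K).
rewrite big_ord1 => /(_ (fun=> mX) (measurable_cst _)) h.
apply: le_lt_trans (h _) _; first by move=> s sT; rewrite big_ord1; exact: hK.
by rewrite integral_cst//= lebesgue_measure_itv/= lte_fin T_gt0 oppr0 adde0 -EFinM ltry.
Qed.

Variables (x0 : 'I_n -> R) (beta : 'I_n -> R -> Om -> R) (gam : J -> 'I_n -> R -> Om -> R).
Hypothesis lbeta : forall l, L2p (beta l).
Hypothesis lgam : forall k l, L2p (gam k l).

(** A relation rather than a map, since the integrals are determined only up to null sets. Solutions
    of the equation are its fixed points [picard_step x x]. *)
Definition picard_step x y : Prop :=
  (forall j, L2p (y j)) /\ exists2 Y : J -> 'I_n -> R -> Om -> R,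
    forall k j, ito_integral P T W k (diffu x gam k j) (Y k j) &
    {ae P, forall w, forall t, 0 <= t <= T -> forall j,
      y j t w = x0 j + prim (drift x beta j) t w + \sum_k Y k j t w}.

Lemma picard_step_sproc x y : (forall l, L2p (x l)) -> picard_step x y ->
  forall j, sproc (x0 j) (drift x beta j) (fun k => diffu x gam k j) (y j).
Proof.
move=> lx [ly [Y iY yY]] j; have lb := drift_L2p lx lbeta.
have ld := diffu_L2p lx lgam.
apply: (ito_sproc (lb j) (Y := fun k => Y k j)).
- by move=> k; case: (ld k j) => _ [].
- by move=> k; exact: iY.
- by apply: filterS yY => w h t tT; exact: h.
Qed.

Lemma picard_step_exists x : (forall l, L2p (x l)) -> exists y, picard_step x y.
Proof.
move=> lx; have lb := drift_L2p lx lbeta; have ld := diffu_L2p lx lgam.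
have /choice[Y hY] : forall kj : J * 'I_n, exists Y,
    ito_integral P T W kj.1 (diffu x gam kj.1 kj.2) Y /\
    forall w, {within `[0, T], continuous (fun t => Y t w)}.
  move=> [k j]; have [pd sd] := ld k j.
  by have [Y iY cY] := ito_integral_exists T_gt0 P_complete W_bm k pd sd; exists Y.
pose g j := [set w | good T (drift x beta j) w].
(* Cutting off the paths on which the drift has infinite energy makes every path of [y] continuous,
   which yields progressive measurability. *)
pose y j t w := x0 j + \1_(g j) w * prim (drift x beta j) t w + \sum_k Y (k, j) t w.
have g_ae j : {ae P, forall w, \1_(g j) w = 1 :> R}.
  by apply: filterS (good_ae (lb j)) => w gw; rewrite indicE mem_set.
have yY : {ae P, forall w, forall t, 0 <= t <= T -> forall j,
    y j t w = x0 j + prim (drift x beta j) t w + \sum_k Y (k, j) t w}.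
  have : {ae P, forall w, forall j, \1_(g j) w = 1 :> R} by exact/ae_foralln_fin.
  by apply: filterS => w h t _ j; rewrite /y h mul1r.
have Fg j t : Ft_measurable P W t (\1_(g j)).
  apply: (@Ft_measurable_ae _ _ _ _ P W t (fun=> 1)); last exact: measurable_cst.
  by apply: filterS (g_ae j) => w ->.
have Fy j t : 0 <= t <= T -> Ft_measurable P W t (y j t).
  move=> tT; apply: measurable_funD; last first.
    by apply: measurable_sum => k; have [[FY _ _] _] := hY (k, j); exact: FY.
  apply: measurable_funD; first exact: cst_Ft.
  by apply: measurable_funM; [exact: Fg|exact: (prim_Ft (proj1 (lb j)) tT)].
have cy j w : {within `[0, T], continuous (fun t => y j t w)}.
  move=> t; apply: cvgD; last first.
    by apply: within_continuous_sum => k; have [] := hY (k, j).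
  apply: cvgD; first exact: cvg_cst.
  rewrite indicE; case: (boolP (w \in g j)) => [/set_mem gw|_].
    apply: cvgM; first exact: cvg_cst.
    exact: (prim_continuous T_gt0 P_complete W_bm (proj1 (lb j)) gw).
  rewrite [X in _ --> X]mul0r (_ : (fun t => _) = fun=> 0); first exact: cvg_cst.
  by apply/funext => s; rewrite mul0r.
have py j : progressive P T W (y j) by apply: continuous_progressive => // t; exact: Fy.
exists y; split; last first.
  by exists (fun k j => Y (k, j)) => // k j; have [] := hY (k, j).
move=> j; pose z t w := y j t w - x0 j.
have pz : sproc 0 (drift x beta j) (fun k => diffu x gam k j) z.
  apply: (ito_sproc (lb j) (Y := fun k => Y (k, j))).
  - by move=> k; case: (ld k j) => _ [].
  - by move=> k; have [] := hY (k, j).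
  - by apply: filterS yY => w h t tT; rewrite /z h//; ring.
pose K := sprocK * (wnorm P T (drift x beta j) + \sum_k wnorm P T (diffu x gam k j)).
apply: (@L2p_of_bound _ (2 * x0 j ^+ 2 + 2 * K)) => // t tT; have [_ t_T] := andP tT.
have sz := sproc_sq pz tT.
have hz : ip P (z t) (z t) <= K.
  apply: le_trans (sproc_le pz tT) _; apply: ler_wpM2l; first exact: sprocK_ge0.
  apply: lerD; first by apply: wnorm_mono => //; case: (lb j).
  by apply: ler_sum => k _; apply: wnorm_mono => //; case: (ld k j).
rewrite (_ : (\int[P]_w _ = \int[P]_w ((x0 j + z t w) ^+ 2)%:E)%E); last first.
  by apply: eq_integral => w _; rewrite /z addrCA subrr addr0.
apply: le_trans (int_sqrD_le _ _ _) _; [exact: measurable_cst|by case: sz|].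
rewrite (ipE sz) integral_cst//= [P setT]probability_setT mule1 -!EFinM -EFinD lee_fin.
by rewrite lerD2l ler_pM2l.
Qed.

Lemma picard_stepB x x' y y' : (forall l, L2p (x l)) -> (forall l, L2p (x' l)) ->
  picard_step x y -> picard_step x' y' -> forall t, 0 <= t <= T ->
  \sum_j ip P (fun w => y j t w - y' j t w) (fun w => y j t w - y' j t w) <=
  lin_rate * \sum_l wnorm P t (fun t w => x l t w - x' l t w).
Proof.
move=> lx lx' hy hy' t tT.
have py := picard_step_sproc lx hy; have py' := picard_step_sproc lx' hy'.
have l0 : L2p (fun _ _ => 0) := L2p0 P T W.
pose u j t w := x j t w - x' j t w; pose z j t w := y j t w - y' j t w.
have lu l : L2p (u l) by exact: L2pB.
have pz j : sproc 0 (drift u (fun _ _ _ => 0) j) (fun k => diffu u (fun _ _ _ _ => 0) k j) (z j).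
  apply: sproc_congr (sprocB (py j) (py' j)) => //; first exact: subrr.
    move=> s w; rewrite /drift addr0 opprD addrACA subrr addr0 -sumrB.
    by apply: eq_bigr => l _; rewrite mulrBr.
  move=> k s w; rewrite /diffu addr0 opprD addrACA subrr addr0 -sumrB.
  by apply: eq_bigr => l _; rewrite mulrBr.
have := lin_sproc_le lu (fun=> l0) (fun _ _ => l0) tT pz.
by rewrite zero_data mulr0 add0r.
Qed.

(** The limit of the Picard iterates agrees with its own image only almost everywhere in time and
    path. Since integrals do not see the difference, the image itself is then a fixed point. *)
Lemma picard_step_ae x x' y : (forall l, L2p (x l)) -> (forall l, L2p (x' l)) ->
  (forall l, {ae TS, forall z, win T (x l) z = win T (x' l) z}) ->
  picard_step x y -> picard_step x' y.
Proof.
move=> lx lx' xx' [ly [Y iY yY]]; split => //; exists Y.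
  move=> k j; have ld := diffu_L2p lx lgam k j; have ld' := diffu_L2p lx' lgam k j.
  apply: (ito_integral_ae P_complete W_bm (iY k j) (proj1 (proj2 ld)) (proj1 (proj2 ld'))).
  apply: (@filterS _ _ (ae_filter_ringOfSetsType TS) _ _ _ (ae_foralln_fin xx')) => -[s w] h.
  rewrite /win /diffu /=; have {}h l := h l; rewrite /win /= in h.
  rewrite !mulrDl !mulr_suml; congr (_ + _); apply: eq_bigr => l _.
  by rewrite -!mulrA h.
have pp : {ae P, forall w, forall j t, 0 <= t <= T ->
    prim (drift x beta j) t w = prim (drift x' beta j) t w}.
  apply: ae_foralln_fin => j.
  apply: (prim_ae T_gt0 P_complete W_bm (drift_L2p lx lbeta j) (drift_L2p lx' lbeta j)).
  apply: (@filterS _ _ (ae_filter_ringOfSetsType TS) _ _ _ (ae_foralln_fin xx')) => -[s w] h.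
  rewrite /win /drift /=; have {}h l := h l; rewrite /win /= in h.
  rewrite !mulrDl !mulr_suml; congr (_ + _); apply: eq_bigr => l _.
  by rewrite -!mulrA h.
apply: filterS2 yY pp => w hy hp t tT j.
by rewrite hy// hp.
Qed.

Lemma lin_sde_exists : exists x, picard_step x x.
Proof.
have l0 : L2p (fun _ _ => 0) := L2p0 P T W.
have /choice[Phi hPhi] : forall x, exists y, (forall l, L2p (x l)) -> picard_step x y.
  move=> x; have [lx|nlx] := pselect (forall l, L2p (x l)); last by exists x => lx.
  by have [y hy] := picard_step_exists lx; exists y.
pose X m := iter m Phi (fun _ _ _ => 0).
have lX m l : L2p (X m l).
  by elim: m l => [|m ih] l //=; have [] := hPhi _ ih.
have sX m : picard_step (X m) (X m.+1) by apply: hPhi; exact: lX.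
pose D m l t w := X m.+1 l t w - X m l t w.
have lD m l : L2p (D m l) by exact: L2pB.
have r0 := lin_rate_gt0; set rate := lin_rate in r0.
pose B0 := rate * \sum_l wnorm P T (D 0%N l).
have B00 : 0 <= B0.
  by apply: mulr_ge0; [exact: ltW|apply: sumr_ge0 => l _; exact: wnorm_ge0].
have q0 m : 0 < (8^-1 : R) ^+ m by rewrite exprn_gt0// invr_gt0.
(* With the weight exp(8 rate t) each Picard step gains a factor 1/8, the decay that [L2_limit]
   expects. *)
have lam0 : 0 < 8 * rate by rewrite mulr_gt0.
have sqDm t m l : 0 <= t <= T -> sq P (D m.+1 l t).
  move=> tT; apply: sqB.
    exact: (sproc_sq (picard_step_sproc (lX _) (sX m.+1) l) tT).
  exact: (sproc_sq (picard_step_sproc (lX _) (sX m) l) tT).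
(* The induction starts with [D 1], the first difference of two Picard images; [D 0] enters only
   through its norm over the window. *)
have key m t : 0 <= t <= T ->
    \sum_j ip P (D m.+1 j t) (D m.+1 j t) <= B0 * 8^-1 ^+ m * expR (8 * rate * t).
  elim: m t => [|m ih] t tT; have [t0 t_T] := andP tT.
    apply: le_trans (picard_stepB (lX _) (lX _) (sX 1%N) (sX 0%N) tT) _.
    apply: (@le_trans _ _ B0).
      by rewrite ler_pM2l//; apply: ler_sum => l _; apply: wnorm_mono => //; case: (lD 0%N l).
    rewrite expr0 mulr1; apply: ler_peMr => //.
    by rewrite -[X in X <= _]expR0 ler_expR mulr_ge0// ltW.
  apply: le_trans (picard_stepB (lX _) (lX _) (sX m.+2) (sX m.+1) tT) _.
  have h := @win_exp_bound R d Om P n (D m.+1) t (B0 * 8^-1 ^+ m) (8 * rate) t0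
    (mulr_ge0 B00 (ltW (q0 m))) lam0.
  apply: (@le_trans _ _ (rate * (B0 * 8^-1 ^+ m / (8 * rate) * expR (8 * rate * t)))).
    rewrite ler_pM2l//; apply: h.
    - by move=> l; exact: L2p_win.
    - by move=> s /andP[s0 st] l; apply: sqDm; rewrite s0 (le_trans st).
    - by move=> s /andP[s0 st]; apply: ih; rewrite s0 (le_trans st).
  rewrite le_eqVlt; apply/orP; left; apply/eqP; rewrite exprS; field.
  by rewrite gt_eqF.
have T0 : 0 <= T <= T by rewrite lexx ltW.
pose B1 := B0 / (8 * rate) * expR (8 * rate * T).
have B10 : 0 <= B1.
  apply: mulr_ge0; last exact: expR_ge0.
  by apply: mulr_ge0 => //; rewrite invr_ge0 ltW.
have wD m l : wnorm P T (D m.+1 l) <= B1 * 8^-1 ^+ m.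
  have h := @win_exp_bound R d Om P n (D m.+1) T (B0 * 8^-1 ^+ m) (8 * rate) (ltW T_gt0)
    (mulr_ge0 B00 (ltW (q0 m))) lam0 (fun l => L2p_win (lD m.+1 l) (lexx T))
    (fun s sT l => sqDm s m l sT) (key m).
  rewrite (_ : B1 * _ = B0 * 8^-1 ^+ m / (8 * rate) * expR (8 * rate * T)); last by rewrite /B1; ring.
  apply: le_trans h; rewrite (bigD1 l)//= lerDl.
  by apply: sumr_ge0 => i _; exact: wnorm_ge0.
pose x l t w := rlim (fun m p => X m.+1 l p.1 p.2) (t, w).
have winx l : win T (x l) = rlim (fun m => win T (X m.+1 l)).
  apply/funext => -[t w]; have [tT|tT] := boolP (0 <= t <= T).
    rewrite winE// /x /rlim; congr (fine (limn_esup _)); apply/funext => m.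
    by rewrite winE.
  rewrite win0E//; apply/esym/rlimE; under eq_fun do rewrite win0E//.
  exact: cvg_cst.
have mX m l : measurable_fun setT (win T (X m l) : (measurableTypeR R * Om)%type -> R).
  by case: (lX m l) => _ [].
have hlim l m : (\int[TS]_z ((win T (x l) z - win T (X m.+1 l) z) ^+ 2)%:E <= (4 * B1 * 8^-1 ^+ m)%:E)%E.
  rewrite winx; apply: (@L2_limit _ _ _ TS (fun m => win T (X m.+1 l)) B1) => // p.
  have := wD p l; rewrite -lee_fin; apply: le_trans.
  rewrite /wnorm -ipE; last by apply: L2p_win (lexx T); exact: lD.
  by rewrite /D winB.
have lx l : L2p (x l).
  have px : progressive P T W (x l).
    move=> t tT; rewrite (_ : (fun p => _) = rlim (fun m p => X m.+1 l p.1 p.2)); last first.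
      by apply/funext => -[].
    by apply: measurable_rlim => m; case: (lX m.+1 l) => + _; apply.
  split => //; have mx := measurable_win T_gt0 P_complete W_bm px.
  have s1 : sq TS (fun z => win T (x l) z - win T (X 1%N l) z).
    split; first exact: measurable_funB.
    by apply: le_lt_trans (hlim l 0%N) _; rewrite ltry.

  apply: eq_sq (sqD s1 (proj2 (lX 1%N l))) => z; by rewrite subrK.
have wx m : \sum_l wnorm P T (fun t w => x l t w - X m.+1 l t w) <= n%:R * (4 * B1 * 8^-1 ^+ m).
  rewrite -[n in leRHS]card_ord mulr_natl -sumr_const; apply: ler_sum => l _.
  rewrite -lee_fin /wnorm -ipE; last by apply: L2p_win (lexx T); exact: L2pB.
  by rewrite winB; exact: hlim.
(* [x] is only a pointwise limit of iterates. The solution is its Picard image [y], which is shown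
   to coincide with [x] almost everywhere. *)
have hy := hPhi x lx; have [ly _] := hy; set y := Phi x in hy ly.
pose B2 := rate * (n%:R * (4 * B1)).
have B20 : 0 <= B2.
  apply: mulr_ge0; first exact: ltW.
  by apply: mulr_ge0 => //; apply: mulr_ge0.
have wy m l : wnorm P T (fun t w => y l t w - X m.+2 l t w) <= B2 * 8^-1 ^+ m * expR T.
  have aT t : 0 <= t <= T ->
      \sum_j ip P (fun w => y j t w - X m.+2 j t w) (fun w => y j t w - X m.+2 j t w) <= B2 * 8^-1 ^+ m * expR (1 * t).
    move=> tT; have [t0 t_T] := andP tT.
    apply: le_trans (picard_stepB lx (lX _) hy (sX m.+1) tT) _.
    apply: (@le_trans _ _ (B2 * 8^-1 ^+ m)).
      rewrite (_ : B2 * _ = rate * (n%:R * (4 * B1 * 8^-1 ^+ m))); last by rewrite /B2; ring.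
      rewrite -/rate ler_pM2l//; apply: le_trans _ (wx m).
      by apply: ler_sum => l' _; apply: wnorm_mono => //; apply: L2p_win (lexx T); exact: L2pB.
    apply: ler_peMr; first by rewrite mulr_ge0// ltW.
    by rewrite -[X in X <= _]expR0 ler_expR mul1r.
  have h := @win_exp_bound R d Om P n (fun j t w => y j t w - X m.+2 j t w) T (B2 * 8^-1 ^+ m) 1
    (ltW T_gt0) (mulr_ge0 B20 (ltW (q0 m))) ltr01 (fun l => L2p_win (L2pB (ly l) (lX m.+2 l)) (lexx T)) _ aT.
  move: h; rewrite invr1 mulr1 mul1r => h; apply: le_trans (h _).
    by rewrite (bigD1 l)//= lerDl; apply: sumr_ge0 => i _; exact: wnorm_ge0.
  move=> s sT j; apply: sqB.
    exact: (sproc_sq (picard_step_sproc lx hy j) sT).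
  exact: (sproc_sq (picard_step_sproc (lX _) (sX m.+1) j) sT).
have xy l : {ae TS, forall z, win T (x l) z = win T (y l) z}.
  have sxy : sq TS (win T (fun t w => x l t w - y l t w)) := L2p_win (L2pB (lx l) (ly l)) (lexx T).
  have : wnorm P T (fun t w => x l t w - y l t w) = 0.
    apply/eqP; rewrite eq_le wnorm_ge0 andbT.
    apply: (@le_geometric0 _ _ (2 * (n%:R * (4 * B1)) + 2 * (B2 * expR T))) => m.
    have s1 := L2p_win (L2pB (lx l) (lX m.+2 l)) (lexx T).
    have s2 := L2p_win (L2pB (lX m.+2 l) (ly l)) (lexx T).
    rewrite (_ : (fun t w => _) = (fun t w => (x l t w - X m.+2 l t w) + (X m.+2 l t w - y l t w))); last first.
      by apply/funext => t; apply/funext => w; rewrite addrA subrK.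
    apply: le_trans (wnormD_le s1 s2) _; rewrite [leRHS]mulrDl; apply: lerD.
      rewrite -mulrA ler_pM2l//.
      apply: (@le_trans _ _ (n%:R * (4 * B1 * 8^-1 ^+ m.+1))).
        apply: le_trans _ (wx m.+1); rewrite [leRHS](bigD1 l)//= lerDl.
        by apply: sumr_ge0 => i _; exact: wnorm_ge0.
      rewrite -[leRHS]mulrA; apply: ler_wpM2l => //; apply: ler_wpM2l; first exact: mulr_ge0.
      by rewrite ler_wiXn2l// ?invr_ge0// invf_le1// ler1n.
    rewrite -mulrA ler_pM2l// mulrAC; apply: le_trans _ (wy m l).
    rewrite /wnorm le_eqVlt; apply/orP; left; apply/eqP.
    by apply: eq_Rintegral => z _; rewrite /win; ring.
  move=> /(ip_eq0_ae sxy); apply: (@filterS _ _ (ae_filter_ringOfSetsType TS)) => z.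
  by rewrite winB => /eqP; rewrite subr_eq0 => /eqP.
by exists y; apply: picard_step_ae xy hy.
Qed.

End LinearSDE.

(** * Second moments of linear states *)

Section RealFubini.
Context {d1 d2 : measure_display} {T1 : measurableType d1} {T2 : measurableType d2} {R : realType}.
Variables (m1 : {sigma_finite_measure set T1 -> \bar R}) (m2 : {sigma_finite_measure set T2 -> \bar R}).
Variable f : T1 * T2 -> R.
Hypothesis imf : (m1 \x m2)%E.-integrable setT (EFin \o f).

Let fine_integrable d (T : measurableType d) (nu : {measure set T -> \bar R}) (g : T -> \bar R) :
  nu.-integrable setT g -> nu.-integrable setT (EFin \o (fun x => fine (g x))) /\
  (\int[nu]_x (fine (g x))%:E = \int[nu]_x g x)%E.
Proof.
move=> ig; have mg := measurable_int nu ig.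
have mf : measurable_fun setT (EFin \o (fun x => fine (g x))).
  by apply/measurable_EFinP; apply: measurableT_comp => //; exact: fine_measurable.
split.
  apply: le_integrable ig => // x _ /=.
  by case: (g x) => [r| |] //=; rewrite normr0 leey.
apply: ae_eq_integral => //.
have := integrable_ae measurableT ig.
by apply: (@filterS _ _ (ae_filter_ringOfSetsType nu)) => x h _; rewrite fineK// h.
Qed.

Lemma Rfubini1 : m1.-integrable setT (EFin \o (fun x => \int[m2]_y f (x, y))) /\
  \int[m1]_x \int[m2]_y f (x, y) = \int[(m1 \x m2)%E]_z f z.
Proof.
have [h1 h2] := fine_integrable (integrable_fubini_F imf).
by split => //; rewrite /Rintegral; congr fine; rewrite -(integral12_prod_meas1 imf).
Qed.

Lemma Rfubini2 : m2.-integrable setT (EFin \o (fun y => \int[m1]_x f (x, y))) /\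
  \int[m2]_y \int[m1]_x f (x, y) = \int[(m1 \x m2)%E]_z f z.
Proof.
have mf := measurable_int _ imf; have /integrableP[_ foo] := imf.
have mabs : measurable_fun setT (fun z => `|(EFin \o f) z|)%E.
  by apply: measurableT_comp.
have iG : m2.-integrable setT (fubini_G m1 (EFin \o f)).
  apply/integrableP; split; first exact: measurable_fubini_G imf.
  apply: le_lt_trans foo; rewrite (@fubini_tonelli2 _ _ _ _ _ m1 m2 _ mabs)//.
  apply: ge0_le_integral => //.
  - by apply: measurableT_comp => //; exact: measurable_fubini_G imf.
  - exact: measurable_fun_fubini_tonelli_G.
  - move=> y _; apply: le_abse_integral => //.
    by apply: measurableT_comp mf _; exact: measurable_pair2.
have [h1 h2] := fine_integrable iG.
by split => //; rewrite /Rintegral; congr fine; rewrite -(integral21_prod_meas1 imf).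
Qed.

End RealFubini.

Lemma integrable_boundedM {d} {T : measurableType d} {R : realType}
  (nu : {measure set T -> \bar R}) (f h : T -> R) (M : R) :
  measurable_fun setT h -> (forall x, `|h x| <= M) ->
  nu.-integrable setT (EFin \o f) -> nu.-integrable setT (EFin \o (fun x => f x * h x)).
Proof.
move=> mh hM if_; have mf := proj1 (measurable_EFinP _ _) (measurable_int nu if_).
apply: (@le_integrable _ _ _ _ _ _ _ (fun x => `|M|%:E * (f x)%:E)%E) => //.
- by apply/measurable_EFinP; exact: measurable_funM.
- move=> x _; rewrite -EFinM !abse_EFin lee_fin !normrM normr_id mulrC ler_wpM2r//.
  exact: le_trans (hM x) (ler_norm _).
- exact: integrableZl.
Qed.

Lemma eq_ae_Rintegral {d} {T : measurableType d} {R : realType}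
  (nu : {measure set T -> \bar R}) (f g : T -> R) :
  measurable_fun setT f -> measurable_fun setT g -> {ae nu, forall x, f x = g x} ->
  \int[nu]_x f x = \int[nu]_x g x.
Proof.
move=> mf mg fg; rewrite /Rintegral; congr fine; apply: ae_eq_integral => //;
  try exact/measurable_EFinP.
by apply: (@filterS _ _ (ae_filter_ringOfSetsType nu) _ _ _ fg) => x + _ => /= ->.
Qed.

Section Triangle.
Context {R : realType}.
Local Notation mu := (@lebesgue_measure R).
Variables f g : measurableTypeR R -> R.
Hypothesis intf : mu.-integrable setT (EFin \o f).
Hypothesis intg : mu.-integrable setT (EFin \o g).

Let mf : measurable_fun setT f.
Proof. by move: (measurable_int mu intf) => /measurable_EFinP. Qed.

Let mg : measurable_fun setT g.
Proof. by move: (measurable_int mu intg) => /measurable_EFinP. Qed.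

Let h (p : measurableTypeR R * measurableTypeR R) : R := f p.1 * g p.2.

Let mh : measurable_fun setT h.
Proof.
by apply: measurable_funM; [exact: measurableT_comp measurable_fst|exact: measurableT_comp measurable_snd].
Qed.

Let ih : (mu \x mu)%E.-integrable setT (EFin \o h).
Proof.
apply/integrable12ltyP; first exact/measurable_EFinP.
have fE x : (\int[mu]_y `|(EFin \o h) (x, y)| = `|f x|%:E * \int[mu]_y `|(g y)%:E|)%E.
  rewrite -ge0_integralZl//; last first.
    by apply: measurableT_comp => //; exact/measurable_EFinP.
  by apply: eq_integral => y _; rewrite /h /= normrM EFinM.
under eq_integral do rewrite fE.
have /integrableP[_ goo] := intg; have /integrableP[_ foo] := intf.
have gfin : (\int[mu]_y `|(g y)%:E|)%E \is a fin_num.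
  by rewrite ge0_fin_numE//; apply: integral_ge0.
rewrite -(fineK gfin); under eq_integral do rewrite muleC.
rewrite ge0_integralZl_EFin//; last 2 first.
- by apply: measurableT_comp => //; apply: measurableT_comp.
- by rewrite fine_ge0//; apply: integral_ge0.
by rewrite lte_mul_pinfty// ?lee_fin ?fine_ge0//; apply: integral_ge0.
Qed.

Let ind (p : measurableTypeR R * measurableTypeR R) : R := (p.2 <= p.1)%R%:R.

Let mind : measurable_fun setT ind.
Proof.
have -> : ind = \1_[set q : R * R | q.2 <= q.1].
  by apply/funext => q; rewrite indicE mem_setE.
apply: measurable_indic.
have -> : [set q : R * R | q.2 <= q.1] = (fun q : measurableTypeR R * measurableTypeR R => q.1 - q.2) @^-1` `[0, +oo[%classic.
  by apply/seteqP; split => q /=; rewrite in_itv/= andbT subr_ge0.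
rewrite -[X in measurable X]setTI.
have md : measurable_fun setT (fun q : measurableTypeR R * measurableTypeR R => q.1 - q.2).
  by apply: measurable_funB.
by apply: md => //; exact: measurable_itv.
Qed.

Let norm_bool (c : bool) : `|c%:R : R| <= 1 /\ `|1 - c%:R : R| <= 1.
Proof. by case: c; rewrite ?subrr ?subr0 normr1 normr0. Qed.

Let ind_le p : `|ind p| <= 1.
Proof. exact: (norm_bool _).1. Qed.

(** Integration by parts for two primitives, obtained from Fubini on the triangles [r <= s] and
    [s < r] of the square; merely integrable densities are enough. *)
Lemma integral_triangle :
  (\int[mu]_s f s) * (\int[mu]_s g s) =
  \int[mu]_s (f s * \int[mu]_r (g r * \1_(`]-oo, s]%classic) r)) +
  \int[mu]_s (g s * \int[mu]_r (f r * \1_(`]-oo, s]%classic) r)).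
Proof.
have mI (s : R) : measurable_fun setT (\1_(`]-oo, s]%classic) : measurableTypeR R -> R).
  exact: measurable_indic.
have I1 (s r : R) : `|\1_(`]-oo, s]%classic) r : R| <= 1.
  by rewrite indicE; case: (_ \in _); rewrite ?normr1 ?normr0.
have i1 := integrable_boundedM mind ind_le ih.
have mind' : measurable_fun setT (fun p => 1 - ind p) by exact: measurable_funB.
have ind_le' p : `|1 - ind p| <= 1 by exact: (norm_bool _).2.
have i2 := integrable_boundedM mind' ind_le' ih.
have -> : (\int[mu]_s f s) * (\int[mu]_s g s) = \int[(mu \x mu)%E]_p h p.
  rewrite -(proj2 (Rfubini1 ih)) mulrC -RintegralZl//.
  by apply: eq_Rintegral => s _; rewrite mulrC -RintegralZl.
have -> : \int[(mu \x mu)%E]_p h p = \int[(mu \x mu)%E]_p (h p * ind p) + \int[(mu \x mu)%E]_p (h p * (1 - ind p)).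
  by rewrite -RintegralD//; apply: eq_Rintegral => p _; ring.
congr (_ + _).
  rewrite -(proj2 (Rfubini1 i1)); apply: eq_Rintegral => s _.
  rewrite -RintegralZl//; last exact: integrable_boundedM (mI s) (I1 s) intg.
  by apply: eq_Rintegral => r _; rewrite /h /ind /= -mulrA indicE mem_setE in_itv.
rewrite -(proj2 (Rfubini2 i2)); apply: eq_Rintegral => r _.
rewrite -RintegralZl//; last exact: integrable_boundedM (mI r) (I1 r) intf.
(* The second triangle is strict whereas the indicator in the claim is not; on each section they
   differ at one point. *)
apply: eq_ae_Rintegral.
- have mp : measurable_fun setT (fun x : measurableTypeR R => (x, r)).
    by apply: measurable_fun_pair.
  exact: (measurableT_comp (measurable_funM mh mind') mp).
- by apply: measurable_funM => //; apply: measurable_funM.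
- exists [set r]; split => //; first exact: lebesgue_measure_set1.
  move=> s /= hs; apply/eqP; apply: contra_notT hs => sr.
  rewrite /h /ind /= indicE mem_setE in_itv/=.
  by case: (ltgtP s r) sr => // sr _; rewrite /=; ring.
Qed.

End Triangle.

Section MomentIdentity.
Context {R : realType} {d : measure_display} {Om : measurableType d} {J : finType}.
Variables (P : probability Om R) (T : R) (W : J -> R -> Om -> R).
Hypothesis T_gt0 : 0 < T.
Hypothesis P_complete : measure_is_complete P.
Hypothesis W_bm : independent_brownians P T W.
Local Notation mu := (@lebesgue_measure R).
Local Notation TS := (timespace P).
Local Notation L2p := (L2p P T W).
Implicit Types (X Y b : R -> Om -> R) (t : R).

Let integrable_win X Y t : sq TS (win t X) -> sq TS (win t Y) ->
  (mu \x P)%E.-integrable setT (EFin \o (fun z : measurableTypeR R * Om => win t X z * win t Y z)).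
Proof. exact: integrable_mulsq. Qed.

Lemma ip_win_time X Y t : sq TS (win t X) -> sq TS (win t Y) ->
  ip TS (win t X) (win t Y) = \int[mu]_s \int[P]_w (win t X (s, w) * win t Y (s, w)).
Proof. by move=> sX sY; rewrite (proj2 (Rfubini1 (integrable_win sX sY))). Qed.

Lemma ip_win_omega X Y t : sq TS (win t X) -> sq TS (win t Y) ->
  ip TS (win t X) (win t Y) = \int[P]_w \int[mu]_s (win t X (s, w) * win t Y (s, w)).
Proof. by move=> sX sY; rewrite (proj2 (Rfubini2 (integrable_win sX sY))). Qed.

(** Square integrability over time and path is inherited by almost every time slice only, which is
    why the identities below are compared under the time integral. *)
Lemma sq_section_ae X t : sq TS (win t X) ->
  {ae mu, forall s : measurableTypeR R, sq P (fun w => win t X (s, w))}.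
Proof.
move=> [mX foo]; have m2 := measurable_sqr mX.
have n0 z : (0 <= (win t X z ^+ 2)%:E)%E by rewrite lee_fin sqr_ge0.
rewrite (@fubini_tonelli1 _ _ _ _ _ (@lebesgue_measure R) P _ m2 n0) in foo.
have mF := @measurable_fun_fubini_tonelli_F _ _ (measurableTypeR R) Om R P _ m2 n0.
have iF : mu.-integrable setT (fubini_F P (fun z => (win t X z ^+ 2)%:E)).
  apply/integrableP; split => //; apply: le_lt_trans foo.
  apply: ge0_le_integral => //.
  - by apply: measurableT_comp.
  - by move=> s _; rewrite gee0_abs//; apply: integral_ge0 => w _.
have := integrable_ae measurableT iF.
apply: (@filterS _ _ (ae_filter_ringOfSetsType mu)) => s /(_ Logic.I).
rewrite fin_numElt => /andP[_ h]; split => //.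
have mp : measurable_fun setT (fun w : Om => (s : measurableTypeR R, w)).
  by apply: measurable_fun_pair.
exact: measurableT_comp mX mp.
Qed.

Lemma win_cstE t (xi : Om -> R) : win t (fun _ => xi) = fun z => xi z.2 * \1_(`[0, t]%classic) z.1.
Proof. by []. Qed.

Lemma sq_win_cst t (xi : Om -> R) : sq P xi -> sq TS (win t (fun _ => xi)).
Proof.
move=> sxi; rewrite win_cstE; apply: sq_rect => //.
by rewrite lebesgue_measure_itv/=; case: ifP; rewrite -?EFinD ltry.
Qed.

Lemma ip_prim b t (xi : Om -> R) : L2p b -> 0 <= t <= T -> sq P xi ->
  ip P (prim b t) xi = ip TS (win t b) (win t (fun _ => xi)).
Proof.
move=> lb tT sxi; have [_ t_T] := andP tT.
have sb := L2p_win lb t_T; have sx := sq_win_cst t sxi.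
rewrite ip_win_omega//.
have [sp _] := prim_sq T_gt0 P_complete W_bm lb tT.
have ibx := integrable_win sb sx.
apply: eq_ae_Rintegral.
- by apply: measurable_funM; [case: sp|case: sxi].
- by move: (measurable_int _ (proj1 (Rfubini2 ibx))) => /measurable_EFinP.
apply: filterS (good_ae lb) => w gw.
rewrite (primE b w t_T) /ip mulrC -RintegralZl//; last first.
  exact: (integrable_mulsq (good_sq T_gt0 P_complete W_bm (proj1 lb) gw) (sq_indic t)).
apply: eq_Rintegral => s _; rewrite win_cstE /= /win /=.
have -> : b s w * \1_(`[0, t]%classic) s = b s w * \1_(`[0, T]%classic) s * \1_(`[0, t]%classic) s.
  rewrite !indicE !mem_setE !in_itv/=; case: (boolP (0 <= s <= t)) => [/andP[s0 st]|_]; last by rewrite !mulr0.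
  by rewrite s0 (le_trans st t_T) !mulr1.
have := @indic_sqr R _ `[0, t]%classic s; set i := \1_`[0, t]%classic s => ii.
rewrite -[in LHS]ii; ring.
Qed.

(** A version of the primitive all of whose paths are continuous, hence progressive, so that it may
    itself appear in norms over a window. *)
Lemma gprim_exists b : L2p b -> exists2 p, L2p p &
  {ae P, forall w, forall t, 0 <= t <= T -> p t w = prim b t w}.
Proof.
move=> lb; pose g := [set w | good T b w].
have g_ae : {ae P, forall w, \1_g w = 1 :> R}.
  by apply: filterS (good_ae lb) => w gw; rewrite indicE mem_set.
pose p t w := \1_g w * prim b t w.
have pp : {ae P, forall w, forall t, 0 <= t <= T -> p t w = prim b t w}.
  by apply: filterS g_ae => w h t _; rewrite /p h mul1r.
exists p => //.
have Fg t : Ft_measurable P W t (\1_g).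
  apply: (@Ft_measurable_ae _ _ _ _ P W t (fun=> 1)); last exact: measurable_cst.
  by apply: filterS g_ae => w ->.
have pr : progressive P T W p.
  apply: continuous_progressive => [t tT|w].
    by apply: measurable_funM; [exact: Fg|exact: (prim_Ft (proj1 lb) tT)].
  rewrite /p indicE; case: (boolP (w \in g)) => [/set_mem gw|_] t.
    apply: cvgM; first exact: cvg_cst.
    exact: (prim_continuous T_gt0 P_complete W_bm (proj1 lb) gw).
  rewrite (_ : (fun t => _) = fun=> 0); first exact: cvg_cst.
  by apply/funext => s; rewrite mul0r.
apply: (L2p_of_bound T_gt0 P_complete W_bm (K := T * wnorm P T b)) => // t tT.
have [_ t_T] := andP tT; have [sp hp] := prim_sq T_gt0 P_complete W_bm lb tT.
have mp : measurable_fun setT (p t).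
  exact: (Ft_measurable_measurable P_complete W_bm t_T (progressive_Ft pr tT)).
rewrite (_ : (\int[P]_w _ = \int[P]_w (prim b t w ^+ 2)%:E)%E); last first.
  apply: ae_eq_integral => //; try by apply: measurable_sqr => //; case: sp.
  by apply: filterS pp => w h _ /=; rewrite h.
apply: le_trans hp _; rewrite (ipE (L2p_win lb t_T)) -EFinM lee_fin ler_pM2l//.
by apply: wnorm_mono => //; case: lb.
Qed.

Lemma prim_prod b b' p p' w t : L2p b -> L2p b' -> 0 <= t <= T -> good T b w -> good T b' w ->
  (forall s, 0 <= s <= T -> p s w = prim b s w) ->
  (forall s, 0 <= s <= T -> p' s w = prim b' s w) ->
  prim b t w * prim b' t w = \int[mu]_s (win t b (s, w) * win t p' (s, w)) +
    \int[mu]_s (win t b' (s, w) * win t p (s, w)).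
Proof.
move=> lb lb' tT gb gb' hp hp'; have [t0 t_T] := andP tT.
have iw c : L2p c -> good T c w -> mu.-integrable setT (EFin \o (fun s => win t c (s, w))).
  move=> lc gc; have := integrable_mulsq (good_sq T_gt0 P_complete W_bm (proj1 lc) gc) (sq_indic t).
  apply: eq_integrable => // s _; rewrite /= /win /= !indicE !mem_setE !in_itv/=.
  case: (boolP (0 <= s <= t)) => [/andP[s0 st]|_]; last by rewrite !mulr0.
  by rewrite s0 (le_trans st t_T) !mulr1.
have primW c s : 0 <= s <= t -> \int[mu]_r (win t c (r, w) * \1_(`]-oo, s]%classic) r) = prim c s w.
  move=> /andP[s0 st]; rewrite /prim [RHS]Rintegral_mkcond; apply: eq_Rintegral => r _.
  rewrite /win /= patchE !indicE !mem_setE !in_itv/=.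
  case: (leP 0 r) => r0 /=; last by rewrite !mulr0 mul0r.
  case: (leP r s) => rs; last by rewrite mulr0.
  by rewrite (le_trans rs st) !mulr1.
have primT c : \int[mu]_r win t c (r, w) = prim c t w.
  rewrite /prim [RHS]Rintegral_mkcond; apply: eq_Rintegral => r _.
  rewrite /win /= patchE !indicE !mem_setE.
  by case: (_ \in _); rewrite ?mulr1 ?mulr0.
rewrite -!primT (integral_triangle (iw _ lb gb) (iw _ lb' gb')).
have step c c' q : (forall s, 0 <= s <= T -> q s w = prim c' s w) ->
  \int[mu]_s (win t c (s, w) * \int[mu]_r (win t c' (r, w) * \1_(`]-oo, s]%classic) r)) =
  \int[mu]_s (win t c (s, w) * win t q (s, w)).
  move=> hq; apply: eq_Rintegral => s _; have [st|st] := boolP (0 <= s <= t).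
    rewrite primW// [win t q _]winE// hq//.
    by case/andP: st => -> /le_trans; apply.
  by rewrite [win t c _]win0E// !mul0r.
by rewrite (step b b' p' hp') (step b' b p hp).
Qed.

Lemma ip_prim_prim b b' p p' t : L2p b -> L2p b' -> L2p p -> L2p p' -> 0 <= t <= T ->
  {ae P, forall w, forall t, 0 <= t <= T -> p t w = prim b t w} ->
  {ae P, forall w, forall t, 0 <= t <= T -> p' t w = prim b' t w} ->
  ip P (prim b t) (prim b' t) = ip TS (win t b) (win t p') + ip TS (win t p) (win t b').
Proof.
move=> lb lb' lp lp' tT hp hp'; have [_ t_T] := andP tT.
have s1 := L2p_win lb t_T; have s2 := L2p_win lb' t_T.
have s3 := L2p_win lp t_T; have s4 := L2p_win lp' t_T.
have [i1 _] := Rfubini2 (integrable_win s1 s4).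
have [i2 _] := Rfubini2 (integrable_win s2 s3).
rewrite (ipC TS (win t p)) (ip_win_omega s1 s4) (ip_win_omega s2 s3) -(RintegralD measurableT i1 i2).
have [sp _] := prim_sq T_gt0 P_complete W_bm lb tT.
have [sp' _] := prim_sq T_gt0 P_complete W_bm lb' tT.
apply: eq_ae_Rintegral.
- by apply: measurable_funM; [case: sp|case: sp'].
- apply: measurable_funD; [move: (measurable_int _ i1)|move: (measurable_int _ i2)];
    by move=> /measurable_EFinP.
have gg := @filterI _ _ (ae_filter_ringOfSetsType P) _ _ (good_ae lb) (good_ae lb').
have hh := @filterI _ _ (ae_filter_ringOfSetsType P) _ _ hp hp'.
apply: filterS2 gg hh => w [gb gb'] [h h'].
exact: (prim_prod lb lb' tT gb gb' h h').
Qed.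

(** Under the time integral the martingale property replaces [Y t] by [Y s], because [b s] is
    F_s-measurable. [y] is a jointly measurable version of [Y], for which the right-hand side makes
    sense. *)
Lemma ip_prim_martingale k b h Y y t : L2p b -> L2p y -> gito P T W k h Y ->
  (forall s, 0 <= s <= T -> {ae P, forall w, y s w = Y s w}) -> 0 <= t <= T ->
  ip P (prim b t) (Y t) = ip TS (win t b) (win t y).
Proof.
move=> lb ly gY yY tT; have [t0 t_T] := andP tT.
have sY := gito_sq P_complete W_bm gY tT.
rewrite (ip_prim lb tT sY).
have s1 := L2p_win lb t_T; have s2 := sq_win_cst t sY; have s3 := L2p_win ly t_T.
rewrite (ip_win_time s1 s2) (ip_win_time s1 s3).
apply: eq_ae_Rintegral.
- by move: (measurable_int _ (proj1 (Rfubini1 (integrable_win s1 s2)))) => /measurable_EFinP.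
- by move: (measurable_int _ (proj1 (Rfubini1 (integrable_win s1 s3)))) => /measurable_EFinP.
apply: (@filterS _ _ (ae_filter_ringOfSetsType mu) _ _ _ (sq_section_ae s1)) => s sbs.
have [st|st] := boolP (0 <= s <= t); last first.
  by congr Rintegral; apply/funext => w; rewrite win0E// !mul0r.
have [s0 s_t] := andP st; have sT : 0 <= s <= T by rewrite s0 (le_trans s_t).
have sb : sq P (b s) by apply: eq_sq sbs => w; rewrite winE.
have sYs := gito_sq P_complete W_bm gY sT.
have mys : measurable_fun setT (y s).
  by apply: (Ft_measurable_measurable P_complete W_bm _ (progressive_Ft (proj1 ly) sT)); case/andP: sT.
transitivity (ip P (b s) (Y t)).
  by apply: eq_Rintegral => w _; rewrite !winE.
rewrite (gito_martingale P_complete W_bm gY s0 s_t t_T (progressive_Ft (proj1 lb) sT) sb).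
transitivity (ip P (b s) (y s)).
  by rewrite ipC (ipC _ _ (y s)) (ip_ae mys (proj1 sYs) (proj1 sb) (yY s sT)).
by apply: eq_Rintegral => w _; rewrite !winE.
Qed.

Variable k0 : J.

(** Ito's product rule in expectation. Each process is split into a primitive and a martingale: the
    product of the primitives is integrated by parts, the mixed products use the martingale
    property, and the product of the martingales uses the isometry. As only the motion [k0] acts, no
    covariance of integrals against different motions occurs. *)
Lemma sproc_ip b h x b' h' x' t :
  sproc P T W 0 b h x -> sproc P T W 0 b' h' x' -> L2p x -> L2p x' ->
  (forall k, k != k0 -> forall t w, h k t w = 0) ->
  (forall k, k != k0 -> forall t w, h' k t w = 0) -> 0 <= t <= T ->
  ip P (x t) (x' t) = ip TS (win t b) (win t x') + ip TS (win t x) (win t b') +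
    ip TS (win t (h k0)) (win t (h' k0)).
Proof.
move=> px px' lx lx' h0 h0' tT; have [_ t_T] := andP tT.
have single b1 h1 x1 : sproc P T W 0 b1 h1 x1 -> (forall k, k != k0 -> forall t w, h1 k t w = 0) ->
    L2p b1 /\ exists2 Y, gito P T W k0 (h1 k0) Y &
    forall s, 0 <= s <= T -> {ae P, forall w, x1 s w = prim b1 s w + Y s w}.
  move=> [lb [Y gY XY]] hk; split => //; exists (Y k0) => // s sT.
  have Y0 k : {ae P, forall w, k != k0 -> Y k s w = 0}.
    have [->|kk0] := eqVneq k k0; first by apply: nearW => w.
    have := gito_isometry P_complete W_bm (gY k) (gY k) sT.
    rewrite [RHS]ip0l; last by move=> z; rewrite /win (hk k kk0) mul0r.
    move=> /(ip_eq0_ae (gito_sq P_complete W_bm (gY k) sT)).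
    by apply: filterS => w.
  apply: filterS2 (ae_foralln_fin Y0) (XY s sT) => w hY ->.
  by rewrite (bigD1 k0)//= big1 ?addr0 ?add0r// => k /hY.
have [lb [Y gY xY]] := single _ _ _ px h0.
have [lb' [Y' gY' xY']] := single _ _ _ px' h0'.
have [p lp hp] := gprim_exists lb; have [p' lp' hp'] := gprim_exists lb'.
pose y s w := x s w - p s w; pose y' s w := x' s w - p' s w.
have ly : L2p y by exact: L2pB.
have ly' : L2p y' by exact: L2pB.
have yY s : 0 <= s <= T -> {ae P, forall w, y s w = Y s w}.
  move=> sT; apply: filterS2 (xY s sT) hp => w hx hpw; rewrite /y hx hpw//; ring.
have yY' s : 0 <= s <= T -> {ae P, forall w, y' s w = Y' s w}.
  move=> sT; apply: filterS2 (xY' s sT) hp' => w hx hpw; rewrite /y' hx hpw//; ring.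
have [sp _] := prim_sq T_gt0 P_complete W_bm lb tT.
have [sp' _] := prim_sq T_gt0 P_complete W_bm lb' tT.
have sY := gito_sq P_complete W_bm gY tT; have sY' := gito_sq P_complete W_bm gY' tT.
have sx := sproc_sq T_gt0 P_complete W_bm px tT.
have sx' := sproc_sq T_gt0 P_complete W_bm px' tT.
rewrite (ip_ae (proj1 sx) (proj1 (sqD sp sY)) (proj1 sx') (xY t tT)) ipC.
rewrite (ip_ae (proj1 sx') (proj1 (sqD sp' sY')) (proj1 (sqD sp sY)) (xY' t tT)) ipC.
rewrite (ipDl sp sY (sqD sp' sY')) !ipDr//.
rewrite (ip_prim_prim lb lb' lp lp' tT hp hp').
rewrite (ip_prim_martingale lb ly' gY' yY' tT) (ipC _ (Y t)).
rewrite (ip_prim_martingale lb' ly gY yY tT).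
rewrite (gito_isometry P_complete W_bm gY gY' tT).
have w1 := L2p_win lb t_T; have w2 := L2p_win lb' t_T.
have w3 := L2p_win lp t_T; have w4 := L2p_win lp' t_T.
have w5 := L2p_win lx t_T; have w6 := L2p_win lx' t_T.
have -> : ip TS (win t b) (win t y') = ip TS (win t b) (win t x') - ip TS (win t b) (win t p').
  by rewrite /y' winB; exact: (ipBr w6 w4 w1).
have -> : ip TS (win t b') (win t y) = ip TS (win t b') (win t x) - ip TS (win t b') (win t p).
  by rewrite /y winB; exact: (ipBr w5 w3 w2).
rewrite !(ipC TS (win t b')); ring.
Qed.

End MomentIdentity.

Lemma integrableRD {d} {T : measurableType d} {R : realType}
  (nu : {measure set T -> \bar R}) (f g : T -> R) :
  nu.-integrable setT (EFin \o f) -> nu.-integrable setT (EFin \o g) ->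
  nu.-integrable setT (EFin \o (fun x => f x + g x)).
Proof. by move=> if_ ig; exact: (integrableD measurableT if_ ig). Qed.

Lemma integrableRZ {d} {T : measurableType d} {R : realType}
  (nu : {measure set T -> \bar R}) (c : R) (f : T -> R) :
  nu.-integrable setT (EFin \o f) -> nu.-integrable setT (EFin \o (fun x => c * f x)).
Proof. by move=> if_; exact: (integrableZl measurableT c if_). Qed.

Section WeightedMoment.
Context {R : realType} {d : measure_display} {Om : measurableType d} {J : finType}.
Variables (P : probability Om R) (T : R) (W : J -> R -> Om -> R).
Hypothesis T_gt0 : 0 < T.
Hypothesis P_complete : measure_is_complete P.
Hypothesis W_bm : independent_brownians P T W.
Local Notation mu := (@lebesgue_measure R).
Local Notation TS := (timespace P).
Local Notation L2p := (L2p P T W).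
Implicit Types (X Y b : R -> Om -> R) (t : R).

Lemma win_smul (c : R -> R) X t : win t (fun s w => c s * X s w) = fun z => c z.1 * win t X z.
Proof. by apply/funext => z; rewrite /win mulrA. Qed.

Variables (kk kap : R -> R) (M : R).
Hypothesis mkk : measurable_fun setT (kk : measurableTypeR R -> R).
Hypothesis mkap : measurable_fun setT (kap : measurableTypeR R -> R).
Hypothesis kkM : forall t, `|kk t| <= M.
Hypothesis kapM : forall t, `|kap t| <= M.
Hypothesis kkE : forall t, 0 <= t <= T -> kk t = kk 0 + \int[mu]_(s in `[0, t]) kap s.

(** By [sproc_ip] the moment [ip P (x t) (x' t)] is the primitive of a density [psi], and the weight
    is a primitive up to its value at 0. The claim is integration by parts for these two functions
    of time, after which [psi] is unfolded again. *)
Lemma weighted_moment (k0 : J) b h x b' h' x' :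
  sproc P T W 0 b h x -> sproc P T W 0 b' h' x' -> L2p x -> L2p x' ->
  (forall k, k != k0 -> forall t w, h k t w = 0) ->
  (forall k, k != k0 -> forall t w, h' k t w = 0) ->
  kk T * ip P (x T) (x' T) =
    ip TS (win T (fun t w => kap t * x t w)) (win T x') +
    (ip TS (win T (fun t w => kk t * b t w)) (win T x') +
     ip TS (win T (fun t w => kk t * x t w)) (win T b') +
     ip TS (win T (fun t w => kk t * h k0 t w)) (win T (h' k0))).
Proof.
move=> px px' lx lx' h0 h0'.
have T0 : 0 <= T <= T by rewrite lexx ltW.
have lb : L2p b by case: px.
have lb' : L2p b' by case: px'.
have sh : sq TS (win T (h k0)).
  by case: px => _ [Y gY _]; exact: (gito_win_sq P_complete W_bm (gY k0) (lexx T)).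
have sh' : sq TS (win T (h' k0)).
  by case: px' => _ [Y gY _]; exact: (gito_win_sq P_complete W_bm (gY k0) (lexx T)).
have [_ sb] := lb; have [_ sb'] := lb'; have [_ sx] := lx; have [_ sx'] := lx'.
have i1 := integrable_mulsq sb sx'; have i2 := integrable_mulsq sx sb'.
have i3 := integrable_mulsq sh sh'.
pose Psi (z : measurableTypeR R * Om) := win T b z * win T x' z + win T x z * win T b' z +
  win T (h k0) z * win T (h' k0) z.
have i12 : TS.-integrable setT (EFin \o (fun z : measurableTypeR R * Om => win T b z * win T x' z + win T x z * win T b' z)).
  exact: integrableRD.
have iPsi : TS.-integrable setT (EFin \o Psi) by exact: integrableRD.
have PsiD (c : measurableTypeR R -> R) : measurable_fun setT c -> (forall s, `|c s| <= M + 1) ->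
    \int[TS]_z (Psi z * c z.1) =
    \int[TS]_z (win T b z * win T x' z * c z.1) + \int[TS]_z (win T x z * win T b' z * c z.1) +
    \int[TS]_z (win T (h k0) z * win T (h' k0) z * c z.1).
  move=> mc cM.
  have mc1 : measurable_fun setT (fun z : (measurableTypeR R * Om)%type => c z.1).
    by apply: measurableT_comp mc _; exact: measurable_fst.
  have j1 := integrable_boundedM mc1 (fun z => cM z.1) i1.
  have j2 := integrable_boundedM mc1 (fun z => cM z.1) i2.
  have j3 := integrable_boundedM mc1 (fun z => cM z.1) i3.
  rewrite -(RintegralD measurableT j1 j2) -RintegralD//; last exact: integrableRD.
  by apply: eq_Rintegral => z _; rewrite /Psi !mulrDl.
pose psi (s : measurableTypeR R) := \int[P]_w Psi (s, w).
have [ipsi PsiE] := Rfubini1 iPsi.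
have Psi0 s w : ~~ (0 <= s <= T) -> Psi (s, w) = 0.
  by move=> sT; rewrite /Psi !(win0E _ _ sT) !mul0r !addr0.
have psi0 s : ~~ (0 <= s <= T) -> psi s = 0.
  move=> sT; rewrite /psi; under eq_Rintegral do rewrite Psi0//.
  by rewrite /Rintegral integral0.
(* [M + 1] bounds the weight and the indicators alike, so the same expansion serves for both. *)
have M1 : 1 <= M + 1 by rewrite lerDr; exact: le_trans (normr_ge0 _) (kkM 0).
have psiM (c : measurableTypeR R -> R) : measurable_fun setT c -> (forall s, `|c s| <= M + 1) ->
    \int[mu]_s (psi s * c s) = \int[TS]_z (Psi z * c z.1).
  move=> mc cM.
  have mc1 : measurable_fun setT (fun z : (measurableTypeR R * Om)%type => c z.1).
    by apply: measurableT_comp mc _; exact: measurable_fst.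
  have ic := integrable_boundedM mc1 (fun z => cM z.1) iPsi.
  have [j1 j2] := Rfubini1 ic; rewrite -j2; apply: eq_ae_Rintegral.
  - apply: measurable_funM => //.
    by move: (measurable_int _ ipsi) => /measurable_EFinP.
  - by move: (measurable_int _ j1) => /measurable_EFinP.
  apply: (@filterS _ _ (ae_filter_ringOfSetsType mu) _ _ _ (ae_integrable1 iPsi)) => s is_ /=.
  rewrite mulrC -RintegralZl//; apply: eq_Rintegral => w _; exact: mulrC.
have mle (t : R) : measurable_fun setT ((\1_(`]-oo, t]%classic) : R -> R) : measurableTypeR R -> R).
  exact: measurable_indic.
have le1 (t s : R) : `|\1_(`]-oo, t]%classic) s : R| <= M + 1.
  by apply: le_trans M1; rewrite indicE; case: (_ \in _); rewrite ?normr1 ?normr0.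
have phiE t : 0 <= t <= T -> \int[mu]_s (psi s * \1_(`]-oo, t]%classic) s) = ip P (x t) (x' t).
  move=> tT; have [t0 t_T] := andP tT; rewrite psiM// PsiD//.
  rewrite (sproc_ip T_gt0 P_complete W_bm px px' lx lx' h0 h0' tT).
  have winM X Y : \int[TS]_z (win T X z * win T Y z * \1_(`]-oo, t]%classic) z.1) =
      ip TS (win t X) (win t Y).
    apply: eq_Rintegral => -[s w] _; rewrite /win /= !indicE !mem_setE !in_itv/=.
    case: (leP 0 s) => s0 /=; last by rewrite !mulr0 !mul0r.
    by case: (leP s t) => st; rewrite ?(le_trans st t_T) ?mulr1 ?mulr0.
  by rewrite !winM.
pose g (s : measurableTypeR R) : R := kap s * \1_(`[0, T]%classic) s.
have ig : mu.-integrable setT (EFin \o g).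
  have -> : EFin \o g = (EFin \o kap) \_ `[0, T].
    apply/funext => s; rewrite patchE /g /= indicE.
    by case: (_ \in _); rewrite ?mulr1 ?mulr0.
  apply/(@integrable_mkcond _ (measurableTypeR R) R mu `[0, T]%classic _ (measurable_itv _)).
  apply: measurable_bounded_integrable; first exact: measurable_itv.
  - by rewrite /= lebesgue_measure_itv/=; case: ifP; rewrite -?EFinD ltry.
  - exact: measurable_funTS.
  - by exists M; split; [exact: num_real|move=> y My s _ /=; exact: le_trans (kapM s) (ltW My)].
have gE t : 0 <= t <= T -> \int[mu]_s (g s * \1_(`]-oo, t]%classic) s) = kk t - kk 0.
  move=> tT; have [t0 t_T] := andP tT.
  rewrite (kkE tT) addrAC subrr add0r [RHS]Rintegral_mkcond; apply: eq_Rintegral => s _.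
  rewrite /g patchE !indicE !mem_setE !in_itv/=.
  case: (leP 0 s) => s0 /=; last by rewrite !mulr0 mul0r.
  by case: (leP s t) => st; rewrite ?(le_trans st t_T) ?mulr1 ?mulr0.
have psiT : \int[mu]_s psi s = ip P (x T) (x' T).
  rewrite -(phiE T T0); apply: eq_Rintegral => s _; rewrite indicE mem_setE in_itv/=.
  have [sT|sT] := leP s T; first by rewrite mulr1.
  by rewrite mulr0 psi0// negb_and -!ltNge sT orbT.
have gT : \int[mu]_s g s = kk T - kk 0.
  rewrite -(gE T T0); apply: eq_Rintegral => s _; rewrite /g !indicE !mem_setE !in_itv/=.
  by case: (leP s T) => sT; rewrite ?mulr1// andbF !mulr0.
have := integral_triangle ipsi ig; rewrite psiT gT.
have kk1 s : `|kk s| <= M + 1 by apply: le_trans (kkM s) _; rewrite lerDl.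
have -> : \int[mu]_s (psi s * \int[mu]_r (g r * \1_(`]-oo, s]%classic) r)) =
    \int[mu]_s (psi s * kk s) - kk 0 * ip P (x T) (x' T).
  rewrite -psiT -RintegralZl// -RintegralB//; last 2 first.
  - exact: integrable_boundedM mkk kk1 ipsi.
  - exact: integrableRZ.
  apply: eq_Rintegral => s _; have [sT|sT] := boolP (0 <= s <= T); last first.
    by rewrite psi0// !mul0r mulr0 subr0.
  by rewrite gE// mulrBr [kk 0 * _]mulrC.
have -> : \int[mu]_s (g s * \int[mu]_r (psi r * \1_(`]-oo, s]%classic) r)) =
    ip TS (win T (fun t w => kap t * x t w)) (win T x').
  have skx : sq TS (win T (fun t w => kap t * x t w)).
    have mc1 : measurable_fun setT (fun z : (measurableTypeR R * Om)%type => kap z.1).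
      by apply: measurableT_comp mkap _; exact: measurable_fst.
    rewrite win_smul.
    exact: (@sq_bdM _ _ _ TS (win T x) (fun z => kap z.1) M mc1 (fun z => kapM z.1) sx).
  rewrite (ip_win_time skx sx'); apply: eq_Rintegral => s _.
  have [sT|sT] := boolP (0 <= s <= T); last first.
    rewrite /g indicE mem_setE in_itv/= (negPf sT) mulr0 mul0r.
    under eq_Rintegral do rewrite win0E// mul0r.
    by rewrite /Rintegral integral0.
  have sxs := sproc_sq T_gt0 P_complete W_bm px sT.
  have sxs' := sproc_sq T_gt0 P_complete W_bm px' sT.
  rewrite phiE// /g indicE mem_setE in_itv/= sT mulr1 -ipZl//.
  by apply: eq_Rintegral => w _; rewrite !winE.
rewrite psiM// PsiD// => e.
have winK X Y : \int[TS]_z (win T X z * win T Y z * kk z.1) =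
    ip TS (win T (fun t w => kk t * X t w)) (win T Y).
  by apply: eq_Rintegral => z _; rewrite win_smul mulrC mulrA.
rewrite !winK in e.
move: e; set a := kk T; set c := ip P _ _ => e.
have -> : a * c = c * (a - kk 0) + kk 0 * c by ring.
rewrite e; ring.
Qed.

End WeightedMoment.

(** * Quadratic functionals of controlled states *)

Section Bridge.
Context {R : realType} {d : measure_display} {Om : measurableType d} {J : finType}.
Variables (P : probability Om R) (T : R) (W : J -> R -> Om -> R).
Hypothesis T_gt0 : 0 < T.
Hypothesis P_complete : measure_is_complete P.
Hypothesis W_bm : independent_brownians P T W.
Local Notation mu := (@lebesgue_measure R).
Local Notation TS := (timespace P).
Local Notation L2p := (L2p P T W).
Local Notation L2F := (L2F P T W).

Definition comp l (x : process R Om l) (j : 'I_l) (t : R) (w : Om) : R := x t w j 0.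

Lemma L2norm2E l (x : process R Om l) : (forall j, progressive P T W (comp x j)) ->
  L2norm2 P T x = (\sum_j \int[TS]_z (win T (comp x j) z ^+ 2)%:E)%E.
Proof.
move=> px; have mx j := measurable_win T_gt0 P_complete W_bm (px j).
have winS : win T (fun t w => sqnorm (x t w)) = fun z => \sum_j win T (comp x j) z ^+ 2.
  apply/funext => z; rewrite /win /sqnorm mulr_suml; apply: eq_bigr => j _.
  by rewrite exprMn indic_sqr.
have mS : measurable_fun setT (win T (fun t w => sqnorm (x t w)) : (measurableTypeR R * Om)%type -> R).
  by rewrite winS; apply: measurable_sum => j; apply: measurable_funX; exact: mx.
rewrite /L2norm2 (integral_win P mS); last by move=> s w; apply: sumr_ge0 => j _; exact: sqr_ge0.
rewrite winS; under eq_integral do rewrite -sumEFin.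
rewrite ge0_integral_sum//.
- by move=> j; exact: measurable_sqr (mx j).
- by move=> j z _; rewrite lee_fin sqr_ge0.
Qed.

Lemma L2F_comp l (x : process R Om l) : L2F x -> forall j, L2p (comp x j).
Proof.
move=> [px foo] j; split; first exact: px.
split; first exact: (measurable_win T_gt0 P_complete W_bm (px j)).
move: foo; rewrite (L2norm2E px); apply: le_lt_trans.
rewrite (bigD1 j)//= leeDl//; apply: sume_ge0 => i _.
by apply: integral_ge0 => z _; rewrite lee_fin sqr_ge0.
Qed.

Lemma L2norm2_wnorm l (x : process R Om l) : (forall j, L2p (comp x j)) ->
  L2norm2 P T x = (\sum_j wnorm P T (comp x j))%:E.
Proof.
move=> lx; rewrite L2norm2E; last by move=> j; case: (lx j).
by rewrite -sumEFin; apply: eq_bigr => j _; rewrite ipE//; case: (lx j).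
Qed.

Lemma comp_L2F l (x : process R Om l) : (forall j, L2p (comp x j)) -> L2F x.
Proof.
move=> lx; split; first by move=> j; case: (lx j).
by rewrite (L2norm2_wnorm lx) ltry.
Qed.

Lemma L2F_mx l m (M : 'M[R]_(l, m)) (x : process R Om m) : L2F x -> L2F (fun t w => M *m x t w).
Proof.
move=> /L2F_comp lx; apply: comp_L2F => j.
have -> : comp (fun t w => M *m x t w) j = fun t w => \sum_i M j i * comp x i t w.
  by apply/funext => t; apply/funext => w; rewrite /comp mxE.
by apply: L2p_sum => i; exact: L2pZ.
Qed.

Lemma L2F_D l (x y : process R Om l) : L2F x -> L2F y -> L2F (fun t w => x t w + y t w).
Proof.
move=> /L2F_comp lx /L2F_comp ly; apply: comp_L2F => j.
have -> : comp (fun t w => x t w + y t w) j = fun t w => comp x j t w + comp y j t w.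
  by apply/funext => t; apply/funext => w; rewrite /comp mxE.
exact: L2pD.
Qed.

Lemma L2F_Z l (c : R) (x : process R Om l) : L2F x -> L2F (fun t w => c *: x t w).
Proof.
move=> /L2F_comp lx; apply: comp_L2F => j.
have -> : comp (fun t w => c *: x t w) j = fun t w => c * comp x j t w.
  by apply/funext => t; apply/funext => w; rewrite /comp mxE.
exact: L2pZ.
Qed.

Lemma L2F_B l (x y : process R Om l) : L2F x -> L2F y -> L2F (fun t w => x t w - y t w).
Proof.
move=> lx /(L2F_Z (-1)) ly; have := L2F_D lx ly.
by under eq_fun do under eq_fun do rewrite scaleN1r.
Qed.

Lemma L2F0 l : L2F (fun _ _ => 0 : 'cV[R]_l).
Proof.
apply: comp_L2F => j; have -> : comp (fun _ _ => 0) j = fun _ _ => 0.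
  by apply/funext => t; apply/funext => w; rewrite /comp mxE.
exact: L2p0.
Qed.

Lemma L2F_sum l (I : finType) (x : I -> process R Om l) : (forall i, L2F (x i)) ->
  L2F (fun t w => \sum_i x i t w).
Proof.
move=> lx; elim: (index_enum I) => [|i r ih].
  rewrite (_ : (fun _ _ => _) = fun _ _ => 0); first exact: L2F0.
  by apply/funext => t; apply/funext => w; rewrite big_nil.
rewrite (_ : (fun _ _ => _) = fun t w => x i t w + \sum_(i <- r) x i t w).
  exact: (L2F_D (lx i) ih).
by apply/funext => t; apply/funext => w; rewrite big_cons.
Qed.

(* Equality almost surely at each time, as given by uniqueness for the state
   equation, is equality almost everywhere on [0, T] x Om. *)
Lemma L2p_ae_win (X Y : R -> Om -> R) : L2p X -> L2p Y ->
  (forall t, 0 <= t <= T -> {ae P, forall w, X t w = Y t w}) ->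
  {ae TS, forall z, win T X z = win T Y z}.
Proof.
move=> lX lY XY; have [pX sX] := lX; have [pY sY] := lY; have [pD sD] := L2pB lX lY.
have D0 : wnorm P T (fun t w => X t w - Y t w) = 0.
  apply/eqP; rewrite eq_le wnorm_ge0 andbT -lee_fin -ipE//.
  have := @sum_win_sq_bound R d Om P 1 (fun=> fun t w => X t w - Y t w) T (fun=> 0).
  rewrite big_ord1 => /(_ (fun=> proj1 sD) (measurable_cst _)) h.
  apply: le_trans (h _) _; last by rewrite integral0.
  move=> s sT; rewrite big_ord1.
  have [_ s_T] := andP sT.
  have mXs := Ft_measurable_measurable P_complete W_bm s_T (progressive_Ft pX sT).
  have mYs := Ft_measurable_measurable P_complete W_bm s_T (progressive_Ft pY sT).
  have -> : (\int[P]_w ((X s w - Y s w) ^+ 2)%:E = \int[P]_w (cst 0 w))%E.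
    apply: ae_eq_integral => //.
      by apply: measurable_sqr; exact: measurable_funB.
    by apply: filterS (XY s sT) => w h' _ /=; rewrite h' subrr expr0n.
  by rewrite integral0.
apply: (@filterS _ _ (ae_filter_ringOfSetsType TS) _ _ _ (ip_eq0_ae sD D0)) => z.
by rewrite winB => /eqP; rewrite subr_eq0 => /eqP.
Qed.

Definition bil {dd} {TT : measurableType dd} (nu : {measure set TT -> \bar R}) l
  (M : 'M[R]_l) (x y : 'I_l -> TT -> R) : R := \sum_j \sum_i M j i * ip nu (x j) (y i).

Definition bilT l (M : 'M[R]_l) (x y : 'I_l -> R -> Om -> R) : R :=
  bil TS M (fun j => win T (x j)) (fun j => win T (y j)).

Lemma qformE l (M : 'M[R]_l) (z : 'cV[R]_l) : qform M z = \sum_j \sum_i M j i * (z j 0 * z i 0).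
Proof.
rewrite /qform mxE exchange_big/=; apply: eq_bigr => i _.
rewrite mxE mulr_suml; apply: eq_bigr => j _; rewrite !mxE; ring.
Qed.

Lemma Rintegral_sum {dd} {TT : measurableType dd} (nu : {measure set TT -> \bar R})
  (I : Type) (r : seq I) (F : I -> TT -> R) :
  (forall i, nu.-integrable setT (EFin \o F i)) ->
  nu.-integrable setT (EFin \o (fun z => \sum_(i <- r) F i z)) /\
  \int[nu]_z (\sum_(i <- r) F i z) = \sum_(i <- r) \int[nu]_z F i z.
Proof.
move=> iF; elim: r => [|i r [ih1 ih2]].
  rewrite big_nil; under eq_fun do rewrite big_nil; split.
    exact: integrable0.
  by rewrite /Rintegral integral0.
rewrite big_cons -ih2; under eq_fun do rewrite big_cons; split.
  exact: integrableRD.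
by rewrite RintegralD.
Qed.

Lemma E_int_win (g : R -> Om -> R) : TS.-integrable setT (EFin \o (win T g)) ->
  E_int P T g = \int[TS]_z win T g z.
Proof.
move=> ig; have [_ e] := Rfubini2 ig; rewrite -e /E_int.
apply: eq_Rintegral => w _; rewrite Rintegral_mkcond; apply: eq_Rintegral => s _.
by rewrite patchE /win /= indicE; case: (_ \in _); rewrite ?mulr1 ?mulr0.
Qed.

Lemma win_qform l (M : 'M[R]_l) (x : process R Om l) : L2F x ->
  TS.-integrable setT (EFin \o (win T (fun t w => qform M (x t w)))) /\
  \int[TS]_z win T (fun t w => qform M (x t w)) z = bilT M (comp x) (comp x).
Proof.
move=> /L2F_comp lx.
have -> : win T (fun t w => qform M (x t w)) =
    fun z => \sum_j \sum_i M j i * (win T (comp x j) z * win T (comp x i) z).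
  apply/funext => z; rewrite /win qformE mulr_suml; apply: eq_bigr => j _.
  rewrite mulr_suml; apply: eq_bigr => i _; rewrite /comp.
  rewrite -[in LHS]indic_sqr; ring.
have i1 j i : TS.-integrable setT (EFin \o (fun z : (measurableTypeR R * Om)%type => win T (comp x j) z * win T (comp x i) z)).
  by apply: integrable_mulsq; [case: (lx j)|case: (lx i)].
have i2 j i := integrableRZ (M j i) (i1 j i).
have [h1 h2] := Rintegral_sum (index_enum _) (fun j => proj1 (Rintegral_sum (index_enum _) (i2 j))).
split => //; rewrite h2; apply: eq_bigr => j _.
rewrite (proj2 (Rintegral_sum (index_enum _) (i2 j))); apply: eq_bigr => i _.
by rewrite RintegralZl.
Qed.

Lemma E_int_qform l (Q S : 'M[R]_l) (y s : process R Om l) : L2F y -> L2F s ->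
  E_int P T (fun t w => - qform Q (y t w) + qform S (s t w)) =
  - bilT Q (comp y) (comp y) + bilT S (comp s) (comp s).
Proof.
move=> ly ls; have [i1 e1] := win_qform Q ly; have [i2 e2] := win_qform S ls.
have winE' : win T (fun t w => - qform Q (y t w) + qform S (s t w)) =
    fun z => (-1) * win T (fun t w => qform Q (y t w)) z + win T (fun t w => qform S (s t w)) z.
  by apply/funext => z; rewrite /win; ring.
have i3 := integrableRZ (-1) i1.
rewrite E_int_win winE'; last exact: integrableRD.
by rewrite RintegralD// RintegralZl// e1 e2 mulN1r.
Qed.

Lemma int_qform l (G : 'M[R]_l) (y : Om -> 'cV[R]_l) : (forall j, sq P (fun w => y w j 0)) ->
  \int[P]_w qform G (y w) = bil P G (fun j w => y w j 0) (fun j w => y w j 0).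
Proof.
move=> sy; under eq_Rintegral do rewrite qformE.
have i2 j i := integrableRZ (G j i) (integrable_mulsq (sy j) (sy i)).
rewrite (proj2 (Rintegral_sum (index_enum _) (fun j => proj1 (Rintegral_sum (index_enum _) (i2 j))))).
apply: eq_bigr => j _; rewrite (proj2 (Rintegral_sum (index_enum _) (i2 j))).
apply: eq_bigr => i _; rewrite RintegralZl//.
exact: integrable_mulsq (sy j) (sy i).
Qed.

Lemma ip_mix {dd} {TT : measurableType dd} (nu : {measure set TT -> \bar R}) (lam : R)
  (a b a' b' : TT -> R) : sq nu a -> sq nu b -> sq nu a' -> sq nu b' ->
  ip nu (fun z => lam * a z + (1 - lam) * b z) (fun z => lam * a' z + (1 - lam) * b' z) =
  lam * ip nu a a' + (1 - lam) * ip nu b b' -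
  lam * (1 - lam) * ip nu (fun z => a z - b z) (fun z => a' z - b' z).
Proof.
move=> sa sb sa' sb'.
have s1 := sqZ lam sa; have s2 := sqZ (1 - lam) sb.
have s1' := sqZ lam sa'; have s2' := sqZ (1 - lam) sb'.
rewrite (ipDl s1 s2 (sqD s1' s2')) (ipDr s1' s2' s1) (ipDr s1' s2' s2).
rewrite (ipBl sa sb (sqB sa' sb')) (ipBr sa' sb' sa) (ipBr sa' sb' sb).
rewrite !ipZl// !ipZr//; ring.
Qed.

Lemma ip_ae2 {dd} {TT : measurableType dd} (nu : {measure set TT -> \bar R})
  (f f' g g' : TT -> R) : sq nu f -> sq nu f' -> sq nu g -> sq nu g' ->
  {ae nu, forall z, f z = f' z} -> {ae nu, forall z, g z = g' z} -> ip nu f g = ip nu f' g'.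
Proof.
move=> sf sf' sg sg' ff' gg'.
rewrite (ip_ae (proj1 sf) (proj1 sf') (proj1 sg) ff') !(ipC nu f').
by rewrite (ip_ae (proj1 sg) (proj1 sg') (proj1 sf') gg').
Qed.

Lemma bil_mix {dd} {TT : measurableType dd} (nu : {measure set TT -> \bar R}) l
  (M : 'M[R]_l) (lam : R) (xm xa xb xd : 'I_l -> TT -> R) :
  (forall j, sq nu (xm j)) -> (forall j, sq nu (xa j)) -> (forall j, sq nu (xb j)) ->
  (forall j, sq nu (xd j)) ->
  (forall j, {ae nu, forall z, xm j z = lam * xa j z + (1 - lam) * xb j z}) ->
  (forall j, {ae nu, forall z, xd j z = xa j z - xb j z}) ->
  bil nu M xm xm = lam * bil nu M xa xa + (1 - lam) * bil nu M xb xb -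
    lam * (1 - lam) * bil nu M xd xd.
Proof.
move=> sm sa sb sd hm hd; rewrite /bil !mulr_sumr -big_split -sumrB /=.
apply: eq_bigr => j _; rewrite !mulr_sumr -big_split -sumrB /=; apply: eq_bigr => i _.
have s1 k : sq nu (fun z => lam * xa k z + (1 - lam) * xb k z) by apply: sqD; exact: sqZ.
have s2 k : sq nu (fun z => xa k z - xb k z) by exact: sqB.
rewrite (ip_ae2 (sm j) (s1 j) (sm i) (s1 i) (hm j) (hm i)).
rewrite (ip_ae2 (sd j) (s2 j) (sd i) (s2 i) (hd j) (hd i)) ip_mix//; ring.
Qed.

Definition quad l (Q S G : 'M[R]_l) (y s : process R Om l) (yT : Om -> 'cV[R]_l) : R :=
  - bilT Q (comp y) (comp y) + bilT S (comp s) (comp s) -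
  bil P G (fun j w => yT w j 0) (fun j w => yT w j 0).

(** A quadratic functional deviates from convexity by exactly its value on the difference. The
    relations between the states are required only almost surely at each time, as uniqueness for the
    equation provides them. *)
Lemma quad_mix l (Q S G : 'M[R]_l) (lam : R) (ym ya yb yd sa sb : process R Om l)
  (Ym Ya Yb Yd : Om -> 'cV[R]_l) :
  L2F ym -> L2F ya -> L2F yb -> L2F yd -> L2F sa -> L2F sb ->
  (forall j, sq P (fun w => Ym w j 0)) -> (forall j, sq P (fun w => Ya w j 0)) ->
  (forall j, sq P (fun w => Yb w j 0)) -> (forall j, sq P (fun w => Yd w j 0)) ->
  (forall t, 0 <= t <= T -> {ae P, forall w, ym t w = lam *: ya t w + (1 - lam) *: yb t w}) ->
  (forall t, 0 <= t <= T -> {ae P, forall w, yd t w = ya t w - yb t w}) ->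
  {ae P, forall w, Ym w = lam *: Ya w + (1 - lam) *: Yb w} ->
  {ae P, forall w, Yd w = Ya w - Yb w} ->
  quad Q S G ym (fun t w => lam *: sa t w + (1 - lam) *: sb t w) Ym =
  lam * quad Q S G ya sa Ya + (1 - lam) * quad Q S G yb sb Yb -
  lam * (1 - lam) * quad Q S G yd (fun t w => sa t w - sb t w) Yd.
Proof.
move=> lm la lb ld lsa lsb sm sa' sb' sd hm hd Hm Hd.
have L := @L2F_comp l.
have mixE (x y : process R Om l) j : comp (fun t w => lam *: x t w + (1 - lam) *: y t w) j =
    fun t w => lam * comp x j t w + (1 - lam) * comp y j t w.
  by apply/funext => t; apply/funext => w; rewrite /comp !mxE.
have subE (x y : process R Om l) j : comp (fun t w => x t w - y t w) j =
    fun t w => comp x j t w - comp y j t w.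
  by apply/funext => t; apply/funext => w; rewrite /comp !mxE.
have lmix := L2F_D (L2F_Z lam lsa) (L2F_Z (1 - lam) lsb).
have lsub := L2F_B lsa lsb.
have wmix (x y : process R Om l) j z : win T (comp (fun t w => lam *: x t w + (1 - lam) *: y t w) j) z =
    lam * win T (comp x j) z + (1 - lam) * win T (comp y j) z.
  by rewrite mixE /win; ring.
have wsub (x y : process R Om l) j z : win T (comp (fun t w => x t w - y t w) j) z =
    win T (comp x j) z - win T (comp y j) z.
  by rewrite subE /win; ring.
have b1 : bilT Q (comp ym) (comp ym) = lam * bilT Q (comp ya) (comp ya) +
    (1 - lam) * bilT Q (comp yb) (comp yb) - lam * (1 - lam) * bilT Q (comp yd) (comp yd).
  apply: bil_mix.
  - by move=> j; case: (L _ lm j).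
  - by move=> j; case: (L _ la j).
  - by move=> j; case: (L _ lb j).
  - by move=> j; case: (L _ ld j).
  - move=> j; have := L2p_ae_win (L _ lm j) (L _ (L2F_D (L2F_Z lam la) (L2F_Z (1 - lam) lb)) j) _.
    move=> /(_ _)/wrap[t tT|]; first by apply: filterS (hm t tT) => w; rewrite /comp => ->.
    by apply: (@filterS _ _ (ae_filter_ringOfSetsType TS)) => z ->; rewrite wmix.
  - move=> j; have := L2p_ae_win (L _ ld j) (L _ (L2F_B la lb) j) _.
    move=> /(_ _)/wrap[t tT|]; first by apply: filterS (hd t tT) => w; rewrite /comp => ->.
    by apply: (@filterS _ _ (ae_filter_ringOfSetsType TS)) => z ->; rewrite wsub.
have b2 : bilT S (comp (fun t w => lam *: sa t w + (1 - lam) *: sb t w))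
    (comp (fun t w => lam *: sa t w + (1 - lam) *: sb t w)) =
    lam * bilT S (comp sa) (comp sa) + (1 - lam) * bilT S (comp sb) (comp sb) -
    lam * (1 - lam) * bilT S (comp (fun t w => sa t w - sb t w)) (comp (fun t w => sa t w - sb t w)).
  apply: bil_mix.
  - by move=> j; case: (L _ lmix j).
  - by move=> j; case: (L _ lsa j).
  - by move=> j; case: (L _ lsb j).
  - by move=> j; case: (L _ lsub j).
  - by move=> j; apply: (@filterE _ _ (ae_filter_ringOfSetsType TS)) => z; exact: wmix.
  - by move=> j; apply: (@filterE _ _ (ae_filter_ringOfSetsType TS)) => z; exact: wsub.
rewrite /quad b1 b2 (bil_mix G (lam := lam) (xa := fun j w => Ya w j 0)
  (xb := fun j w => Yb w j 0) (xd := fun j w => Yd w j 0))//.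
- ring.
- by move=> j; apply: filterS Hm => w ->; rewrite !mxE.
- by move=> j; apply: filterS Hd => w ->; rewrite !mxE.
Qed.

Lemma coef_bound l (A : 'M[R]_l) (C : J -> 'M[R]_l) : exists cm : R,
  (forall j i, `|A j i| <= cm) /\ (forall k j i (t : R), `|C k j i| <= cm).
Proof.
pose cm := \sum_j \sum_i `|A j i| + \sum_k \sum_j \sum_i `|C k j i|.
exists cm; split=> [j i|k j i t].
  rewrite /cm (bigD1 j)//= (bigD1 i)//= -!addrA lerDl !addr_ge0//.
  - by apply: sumr_ge0.
  - by apply: sumr_ge0 => ? _; apply: sumr_ge0.
  - by apply: sumr_ge0 => ? _; apply: sumr_ge0 => ? _; apply: sumr_ge0.
rewrite /cm addrC (bigD1 k)//= (bigD1 j)//= (bigD1 i)//= -!addrA lerDl !addr_ge0//.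
- by apply: sumr_ge0.
- by apply: sumr_ge0 => ? _; apply: sumr_ge0.
- by apply: sumr_ge0 => ? _; apply: sumr_ge0 => ? _; apply: sumr_ge0.
- by apply: sumr_ge0 => ? _; apply: sumr_ge0.
Qed.

(** [xget] returns a solution as soon as one exists, and the fixed point of Picard's iteration is a
    witness; otherwise the chosen process would be the default 0. *)
Lemma sde_solutionP l (x0 : 'cV[R]_l) (A : 'M[R]_l) (C : J -> 'M[R]_l)
    (b : process R Om l) (g : J -> process R Om l) : L2F b -> (forall k, L2F (g k)) ->
  let x := sde_solution P T W x0 (fun x t w => A *m x t w + b t w)
    (fun x k t w => C k *m x t w + g k t w) in
  L2F x /\ lin_sproc P T W (fun j i => A j i) (fun k j i _ => C k j i)
    (fun j => x0 j 0) (comp b) (fun k => comp (g k)) (comp x).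
Proof.
move=> lb lg x.
have driftE (y : process R Om l) j : comp (fun t w => A *m y t w + b t w) j =
    drift (fun j i => A j i) (comp y) (comp b) j.
  by apply/funext => t; apply/funext => w; rewrite /comp /drift !mxE.
have diffuE (y : process R Om l) k j : comp (fun t w => C k *m y t w + g k t w) j =
    diffu (fun k j i _ => C k j i) (comp y) (fun k => comp (g k)) k j.
  by apply/funext => t; apply/funext => w; rewrite /comp /diffu !mxE.
have [cm [cA cC]] := coef_bound A C.
have lb' := L2F_comp lb; have lg' k := L2F_comp (lg k).
have [y [ly [Y iY yY]]] := @lin_sde_exists R d Om J P T W T_gt0 P_complete W_bm l
  (fun j i => A j i) (fun k j i _ => C k j i) cm cA cC (fun _ _ _ => measurable_cst _)
  (fun j => x0 j 0) (comp b) (fun k => comp (g k)) lb' lg'.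
have [lx [Z iZ xZ]] : L2F x /\ ito_process P T W x0 (fun t w => A *m x t w + b t w)
    (fun k t w => C k *m x t w + g k t w) x.
  suff hex : exists y, [set x | L2F x /\ ito_process P T W x0 (fun t w => A *m x t w + b t w)
      (fun k t w => C k *m x t w + g k t w) x] y by exact: (xgetPex _ hex).
  pose y' : process R Om l := fun t w => \col_j y j t w.
  have cy : comp y' = y.
    by apply/funext => j; apply/funext => t; apply/funext => w; rewrite /comp mxE.
  exists y'; split; first by apply: comp_L2F => j; rewrite cy.
  exists (fun k t w => \col_j Y k j t w).
    move=> k j; have := iY k j; rewrite -cy -diffuE.
    by rewrite (_ : (fun t w => (\col_j0 Y k j0 t w) j 0) = Y k j)//;
      apply/funext => t; apply/funext => w; rewrite mxE.
  apply: filterS yY => w h t tT j; rewrite -[LHS]/(comp y' j t w) cy h//.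
  congr (_ + _ + _); last by apply: eq_bigr => k _; rewrite mxE.
  by rewrite /prim; apply: eq_Rintegral => s _; rewrite -cy -driftE.
split => // j; rewrite -driftE.
have ld k : L2p (comp (fun t w => C k *m x t w + g k t w) j).
  exact: (L2F_comp (L2F_D (L2F_mx (C k) lx) (lg k)) j).
rewrite (_ : (fun k => _) = fun k => comp (fun t w => C k *m x t w + g k t w) j); last first.
  by apply/funext => k; rewrite diffuE.
apply: (ito_sproc P_complete W_bm (Y := fun k t w => Z k t w j 0)).
- exact: (L2F_comp (L2F_D (L2F_mx A lx) lb) j).
- by move=> k; case: (ld k) => _ [].
- by move=> k; exact: iZ.
- by apply: filterS xZ => w h t tT; rewrite [LHS]h.
Qed.

Lemma lin_sproc_vec_unique l (A : 'M[R]_l) (C : J -> 'M[R]_l) (x0 : 'I_l -> R)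
    (b : 'I_l -> R -> Om -> R) (g : J -> 'I_l -> R -> Om -> R) (x y : process R Om l) :
  L2F x -> L2F y ->
  lin_sproc P T W (fun j i => A j i) (fun k j i _ => C k j i) x0 b g (comp x) ->
  lin_sproc P T W (fun j i => A j i) (fun k j i _ => C k j i) x0 b g (comp y) ->
  forall t, 0 <= t <= T -> {ae P, forall w, x t w = y t w}.
Proof.
move=> /L2F_comp lx /L2F_comp ly px py t tT.
have [cm [cA cC]] := coef_bound A C.
have h := @lin_sproc_unique R d Om J P T W T_gt0 P_complete W_bm l
  (fun j i => A j i) (fun k j i _ => C k j i) cm cA cC (fun _ _ _ => measurable_cst _)
  x0 b g (comp x) (comp y) lx ly px py t tT.
apply: filterS (ae_foralln_fin h) => w hw; apply/matrixP => j i.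
by rewrite (ord1 i); exact: hw.
Qed.

End Bridge.

Section VectorSDE.
Context {R : realType} {d : measure_display} {Om : measurableType d} {J : finType}.
Variables (P : probability Om R) (T : R) (W : J -> R -> Om -> R).
Hypothesis T_gt0 : 0 < T.
Hypothesis P_complete : measure_is_complete P.
Hypothesis W_bm : independent_brownians P T W.
Local Notation L2F := (L2F P T W).
Variables (l : nat) (A : 'M[R]_l) (C : J -> 'M[R]_l).

Definition vsol (x0 : 'cV[R]_l) (b : process R Om l) (g : J -> process R Om l)
    (x : process R Om l) : Prop :=
  L2F x /\ lin_sproc P T W (fun j i => A j i) (fun k j i _ => C k j i)
    (fun j => x0 j 0) (comp b) (fun k => comp (g k)) (comp x).

Lemma vsol_lin (c c' : R) x0 b g x x0' b' g' x' : vsol x0 b g x -> vsol x0' b' g' x' ->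
  vsol (c *: x0 + c' *: x0') (fun t w => c *: b t w + c' *: b' t w)
    (fun k t w => c *: g k t w + c' *: g' k t w) (fun t w => c *: x t w + c' *: x' t w).
Proof.
move=> [lx px] [lx' px']; split.
  exact: (L2F_D T_gt0 P_complete W_bm (L2F_Z T_gt0 P_complete W_bm c lx)
    (L2F_Z T_gt0 P_complete W_bm c' lx')).
apply: lin_sproc_congr (lin_sprocD T_gt0 P_complete W_bm
  (lin_sprocZ T_gt0 P_complete W_bm c px) (lin_sprocZ T_gt0 P_complete W_bm c' px')).
- by move=> j; rewrite !mxE.
- by move=> j t w; rewrite /comp !mxE.
- by move=> k j t w; rewrite /comp !mxE.
- by move=> j t w; rewrite /comp !mxE.
Qed.

Lemma vsol_unique x0 b g x x0' b' g' x' : vsol x0 b g x -> vsol x0' b' g' x' ->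
  x0 = x0' -> (forall t w, b t w = b' t w) -> (forall k t w, g k t w = g' k t w) ->
  forall t, 0 <= t <= T -> {ae P, forall w, x t w = x' t w}.
Proof.
move=> [lx px] [lx' px'] e0 eb eg.
apply: (lin_sproc_vec_unique T_gt0 P_complete W_bm lx lx' px).
apply: lin_sproc_congr px'.
- by move=> j; rewrite e0.
- by move=> j t w; rewrite /comp eb.
- by move=> k j t w; rewrite /comp eg.
- by [].
Qed.

Lemma vsol_sq x0 b g x t : vsol x0 b g x -> 0 <= t <= T -> forall j, sq P (fun w => x t w j 0).
Proof. by move=> [_ px] tT j; exact: (sproc_sq T_gt0 P_complete W_bm (px j) tT). Qed.

End VectorSDE.

(** * Convexity defects of the social and the homogeneous functional *)

Section Convexity.
Context {R : realType} {d : measure_display} {Om : measurableType d}.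
Context {n r N : nat}.
Variables (P : probability Om R) (T : R) (W : 'I_N.+1 -> R -> Om -> R).
Hypothesis T_gt0 : 0 < T.
Hypothesis P_complete : measure_is_complete P.
Hypothesis W_bm : independent_brownians P T W.
Variables (A C0 Gam Gam0 : 'M[R]_n) (B D D0 : 'M[R]_(n, r)) (Q G R0 : 'M[R]_n).
Variables (f sigma eta : process R Om n) (eta0 : Om -> 'cV[R]_n) (x0 : 'cV[R]_n).
Variable u : 'I_N -> process R Om r.
Local Notation L2F := (L2F P T W).
Hypothesis N_gt0 : (0 < N)%N.
Hypothesis f_L2 : L2F f.
Hypothesis sigma_L2 : L2F sigma.
Hypothesis eta_L2 : L2F eta.
Hypothesis eta0_L2 : L2_FT P T W eta0.
Hypothesis u_L2 : forall i, L2F (u i).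

Definition noise0 (c : process R Om n) (k : 'I_N.+1) : process R Om n :=
  fun t w => if k == ord0 then c t w else 0.
Definition coef0 (k : 'I_N.+1) : 'M[R]_n := if k == ord0 then C0 else 0.
Definition agent_noise (c : process R Om n) (i : 'I_N) (k : 'I_N.+1) : process R Om n :=
  fun t w => if k == ord0 then D0 *m u i t w + c t w
             else if k == lift ord0 i then D *m u i t w + sigma t w else 0.
Local Notation hom := (hom_state P T W A C0).
Local Notation agent := (agent_state P T W A C0 B D D0 f sigma x0 u).
Local Notation vsol := (vsol P T W A coef0).

Lemma noise0_L2F c k : L2F c -> L2F (noise0 c k).
Proof.
move=> lc; rewrite /noise0; case: (k == ord0); first exact: lc.
exact: (L2F0 T_gt0 P_complete W_bm).
Qed.

Lemma hom_stateP c : L2F c -> vsol 0 (fun _ _ => 0) (noise0 c) (hom c).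
Proof.
move=> lc; have -> : hom c = sde_solution P T W 0 (fun x t w => A *m x t w + 0)
    (fun x k t w => coef0 k *m x t w + noise0 c k t w).
  rewrite /hom_state; congr sde_solution.
    by apply/funext => x; apply/funext => t; apply/funext => w; rewrite addr0.
  apply/funext => x; apply/funext => k; apply/funext => t; apply/funext => w.
  by rewrite /coef0 /noise0; case: (k == ord0); rewrite // mul0mx addr0.
apply: (sde_solutionP T_gt0 P_complete W_bm) => [|k].
  exact: (L2F0 T_gt0 P_complete W_bm).
exact: noise0_L2F.
Qed.

Lemma agent_stateP c i : L2F c ->
  vsol x0 (fun t w => B *m u i t w + f t w) (agent_noise c i) (agent c i).
Proof.
move=> lc; have -> : agent c i =
    sde_solution P T W x0 (fun x t w => A *m x t w + (B *m u i t w + f t w))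
    (fun x k t w => coef0 k *m x t w + agent_noise c i k t w).
  rewrite /agent_state; congr sde_solution.
    by apply/funext => x; apply/funext => t; apply/funext => w; rewrite addrA.
  apply/funext => x; apply/funext => k; apply/funext => t; apply/funext => w.
  rewrite /coef0 /agent_noise; case: (k == ord0); first by rewrite addrA.
  by rewrite mul0mx add0r.
have lmx (M : 'M[R]_(n, r)) := L2F_mx T_gt0 P_complete W_bm M (u_L2 i).
apply: (sde_solutionP T_gt0 P_complete W_bm) => [|k].
  exact: (L2F_D T_gt0 P_complete W_bm (lmx B) f_L2).
rewrite /agent_noise; case: (k == ord0).
  exact: (L2F_D T_gt0 P_complete W_bm (lmx D0) lc).
case: (k == lift ord0 i); last exact: (L2F0 T_gt0 P_complete W_bm).
exact: (L2F_D T_gt0 P_complete W_bm (lmx D) sigma_L2).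
Qed.

Lemma L2F_lin c1 c2 (a b : process R Om n) : L2F a -> L2F b -> L2F (fun t w => c1 *: a t w + c2 *: b t w).
Proof.
move=> la lb; exact: (L2F_D T_gt0 P_complete W_bm (L2F_Z T_gt0 P_complete W_bm c1 la)
    (L2F_Z T_gt0 P_complete W_bm c2 lb)).
Qed.

Lemma L2F_sub (a b : process R Om n) : L2F a -> L2F b -> L2F (fun t w => a t w - b t w).
Proof. by move=> la lb; exact: (L2F_B T_gt0 P_complete W_bm la lb). Qed.

Lemma hom_state_lin c1 c2 a b : L2F a -> L2F b -> forall t, 0 <= t <= T ->
  {ae P, forall w, hom (fun t w => c1 *: a t w + c2 *: b t w) t w = c1 *: hom a t w + c2 *: hom b t w}.
Proof.
move=> la lb; have lab := L2F_lin c1 c2 la lb.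
apply: (vsol_unique T_gt0 P_complete W_bm (hom_stateP lab)
  (vsol_lin T_gt0 P_complete W_bm c1 c2 (hom_stateP la) (hom_stateP lb))).
- by rewrite !scaler0 addr0.
- by move=> t w; rewrite !scaler0 addr0.
- by move=> k t w; rewrite /noise0; case: (k == ord0); rewrite // !scaler0 addr0.
Qed.

Lemma hom_state_sub a b : L2F a -> L2F b -> forall t, 0 <= t <= T ->
  {ae P, forall w, hom (fun t w => a t w - b t w) t w = hom a t w - hom b t w}.
Proof.
move=> la lb t tT; have := hom_state_lin 1 (-1) la lb tT.
rewrite (_ : (fun t w => 1 *: a t w + _) = fun t w => a t w - b t w); last first.
  by apply/funext => s; apply/funext => w; rewrite scale1r scaleN1r.
by apply: filterS => w ->; rewrite scale1r scaleN1r.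
Qed.

(** The state is affine in the control: since the weights add up to 1, the combination reproduces
    the fixed inputs and the initial value. *)
Lemma agent_state_mix lam a b i : L2F a -> L2F b -> forall t, 0 <= t <= T ->
  {ae P, forall w, agent (fun t w => lam *: a t w + (1 - lam) *: b t w) i t w =
    lam *: agent a i t w + (1 - lam) *: agent b i t w}.
Proof.
move=> la lb; have lab := L2F_lin lam (1 - lam) la lb.
have mixE (v : 'cV[R]_n) : v = lam *: v + (1 - lam) *: v.
  by rewrite -scalerDl addrC subrK scale1r.
apply: (vsol_unique T_gt0 P_complete W_bm (agent_stateP i lab)
  (vsol_lin T_gt0 P_complete W_bm lam (1 - lam) (agent_stateP i la) (agent_stateP i lb))).
- exact: mixE.
- by move=> t w; exact: mixE.
- move=> k t w; rewrite /agent_noise; case: (k == ord0).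
    by rewrite !scalerDr addrACA -mixE.
  by case: (k == lift ord0 i); rewrite -mixE.
Qed.

Lemma agent_state_sub a b i : L2F a -> L2F b -> forall t, 0 <= t <= T ->
  {ae P, forall w, hom (fun t w => a t w - b t w) t w = agent a i t w - agent b i t w}.
Proof.
move=> la lb; have lab := L2F_sub la lb.
have h := vsol_unique T_gt0 P_complete W_bm (hom_stateP lab)
  (vsol_lin T_gt0 P_complete W_bm 1 (-1) (agent_stateP i la) (agent_stateP i lb)).
move=> t tT; have := h _ _ _ t tT.
move=> /(_ _ _ _)/wrap[|t' w|k t' w|].
- by rewrite scale1r scaleN1r subrr.
- by rewrite scale1r scaleN1r subrr.
- rewrite scale1r scaleN1r /noise0 /agent_noise; case: (k == ord0).
    by rewrite opprD addrACA subrr add0r.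
  by case: (k == lift ord0 i); rewrite subrr.
- by apply: filterS => w ->; rewrite scale1r scaleN1r.
Qed.

Definition dev c i : process R Om n :=
  fun t w => agent c i t w - Gam *m mean_state (agent c) t w - eta t w.
Definition devT c i w := agent c i T w - Gam0 *m mean_state (agent c) T w - eta0 w.
Definition hdev c : process R Om n := fun t w => (1%:M - Gam) *m hom c t w.
Definition hdevT c w := (1%:M - Gam0) *m hom c T w.

Let T_itv : 0 <= T <= T. Proof. by rewrite lexx ltW. Qed.

Lemma sq_mx l m (M : 'M[R]_(l, m)) (y : Om -> 'cV[R]_m) : (forall j, sq P (fun w => y w j 0)) ->
  forall j, sq P (fun w => (M *m y w) j 0).
Proof.
move=> sy j; under eq_fun do rewrite mxE.
by apply: sq_sum => i _; exact: sqZ.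
Qed.

Lemma eta0_sq j : sq P (fun w => eta0 w j 0).
Proof.
have [m fi] := eta0_L2.
have mj i := Ft_measurable_measurable P_complete W_bm (lexx T) (m i).
split; first exact: mj.
move: fi; apply: le_lt_trans; apply: ge0_le_integral => //.
- by move=> w _; rewrite lee_fin sqr_ge0.
- by apply: measurable_sqr; exact: mj.
- apply/measurable_EFinP; rewrite /sqnorm; apply: measurable_sum => i.
  by apply: measurable_funX; exact: mj.
- move=> w _; rewrite lee_fin /sqnorm (bigD1 j)//= lerDl.
  by apply: sumr_ge0 => i _; exact: sqr_ge0.
Qed.

Lemma hdev_L2F c : L2F c -> L2F (hdev c).
Proof. by move=> lc; exact: (L2F_mx T_gt0 P_complete W_bm _ (proj1 (hom_stateP lc))). Qed.

Lemma hdevT_sq c j : L2F c -> sq P (fun w => hdevT c w j 0).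
Proof.
move=> lc; apply: sq_mx => i.
exact: (vsol_sq T_gt0 P_complete W_bm (hom_stateP lc) T_itv).
Qed.

Lemma mean_L2F c : L2F c -> L2F (mean_state (agent c)).
Proof.
move=> lc; apply: (L2F_Z T_gt0 P_complete W_bm).
by apply: (L2F_sum T_gt0 P_complete W_bm) => i; exact: (proj1 (agent_stateP i lc)).
Qed.

Lemma dev_L2F c i : L2F c -> L2F (dev c i).
Proof.
move=> lc; have lm := L2F_mx T_gt0 P_complete W_bm Gam (mean_L2F lc).
exact: (L2F_sub (L2F_sub (proj1 (agent_stateP i lc)) lm) eta_L2).
Qed.

Lemma devT_sq c i j : L2F c -> sq P (fun w => devT c i w j 0).
Proof.
move=> lc; have sa k l : sq P (fun w => agent c k T w l 0).
  exact: (vsol_sq T_gt0 P_complete W_bm (agent_stateP k lc) T_itv).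
have sm l : sq P (fun w => mean_state (agent c) T w l 0).
  rewrite /mean_state; under eq_fun do rewrite mxE summxE.
  by apply: sqZ; apply: sq_sum => k _; exact: sa.
have h := sqB (sqB (sa i j) (sq_mx Gam0 sm j)) (eta0_sq j).
rewrite (_ : (fun w => devT c i w j 0) = fun w => agent c i T w j 0 -
    (Gam0 *m mean_state (agent c) T w) j 0 - eta0 w j 0); first exact: h.
by apply/funext => w; rewrite /devT !mxE.
Qed.

Lemma hdev_mix lam a b t : L2F a -> L2F b -> 0 <= t <= T -> forall M : 'M[R]_n,
  {ae P, forall w, M *m hom (fun t w => lam *: a t w + (1 - lam) *: b t w) t w =
    lam *: (M *m hom a t w) + (1 - lam) *: (M *m hom b t w)}.
Proof.
move=> la lb tT M; apply: filterS (hom_state_lin lam (1 - lam) la lb tT) => w ->.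
by rewrite mulmxDr !scalemxAr.
Qed.

Lemma hdev_sub a b t : L2F a -> L2F b -> 0 <= t <= T -> forall M : 'M[R]_n,
  {ae P, forall w, M *m hom (fun t w => a t w - b t w) t w = M *m hom a t w - M *m hom b t w}.
Proof.
move=> la lb tT M; apply: filterS (hom_state_sub la lb tT) => w ->.
by rewrite mulmxBr.
Qed.

Lemma mean_field_mix lam i (M : 'M[R]_n) (e : 'cV[R]_n) (v v1 v2 : 'I_N -> 'cV[R]_n) :
  (forall k, v k = lam *: v1 k + (1 - lam) *: v2 k) ->
  v i - M *m (N%:R^-1 *: \sum_k v k) - e =
  lam *: (v1 i - M *m (N%:R^-1 *: \sum_k v1 k) - e) +
  (1 - lam) *: (v2 i - M *m (N%:R^-1 *: \sum_k v2 k) - e).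
Proof.
move=> h; rewrite (h i) (eq_bigr _ (fun k _ => h k)).
rewrite big_split/= -!scaler_sumr -!scalemxAr mulmxDr -!scalemxAr.
move: (M *m \sum_i _) (M *m \sum_i _) (v1 i) (v2 i) => s s' x x'.
by apply/matrixP => p q; rewrite !mxE; ring.
Qed.

Lemma mean_field_sub i (M : 'M[R]_n) (e z : 'cV[R]_n) (v1 v2 : 'I_N -> 'cV[R]_n) :
  (forall k, z = v1 k - v2 k) ->
  (1%:M - M) *m z = (v1 i - M *m (N%:R^-1 *: \sum_k v1 k) - e) -
    (v2 i - M *m (N%:R^-1 *: \sum_k v2 k) - e).
Proof.
move=> h; have zE : z = N%:R^-1 *: \sum_k v1 k - N%:R^-1 *: \sum_k v2 k.
  rewrite -scalerBr -sumrB -(eq_bigr _ (fun k _ => h k)) sumr_const card_ord.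
  by rewrite -[z *+ N]scaler_nat scalerA mulVf ?scale1r// pnatr_eq0 -lt0n.
rewrite mulmxBl mul1mx {1}(h i) zE mulmxBr.
move: (M *m _) (M *m _) (v1 i) (v2 i) => s s' x x'.
by apply/matrixP => p q; rewrite !mxE; ring.
Qed.

Lemma agent_dev_mix lam a b i t (M : 'M[R]_n) (e : Om -> 'cV[R]_n) :
  L2F a -> L2F b -> 0 <= t <= T ->
  let c := fun t w => lam *: a t w + (1 - lam) *: b t w in
  let y c w := agent c i t w - M *m mean_state (agent c) t w - e w in
  {ae P, forall w, y c w = lam *: y a w + (1 - lam) *: y b w}.
Proof.
move=> la lb tT c y.
have h := ae_foralln_fin (fun k => agent_state_mix lam k la lb tT).
apply: filterS h => w; rewrite /y /mean_state.
exact: (@mean_field_mix lam i M (e w) (fun k => agent c k t w) (fun k => agent a k t w)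
  (fun k => agent b k t w)).
Qed.

Lemma agent_dev_sub a b i t (M : 'M[R]_n) (e : Om -> 'cV[R]_n) :
  L2F a -> L2F b -> 0 <= t <= T ->
  let y c w := agent c i t w - M *m mean_state (agent c) t w - e w in
  {ae P, forall w, (1%:M - M) *m hom (fun t w => a t w - b t w) t w = y a w - y b w}.
Proof.
move=> la lb tT y.
have h := ae_foralln_fin (fun k => agent_state_sub k la lb tT).
apply: filterS h => w; rewrite /y /mean_state.
exact: (@mean_field_sub i M (e w) (hom (fun t w => a t w - b t w) t w)
  (fun k => agent a k t w) (fun k => agent b k t w)).
Qed.

Lemma J_hom_quad c : L2F c ->
  J_hom P T W A C0 Gam Gam0 Q G R0 c = quad P T Q R0 G (hdev c) c (hdevT c).
Proof.
move=> lc; rewrite /J_hom /quad; congr (_ - _).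
  exact: (E_int_qform T_gt0 P_complete W_bm Q R0 (hdev_L2F lc) lc).
by rewrite -int_qform// => j; exact: hdevT_sq.
Qed.

Lemma J_soc_quad c : L2F c ->
  J_soc P T W A C0 Gam Gam0 B D D0 Q G R0 f sigma eta eta0 x0 u c =
  2^-1 * \sum_i quad P T Q R0 G (dev c i) c (devT c i).
Proof.
move=> lc; rewrite /J_soc; congr (_ * _); apply: eq_bigr => i _; rewrite /quad; congr (_ - _).
  exact: (E_int_qform T_gt0 P_complete W_bm Q R0 (dev_L2F i lc) lc).
by rewrite -int_qform// => j; exact: devT_sq.
Qed.

Lemma J_hom_mix a b lam : L2F a -> L2F b ->
  let J := J_hom P T W A C0 Gam Gam0 Q G R0 in
  J (fun t w => lam *: a t w + (1 - lam) *: b t w) = lam * J a + (1 - lam) * J b -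
  lam * (1 - lam) * (1 * J (fun t w => a t w - b t w)).
Proof.
move=> la lb J; have lab := L2F_lin lam (1 - lam) la lb; have lB := L2F_sub la lb.
rewrite mul1r /J (J_hom_quad la) (J_hom_quad lb) (J_hom_quad lab) (J_hom_quad lB).
have h := (quad_mix T_gt0 P_complete W_bm Q R0 G (hdev_L2F lab) (hdev_L2F la) (hdev_L2F lb)
  (hdev_L2F lB) la lb (fun j => hdevT_sq j lab) (fun j => hdevT_sq j la) (fun j => hdevT_sq j lb) (fun j => hdevT_sq j lB)
  (fun t tT => hdev_mix lam la lb tT (1%:M - Gam)) (fun t tT => hdev_sub la lb tT (1%:M - Gam))
  (hdev_mix lam la lb T_itv (1%:M - Gam0)) (hdev_sub la lb T_itv (1%:M - Gam0))).
exact: h.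
Qed.

Lemma half_sum_mix lam (qe : R) (q qa qb : 'I_N -> R) :
  (forall i, q i = lam * qa i + (1 - lam) * qb i - lam * (1 - lam) * qe) ->
  2^-1 * \sum_i q i = lam * (2^-1 * \sum_i qa i) + (1 - lam) * (2^-1 * \sum_i qb i) -
  lam * (1 - lam) * (2^-1 * N%:R * qe).
Proof.
move=> h; rewrite (eq_bigr _ (fun i _ => h i)) sumrB big_split/= -!mulr_sumr sumr_const card_ord.
rewrite -[_ *+ N]mulr_natl; ring.
Qed.

Lemma J_soc_mix a b lam : L2F a -> L2F b ->
  let J := J_soc P T W A C0 Gam Gam0 B D D0 Q G R0 f sigma eta eta0 x0 u in
  J (fun t w => lam *: a t w + (1 - lam) *: b t w) = lam * J a + (1 - lam) * J b -
  lam * (1 - lam) * (2^-1 * N%:R * J_hom P T W A C0 Gam Gam0 Q G R0 (fun t w => a t w - b t w)).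
Proof.
move=> la lb J; have lab := L2F_lin lam (1 - lam) la lb; have lB := L2F_sub la lb.
rewrite /J (J_soc_quad la) (J_soc_quad lb) (J_soc_quad lab) (J_hom_quad lB).
set c := fun t w => _ + _; set e := fun t w => _ - _.
have h i : quad P T Q R0 G (dev c i) c (devT c i) =
    lam * quad P T Q R0 G (dev a i) a (devT a i) +
    (1 - lam) * quad P T Q R0 G (dev b i) b (devT b i) -
    lam * (1 - lam) * quad P T Q R0 G (hdev e) e (hdevT e) :=
  quad_mix T_gt0 P_complete W_bm Q R0 G (dev_L2F i lab) (dev_L2F i la) (dev_L2F i lb)
  (hdev_L2F lB) la lb (fun j => devT_sq i j lab) (fun j => devT_sq i j la)
  (fun j => devT_sq i j lb) (fun j => hdevT_sq j lB)
  (fun t tT => agent_dev_mix lam i Gam (eta t) la lb tT)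
  (fun t tT => agent_dev_sub i Gam (eta t) la lb tT)
  (agent_dev_mix lam i Gam0 eta0 la lb T_itv) (agent_dev_sub i Gam0 eta0 la lb T_itv).
exact: (half_sum_mix h).
Qed.

(** By [Jmix] both conditions compare multiples of [lam (1 - lam)], so the single test [b = 0],
    [lam = 1/2] already recovers coercivity. The factor [kappa] is N / 2 for the social functional
    and 1 for the homogeneous one. *)
Lemma uniformly_convexE (J q : process R Om n -> R) (kappa : R) : 0 < kappa ->
  (forall a b lam, L2F a -> L2F b ->
     J (fun t w => lam *: a t w + (1 - lam) *: b t w) = lam * J a + (1 - lam) * J b -
     lam * (1 - lam) * (kappa * q (fun t w => a t w - b t w))) ->
  uniformly_convex P T W J <->
  exists2 delta, 0 < delta & forall c, L2F c -> delta * fine (L2norm2 P T c) <= q c.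
Proof.
move=> k0 Jmix; split=> -[delta d0 h].
  exists (delta / kappa); first exact: divr_gt0.
  move=> c lc; have l0 : L2F (fun _ _ => 0 : 'cV[R]_n) by exact: (L2F0 T_gt0 P_complete W_bm).
  have half : 0 <= (2^-1 : R) <= 1 by lra.
  have := h c _ 2^-1 lc l0 half; rewrite (Jmix _ _ _ lc l0).
  rewrite (_ : (fun t w => c t w - 0) = c); last first.
    by apply/funext => t; apply/funext => w; rewrite subr0.
  move=> h'; rewrite mulrAC ler_pdivrMr//; lra.
exists (kappa * delta); first exact: mulr_gt0.
move=> a b lam la lb /andP[lam0 lam1]; rewrite Jmix// lerD2l lerN2.
have := h _ (L2F_sub la lb); set m := fine _; set j := q _ => hq.
have -> : kappa * delta * lam * (1 - lam) * m = lam * (1 - lam) * (kappa * (delta * m)) by ring.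
by apply: ler_wpM2l; [nra|apply: ler_wpM2l hq; exact: ltW].
Qed.

End Convexity.

(** * Completion of squares along the Riccati equation *)

Section ContinuousMatrices.
Context {R : realType}.
Variables a b : R.
Local Notation mu := (@lebesgue_measure R).
Local Notation wc f := ({within `[a, b], continuous (f : R -> R)}).

Lemma wc_cst (c : R) : wc (fun=> c).
Proof. by move=> t; exact: cvg_cst. Qed.

Lemma wcD f g : wc f -> wc g -> wc (fun t => f t + g t).
Proof. by move=> cf cg t; apply: cvgD; [exact: cf|exact: cg]. Qed.

Lemma wcM f g : wc f -> wc g -> wc (fun t => f t * g t).
Proof. by move=> cf cg t; apply: cvgM; [exact: cf|exact: cg]. Qed.

Lemma wcN f : wc f -> wc (fun t => - f t).
Proof. by move=> cf t; apply: cvgN; exact: cf. Qed.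

Lemma wc_norm f : wc f -> wc (fun t => `|f t|).
Proof. by move=> cf t; apply: cvg_norm; exact: cf. Qed.

Lemma wc_prod (I : Type) (r : seq I) (F : I -> R -> R) :
  (forall i, wc (F i)) -> wc (fun t => \prod_(i <- r) F i t).
Proof.
move=> cF; elim: r => [|i r ih].
  rewrite (_ : (fun t => _) = fun=> 1); first exact: wc_cst.
  by apply/funext => s; rewrite big_nil.
rewrite (_ : (fun t => _) = fun t => F i t * \prod_(j <- r) F j t); first exact: wcM.
by apply/funext => s; rewrite big_cons.
Qed.

Lemma wc_eq f g : (forall t, a <= t <= b -> f t = g t) -> wc g -> wc f.
Proof.
move=> fg; apply: subspace_eq_continuous => t.
by rewrite inE/= in_itv/= => tab; rewrite /from_subspace fg.
Qed.

Lemma wcV f : wc f -> (forall t, a <= t <= b -> f t != 0) -> wc (fun t => (f t)^-1).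
Proof.
move=> cf f0; apply/subspace_continuousP => t /=; rewrite in_itv/= => tab.
apply: cvgV; first exact: f0.
by move/subspace_continuousP : cf; apply; rewrite /= in_itv.
Qed.

Definition mxwc m n (F : R -> 'M[R]_(m, n)) : Prop := forall i j, wc (fun t => F t i j).

Lemma mxwc_cst m n (M : 'M[R]_(m, n)) : mxwc (fun=> M).
Proof. by move=> i j; exact: wc_cst. Qed.

Lemma mxwcD m n (F G : R -> 'M[R]_(m, n)) : mxwc F -> mxwc G -> mxwc (fun t => F t + G t).
Proof. move=> cF cG i j; rewrite (_ : (fun t => _) = fun t => F t i j + G t i j); first exact: wcD.
by apply/funext => t; rewrite mxE. Qed.

Lemma mxwcN m n (F : R -> 'M[R]_(m, n)) : mxwc F -> mxwc (fun t => - F t).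
Proof. move=> cF i j; rewrite (_ : (fun t => _) = fun t => - F t i j); first exact: wcN.
by apply/funext => t; rewrite mxE. Qed.

Lemma mxwcM m n p (F : R -> 'M[R]_(m, n)) (G : R -> 'M[R]_(n, p)) :
  mxwc F -> mxwc G -> mxwc (fun t => F t *m G t).
Proof.
move=> cF cG i j; rewrite (_ : (fun t => _) = fun t => \sum_k F t i k * G t k j).
  by apply: within_continuous_sum => k; exact: wcM.
by apply/funext => t; rewrite mxE.
Qed.

Lemma wc_det n (F : R -> 'M[R]_n) : mxwc F -> wc (fun t => \det (F t)).
Proof.
move=> cF; rewrite /determinant; apply: within_continuous_sum => s.
by apply: wcM; [exact: wc_cst|apply: wc_prod => i; exact: cF].
Qed.

Lemma mxwc_adj n (F : R -> 'M[R]_n) : mxwc F -> mxwc (fun t => \adj (F t)).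
Proof.
move=> cF i j; rewrite (_ : (fun t => _) =
    fun t => (-1) ^+ (j + i) * \det (row' j (col' i (F t)))).
  apply: wcM; [exact: wc_cst|apply: wc_det => k l].
  rewrite (_ : (fun t => _) = fun t => F t (lift j k) (lift i l)); first exact: cF.
  by apply/funext => t; rewrite !mxE.
by apply/funext => t; rewrite mxE.
Qed.

Lemma mxwc_inv n (F : R -> 'M[R]_n) : mxwc F ->
  (forall t, a <= t <= b -> F t \in unitmx) -> mxwc (fun t => invmx (F t)).
Proof.
move=> cF uF i j.
apply: (@wc_eq _ (fun t => (\det (F t))^-1 * (\adj (F t)) i j)) => [t tab|].
  by rewrite /invmx uF// !mxE.
apply: wcM; last exact: mxwc_adj.
apply: wcV; first exact: wc_det.
by move=> t tab; have := uF t tab; rewrite unitmxE unitfE.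
Qed.

(** Extension by 0: continuity on [[a, b]] becomes boundedness and measurability on the whole line,
    as the moment identities and the feedback gains require. *)
Definition cut (f : R -> R) (t : R) : R := f t * \1_(`[a, b]%classic) t.

Lemma cutE f t : a <= t <= b -> cut f t = f t.
Proof. by move=> tab; rewrite /cut indicE mem_set ?mulr1//= in_itv. Qed.

Lemma cut0 f t : ~~ (a <= t <= b) -> cut f t = 0.
Proof. by move=> tab; rewrite /cut indicE memNset ?mulr0//= in_itv/=; exact/negP. Qed.

Lemma measurable_cut f : wc f -> measurable_fun setT (cut f : measurableTypeR R -> R).
Proof.
move=> cf; have mf : measurable_fun (`[a, b]%classic) (f : measurableTypeR R -> R).
  exact: (subspace_continuous_measurable_fun (measurable_itv _) cf).
rewrite (_ : cut f = f \_ `[a, b]); first by apply/(measurable_restrictT _ _).1.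
apply/funext => t; rewrite patchE /cut indicE.
by case: (_ \in _); rewrite ?mulr1 ?mulr0.
Qed.

Lemma wc_bounded f : wc f -> exists2 M : R, 0 <= M & forall t, a <= t <= b -> `|f t| <= M.
Proof.
move=> cf; have [ab|ba] := leP a b; last first.
  by exists 0 => // t /andP[h1 h2]; have := lt_le_trans ba (le_trans h1 h2); rewrite ltxx.
have [c _ hc] := EVT_max ab (wc_norm cf).
by exists `|f c| => // t tab; apply: hc; rewrite in_itv.
Qed.

Lemma mxwc_bounded m n (F : R -> 'M[R]_(m, n)) : mxwc F ->
  exists2 M : R, 0 <= M & forall t, a <= t <= b -> forall i j, `|F t i j| <= M.
Proof.
move=> cF; have /choice[M hM] : forall p : 'I_m * 'I_n, exists M : R, 0 <= M /\
    forall t, a <= t <= b -> `|F t p.1 p.2| <= M.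
  by move=> p; have [M M0 h] := wc_bounded (cF p.1 p.2); exists M.
exists (\sum_p M p); first by apply: sumr_ge0 => p _; case: (hM p).
move=> t tab i j; apply: le_trans ((hM (i, j)).2 t tab) _.
by rewrite (bigD1 (i, j))//= lerDl; apply: sumr_ge0 => p _; case: (hM p).
Qed.

Lemma cut_le f (M : R) : 0 <= M -> (forall t, a <= t <= b -> `|f t| <= M) ->
  forall t, `|cut f t| <= M.
Proof.
move=> M0 h t; have [tab|tab] := boolP (a <= t <= b); first by rewrite cutE// h.
by rewrite cut0// normr0.
Qed.

Lemma wc_FTC F f : wc F -> wc f -> (forall t, a < t < b -> derivable F t 1 /\ F^`()%classic t = f t) ->
  forall t, a <= t <= b -> F t = F a + \int[mu]_(s in `[a, t]) f s.
Proof.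
move=> cF cf dF t /andP[]; rewrite le_eqVlt => /predU1P[<- _|at_ tb].
  by rewrite set_itv1 Rintegral_set1 addr0.
have sub : `[a, t]%classic `<=` `[a, b].
  by apply: subset_itvl; rewrite bnd_simp.
have cF' := continuous_subspaceW sub cF.
have [cF1 cF2 cF3] := (continuous_within_itvP F at_).1 cF'.
have inab s : s \in `]a, t[ -> a < s < b.
  by rewrite in_itv/= => /andP[-> /lt_le_trans->].
rewrite /Rintegral (continuous_FTC2 at_ (continuous_subspaceW sub cf) (F := F)).
- by rewrite -EFinB /= addrC subrK.
- by split => // s /inab/dF[].
- by move=> s /inab/dF[].
Qed.

End ContinuousMatrices.

Section Forms.
Context {R : realType} {n : nat}.
Implicit Types (M : 'M[R]_n) (x y : 'cV[R]_n).

Definition bform M x y : R := \sum_j \sum_i M j i * (x j 0 * y i 0).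

Lemma bformE M x y : bform M x y = (x^T *m M *m y) 0 0.
Proof.
rewrite /bform mxE exchange_big/=; apply: eq_bigr => i _.
rewrite mxE mulr_suml; apply: eq_bigr => j _; rewrite !mxE; ring.
Qed.

Lemma qformbE M x : qform M x = bform M x x.
Proof. by rewrite bformE. Qed.

Lemma bformZl M (c : R) x y : bform M (c *: x) y = c * bform M x y.
Proof.
rewrite /bform mulr_sumr; apply: eq_bigr => j _; rewrite mulr_sumr; apply: eq_bigr => i _.
rewrite mxE; ring.
Qed.

Lemma bformZr M (c : R) x y : bform M x (c *: y) = c * bform M x y.
Proof.
rewrite /bform mulr_sumr; apply: eq_bigr => j _; rewrite mulr_sumr; apply: eq_bigr => i _.
rewrite mxE; ring.
Qed.

Lemma qformZ M (c : R) x : qform M (c *: x) = c ^+ 2 * qform M x.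
Proof. by rewrite !qformbE bformZl bformZr mulrA -expr2. Qed.

Lemma addmxE m p (F G : 'M[R]_(m, p)) i j : (F + G) i j = F i j + G i j.
Proof. by rewrite mxE. Qed.

Lemma qformD M M' x : qform (M + M') x = qform M x + qform M' x.
Proof. by rewrite /qform mulmxDr mulmxDl mxE. Qed.

Lemma qformN M x : qform (- M) x = - qform M x.
Proof. by rewrite /qform mulmxN mulNmx mxE. Qed.

Lemma qform_mul m (M : 'M[R]_m) (C : 'M[R]_(m, n)) x :
  qform M (C *m x) = qform (C^T *m M *m C) x.
Proof. by rewrite /qform trmx_mul !mulmxA. Qed.

Lemma bformC M x y : M^T = M -> bform M x y = bform M y x.
Proof.
move=> sM; rewrite /bform exchange_big/=; apply: eq_bigr => i _; apply: eq_bigr => j _.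
by rewrite -[in LHS]sM mxE [y i 0 * _]mulrC.
Qed.

Lemma qformDv M x y : M^T = M -> qform M (x + y) = qform M x + 2 * bform M x y + qform M y.
Proof.
move=> sM; have h := bformC x y sM; rewrite !bformE in h *.
by rewrite /qform [(x + y)^T]linearD /= !mulmxDl !mulmxDr !addmxE -h; ring.
Qed.

Lemma sqnorm_ge0 x : 0 <= sqnorm x.
Proof. by apply: sumr_ge0 => i _; exact: sqr_ge0. Qed.

Lemma sqnorm_gt0 x : x != 0 -> 0 < sqnorm x.
Proof.
move=> x0; rewrite lt_neqAle sqnorm_ge0 andbT eq_sym; apply: contra x0.
rewrite psumr_eq0; last by move=> i _; exact: sqr_ge0.
move=> /allP h; apply/eqP/matrixP => i j; rewrite (ord1 j) mxE.
by have := h i (mem_index_enum i); rewrite sqrf_eq0 => /eqP.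
Qed.

Lemma le_sqnorm x i : `|x i 0| ^+ 2 <= sqnorm x.
Proof.
rewrite real_normK ?num_real// /sqnorm (bigD1 i)//= lerDl.
by apply: sumr_ge0 => j _; exact: sqr_ge0.
Qed.

(** Young's inequality [u w <= rho w^2 + u^2 / (4 rho)], entry by entry. The free parameter allows a
    mixed term to be charged almost entirely to one of the two vectors. *)
Lemma bform_le M (x y : 'cV[R]_n) (B rho : R) : (forall i j, `|M i j| <= B) -> 0 < rho ->
  `|bform M x y| <= n%:R * B * (rho * sqnorm y + (4 * rho)^-1 * sqnorm x).
Proof.
move=> hB r0.
have e : n%:R * B * (rho * sqnorm y + (4 * rho)^-1 * sqnorm x) =
    \sum_j \sum_i B * (rho * y i 0 ^+ 2 + (4 * rho)^-1 * x j 0 ^+ 2).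
  under eq_bigr do rewrite -mulr_sumr big_split/= -mulr_sumr sumr_const card_ord -/(sqnorm y).
  rewrite -mulr_sumr big_split/= sumr_const card_ord sumrMnl -mulr_sumr -/(sqnorm x).
  by rewrite -[X in _ = _ * (X + _)]mulr_natl -[X in _ = _ * (_ + X)]mulr_natl; ring.
rewrite e /bform; apply: le_trans (ler_norm_sum _ _ _) _; apply: ler_sum => j _.
apply: le_trans (ler_norm_sum _ _ _) _; apply: ler_sum => i _.
rewrite normrM; apply: ler_pM => //.
rewrite normrM -(real_normK (num_real (x j 0))) -(real_normK (num_real (y i 0))).
move: `|x j 0| `|y i 0| => u w.
have := sqr_ge0 (2 * rho * w - u) => h.
rewrite -(ler_pM2l (_ : 0 < 4 * rho)) ?mulr_gt0//.
have -> : 4 * rho * (rho * w ^+ 2 + (4 * rho)^-1 * u ^+ 2) = (2 * rho * w) ^+ 2 + u ^+ 2.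
  by field; rewrite gt_eqF.
lra.
Qed.

Lemma qform_le M x (B : R) : (forall i j, `|M i j| <= B) -> `|qform M x| <= n%:R * B * sqnorm x.
Proof.
move=> hB; rewrite qformbE; have half0 : 0 < 2^-1 :> R by rewrite invr_gt0.
apply: le_trans (bform_le x x hB half0) _.
by rewrite le_eqVlt; apply/orP; left; apply/eqP; field.
Qed.

(** The form is evaluated at [q x - p y], with [q] its value at [y] and [p] the mixed term; the
    result is [q] times the difference of the two sides. *)
Lemma qform_psd_CS M x y : M^T = M -> (forall z, 0 <= qform M z) -> 0 < qform M y ->
  bform M x y ^+ 2 <= qform M x * qform M y.
Proof.
move=> sM M0 y0; set p := bform M x y; set q := qform M y.
have := M0 (q *: x + (- p) *: y); rewrite qformDv//.
have -> : qform M (q *: x) = q ^+ 2 * qform M x.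
  rewrite qformZ; ring.
have -> : qform M ((- p) *: y) = p ^+ 2 * q.
  rewrite qformZ -/q; ring.
have -> : bform M (q *: x) ((- p) *: y) = - (q * p * p).
  rewrite bformZl bformZr -/p; ring.
move=> h; have : 0 <= q * (qform M x * q - p ^+ 2).
  by apply: le_trans h _; rewrite le_eqVlt; apply/orP; left; apply/eqP; ring.
by rewrite pmulr_rge0// subr_ge0.
Qed.

Lemma pdef_unit M : pdef M -> M \in unitmx.
Proof.
move=> [sM M0]; rewrite unitmxE unitfE; apply/negP => /eqP/eqP/det0P[v v0 vM].
have := M0 v^T; rewrite -(inj_eq trmx_inj) trmxK trmx0 v0 /qform trmxK vM mul0mx mxE ltxx.
by move=> /(_ isT).
Qed.

(** Cauchy-Schwarz for [M] at [x] and [M^-1 x] bounds the fourth power of the norm of [x] by the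
    product of the forms of [M] and of its inverse at [x]. A bound on the entries of the inverse
    thus gives a lower bound on [M] without eigenvalues. *)
Lemma pdef_lower M (B : R) : 0 < B -> pdef M -> (forall i j, `|(invmx M) i j| <= B) ->
  forall x, (n%:R * B)^-1 * sqnorm x <= qform M x.
Proof.
move=> B0 pM hB x; have [sM M0] := pM; have uM := pdef_unit pM.
have [->|x0] := eqVneq x 0.
  by rewrite /qform trmx0 !mul0mx mxE /sqnorm big1 ?mulr0// => i _; rewrite mxE expr0n.
have s0 := sqnorm_gt0 x0.
have n0 : 0 < n%:R :> R.
  case: (n) x x0 {s0} => [|m] x x0; last by rewrite ltr0n.
  by move: x0; rewrite (flatmx0 x) eqxx.
set y := invmx M *m x; have My : M *m y = x by rewrite mulmxA mulmxV// mul1mx.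
have y0 : y != 0 by apply: contra x0 => /eqP y0; rewrite -My y0 mulmx0.
have qy : qform M y = qform (invmx M) x.
  have siM : (invmx M)^T = invmx M by rewrite trmx_inv sM.
  rewrite qform_mul siM -[_ *m M]/(_) mulVmx// mul1mx //.
have bxy : bform M x y = sqnorm x.
  rewrite bformE -mulmxA My mxE; apply: eq_bigr => i _; rewrite mxE; ring.
have psd z : 0 <= qform M z.
  have [->|/M0/ltW//] := eqVneq z 0; by rewrite /qform trmx0 !mul0mx mxE.
have := qform_psd_CS x sM psd (M0 y y0); rewrite bxy qy => h1.
have h2 := le_trans (ler_norm _) (qform_le x hB).
have h3 : sqnorm x * sqnorm x <= qform M x * (n%:R * B) * sqnorm x.
  rewrite -expr2; apply: le_trans h1 _; rewrite -mulrA; apply: ler_wpM2l => //.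
rewrite ler_pM2r// in h3.
by rewrite mulrC ler_pdivrMr// mulr_gt0.
Qed.

End Forms.

Section Lyapunov.
Context {R : realType} {d : measure_display} {Om : measurableType d} {J : finType}.
Variables (P : probability Om R) (T : R) (W : J -> R -> Om -> R).
Hypothesis T_gt0 : 0 < T.
Hypothesis P_complete : measure_is_complete P.
Hypothesis W_bm : independent_brownians P T W.
Local Notation mu := (@lebesgue_measure R).
Local Notation TS := (timespace P).
Local Notation L2F := (L2F P T W).
Local Notation L2p := (L2p P T W).
Variables (n : nat) (A : 'M[R]_n) (K Kd : R -> 'M[R]_n).
Hypothesis cK : mxwc 0 T K.
Hypothesis cKd : mxwc 0 T Kd.
Hypothesis KE : forall i j t, 0 <= t <= T ->
  K t i j = K 0 i j + \int[mu]_(s in `[0, t]) Kd s i j.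

Lemma lyapunov_qform (M M' : 'M[R]_n) (x y : 'cV[R]_n) :
  qform (M' + A^T *m M + M *m A) x + qform M y =
  \sum_i \sum_j (M' i j * (x i 0 * x j 0) + (M i j * ((A *m x) i 0 * x j 0) +
    M i j * (x i 0 * (A *m x) j 0) + M i j * (y i 0 * y j 0))).
Proof.
rewrite !qformD.
have -> : qform (A^T *m M) x = bform M (A *m x) x.
  by rewrite bformE /qform trmx_mul !mulmxA.
have -> : qform (M *m A) x = bform M x (A *m x) by rewrite bformE /qform !mulmxA.
rewrite !qformbE /bform -!big_split/=; apply: eq_bigr => i _.
by rewrite -!big_split/=; apply: eq_bigr => j _; ring.
Qed.

(** Ito's formula for [z^T K z] in expectation: [weighted_moment] for each pair of components with
    the weight [K i j], summed over the pairs. *)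
Lemma lyapunov_identity (k0 : J) (z h : process R Om n) (hh : J -> 'I_n -> R -> Om -> R) :
  L2F z -> L2F h ->
  (forall j, sproc P T W 0 (comp (fun t w => A *m z t w) j) (fun k => hh k j) (comp z j)) ->
  (forall k j t w, k != k0 -> hh k j t w = 0) ->
  (forall j, hh k0 j = comp h j) ->
  let F := win T (fun t w =>
    qform (Kd t + A^T *m K t + K t *m A) (z t w) + qform (K t) (h t w)) in
  TS.-integrable setT (EFin \o F) /\
  \int[P]_w qform (K T) (z T w) = \int[TS]_y F y.
Proof.
move=> lz lh pz hh0 hhE F.
have TT : 0 <= T <= T by rewrite lexx ltW.
have lAz := L2F_mx T_gt0 P_complete W_bm A lz.
have cz := L2F_comp T_gt0 P_complete W_bm lz.
have cb := L2F_comp T_gt0 P_complete W_bm lAz.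
have ch := L2F_comp T_gt0 P_complete W_bm lh.
pose kk i j := cut 0 T (fun t => K t i j); pose kap i j := cut 0 T (fun t => Kd t i j).
have [M1 M10 hM1] := mxwc_bounded cK; have [M2 M20 hM2] := mxwc_bounded cKd.
pose M := M1 + M2.
have kkM i j t : `|kk i j t| <= M.
  by apply: cut_le => [|s sT]; [exact: addr_ge0|apply: le_trans (hM1 s sT i j) _; rewrite lerDl].
have kapM i j t : `|kap i j t| <= M.
  by apply: cut_le => [|s sT]; [exact: addr_ge0|apply: le_trans (hM2 s sT i j) _; rewrite lerDr].
have mkk i j : measurable_fun setT (kk i j : measurableTypeR R -> R) := measurable_cut (@cK i j).
have mkap i j : measurable_fun setT (kap i j : measurableTypeR R -> R) := measurable_cut (@cKd i j).
have kkE i j t : 0 <= t <= T -> kk i j t = kk i j 0 + \int[mu]_(s in `[0, t]) kap i j s.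
  move=> tT; have z0 : 0 <= (0 : R) <= T by rewrite lexx ltW.
  rewrite /kk (cutE _ tT) (cutE _ z0) (KE i j tT); congr (_ + _).
  apply: eq_Rintegral => s; rewrite inE/= in_itv/= => /andP[s0 st].
  by rewrite /kap cutE// s0 (le_trans st)//; case/andP: tT.
have mom i j := weighted_moment T_gt0 P_complete W_bm (mkk i j) (mkap i j) (kkM i j) (kapM i j)
  (kkE i j) (pz i) (pz j) (cz i) (cz j) (fun k hk t w => hh0 k i t w hk)
  (fun k hk t w => hh0 k j t w hk).
pose g i j (y : measurableTypeR R * Om) :=
  win T (fun t w => kap i j t * comp z i t w) y * win T (comp z j) y +
  (win T (fun t w => kk i j t * comp (fun t w => A *m z t w) i t w) y * win T (comp z j) y +
   win T (fun t w => kk i j t * comp z i t w) y * win T (comp (fun t w => A *m z t w) j) y +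
   win T (fun t w => kk i j t * comp h i t w) y * win T (comp h j) y).
have skk i j X : L2p X -> sq TS (win T (fun t w => kk i j t * X t w)).
  by move=> lX; case: (L2pM (mkk i j) (kkM i j) lX).
have skap i j X : L2p X -> sq TS (win T (fun t w => kap i j t * X t w)).
  by move=> lX; case: (L2pM (mkap i j) (kapM i j) lX).
have i1 i j := integrable_mulsq (skap i j _ (cz i)) (proj2 (cz j)).
have i2 i j := integrable_mulsq (skk i j _ (cb i)) (proj2 (cz j)).
have i3 i j := integrable_mulsq (skk i j _ (cz i)) (proj2 (cb j)).
have i4 i j := integrable_mulsq (skk i j _ (ch i)) (proj2 (ch j)).
have i23 i j := integrableRD (i2 i j) (i3 i j).
have i234 i j := integrableRD (i23 i j) (i4 i j).
have ig i j : TS.-integrable setT (EFin \o g i j) := integrableRD (i1 i j) (i234 i j).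
have gE i j : \int[TS]_y g i j y = kk i j T * ip P (comp z i T) (comp z j T).
  rewrite mom hhE hhE /g (RintegralD measurableT (i1 i j) (i234 i j)).
  by rewrite (RintegralD measurableT (i23 i j) (i4 i j)) (RintegralD measurableT (i2 i j) (i3 i j)).
have [iG GE] := Rintegral_sum (index_enum _)
  (fun i => proj1 (Rintegral_sum (index_enum _) (ig i))).
have FE : F = fun y => \sum_i \sum_j g i j y.
  apply/funext => y; rewrite /F /g /win /kap /kk /comp.
  have [yT|yT] := boolP (0 <= y.1 <= T).
    have -> : \1_(`[0, T]%classic) y.1 = 1 :> R by rewrite indicE mem_set//= in_itv.
    rewrite mulr1 lyapunov_qform; apply: eq_bigr => i _; apply: eq_bigr => j _.
    by rewrite !cutE// !mulr1; ring.
  have -> : \1_(`[0, T]%classic) y.1 = 0 :> R.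
    by rewrite indicE memNset//= in_itv/=; exact/negP.
  by rewrite mulr0 big1// => i _; rewrite big1// => j _; rewrite !mulr0 !addr0.
rewrite FE; split => //.
rewrite int_qform; last first.
  by move=> j; exact: (sproc_sq T_gt0 P_complete W_bm (pz j) TT).
rewrite GE; apply: eq_bigr => i _; rewrite (proj2 (Rintegral_sum (index_enum _) (ig i))).
by apply: eq_bigr => j _; rewrite gE /kk cutE.
Qed.

End Lyapunov.

Section RiccatiSufficient.
Context {R : realType} {d : measure_display} {Om : measurableType d}.
Context {N n : nat}.
Variables (P : probability Om R) (T : R) (W : 'I_N.+1 -> R -> Om -> R).
Hypothesis T_gt0 : 0 < T.
Hypothesis P_complete : measure_is_complete P.
Hypothesis W_bm : independent_brownians P T W.
Variables (A C0 Gam Gam0 Q G R0 : 'M[R]_n).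
Local Notation mu := (@lebesgue_measure R).
Local Notation TS := (timespace P).
Local Notation L2F := (L2F P T W).
Local Notation L2p := (L2p P T W).
Local Notation hom := (hom_state P T W A C0).

(** In this form the constant term of the Riccati equation is the matrix of the running state cost
    of [J_hom], sign included, and the terminal value is that of the terminal cost. *)
Lemma XiE (F M : 'M[R]_n) : Xi F M - M = - ((1%:M - F)^T *m M *m (1%:M - F)).
Proof.
rewrite /Xi [(1%:M - F)^T]linearB/= trmx1 !mulmxBr !mulmxBl !mul1mx !mulmx1.
by move: (F^T *m M) (M *m F) (F^T *m M *m F) => X Y Z; apply/matrixP => i j; rewrite !mxE; ring.
Qed.

Variables K Kd : R -> 'M[R]_n.
Hypothesis cK : mxwc 0 T K.
Hypothesis cKd : mxwc 0 T Kd.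
Hypothesis KE : forall i j t, 0 <= t <= T ->
  K t i j = K 0 i j + \int[mu]_(s in `[0, t]) Kd s i j.
Hypothesis KT : K T = Xi Gam0 G - G.

(** By [KT] the terminal cost is the mean of [z^T K z] at time [T], which the moment identity turns
    into a running cost. Stating this before any equation for [K] is imposed makes it available in
    both directions of the equivalence. *)
Lemma J_hom_lyapunov c : L2F c ->
  let F := win T (fun t w =>
    qform (Kd t + A^T *m K t + K t *m A + (Xi Gam Q - Q)) (hom c t w) +
    qform (K t) (C0 *m hom c t w + c t w) + qform R0 (c t w)) in
  TS.-integrable setT (EFin \o F) /\
  J_hom P T W A C0 Gam Gam0 Q G R0 c = \int[TS]_y F y.
Proof.
move=> lc F; have [lz pz] := hom_stateP T_gt0 P_complete W_bm A C0 lc.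
have TT : 0 <= T <= T by rewrite lexx ltW.
set z := hom c in lz pz F *.
have lCz := L2F_mx T_gt0 P_complete W_bm C0 lz.
have lh := L2F_D T_gt0 P_complete W_bm lCz lc.
pose hh (k : 'I_N.+1) j t w :=
  if k == ord0 then comp (fun t w => C0 *m z t w + c t w) j t w else 0.
have pz' j : sproc P T W 0 (comp (fun t w => A *m z t w) j) (fun k => hh k j) (comp z j).
  apply: sproc_congr (pz j); first by rewrite mxE.
  - by move=> t w; rewrite /drift /comp !mxE addr0.
  - move=> k t w; rewrite /diffu /hh /comp /coef0 /noise0; case: (k == ord0).
      by rewrite !mxE.
    by rewrite big1 ?mxE ?addr0// => i _; rewrite mxE mul0r.
  - by [].
have [i1 e1] := lyapunov_identity T_gt0 P_complete W_bm cK cKd KE lz lh pz'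
  (fun k j t w (hk : k != ord0) => ifN_eq _ _ hk) (fun j => erefl).
have lGz := L2F_mx T_gt0 P_complete W_bm (1%:M - Gam) lz.
have [i2 _] := win_qform T_gt0 P_complete W_bm Q lGz.
have [i3 _] := win_qform T_gt0 P_complete W_bm R0 lc.
set F1 := win T (fun t w => _ + qform (K t) (_ + _)) in i1 e1.
set F2 := win T (fun t w => qform Q _) in i2; set F3 := win T _ in i3.
have FE : F = fun y => F1 y + ((-1) * F2 y + F3 y).
  apply/funext => y; rewrite /F /F1 /F2 /F3 /win XiE qformD qformN -qform_mul; ring.
have i23 := integrableRD (integrableRZ (-1) i2) i3.
rewrite FE; split; first exact: integrableRD.
rewrite RintegralD// -e1 /J_hom -/z addrC; congr (_ + _).
  have sz j : sq P (fun w => z T w j 0) := sproc_sq T_gt0 P_complete W_bm (pz' j) TT.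
  under [in LHS]eq_Rintegral do rewrite qform_mul.
  rewrite !int_qform// KT XiE /bil -sumrN; apply: eq_bigr => j _.
  by rewrite -sumrN; apply: eq_bigr => i _; rewrite [in RHS]mxE mulNr.
have E23 : win T (fun t w => - qform Q ((1%:M - Gam) *m z t w) + qform R0 (c t w)) =
    fun y => (-1) * F2 y + F3 y.
  by apply/funext => y; rewrite /F2 /F3 /win; ring.
by rewrite E_int_win E23.
Qed.

End RiccatiSufficient.

Section CompletionOfSquares.
Context {R : realType} {n : nat}.

(** With [M = K + R0] and [L = M^-1 K C0] one has [M L = K C0]. Hence the mixed term of the square
    is the mixed term on the left, and the form of [M] at [L z] is the quadratic term of the Riccati
    equation. *)
Lemma completed_square (K R0 C0 X : 'M[R]_n) (z c : 'cV[R]_n) : K^T = K -> R0^T = R0 -> K + R0 \in unitmx ->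
  X + C0^T *m K *m C0 - C0^T *m K *m invmx (K + R0) *m K *m C0 = 0 ->
  qform X z + qform K (C0 *m z + c) + qform R0 c =
  qform (K + R0) (c + invmx (K + R0) *m K *m C0 *m z).
Proof.
move=> sK sR uM hX; set M := K + R0 in uM hX *.
have sM : M^T = M by rewrite linearD/= sK sR.
have -> : X = C0^T *m K *m invmx M *m K *m C0 - C0^T *m K *m C0.
  by apply/eqP; rewrite -subr_eq0 opprB addrA; apply/eqP; rewrite -[RHS]hX addrAC.
set L := invmx M *m K *m C0.
have ML : M *m L = K *m C0 by rewrite /L !mulmxA mulmxV// mul1mx.
have e1 : bform M c (L *m z) = bform K (C0 *m z) c.
  move: (L) ML => L' ML; by rewrite (bformC _ _ sK) !bformE !mulmxA -(mulmxA c^T M L') ML !mulmxA.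
have e2 : qform M (L *m z) = qform (C0^T *m K *m invmx M *m K *m C0) z.
  rewrite qform_mul -mulmxA ML /L !trmx_mul sK trmx_inv sM !mulmxA.
  by [].
rewrite !qformDv// e1 e2 qformD qformN -qform_mul /M qformD; ring.
Qed.

Lemma pdef_sym (K R0 : 'M[R]_n) : R0^T = R0 -> pdef (K + R0) -> K^T = K.
Proof. by move=> sR [sM _]; rewrite -[LHS](addrK R0) -{1}sR -linearD/= sM addrK. Qed.

End CompletionOfSquares.

(** * Controls as deviations from a linear feedback *)

Section Feedback.
Context {R : realType} {d : measure_display} {Om : measurableType d}.
Context {N n : nat}.
Variables (P : probability Om R) (T : R) (W : 'I_N.+1 -> R -> Om -> R).
Hypothesis T_gt0 : 0 < T.
Hypothesis P_complete : measure_is_complete P.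
Hypothesis W_bm : independent_brownians P T W.
Variables (A C0 : 'M[R]_n).
Local Notation mu := (@lebesgue_measure R).
Local Notation TS := (timespace P).
Local Notation L2F := (L2F P T W).
Local Notation L2p := (L2p P T W).
Local Notation hom := (hom_state P T W A C0).

Lemma wnorm0 t : wnorm P t (fun _ _ => 0 : R) = 0.
Proof. by apply: ip0l => z; rewrite /win mul0r. Qed.

Lemma sum_wnorm_le m (X : 'I_m -> R -> Om -> R) t (k : R -> R) : 0 <= t <= T ->
  (forall j, L2p (X j)) -> (forall s, 0 <= s <= t -> forall j, sq P (X j s)) ->
  measurable_fun setT (k : measurableTypeR R -> R) ->
  (forall s, 0 <= s <= t -> \sum_j ip P (X j s) (X j s) <= k s) ->
  ((\sum_j wnorm P t (X j))%:E <= \int[mu]_(s in `[0%R, t]) (k s)%:E)%E.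
Proof.
move=> /andP[_ tT] lX sX mk hk.
have sW j : sq TS (win t (X j)) := L2p_win (lX j) tT.
rewrite -sumEFin (eq_bigr (fun j => \int[TS]_z (win t (X j) z ^+ 2)%:E)%E); last first.
  by move=> j _; rewrite /wnorm -ipE.
apply: sum_win_sq_bound => // [j|s st]; first by case: (sW j).
rewrite (eq_bigr (fun j => (ip P (X j s) (X j s))%:E)) => [|j _].
  by rewrite sumEFin lee_fin; exact: hk.
by rewrite ipE//; exact: sX.
Qed.

Lemma wnorm_noise0 t (v : process R Om n) j :
  \sum_k wnorm P t (comp (noise0 (N := N) v k) j) = wnorm P t (comp v j).
Proof.
rewrite (bigD1 ord0)//= big1 ?addr0//.
move=> k k0; rewrite (_ : comp _ j = fun _ _ => 0); first exact: wnorm0.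
by apply/funext => s; apply/funext => w; rewrite /comp /noise0 (negPf k0) mxE.
Qed.

Lemma sum_wnorm (v : process R Om n) : L2F v ->
  \int[TS]_z win T (fun t w => sqnorm (v t w)) z = \sum_j wnorm P T (comp v j) /\
  TS.-integrable setT (EFin \o win T (fun t w => sqnorm (v t w))).
Proof.
move=> lv; have sqE (x : 'cV[R]_n) : sqnorm x = qform 1%:M x.
  by rewrite /qform mulmx1 mxE; apply: eq_bigr => i _; rewrite mxE.
rewrite (_ : (fun t w => _) = fun t w => qform 1%:M (v t w)); last first.
  by apply/funext => s; apply/funext => w; exact: sqE.
have [h1 h2] := win_qform T_gt0 P_complete W_bm 1%:M lv.
split => //; rewrite h2 /bilT /bil; apply: eq_bigr => j _.
rewrite (bigD1 j)//= mxE eqxx mul1r big1 ?addr0// => i ij.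
by rewrite mxE eq_sym (negPf ij) mul0r.
Qed.

(* The gains are bounded measurable: the closed loop is again a linear
   equation, whose input is the deviation v from the feedback. *)
Variables (L : 'I_n -> 'I_n -> R -> R) (ML : R).
Hypothesis mL : forall i j, measurable_fun setT (L i j : measurableTypeR R -> R).
Hypothesis LM : forall i j t, `|L i j t| <= ML.

Definition loop (k : 'I_N.+1) j i t := if k == ord0 then C0 j i - L j i t else 0.

Lemma loop_bound : exists cm : R, (forall j i, `|A j i| <= cm) /\
  (forall k j i t, `|loop k j i t| <= cm).
Proof.
have [cm [hA hC]] := coef_bound A (fun _ : 'I_1 => C0).
have cm0 (j i : 'I_n) : 0 <= cm by exact: (le_trans (normr_ge0 _) (hA j i)).
have M0 (j i : 'I_n) : 0 <= ML := le_trans (normr_ge0 _) (LM j i 0).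
exists (cm + ML); split=> [j i|k j i t].
  by apply: le_trans (hA j i) _; rewrite lerDl (M0 j i).
rewrite /loop; case: (k == ord0); last by rewrite normr0 addr_ge0 ?(cm0 j i) ?(M0 j i).
by apply: le_trans (ler_normB _ _) _; apply: lerD => //; exact: (hC ord0 j i 0).
Qed.

Lemma measurable_loop k j i : measurable_fun setT (loop k j i : measurableTypeR R -> R).
Proof.
rewrite /loop; case: (k == ord0); last exact: measurable_cst.
by apply: measurable_funB => //; exact: mL.
Qed.

Definition deviation (c z : process R Om n) : process R Om n :=
  fun t w => \col_j (c t w j 0 + \sum_i L j i t * z t w i 0).

Lemma deviation_L2F c z : L2F c -> L2F z -> L2F (deviation c z).
Proof.
move=> lc lz; apply: (comp_L2F T_gt0 P_complete W_bm) => j.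
have -> : comp (deviation c z) j = fun t w => comp c j t w + \sum_i L j i t * comp z i t w.
  by apply/funext => t; apply/funext => w; rewrite /comp mxE.
have cc := L2F_comp T_gt0 P_complete W_bm lc; have cz := L2F_comp T_gt0 P_complete W_bm lz.
by apply: L2pD => //; apply: L2p_sum => i; exact: (L2pM (mL j i) (LM j i) (cz i)).
Qed.

Lemma closed_loop c : L2F c ->
  lin_sproc P T W (fun j i => A j i) loop (fun=> 0) (fun _ _ _ => 0)
    (fun k => comp (noise0 (deviation c (hom c)) k)) (comp (hom c)).
Proof.
move=> lc j; have [_ pz] := hom_stateP T_gt0 P_complete W_bm A C0 lc.
apply: sproc_congr (pz j) => //; first by rewrite mxE.
- by move=> t w; rewrite /drift /comp mxE.
- move=> k t w; rewrite /diffu /loop /coef0 /noise0 /comp.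
  case: (k == ord0).
    rewrite mxE addrCA addrC -big_split/=; congr (_ + _); apply: eq_bigr => i _; ring.
  by rewrite !mxE !addr0; apply: eq_bigr => i _; rewrite mxE.
Qed.

Lemma loop_le : exists2 k0 : R, 0 <= k0 &
  forall v x, L2F v -> L2F x ->
  lin_sproc P T W (fun j i => A j i) loop (fun=> 0) (fun _ _ _ => 0)
    (fun k => comp (noise0 v k)) (comp x) ->
  forall t, 0 <= t <= T ->
  \sum_j ip P (comp x j t) (comp x j t) <= k0 * \sum_j wnorm P t (comp v j).
Proof.
have [cm [hA hC]] := loop_bound.
pose k0 : R := 4 * @sprocK R 'I_N.+1 T * expR (2 * @lin_rate R 'I_N.+1 T n cm * T).
exists k0.
  by rewrite /k0 mulr_ge0 ?expR_ge0// mulr_ge0// (@sprocK_ge0 R 'I_N.+1 T T_gt0).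
move=> v x lv lx px t tT.
have l0 : L2p (fun _ _ => 0) := L2p0 P T W.
have := lin_sproc_bound T_gt0 P_complete W_bm hA hC measurable_loop px
  (L2F_comp T_gt0 P_complete W_bm lx) (fun=> l0)
  (fun k j => L2F_comp T_gt0 P_complete W_bm (noise0_L2F T_gt0 P_complete W_bm k lv) j) tT.
rewrite [X in _ * (X + _)]big1 => [|j _]; last exact: wnorm0.
by rewrite add0r (eq_bigr _ (fun j _ => wnorm_noise0 t _ j)).
Qed.

Lemma control_le_deviation : exists2 k1 : R, 0 < k1 &
  forall c, L2F c -> fine (L2norm2 P T c) <=
  k1 * \sum_j wnorm P T (comp (deviation c (hom c)) j).
Proof.
have [k0 k00 hk] := loop_le.
exists (2 * (n%:R * ML ^+ 2) * n%:R * (T * k0) + 2).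
  rewrite ltr_wpDl//; apply: mulr_ge0; last by rewrite mulr_ge0// ltW.
  by apply: mulr_ge0 => //; apply: mulr_ge0 => //; apply: mulr_ge0 => //; exact: sqr_ge0.
move=> c lc; have [lz pz] := hom_stateP T_gt0 P_complete W_bm A C0 lc.
have cc := L2F_comp T_gt0 P_complete W_bm lc; have cz := L2F_comp T_gt0 P_complete W_bm lz.
have lv := deviation_L2F lc lz; have cv := L2F_comp T_gt0 P_complete W_bm lv.
have TT : 0 <= T <= T by rewrite lexx ltW.
set V := \sum_j wnorm P T (comp _ j).
have hz : \sum_j wnorm P T (comp (hom c) j) <= T * k0 * V.
  rewrite -lee_fin; apply: le_trans (sum_wnorm_le TT cz _ (measurable_cst (k0 * V)) _) _.
  - by move=> s sT j; exact: (vsol_sq T_gt0 P_complete W_bm (conj lz pz) sT).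
  - move=> s sT; apply: le_trans (hk _ _ lv lz (closed_loop lc) s sT) _; apply: ler_wpM2l => //.
    apply: ler_sum => j _; have [_ s_T] := andP sT.
    by apply: wnorm_mono => //; case: (cv j).
  - rewrite (_ : (\int[mu]_(s in `[0%R, T]) _)%E =
      (\int[mu]_(s in `[0%R, T]) cst (k0 * V)%:E s)%E)//.
    rewrite integral_cst//= lebesgue_measure_itv/= lte_fin T_gt0 sube0 -EFinM lee_fin.
    by rewrite mulrC mulrA.
rewrite (L2norm2_wnorm T_gt0 P_complete W_bm cc)/=.
apply: (@le_trans _ _ (\sum_(j < n) (2 * (n%:R * ML ^+ 2) * \sum_i wnorm P T (comp (hom c) i) +
    2 * wnorm P T (comp (deviation c (hom c)) j)))).
  apply: ler_sum => j _.
  have -> : comp c j = fun t w => \sum_i (- L j i t) * comp (hom c) i t w +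
      comp (deviation c (hom c)) j t w.
    apply/funext => t; apply/funext => w; rewrite /comp mxE addrCA -big_split/=.
    by rewrite big1 ?addr0// => i _; ring.
  apply: (lin_wnorm_le (c := fun i t => - L j i t)) => //.
  - by move=> i; apply: measurableT_comp => //; exact: mL.
  - by move=> i t; rewrite normrN.
  - by move=> i; case: (cz i).
  - by case: (cv j).
rewrite big_split/= sumr_const card_ord -mulr_sumr -[_ *+ n]mulr_natl -/V [leRHS]mulrDl lerD2r.
rewrite (_ : 2 * _ * _ * _ * V = 2 * (n%:R * ML ^+ 2) * n%:R * (T * k0 * V)); last by ring.
rewrite mulrCA mulrA; apply: ler_wpM2l => //.
by apply: mulr_ge0 => //; apply: mulr_ge0 => //; apply: mulr_ge0 => //; exact: sqr_ge0.
Qed.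

End Feedback.

Section RiccatiCost.
Context {R : realType} {d : measure_display} {Om : measurableType d}.
Context {N n : nat}.
Variables (P : probability Om R) (T : R) (W : 'I_N.+1 -> R -> Om -> R).
Hypothesis T_gt0 : 0 < T.
Hypothesis P_complete : measure_is_complete P.
Hypothesis W_bm : independent_brownians P T W.
Variables (A C0 Gam Gam0 Q G R0 : 'M[R]_n).
Hypothesis R0_sym : R0^T = R0.
Local Notation mu := (@lebesgue_measure R).
Local Notation TS := (timespace P).
Local Notation L2F := (L2F P T W).
Local Notation L2p := (L2p P T W).
Local Notation hom := (hom_state P T W A C0).
Local Notation J := (J_hom P T W A C0 Gam Gam0 Q G R0).

Variables K Kd : R -> 'M[R]_n.
Hypothesis cK : mxwc 0 T K.
Hypothesis cKd : mxwc 0 T Kd.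
Hypothesis KE : forall i j t, 0 <= t <= T ->
  K t i j = K 0 i j + \int[mu]_(s in `[0, t]) Kd s i j.
Hypothesis KT : K T = Xi Gam0 G - G.

Hypothesis K_sym : forall t, 0 <= t <= T -> (K t)^T = K t.
Hypothesis M_unit : forall t, 0 <= t <= T -> K t + R0 \in unitmx.
Hypothesis KdE : forall t, 0 <= t <= T ->
  Kd t + A^T *m K t + K t *m A + (Xi Gam Q - Q) + C0^T *m K t *m C0 -
  C0^T *m K t *m invmx (K t + R0) *m K t *m C0 = 0.

Definition gain i j := cut 0 T (fun t => (invmx (K t + R0) *m K t *m C0) i j).

Lemma mxwc_gain : mxwc 0 T (fun t => invmx (K t + R0) *m K t *m C0).
Proof.
apply: mxwcM; last exact: mxwc_cst.
apply: mxwcM => //; apply: mxwc_inv M_unit.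
by apply: mxwcD => //; exact: mxwc_cst.
Qed.

Lemma measurable_gain i j : measurable_fun setT (gain i j : measurableTypeR R -> R).
Proof. exact: (measurable_cut (@mxwc_gain i j)). Qed.

Lemma gain_bounded : exists2 ML : R, 0 <= ML & forall i j t, `|gain i j t| <= ML.
Proof.
have [ML M0 hM] := mxwc_bounded mxwc_gain.
by exists ML => // i j t; apply: cut_le => // s sT; exact: hM.
Qed.

Lemma J_hom_completed c : L2F c ->
  let F := win T (fun t w => qform (K t + R0) (deviation gain c (hom c) t w)) in
  TS.-integrable setT (EFin \o F) /\ J c = \int[TS]_y F y.
Proof.
move=> lc F; have := J_hom_lyapunov T_gt0 P_complete W_bm A C0 Gam Q R0 cK cKd KE KT lc.
set F1 := win T _; suff -> : F = F1 by [].
apply/funext => -[t w]; rewrite /F1 /F /win /=.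
have [tT|tT] := boolP (0 <= t <= T); last first.
  by rewrite indicE memNset ?mulr0//= in_itv/=; exact/negP.
congr (_ * _).
rewrite (completed_square (X := Kd t + A^T *m K t + K t *m A + (Xi Gam Q - Q)))//.
- congr qform; apply/matrixP => j i; rewrite (ord1 i) !mxE; congr (_ + _).
  by apply: eq_bigr => l _; rewrite /gain cutE.
- exact: K_sym.
- exact: M_unit.
- exact: KdE.
Qed.

End RiccatiCost.

Section RiccatiSufficient.
Context {R : realType} {d : measure_display} {Om : measurableType d}.
Context {N n : nat}.
Variables (P : probability Om R) (T : R) (W : 'I_N.+1 -> R -> Om -> R).
Hypothesis T_gt0 : 0 < T.
Hypothesis P_complete : measure_is_complete P.
Hypothesis W_bm : independent_brownians P T W.
Hypothesis n_gt0 : (0 < n)%N.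
Variables (A C0 Gam Gam0 Q G R0 : 'M[R]_n).
Hypothesis R0_sym : R0^T = R0.
Local Notation TS := (timespace P).

Lemma riccati_sufficient (K : R -> 'M[R]_n) :
  riccati_solution T A C0 Gam Gam0 Q G R0 K ->
  (forall t, 0 <= t <= T -> pdef (K t + R0)) ->
  exists2 delta, 0 < delta & forall c, L2F P T W c ->
    delta * fine (L2norm2 P T c) <= J_hom P T W A C0 Gam Gam0 Q G R0 c.
Proof.
move=> [cK dK eqK KT] pM.
have uM t tT := pdef_unit (pM t tT).
pose X t := K t *m A + A^T *m K t + C0^T *m K t *m C0
  - C0^T *m K t *m invmx (K t + R0) *m K t *m C0 + Xi Gam Q - Q.
(* The derivative is read off the equation, which makes it continuous up to the end points, where
   derivability of [K] is not part of a solution. *)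
pose Kd t := - X t.
have cM : mxwc 0 T (fun t => K t + R0) by apply: mxwcD => //; exact: mxwc_cst.
have cI : mxwc 0 T (fun t => invmx (K t + R0)) := mxwc_inv cM uM.
have cc (F : 'M[R]_n) : mxwc 0 T (fun=> F) := @mxwc_cst R 0 T n n F.
have cCK : mxwc 0 T (fun t => C0^T *m K t) := mxwcM (cc _) cK.
have cKd : mxwc 0 T Kd.
  apply: mxwcN; apply: mxwcD; last exact: cc.
  apply: mxwcD; last exact: cc.
  apply: mxwcD; last first.
    by apply: mxwcN; apply: mxwcM; [apply: mxwcM; [exact: mxwcM|]|].
  apply: mxwcD; last exact: mxwcM.
  by apply: mxwcD; apply: mxwcM.
have KE i j t : 0 <= t <= T -> K t i j = K 0 i j + \int[lebesgue_measure]_(s in `[0, t]) Kd s i j.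
  apply: (wc_FTC (cK i j) (cKd i j)) => s sT; split; first exact: dK.
  have /matrixP/(_ i j) := eqK s sT; rewrite /Kd /X !mxE => h.
  by apply/eqP; rewrite -subr_eq0; apply/eqP; rewrite -[RHS]h; ring.
have KS t : 0 <= t <= T -> (K t)^T = K t by move=> /pM; exact: pdef_sym.
have KdE t : 0 <= t <= T -> Kd t + A^T *m K t + K t *m A + (Xi Gam Q - Q) + C0^T *m K t *m C0 -
    C0^T *m K t *m invmx (K t + R0) *m K t *m C0 = 0.
  move=> _; rewrite /Kd /X.
  move: (K t *m A) (A^T *m K t) (C0^T *m K t *m C0) (Xi Gam Q) => X1 X2 X3 X4.
  by move: (C0^T *m _ *m _ *m _ *m _) => X5; apply/matrixP => i j; rewrite !mxE; ring.
have [B B0 hB] := mxwc_bounded cI.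
(* The lower bound that [pdef_lower] gives for [K t + R0], uniformly in [t]; adding 1 to [B] ensures
   positivity. *)
pose m0 : R := (n%:R * (B + 1))^-1.
have m00 : 0 < m0 by rewrite invr_gt0 mulr_gt0 ?ltr0n// ltr_wpDl.
have [ML ML0 gM] := gain_bounded C0 cK uM.
have mg := measurable_gain C0 cK uM.
have [k1 k10 hk] := control_le_deviation T_gt0 P_complete W_bm A C0 mg gM.
exists (m0 / k1); first exact: divr_gt0.
move=> c lc; have [lz pz] := hom_stateP T_gt0 P_complete W_bm A C0 lc.
have [iF JE] := J_hom_completed T_gt0 P_complete W_bm R0_sym cK cKd KE KT KS uM KdE lc.
have lv := deviation_L2F T_gt0 P_complete W_bm mg gM lc lz.
have [VE iV] := sum_wnorm T_gt0 P_complete W_bm lv.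
apply: (@le_trans _ _ (m0 * \sum_j wnorm P T (comp (deviation (gain T C0 R0 K) c
    (hom_state P T W A C0 c)) j))).
  by rewrite -mulrA; apply: ler_wpM2l; [exact: ltW|rewrite mulrC ler_pdivrMr// mulrC; exact: hk].
rewrite JE -VE -RintegralZl//; apply: le_Rintegral => //; first exact: integrableRZ.
move=> -[t w] _; rewrite /win /= mulrA.
have [tT|tT] := boolP (0 <= t <= T); last first.
  by rewrite indicE memNset ?mulr0//= in_itv/=; exact/negP.
rewrite indicE mem_set/= ?in_itv// !mulr1.
apply: pdef_lower; [exact: ltr_wpDl|exact: pM|move=> i j].
by apply: le_trans (hB t tT i j) _; rewrite lerDl.
Qed.

End RiccatiSufficient.

(** * The truncated Riccati equation *)

Section MatrixODE.
Context {R : realType} {n : nat}.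
Local Notation mu := (@lebesgue_measure R).
Implicit Types X Y : 'M[R]_n.

Definition mnorm X : R := \sum_(p : 'I_n * 'I_n) `|X p.1 p.2|.

Lemma mnorm_ge0 X : 0 <= mnorm X.
Proof. by apply: sumr_ge0. Qed.

Lemma le_mnorm X i j : `|X i j| <= mnorm X.
Proof. by rewrite /mnorm (bigD1 (i, j))//= lerDl; apply: sumr_ge0. Qed.

Lemma mnormN X : mnorm (- X) = mnorm X.
Proof. by apply: eq_bigr => p _; rewrite mxE normrN. Qed.

Lemma mnormD X Y : mnorm (X + Y) <= mnorm X + mnorm Y.
Proof. by rewrite -big_split/=; apply: ler_sum => p _; rewrite mxE ler_normD. Qed.

Lemma mnormB X Y : mnorm (X - Y) <= mnorm X + mnorm Y.
Proof. by rewrite -(mnormN Y); exact: mnormD. Qed.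

Lemma mnorm_le X (c : R) : (forall i j, `|X i j| <= c) -> mnorm X <= (n * n)%:R * c.
Proof.
move=> h; apply: le_trans (ler_sum _ (fun p _ => h p.1 p.2)) _.
by rewrite sumr_const card_prod card_ord mulr_natl.
Qed.

(** A crude constant of submultiplicativity for the entrywise sum norm; what matters is that it
    depends on [n] alone. *)
Definition mnormK : R := (n * n)%:R * n%:R.

Lemma mnormK_ge0 : 0 <= mnormK. Proof. by rewrite mulr_ge0. Qed.

Lemma mnormM X Y : mnorm (X *m Y) <= mnormK * mnorm X * mnorm Y.
Proof.
rewrite /mnormK -!mulrA; apply: mnorm_le => i j; rewrite mxE.
apply: le_trans (ler_norm_sum _ _ _) _.
apply: (@le_trans _ _ (\sum_(k < n) mnorm X * mnorm Y)).
  by apply: ler_sum => k _; rewrite normrM; apply: ler_pM => //; exact: le_mnorm.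
by rewrite sumr_const card_ord mulr_natl.
Qed.

Lemma wc_mnorm (a b : R) (G : R -> 'M[R]_n) : mxwc a b G ->
  {within `[a, b], continuous (fun t => mnorm (G t))}.
Proof. by move=> cG; apply: within_continuous_sum => p; apply: wc_norm; exact: cG. Qed.

Lemma mxwc_lipschitz (a b L : R) (F : 'M[R]_n -> 'M[R]_n) (G : R -> 'M[R]_n) :
  (forall X Y, mnorm (F X - F Y) <= L * mnorm (X - Y)) -> mxwc a b G ->
  mxwc a b (fun t => F (G t)).
Proof.
move=> LF cG i j; apply/within_itv_continuousP => t tab e e0.
have ch : {within `[a, b], continuous (fun s => L * mnorm (G t - G s))}.
  apply: wcM; first exact: wc_cst.
  by apply: wc_mnorm; apply: mxwcD; [exact: mxwc_cst|exact: mxwcN].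
have [dl dl0 h] := (within_itv_continuousP _ _ _).1 ch t tab e e0.
exists dl => // s sab ts; have := h s sab ts.
have -> : mnorm (G t - G t) = 0.
  by rewrite subrr /mnorm big1// => p _; rewrite mxE normr0.
rewrite mulr0 sub0r normrN => h1.
apply: le_lt_trans (le_lt_trans (ler_norm _) h1); apply: le_trans (LF _ _).
by have := le_mnorm (F (G t) - F (G s)) i j; rewrite !mxE.
Qed.

Variable T : R.
Hypothesis T_gt0 : 0 < T.

Let sub_itv t : 0 <= t <= T -> `[0, t]%classic `<=` `[0, T].
Proof. by move=> /andP[_ tT]; apply: subset_itvl; rewrite bnd_simp. Qed.

Lemma wc_integrable (f : R -> R) t : {within `[0, T], continuous f} -> 0 <= t <= T ->
  mu.-integrable `[0, t] (EFin \o f).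
Proof.
move=> cf tT; apply: (@continuous_compact_integrable R f).
  exact: segment_compact.
exact: continuous_subspaceW (sub_itv tT) cf.
Qed.

Lemma int_mnorm_le (G : R -> 'M[R]_n) (B l t : R) : mxwc 0 T G -> 0 <= B -> 0 < l ->
  0 <= t <= T -> (forall s, 0 <= s <= t -> mnorm (G s) <= B * expR (l * s)) ->
  mnorm (\matrix_(i, j) \int[mu]_(s in `[0, t]) G s i j) <= B / l * expR (l * t).
Proof.
move=> cG B0 l0 tT h; have [t0 t_T] := andP tT.
rewrite -lee_fin; apply: le_trans (integral_expR_le B0 l0 t0).
have iG i j : mu.-integrable `[0, t] (EFin \o (fun s => G s i j)) := wc_integrable (cG i j) tT.
have mG i j : measurable_fun `[0, t] (fun s => G s i j).
  by have [/measurable_EFinP] := integrableP _ _ _ (iG i j).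
apply: (@le_trans _ _ (\int[mu]_(s in `[0%R, t]) (mnorm (G s))%:E)%E); last first.
  apply: ge0_le_integral => //.
  - by move=> s _; rewrite lee_fin mnorm_ge0.
  - apply/measurable_EFinP; rewrite /mnorm; apply: measurable_sum => p.
    by apply: measurableT_comp => //; exact: mG.
  - apply/measurable_EFinP; apply: measurable_funM => //.
    by apply: measurableT_comp => //; exact: measurable_funM.
rewrite /mnorm -sumEFin; under [leRHS]eq_integral do rewrite -sumEFin.
rewrite ge0_integral_sum//=; last first.
- by move=> p; apply/measurable_EFinP; apply: measurableT_comp => //; exact: mG.
apply: lee_sum => p _; rewrite mxE.
have fi : (\int[mu]_(s in `[0%R, t]) (G s p.1 p.2)%:E)%E \is a fin_num.
  exact: (integrable_fin_num _ (iG p.1 p.2)).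
rewrite /Rintegral -abse_EFin fineK//.
by apply: le_abse_integral => //; apply/measurable_EFinP; exact: mG.
Qed.

Variables (F : 'M[R]_n -> 'M[R]_n) (L : R) (X0 : 'M[R]_n).
Hypothesis L_gt0 : 0 < L.
Hypothesis F_lip : forall X Y, mnorm (F X - F Y) <= L * mnorm (X - Y).

Definition picard_map (G : R -> 'M[R]_n) (t : R) : 'M[R]_n :=
  X0 + \matrix_(i, j) \int[mu]_(s in `[0, t]) F (G s) i j.

Lemma picard_map_continuous G : mxwc 0 T G -> mxwc 0 T (picard_map G).
Proof.
move=> cG i j; have cF := mxwc_lipschitz F_lip cG.
rewrite (_ : (fun t => _) = fun t => X0 i j + \int[mu]_(s in `[0, t]) F (G s) i j); last first.
  by apply/funext => t; rewrite !mxE.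
apply: wcD; first exact: wc_cst.
apply: parameterized_integral_continuous; first exact: ltW.
by apply: (wc_integrable (cF i j)); rewrite lexx ltW.
Qed.

(** In the norm weighted by exp(-2 L t) the map contracts by 1/2 on all of [[0, T]], so short
    intervals need not be pieced together. *)
Lemma picard_map_le G H (B : R) t : mxwc 0 T G -> mxwc 0 T H -> 0 <= B -> 0 <= t <= T ->
  (forall s, 0 <= s <= T -> mnorm (G s - H s) <= B * expR (2 * L * s)) ->
  mnorm (picard_map G t - picard_map H t) <= B / 2 * expR (2 * L * t).
Proof.
move=> cG cH B0 tT h.
have cFG := mxwc_lipschitz F_lip cG; have cFH := mxwc_lipschitz F_lip cH.
have cD : mxwc 0 T (fun s => F (G s) - F (H s)) by apply: mxwcD => //; exact: mxwcN.
have -> : picard_map G t - picard_map H t =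
    \matrix_(i, j) \int[mu]_(s in `[0, t]) (F (G s) - F (H s)) i j.
  apply/matrixP => i j; rewrite !mxE opprD addrACA subrr add0r.
  under [RHS]eq_Rintegral do rewrite !mxE.
  by rewrite RintegralB//; apply: wc_integrable.
have -> : B / 2 * expR (2 * L * t) = L * B / (2 * L) * expR (2 * L * t).
  by congr (_ * _); field; rewrite gt_eqF.
apply: int_mnorm_le => //; [by rewrite mulr_ge0// ltW|by rewrite mulr_gt0|].
move=> s /andP[s0 st]; apply: le_trans (F_lip _ _) _; rewrite -mulrA.
apply: ler_wpM2l; first exact: ltW.
by apply: h; rewrite s0 (le_trans st)//; case/andP: tT.
Qed.

(** Symmetry of the solution is inherited from the iterates, each of which is symmetric, rather than
    deduced from uniqueness. *)
Lemma matrix_ode : exists Y : R -> 'M[R]_n,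
  [/\ mxwc 0 T Y, forall t, 0 <= t <= T -> Y t = picard_map Y t &
      X0^T = X0 -> (forall X, F X^T = (F X)^T) -> forall t, 0 <= t <= T -> (Y t)^T = Y t].
Proof.
pose X m := iter m picard_map (fun=> X0).
have cX m : mxwc 0 T (X m).
  by elim: m => [|m ih]; [exact: mxwc_cst|exact: picard_map_continuous].
have [B B0 hB] := mxwc_bounded (cX 1%N).
pose D := mnorm X0 + (n * n)%:R * B.
have D0 : 0 <= D by rewrite addr_ge0 ?mnorm_ge0 ?mulr_ge0.
have l0 : 0 < 2 * L by rewrite mulr_gt0.
have step m : forall t, 0 <= t <= T -> mnorm (X m.+1 t - X m t) <= D * 2^-1 ^+ m * expR (2 * L * t).
  elim: m => [|m ih] t tT.
    have [t0 _] := andP tT; rewrite expr0 mulr1.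
    apply: (@le_trans _ _ D).
      apply: le_trans (mnormB _ _) _; rewrite /D addrC; apply: lerD => //.
      by apply: mnorm_le => i j; exact: hB.
    by rewrite ler_peMr// -[leLHS]expR0 ler_expR mulr_ge0// ltW.
  have := @picard_map_le (X m.+1) (X m) (D * 2^-1 ^+ m) t (cX _) (cX _) _ tT ih.
  rewrite -/(X m.+2 t) -/(X m.+1 t) exprSr mulrA; apply.
  by rewrite mulr_ge0// exprn_ge0.
pose C := D * expR (2 * L * T) + 1.
have C0 : 0 < C by rewrite ltr_wpDl// mulr_ge0// expR_ge0.
have stepC m t i j : 0 <= t <= T -> `|X m.+1 t i j - X m t i j| <= C * 2^-1 ^+ m.
  move=> tT; have := le_mnorm (X m.+1 t - X m t) i j; rewrite !mxE => h.
  apply: le_trans h _; apply: le_trans (step m t tT) _.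
  rewrite mulrAC; apply: ler_wpM2r; first by rewrite exprn_ge0.
  apply: (@le_trans _ _ (D * expR (2 * L * T))); last by rewrite lerDl.
  apply: ler_wpM2l => //; rewrite ler_expR; apply: ler_wpM2l; first exact: ltW.
  by case/andP: tT.
have geo0 (c D1 : R) : (forall m, c <= D1 * 2^-1 ^+ m) -> c <= 0.
  move=> h; apply: (@le_geometric0 R c D1) => m.
  by have := h (3 * m)%N; rewrite exprM (_ : 2^-1 ^+ 3 = 8^-1 :> R)//; field.
have lim t i j : exists l, 0 <= t <= T -> forall m, `|l - X m t i j| <= 2 * C * 2^-1 ^+ m.
  have [tT|_] := boolP (0 <= t <= T); last by exists 0.
  (* Rescaling by [C^-1] brings the steps down to 2^-m, the normalization of
     [geometric_steps_cvg]. *)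
  have [|l [_ hl]] := @geometric_steps_cvg R (fun m => C^-1 * X m t i j) 0%N.
    move=> m _; rewrite -mulrBr normrM gtr0_norm ?invr_gt0// mulrC ler_pdivrMr// mulrC.
    exact: stepC.
  exists (C * l) => _ m; have := hl m isT.
  have -> : C * l - X m t i j = C * (l - C^-1 * X m t i j) by rewrite mulrBr mulrA mulfV ?mul1r// gt_eqF.
  rewrite normrM gtr0_norm// => h.
  by rewrite (_ : 2 * C * _ = C * (2 * 2^-1 ^+ m)); [apply: ler_wpM2l => //; exact: ltW|ring].
have /choice[Yt hYt] : forall t, exists Y : 'M[R]_n, 0 <= t <= T ->
    forall m i j, `|Y i j - X m t i j| <= 2 * C * 2^-1 ^+ m.
  move=> t; have /choice[f hf] : forall p : 'I_n * 'I_n, exists l, 0 <= t <= T ->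
      forall m, `|l - X m t p.1 p.2| <= 2 * C * 2^-1 ^+ m by move=> p; exact: lim.
  exists (\matrix_(i, j) f (i, j)) => tT m i j; rewrite mxE.
  exact: (hf (i, j) tT m).
have C2 : 0 <= 2 * C by rewrite mulr_ge0// ltW.
have cY : mxwc 0 T Yt.
  move=> i j; apply/within_itv_continuousP => t tT e e0.
  have [m hm] : exists m, 2 * C * 2^-1 ^+ m < e / 3.
    apply: contrapT => h; have : e / 3 <= 0.
      by apply: (geo0 _ (2 * C)) => m; rewrite leNgt; apply/negP => hm; apply: h; exists m.
    by rewrite leNgt divr_gt0.
  have e3 : 0 < e / 3 by rewrite divr_gt0.
  have [dl dl0 hdl] := (within_itv_continuousP _ _ _).1 (cX m i j) t tT (e / 3) e3.
  exists dl => // s sT ts; have h1 := hYt t tT m i j; have h2 := hYt s sT m i j.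
  have h3 := hdl s sT ts.
  rewrite (_ : _ - _ = (Yt t i j - X m t i j) + (X m t i j - X m s i j) - (Yt s i j - X m s i j)); last by ring.
  apply: le_lt_trans (ler_normB _ _) _; apply: le_lt_trans (lerD (ler_normD _ _) (lexx _)) _; lra.
exists Yt; split => // [t tT|sX sF t tT].
  apply/matrixP => i j; apply/eqP; rewrite -subr_eq0 -normr_le0.
  pose D1 := 2 * C + (n * n)%:R * (2 * C) * expR (2 * L * T).
  have eT s : 0 <= s <= T -> 1 <= expR (2 * L * s) <= expR (2 * L * T).
    move=> /andP[s0 sT]; apply/andP; split.
      by rewrite -[leLHS]expR0 ler_expR !mulr_ge0// ltW.
    by rewrite ler_expR; apply: ler_wpM2l => //; rewrite mulr_ge0// ltW.
  apply: (geo0 _ D1) => m.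
  rewrite (_ : _ - _ = (Yt t i j - X m.+1 t i j) + (picard_map (X m) t - picard_map Yt t) i j); last first.
    by rewrite /X iterS !mxE; ring.
  apply: le_trans (ler_normD _ _) _.
  have h1 : `|Yt t i j - X m.+1 t i j| <= 2 * C * 2^-1 ^+ m.
    apply: le_trans (hYt t tT m.+1 i j) _; apply: ler_wpM2l => //.
    by rewrite exprS ler_piMl ?exprn_ge0// invf_le1 ?ler1n.
  set B1 := (n * n)%:R * (2 * C * 2^-1 ^+ m).
  have B10 : 0 <= B1 by rewrite mulr_ge0// mulr_ge0// exprn_ge0.
  have h2 := @picard_map_le (X m) Yt B1 t (cX m) cY B10 tT.
  have h3 : mnorm (picard_map (X m) t - picard_map Yt t) <= B1 / 2 * expR (2 * L * t).
    apply: h2 => s sT; apply: (@le_trans _ _ B1).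
      by apply: mnorm_le => k l; rewrite !mxE distrC; exact: hYt.
    by rewrite ler_peMr//; case/andP: (eT s sT).
  have h4 := le_trans (le_mnorm _ i j) h3.
  rewrite /D1 mulrDl; apply: lerD => //; apply: le_trans h4 _.
  rewrite (_ : _ * 2^-1 ^+ m = B1 * expR (2 * L * T)); last by rewrite /B1; ring.
  have [_ e2] := andP (eT t tT); have e1 := expR_ge0 (2 * L * t); move: B10 e1 e2.
  clear -R; move: B1 (expR (2 * L * t)) (expR _) => B2 u v B20 e1 e2; nra.
have sXm m s : (X m s)^T = X m s.
  elim: m s => [|m ih] s; first exact: sX.
  rewrite /X iterS /picard_map linearD/= sX; congr (_ + _).
  apply/matrixP => i j; rewrite !mxE; apply: eq_Rintegral => r _.
  by have /matrixP/(_ i j) := sF (X m r); rewrite ih mxE => ->.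
apply/matrixP => i j; rewrite mxE; apply/eqP; rewrite -subr_eq0 -normr_le0.
apply: (geo0 _ (4 * C)) => m.
rewrite (_ : _ - _ = (Yt t j i - X m t j i) - (Yt t i j - X m t i j)); last first.
  by rewrite -[in X in _ = _ - X - _](sXm m t) !mxE; ring.
apply: le_trans (ler_normB _ _) _.
have h1 := hYt t tT m i j; have h2 := hYt t tT m j i.
by rewrite (_ : 4 * C * _ = 2 * C * 2^-1 ^+ m + 2 * C * 2^-1 ^+ m); [exact: lerD|ring].
Qed.

(* The bound does not involve the Lipschitz constant L, hence not the level at
   which the inverse is truncated. *)
Lemma matrix_ode_bound (a b : R) (Y : R -> 'M[R]_n) : 0 < a -> 0 <= b -> mxwc 0 T Y ->
  (forall X, mnorm (F X) <= a * mnorm X + b) ->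
  (forall t, 0 <= t <= T -> Y t = picard_map Y t) ->
  forall t, 0 <= t <= T -> mnorm (Y t) <= 2 * (mnorm X0 + b / a) * expR (2 * a * T).
Proof.
move=> a0 b0 cY Fab YE.
(* At a maximum point of the weighted norm [g] the integral inequality closes on itself: for the
   maximal value u it gives u <= mnorm X0 + (u + b / a) / 2, since exp(2 a t) is at least 1
   there. *)
pose g t := expR (- (2 * a * t)) * mnorm (Y t).
have cg : {within `[0, T], continuous g}.
  apply: wcM; last exact: wc_mnorm.
  apply: continuous_subspaceT => t; apply: continuous_comp; last exact: continuous_expR.
  by apply: cvgN; apply: cvgM; [exact: cvg_cst|exact: cvg_id].
have [tm tmT hm] := EVT_max (ltW T_gt0) cg.
have tm' : 0 <= tm <= T by move: tmT; rewrite in_itv.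
have [tm0 tm1] := andP tm'.
have gm0 : 0 <= g tm by rewrite mulr_ge0 ?expR_ge0 ?mnorm_ge0.
have Yg s : mnorm (Y s) = g s * expR (2 * a * s).
  by rewrite /g mulrAC expRN mulVf ?mul1r// gt_eqF// expR_gt0.
have gm : g tm <= 2 * (mnorm X0 + b / a).
  have e1 : 1 <= expR (2 * a * tm) by rewrite -[leLHS]expR0 ler_expR !mulr_ge0// ltW.
  have h : mnorm (Y tm) <= mnorm X0 + (a * g tm + b) / (2 * a) * expR (2 * a * tm).
    rewrite YE// /picard_map; apply: le_trans (mnormD _ _) _; rewrite lerD2l.
    apply: int_mnorm_le => //.
    - exact: mxwc_lipschitz.
    - by rewrite addr_ge0// mulr_ge0// ltW.
    - by rewrite mulr_gt0.
    move=> s /andP[s0 st]; have sT : 0 <= s <= T by rewrite s0 (le_trans st).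
    apply: le_trans (Fab _) _; rewrite mulrDl; apply: lerD.
      rewrite Yg mulrA; apply: ler_wpM2r; first exact: expR_ge0.
      by apply: ler_wpM2l; [exact: ltW|apply: hm; rewrite in_itv].
    by rewrite ler_peMr// -[leLHS]expR0 ler_expR !mulr_ge0// ltW.
  rewrite Yg in h; rewrite -(ler_pM2r (lt_le_trans ltr01 e1)).
  have h1 : (a * g tm + b) / (2 * a) = 2^-1 * g tm + 2^-1 * (b / a).
    by field; rewrite gt_eqF.
  rewrite h1 in h; have X00 := mnorm_ge0 X0.
  have ba0 : 0 <= b / a by rewrite divr_ge0// ltW.
  move: (g tm) (expR _) (mnorm X0) (b / a) e1 h X00 ba0 => u v x y e1 h X00 ba0; nra.
move=> t tT; rewrite Yg; apply: ler_pM; rewrite ?expR_ge0//.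
- by rewrite mulr_ge0 ?expR_ge0 ?mnorm_ge0.
- by apply: le_trans gm; apply: hm; rewrite in_itv.
- by rewrite ler_expR; apply: ler_wpM2l; [rewrite mulr_ge0// ltW|case/andP: tT].
Qed.

End MatrixODE.

(** * A bounded Lipschitz substitute for matrix inversion *)

Section TruncatedInverse.
Context {R : realType} {n : nat}.
Implicit Types (X Y : 'M[R]_n) (f g : 'M[R]_n -> R).

(** Boundedness is carried along because Lipschitz functions alone are not stable under products, of
    which determinants consist. *)
Definition blip f : Prop := exists M L : R, [/\ 0 <= M, 0 <= L, forall X, `|f X| <= M &
  forall X Y, `|f X - f Y| <= L * mnorm (X - Y)].

Lemma blip_cst (c : R) : blip (fun=> c).
Proof.
exists `|c|, 0; split => // X Y.
by rewrite subrr normr0 mul0r.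
Qed.

Lemma blipD f g : blip f -> blip g -> blip (fun X => f X + g X).
Proof.
move=> [M [L [M0 L0 fM fL]]] [M' [L' [M0' L0' gM gL]]].
exists (M + M'), (L + L'); split; [exact: addr_ge0|exact: addr_ge0| |] => X.
  by apply: le_trans (ler_normD _ _) _; exact: lerD.
move=> Y; rewrite (_ : _ - _ = (f X - f Y) + (g X - g Y)); last by ring.
by apply: le_trans (ler_normD _ _) _; rewrite mulrDl; exact: lerD.
Qed.

Lemma blipM f g : blip f -> blip g -> blip (fun X => f X * g X).
Proof.
move=> [M [L [M0 L0 fM fL]]] [M' [L' [M0' L0' gM gL]]].
exists (M * M'), (L * M' + M * L'); split.
- exact: mulr_ge0.
- by apply: addr_ge0; exact: mulr_ge0.
- by move=> X; rewrite normrM; exact: ler_pM.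
move=> X Y; rewrite (_ : _ - _ = (f X - f Y) * g X + f Y * (g X - g Y)); last by ring.
apply: le_trans (ler_normD _ _) _; rewrite [leRHS]mulrDl !normrM; apply: lerD.
  by rewrite mulrAC; apply: ler_pM.
by rewrite -mulrA; apply: ler_pM.
Qed.

Lemma blip_sum (I : Type) (r : seq I) (F : I -> 'M[R]_n -> R) :
  (forall i, blip (F i)) -> blip (fun X => \sum_(i <- r) F i X).
Proof.
move=> bF; elim: r => [|i r ih].
  by rewrite (_ : (fun X => _) = fun=> 0); [exact: blip_cst|apply/funext => X; rewrite big_nil].
rewrite (_ : (fun X => _) = fun X => F i X + \sum_(j <- r) F j X); first exact: blipD.
by apply/funext => X; rewrite big_cons.
Qed.

Lemma blip_prod (I : Type) (r : seq I) (F : I -> 'M[R]_n -> R) :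
  (forall i, blip (F i)) -> blip (fun X => \prod_(i <- r) F i X).
Proof.
move=> bF; elim: r => [|i r ih].
  by rewrite (_ : (fun X => _) = fun=> 1); [exact: blip_cst|apply/funext => X; rewrite big_nil].
rewrite (_ : (fun X => _) = fun X => F i X * \prod_(j <- r) F j X); first exact: blipM.
by apply/funext => X; rewrite big_cons.
Qed.

Lemma blip_clip (c : R) f : 0 <= c -> (exists2 L, 0 <= L &
  forall X Y, `|f X - f Y| <= L * mnorm (X - Y)) -> blip (fun X => clip c (f X)).
Proof.
move=> c0 [L L0 fL]; exists c, L; split => // [X|X Y]; first exact: clip_le.
by apply: le_trans (clip_lip _ _ _) _; exact: fL.
Qed.

Lemma blip_max (c : R) f : blip f -> blip (fun X => Num.max (f X) c).
Proof.
move=> [M [L [M0 L0 fM fL]]]; exists (M + `|c|), L; split => //.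
- by rewrite addr_ge0.
- move=> X; rewrite /Num.max; case: ifP => _; first by rewrite lerDr.
  by apply: le_trans (fM X) _; rewrite lerDl.
move=> X Y; apply: le_trans (fL X Y); rewrite /Num.max.
case: ltP => h1; case: ltP => h2 //; first by rewrite subrr normr0.
  rewrite ler_norml; have h3 := ler_norm (f Y - f X); rewrite distrC in h3.
  by apply/andP; split; lra.
have h3 := ler_norm (f X - f Y).
by rewrite ler_norml; apply/andP; split; lra.
Qed.

Lemma blipV (c : R) f : 0 < c -> (forall X, c <= f X) -> blip f -> blip (fun X => (f X)^-1).
Proof.
move=> c0 fc [M [L [M0 L0 fM fL]]]; exists c^-1, (L / c ^+ 2).
have f0 X : 0 < f X := lt_le_trans c0 (fc X).
split; [by rewrite invr_ge0 ltW|by rewrite divr_ge0// exprn_ge0// ltW| |] => X.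
  by rewrite gtr0_norm ?invr_gt0// lef_pV2// posrE.
move=> Y; rewrite (_ : _ - _ = (f Y - f X) / (f X * f Y)); last first.
  by field; rewrite !gt_eqF.
rewrite normrM distrC mulrAC; apply: ler_pM => //.
rewrite gtr0_norm ?invr_gt0 ?mulr_gt0// lef_pV2 ?posrE ?mulr_gt0 ?exprn_gt0//.
by rewrite expr2; apply: ler_pM => //; exact: ltW.
Qed.

Definition mclip (c : R) X : 'M[R]_n := \matrix_(i, j) clip c (X i j).

(* Unlike the inverse, a bounded Lipschitz function of all matrices; the factor
   x / max(x^2, c0^2) stands for 1 / x. *)
Definition tinv (c c0 B : R) X : 'M[R]_n := \matrix_(i, j)
  clip B ((\adj (mclip c X)) i j * (\det (mclip c X) * (Num.max (\det (mclip c X) ^+ 2) (c0 ^+ 2))^-1)).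

Lemma tinv_entry c c0 B X i j : tinv c c0 B X i j =
  clip B ((\adj (mclip c X)) i j * (\det (mclip c X) * (Num.max (\det (mclip c X) ^+ 2) (c0 ^+ 2))^-1)).
Proof. by rewrite mxE. Qed.

Section Bounds.
Variables c c0 B : R.
Hypotheses (c_ge0 : 0 <= c) (c0_gt0 : 0 < c0) (B_ge0 : 0 <= B).

Lemma blip_mclip i j : blip (fun X => mclip c X i j).
Proof.
rewrite (_ : (fun X => _) = fun X => clip c (X i j)); last by apply/funext => X; rewrite mxE.
apply: blip_clip => //; exists 1 => // X Y; rewrite mul1r.
by have := le_mnorm (X - Y) i j; rewrite !mxE.
Qed.

Lemma blip_det m (F : 'M[R]_n -> 'M[R]_m) : (forall i j, blip (fun X => F X i j)) ->
  blip (fun X => \det (F X)).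
Proof.
move=> bF; apply: blip_sum => s; apply: blipM; first exact: blip_cst.
by apply: blip_prod => i; exact: bF.
Qed.

Lemma tinv_lipschitz : exists2 L, 0 <= L &
  forall X Y, mnorm (tinv c c0 B X - tinv c c0 B Y) <= L * mnorm (X - Y).
Proof.
have b1 : blip (fun X => \det (mclip c X)) := blip_det blip_mclip.
have b2 i j : blip (fun X => (\adj (mclip c X)) i j).
  rewrite (_ : (fun X => _) = fun X => (-1) ^+ (j + i) * \det (row' j (col' i (mclip c X)))).
    apply: blipM; first exact: blip_cst.
    apply: blip_det => k l.
    rewrite (_ : (fun X => _) = fun X => mclip c X (lift j k) (lift i l)); first exact: blip_mclip.
    by apply/funext => X; rewrite !mxE.
  by apply/funext => X; rewrite mxE.
have b3 : blip (fun X => (Num.max (\det (mclip c X) ^+ 2) (c0 ^+ 2))^-1).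
  apply: (blipV (c := c0 ^+ 2)); first exact: exprn_gt0.
    by move=> X; rewrite le_max lexx orbT.
  by apply: blip_max; apply: blipM.
have b4 i j : exists L, 0 <= L /\ forall X Y,
    `|tinv c c0 B X i j - tinv c c0 B Y i j| <= L * mnorm (X - Y).
  have [M [L [_ L0 _ h]]] := blipM (b2 i j) (blipM b1 b3).
  by exists L; split => // X Y; rewrite !tinv_entry; apply: le_trans (clip_lip _ _ _) _.
have /choice[L hL] : forall p : 'I_n * 'I_n, exists L, 0 <= L /\ forall X Y,
    `|tinv c c0 B X p.1 p.2 - tinv c c0 B Y p.1 p.2| <= L * mnorm (X - Y).
  by move=> p; exact: b4.
exists (\sum_p L p); first by apply: sumr_ge0 => p _; case: (hL p).
move=> X Y; rewrite mulr_suml; apply: ler_sum => p _.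
suff -> : (tinv c c0 B X - tinv c c0 B Y) p.1 p.2 =
  tinv c c0 B X p.1 p.2 - tinv c c0 B Y p.1 p.2 by exact: (hL p).2.
by move: (tinv c c0 B X) (tinv c c0 B Y) => U V; rewrite !mxE.
Qed.

Lemma tinv_le X i j : `|tinv c c0 B X i j| <= B.
Proof. by rewrite tinv_entry; exact: clip_le. Qed.

(** Makes the truncated equation invariant under transposition, so that its solution stays
    symmetric. *)
Lemma tinv_tr X : tinv c c0 B X^T = (tinv c c0 B X)^T.
Proof.
have e : mclip c X^T = (mclip c X)^T by apply/matrixP => i j; rewrite !mxE.
apply/matrixP => i j; rewrite [RHS]mxE !tinv_entry e det_tr -trmx_adj.
by congr (clip B (_ * _)); rewrite mxE.
Qed.

Lemma tinvE X : (forall i j, `|X i j| <= c) -> c0 <= `|\det X| ->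
  (forall i j, `|invmx X i j| <= B) -> tinv c c0 B X = invmx X.
Proof.
move=> Xc dX iX.
have e : mclip c X = X by apply/matrixP => i j; rewrite mxE clip_id.
have d0 : \det X != 0 by rewrite -normr_gt0 (lt_le_trans c0_gt0).
have uX : X \in unitmx by rewrite unitmxE unitfE.
apply/matrixP => i j; rewrite mxE e -[RHS](clip_id (iX i j)); congr clip.
rewrite /invmx uX !mxE max_l; last first.
  by rewrite -[leRHS]real_normK ?num_real// ler_sqr ?nnegrE// ltW.
by rewrite mulrC; congr (_ * _); field.
Qed.

End Bounds.
End TruncatedInverse.

Section TruncatedRiccati.
Context {R : realType} {n : nat}.
Local Notation mu := (@lebesgue_measure R).
Variables (T : R) (A C0 R0 S KT : 'M[R]_n).
Hypothesis T_gt0 : 0 < T.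

Lemma wc_rev f : {within `[0, T], continuous f} -> {within `[0, T], continuous (fun t : R => (f (T - t) : R))}.
Proof.
move=> cf; apply/within_itv_continuousP => t tT e e0.
have rev s : 0 <= s <= T -> 0 <= T - s <= T by move=> /andP[s0 sT]; apply/andP; split; lra.
have [dl dl0 h] := (within_itv_continuousP _ _ _).1 cf _ (rev _ tT) e e0.
exists dl => // s sT ts; apply: h; first exact: rev.
by rewrite (_ : _ - _ = - (t - s)) ?normrN//; ring.
Qed.

Lemma int_is_derive (f : R -> R) (k : R) t : {within `[0, T], continuous f} -> 0 < t < T ->
  let g t := k + \int[mu]_(s in `[0, T - t]) f s in
  derivable g t 1 /\ g^`()%classic t = - f (T - t).
Proof.
move=> cf /andP[t0 tT] g.
have x0 : 0 < T - t by rewrite subr_gt0.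
have xT : T - t < T by rewrite ltrBlDr ltrDl.
have cx : {for T - t, continuous f}.
  have [h _ _] := (continuous_within_itvP f T_gt0).1 cf.
  by apply: h; rewrite in_itv/= x0.
have TT : 0 <= T <= T by rewrite lexx ltW.
have [d1 d2] := @continuous_FTC1_closed R f 0 (T - t) T xT (wc_integrable cf TT) x0 cx.
have i1 : is_derive (T - t) (1 : R) (fun x => \int[mu]_(s in `[0, x]) f s) (f (T - t)).
  by apply: DeriveDef; [exact: d1|rewrite -derive1E; exact: d2].
have i2 : is_derive t (1 : R) (fun x : R => T - x) (-1).
  have := @is_deriveB R R R (cst T) id t 1 0 1 (is_derive_cst T t 1) (is_derive_id t 1).
  by rewrite sub0r.
have i3 := @is_derive1_comp R (fun x => \int[mu]_(s in `[0, x]) f s) (fun x => T - x) t _ _ i1 i2.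
have i4 := @is_deriveD R R R (cst k) _ t 1 0 _ (is_derive_cst k t 1) i3.
have -> : g = cst k + ((fun x => \int[mu]_(s in `[0, x]) f s) \o (fun x => T - x)).
  by apply/funext.
by case: i4 => e1 e2; split => //; rewrite derive1E e2 add0r mulrN1.
Qed.

(** The right-hand side in reversed time, in the resolvent form of [riccati_resolvent]: with
    [C0^T R0 C0] moved into [S], the inverse is the only nonlinearity. *)
Let F (inv : 'M[R]_n -> 'M[R]_n) (X : 'M[R]_n) : 'M[R]_n :=
  X *m A + A^T *m X + S - (R0 *m C0)^T *m inv (X + R0) *m (R0 *m C0).

Lemma truncated_riccati (c0 B : R) : 0 < c0 -> 0 <= B -> KT^T = KT -> S^T = S -> R0^T = R0 ->
  exists K Kd I : R -> 'M[R]_n,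
  [/\ [/\ mxwc 0 T K, mxwc 0 T Kd & mxwc 0 T I], K T = KT,
      [/\ forall t, 0 <= t <= T -> (K t)^T = K t,
          forall t, 0 < t < T -> forall i j, derivable (fun s => K s i j) t 1 /\
            (fun s => K s i j)^`()%classic t = Kd t i j &
          forall i j t, 0 <= t <= T ->
            K t i j = K 0 i j + \int[mu]_(s in `[0, t]) Kd s i j],
      forall t, 0 <= t <= T -> Kd t =
        - (K t *m A + A^T *m K t + S - (R0 *m C0)^T *m I t *m (R0 *m C0)) &
      forall t, 0 <= t <= T -> c0 <= `|\det (K t + R0)| ->
        (forall i j, `|invmx (K t + R0) i j| <= B) -> I t = invmx (K t + R0)].
Proof.
move=> c00 B0 sKT sS sR.
pose E := R0 *m C0.
(* The growth constants [a] and [b] involve the entry bound [B] but not the clipping level [c]. The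
   a priori bound [Y0] is therefore known before [c] is fixed, and [c] is taken so large that
   clipping of [K + R0] never acts along the solution. *)
pose a := @mnormK R n * (mnorm A + mnorm A^T) + 1.
pose b := mnorm S + @mnormK R n * (@mnormK R n * mnorm E^T * ((n * n)%:R * B)) * mnorm E.
pose Y0 := 2 * (mnorm KT + b / a) * expR (2 * a * T).
pose c := `|Y0| + mnorm R0.
have K0 : 0 <= @mnormK R n := mnormK_ge0.
have m0 (X : 'M[R]_n) := mnorm_ge0 X.
have a0 : 0 < a by rewrite ltr_wpDl// mulr_ge0// addr_ge0.
have b0 : 0 <= b.
  apply: addr_ge0 => //; apply: mulr_ge0 => //; apply: mulr_ge0 => //.
  by apply: mulr_ge0; [exact: mulr_ge0|exact: mulr_ge0].
have cc : 0 <= c by rewrite addr_ge0.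
pose inv := @tinv R n c c0 B.
have [L L0 invL] := tinv_lipschitz (n := n) B cc c00.
pose L1 := @mnormK R n * (mnorm A + mnorm A^T) + @mnormK R n * (@mnormK R n * mnorm E^T * L) * mnorm E + 1.
have L10 : 0 < L1.
  by rewrite ltr_wpDl// addr_ge0// !mulr_ge0// addr_ge0.
have linA (X : 'M[R]_n) : mnorm (X *m A + A^T *m X) <= @mnormK R n * (mnorm A + mnorm A^T) * mnorm X.
  apply: le_trans (mnormD _ _) _; apply: le_trans (lerD (mnormM _ _) (mnormM _ _)) _.
  by rewrite le_eqVlt; apply/orP; left; apply/eqP; ring.
have linE (X : 'M[R]_n) : mnorm (E^T *m X *m E) <= @mnormK R n * (@mnormK R n * mnorm E^T * mnorm X) * mnorm E.
  apply: le_trans (mnormM _ _) _; apply: ler_wpM2r => //; apply: ler_wpM2l => //.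
  exact: mnormM.
have Flip X Y : mnorm (F inv X - F inv Y) <= L1 * mnorm (X - Y).
  have -> : F inv X - F inv Y = ((X - Y) *m A + A^T *m (X - Y)) -
      E^T *m (inv (X + R0) - inv (Y + R0)) *m E.
    rewrite /F -/E !mulmxBr !mulmxBl.
    move: (X *m A) (A^T *m X) (Y *m A) (A^T *m Y) (_ *m E) (_ *m E) => u1 u2 u3 u4 u5 u6.
    by apply/matrixP => i j; rewrite !mxE; ring.
  apply: le_trans (mnormB _ _) _.
  have h1 : mnorm (inv (X + R0) - inv (Y + R0)) <= L * mnorm (X - Y).
    apply: le_trans (invL _ _) _; rewrite (_ : X + R0 - (Y + R0) = X - Y)//.
    by rewrite opprD addrACA subrr addr0.
  apply: le_trans (lerD (linA _) (linE _)) _.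
  have h2 : @mnormK R n * (@mnormK R n * mnorm E^T * mnorm (inv (X + R0) - inv (Y + R0))) * mnorm E <=
      @mnormK R n * (@mnormK R n * mnorm E^T * (L * mnorm (X - Y))) * mnorm E.
    by apply: ler_wpM2r => //; apply: ler_wpM2l => //; apply: ler_wpM2l => //; exact: mulr_ge0.
  rewrite /L1; have h3 := m0 (X - Y); lra.
have Fgr X : mnorm (F inv X) <= a * mnorm X + b.
  rewrite /F -/E; apply: le_trans (mnormB _ _) _; apply: le_trans (lerD (mnormD _ _) (linE _)) _.
  rewrite /a /b [(_ + 1) * _]mulrDl mul1r.
  have h1 : mnorm (inv (X + R0)) <= (n * n)%:R * B by apply: mnorm_le => i j; exact: tinv_le.
  have h2 := linA X.
  have h3 : @mnormK R n * (@mnormK R n * mnorm E^T * mnorm (inv (X + R0))) * mnorm E <=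
      @mnormK R n * (@mnormK R n * mnorm E^T * ((n * n)%:R * B)) * mnorm E.
    by apply: ler_wpM2r => //; apply: ler_wpM2l => //; apply: ler_wpM2l => //; exact: mulr_ge0.
  have h4 := m0 X; lra.
have Ftr X : F inv X^T = (F inv X)^T.
  rewrite /F -/E linearB/= !linearD/= !trmx_mul !trmxK sS -!mulmxA; congr (_ - _).
    by rewrite [X^T *m A + _]addrC.
  have -> : X^T + R0 = (X + R0)^T by rewrite linearD/= sR.
  by rewrite /inv tinv_tr.
have [Y [cY YE Ysym]] := matrix_ode T_gt0 KT L10 Flip.
have cFY := mxwc_lipschitz Flip cY.
have Yb := matrix_ode_bound T_gt0 Flip a0 b0 cY Fgr YE.
(* The integral formula is taken as the definition instead of [Y (T - t)], with which it agrees on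
   [[0, T]]: being an explicit primitive it can be differentiated directly. *)
pose K t := picard_map (F inv) KT Y (T - t).
have rev s : 0 <= s <= T -> 0 <= T - s <= T by move=> /andP[s0 sT]; apply/andP; split; lra.
have KY t : 0 <= t <= T -> K t = Y (T - t) by move=> /rev; rewrite /K => /YE ->.
pose Kd t := - F inv (Y (T - t)).
have cK : mxwc 0 T K.
  move=> i j; apply: (wc_eq (g := fun t => Y (T - t) i j)) => [t tT|]; first by rewrite KY.
  exact: (wc_rev (cY i j)).
have cKd : mxwc 0 T Kd.
  by apply: mxwcN => i j; exact: (wc_rev (cFY i j)).
have cI : mxwc 0 T (fun t => inv (K t + R0)).
  apply: (@mxwc_lipschitz R n 0 T L inv (fun t => K t + R0)) => //.
  by apply: mxwcD => //; exact: mxwc_cst.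
have dK t : 0 < t < T -> forall i j, derivable (fun s => K s i j) t 1 /\
    (fun s => K s i j)^`()%classic t = Kd t i j.
  move=> tT i j; have [h1 h2] := int_is_derive (KT i j) (cFY i j) tT.
  have -> : (fun s => K s i j) = fun t => KT i j + \int[mu]_(s in `[0, T - t]) F inv (Y s) i j.
    by apply/funext => s; rewrite /K /picard_map !mxE.
  split; first exact: h1.
  by rewrite h2 /Kd; move: (F inv _) => Z; rewrite mxE.
exists K, Kd, (fun t => inv (K t + R0)); split.
- by split; [exact: cK|exact: cKd|exact: cI].
- by rewrite /K subrr; apply/matrixP => i j; rewrite !mxE set_itv1 Rintegral_set1 addr0.
- split; last by move=> i j t tT; exact: (wc_FTC (cK i j) (cKd i j) (fun s sT => dK s sT i j) tT).
    by move=> t tT; rewrite KY//; exact: (Ysym sKT Ftr _ (rev _ tT)).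
  exact: dK.
- by move=> t tT; rewrite /Kd -KY.
- move=> t tT dt it; apply: tinvE => // i j; rewrite mxE.
  apply: le_trans (ler_normD _ _) _; apply: lerD; last exact: le_mnorm.
  rewrite KY//; apply: le_trans (le_mnorm _ i j) _.
  exact: le_trans (Yb _ (rev _ tT)) (ler_norm _).
Qed.

End TruncatedRiccati.

(** * Necessity of the Riccati equation *)

Section CoerciveForms.
Context {R : realType} {n : nat}.
Implicit Types (M : 'M[R]_n).

Lemma det_le (m : nat) (X : 'M[R]_m) (B : R) : (forall i j, `|X i j| <= B) ->
  `|\det X| <= m`!%:R * B ^+ m.
Proof.
move=> hB; rewrite /determinant; apply: le_trans (ler_norm_sum _ _ _) _.
have h (s : 'S_m) : `|(-1) ^+ s * \prod_i X i (s i)| <= B ^+ m.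
  rewrite normrM normrX normrN1 expr1n mul1r normr_prod.
  rewrite -[X in _ <= B ^+ X]card_ord -prodr_const; apply: ler_prod => i _.
  by rewrite normr_ge0 hB.
apply: le_trans (ler_sum _ (fun s _ => h s)) _.
by rewrite sumr_const perm.card_Sn mulr_natl.
Qed.

Variables (M : 'M[R]_n) (m : R).
Hypothesis m_gt0 : 0 < m.
Hypothesis M_ge : forall x : 'cV[R]_n, m * sqnorm x <= qform M x.

Lemma coercive_unit : M \in unitmx.
Proof.
rewrite -unitmx_tr unitmxE unitfE; apply/negP => /eqP/eqP/det0P[v v0 vM].
have v1 : v^T != 0 by rewrite -(inj_eq trmx_inj) trmxK trmx0.
have := M_ge v^T; rewrite leNgt => /negP; apply.
rewrite (_ : qform M v^T = 0) ?mulr_gt0 ?sqnorm_gt0//.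
by rewrite /qform trmxK -mulmxA -[M *m _]trmxK trmx_mul trmxK vM trmx0 mulmx0 mxE.
Qed.

(** For the column [y] of index [j] of the inverse, [qform M y] is the diagonal entry [y j].
    Coercivity then bounds first this entry, by [m^-1], and with it the whole column. *)
Lemma coercive_inv_le i j : `|invmx M i j| <= m^-1.
Proof.
have uM := coercive_unit; pose y := col j (invmx M).
have My : M *m y = delta_mx j 0 by rewrite /y colE mulmxA mulmxV// mul1mx.
have qy : qform M y = y j 0.
  rewrite /qform -mulmxA My mxE (bigD1 j)//= !mxE !eqxx mulr1 big1 ?addr0// => k kj.
  by rewrite !mxE (negPf kj) mulr0.
have h := M_ge y; rewrite qy in h.
have h1 := le_sqnorm y j; have h2 := le_sqnorm y i.
have yi : y i 0 = invmx M i j by rewrite mxE.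
have yj : y j 0 <= m^-1.
  rewrite leNgt; apply/negP => h3; have y0 : 0 < y j 0 by apply: lt_trans h3; rewrite invr_gt0.
  move: h; apply/negP; rewrite -ltNge; apply: lt_le_trans (ler_wpM2l (ltW m_gt0) h1).
  rewrite real_normK ?num_real// expr2 mulrA ltr_pMl//.
  by rewrite -(mulfV (lt0r_neq0 m_gt0)) ltr_pM2l.
rewrite -yi -ler_sqr ?nnegrE ?invr_ge0 ?(ltW m_gt0)//; apply: le_trans h2 _.
have : m * sqnorm y <= m^-1 := le_trans h yj.
by rewrite mulrC -ler_pdivlMr// -expr2.
Qed.

(** The entry bound on the inverse bounds its determinant from above, and the two determinants are
    reciprocal. This provides the level [c0] of the truncated inverse. *)
Lemma coercive_det : m ^+ n / n`!%:R <= `|\det M|.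
Proof.
have uM := coercive_unit; have h := det_le (fun i j => coercive_inv_le i j).
rewrite ler_pdivrMr ?ltr0n ?fact_gt0//.
have d1 : `|\det M| * `|\det (invmx M)| = 1 by rewrite -normrM -det_mulmx mulmxV// det1 normr1.
have := ler_wpM2l (normr_ge0 (\det M)) h; rewrite d1 => h'.
have mn0 : 0 < m ^+ n by rewrite exprn_gt0.
rewrite -[leLHS]mulr1; apply: le_trans (ler_wpM2l (ltW mn0) h') _.
rewrite exprVn; move: `|\det M| (n`!%:R) => u w.
by rewrite le_eqVlt; apply/orP; left; apply/eqP; field; rewrite gt_eqF.
Qed.

End CoerciveForms.

Section FeedbackState.
Context {R : realType} {d : measure_display} {Om : measurableType d}.
Context {N n : nat}.
Variables (P : probability Om R) (T : R) (W : 'I_N.+1 -> R -> Om -> R).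
Hypothesis T_gt0 : 0 < T.
Hypothesis P_complete : measure_is_complete P.
Hypothesis W_bm : independent_brownians P T W.
Variables (A C0 : 'M[R]_n).
Local Notation mu := (@lebesgue_measure R).
Local Notation TS := (timespace P).
Local Notation L2F := (L2F P T W).
Local Notation L2p := (L2p P T W).
Local Notation hom := (hom_state P T W A C0).
Variables (L : 'I_n -> 'I_n -> R -> R) (ML : R).
Hypothesis mL : forall i j, measurable_fun setT (L i j : measurableTypeR R -> R).
Hypothesis LM : forall i j t, `|L i j t| <= ML.

(** The deviation [v] is prescribed. The closed loop is solved for [z] first, the control is then
    defined as [v - L z], and uniqueness identifies [z] as its state; the opposite order would be
    circular. *)
Lemma feedback_state v : L2F v -> exists z c : process R Om n,
  [/\ L2F z, L2F c,
      lin_sproc P T W (fun j i => A j i) (loop (N := N) C0 L) (fun=> 0) (fun _ _ _ => 0)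
        (fun k => comp (noise0 v k)) (comp z),
      forall j t w, c t w j 0 = v t w j 0 - \sum_i L j i t * z t w i 0 &
      forall t, 0 <= t <= T -> {ae P, forall w, hom c t w = z t w}].
Proof.
move=> lv; have [cm [hA hC]] := @loop_bound R N n A C0 L ML LM.
have l0 : L2p (fun _ _ => 0) := L2p0 P T W.
have ln k j := L2F_comp T_gt0 P_complete W_bm (noise0_L2F T_gt0 P_complete W_bm k lv) j.
have mlp := measurable_loop (N := N) C0 mL.
have [x hx] := lin_sde_exists T_gt0 P_complete W_bm hA hC mlp (fun=> 0) (fun=> l0) ln.
have lx : forall l, L2p (x l) by case: hx.
have px := picard_step_sproc P_complete W_bm hA hC mlp (fun=> l0) ln lx hx.
pose z : process R Om n := fun t w => \col_j x j t w.
have zE : comp z = x.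
  by apply/funext => j; apply/funext => t; apply/funext => w; rewrite /comp mxE.
have lz : L2F z by apply: (comp_L2F T_gt0 P_complete W_bm) => j; rewrite zE.
pose c := deviation (fun j i t => - L j i t) v z.
have mNL i j : measurable_fun setT ((fun t => - L i j t) : measurableTypeR R -> R).
  by apply: measurableT_comp => //; exact: mL.
have NLM i j t : `|- L i j t| <= ML by rewrite normrN.
have lc : L2F c := deviation_L2F T_gt0 P_complete W_bm mNL NLM lv lz.
exists z, c; split => //; first by rewrite zE.
  move=> j t w; rewrite mxE -sumrN; congr (_ + _); apply: eq_bigr => i _; exact: mulNr.
apply: (vsol_unique T_gt0 P_complete W_bm (hom_stateP T_gt0 P_complete W_bm A C0 lc)
  (x0' := 0) (b' := fun _ _ => 0) (g' := noise0 c)) => //.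
split => // j; apply: sproc_congr (px j) => //; first by rewrite mxE.
- by move=> t w; rewrite zE /drift /comp mxE.
- move=> k t w; rewrite zE /diffu /loop /coef0 /noise0 /comp.
  case: (k == ord0).
    rewrite mxE addrCA addrC -big_split/=; congr (_ + _); apply: eq_bigr => i _.
    by rewrite mxE; ring.
  by rewrite !mxE !addr0; apply: eq_bigr => i _; rewrite !mxE.
- by move=> t w; rewrite zE.
Qed.

End FeedbackState.

(** * Short deterministic pulses *)

Section Pulse.
Context {R : realType} {d : measure_display} {Om : measurableType d} {J : finType}.
Variables (P : probability Om R) (T : R) (W : J -> R -> Om -> R).
Hypothesis T_gt0 : 0 < T.
Hypothesis P_complete : measure_is_complete P.
Hypothesis W_bm : independent_brownians P T W.
Local Notation mu := (@lebesgue_measure R).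
Local Notation TS := (timespace P).
Local Notation L2p := (L2p P T W).
Variables (s e : R).
Hypotheses (e_gt0 : 0 < e) (e_le : e <= s) (sT : s <= T).

Definition pulse (t : R) : R := \1_(`[s - e, s]%classic) t.

Lemma pulseE t : s - e <= t <= s -> pulse t = 1.
Proof. by move=> h; rewrite /pulse indicE mem_set//= in_itv. Qed.

Lemma pulse0 t : ~~ (s - e <= t <= s) -> pulse t = 0.
Proof. by move=> h; rewrite /pulse indicE memNset//= in_itv/=; exact/negP. Qed.

Lemma measurable_pulse : measurable_fun setT (pulse : measurableTypeR R -> R).
Proof. by apply: measurable_indic; exact: measurable_itv. Qed.

Lemma pulse_le1 t : `|pulse t| <= 1.
Proof. by rewrite /pulse indicE; case: (_ \in _); rewrite ?normr1 ?normr0. Qed.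

Lemma pulse_L2p : L2p (fun t _ => pulse t).
Proof.
have l1 : L2p (fun _ _ => 1).
  split; first by move=> t tT; exact: measurable_cst.
  apply: sq_win_cst; split; first exact: measurable_cst.
  by under eq_integral do rewrite expr1n; rewrite integral_cst//= probability_setT mule1 ltry.
have := L2pM measurable_pulse pulse_le1 l1.
by under [X in L2p X -> _]eq_fun do under eq_fun do rewrite mulr1.
Qed.

Lemma win_pulse z : win s (fun t (_ : Om) => pulse t) z = pulse z.1.
Proof.
rewrite /win; have [h|h] := boolP (s - e <= z.1 <= s); last by rewrite pulse0// mul0r.
rewrite pulseE// mul1r indicE mem_set//= in_itv/=; move/andP: h => [h ->].
by rewrite andbT (le_trans _ h)// subr_ge0.
Qed.

Lemma integral_pulse : (\int[mu]_(t in `[0%R, s]) (pulse t)%:E = e%:E)%E.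
Proof.
rewrite /pulse integral_indic//= setIidl.
  rewrite lebesgue_measure_itv/= lte_fin ltrBlDr ltrDl e_gt0 -EFinB.
  by congr EFin; ring.
by move=> t /=; rewrite !in_itv/= => /andP[h ->]; rewrite andbT (le_trans _ h)// subr_ge0.
Qed.

Lemma wnorm_pulse : wnorm P s (fun t _ => pulse t) = e.
Proof.
have [_ sp] := pulse_L2p; have ss : sq TS (win s (fun t (_ : Om) => pulse t)) := L2p_win pulse_L2p sT.
rewrite /wnorm (ip_win_time ss ss).
transitivity (\int[mu]_(t in `[0, s]) pulse t); last by rewrite /Rintegral integral_pulse.
rewrite [RHS]Rintegral_mkcond; apply: eq_Rintegral => t _.
under eq_Rintegral do rewrite win_pulse/=.
rewrite (_ : \int[P]__ _ = pulse t * pulse t); last first.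
  by rewrite /Rintegral (integral_cst P measurableT (pulse t * pulse t)%:E)/= probability_setT mule1.
rewrite patchE.
have [h|h] := boolP (s - e <= t <= s).
  rewrite pulseE// mulr1 mem_set//= in_itv/=; move/andP: h => [h ->].
  by rewrite andbT (le_trans _ h)// subr_ge0.
by rewrite pulse0// mulr0; case: ifP.
Qed.

(** The factor [pulse t] records that no input enters before [s - e]. Integrated over time it yields
    a second factor [e], so a state driven by the pulse has energy of order [e^2] up to time [s],
    against [e] for the pulse itself. *)
Lemma wnorm_pulse_le t : 0 <= t <= s -> wnorm P t (fun t _ => pulse t) <= e * pulse t.
Proof.
move=> /andP[t0 ts]; have [h|h] := leP (s - e) t.
  rewrite pulseE ?h// mulr1 -wnorm_pulse; apply: wnorm_mono => //.
  exact: (L2p_win pulse_L2p sT).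
rewrite pulse0 ?mulr0; last by rewrite negb_and -ltNge h.
rewrite le_eqVlt; apply/orP; left; apply/eqP; apply: ip0l => z.
rewrite /win; have [zt|zt] := boolP (0 <= z.1 <= t).
  rewrite pulse0 ?mul0r// negb_and -ltNge; apply/orP; left.
  by case/andP: zt => _ zt; exact: le_lt_trans zt h.
by rewrite indicE memNset ?mulr0//= in_itv/=; exact/negP.
Qed.

Lemma pulse_integrable : TS.-integrable setT (EFin \o (fun z : (measurableTypeR R * Om)%type => pulse z.1)) /\
  \int[TS]_z pulse z.1 = e.
Proof.
have ss : sq TS (win s (fun t (_ : Om) => pulse t)) := L2p_win pulse_L2p sT.
have h : (fun z => win s (fun t (_ : Om) => pulse t) z * win s (fun t (_ : Om) => pulse t) z) =
    fun z : (measurableTypeR R * Om)%type => pulse z.1.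
  by apply/funext => z; rewrite win_pulse -expr2 /pulse indic_sqr.
split; first by rewrite -h; exact: (integrable_mulsq ss ss).
by rewrite -[RHS]wnorm_pulse /wnorm /ip h.
Qed.

End Pulse.

Lemma ae_le_Rintegral {d} {T : measurableType d} {R : realType}
  (nu : {measure set T -> \bar R}) (f g : T -> R) :
  nu.-integrable setT (EFin \o f) -> nu.-integrable setT (EFin \o g) ->
  {ae nu, forall x, f x <= g x} -> \int[nu]_x f x <= \int[nu]_x g x.
Proof.
move=> fi gi fg; rewrite -subr_ge0 -RintegralB//.
have [/measurable_EFinP mf _] := integrableP _ _ _ fi.
have [/measurable_EFinP mg _] := integrableP _ _ _ gi.
have mB : measurable_fun setT (fun x => g x - f x) by exact: measurable_funB.
rewrite (@eq_ae_Rintegral _ _ _ nu (fun x => g x - f x) (fun x => `|g x - f x|) mB).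
- exact: Rintegral_ge0.
- exact: measurableT_comp.
- apply: (@filterS _ _ (ae_filter_ringOfSetsType nu) _ _ _ fg) => x h.
  by rewrite ger0_norm// subr_ge0.
Qed.

Section RiccatiNecessary.
Context {R : realType} {d : measure_display} {Om : measurableType d}.
Context {N n : nat}.
Variables (P : probability Om R) (T : R) (W : 'I_N.+1 -> R -> Om -> R).
Hypothesis T_gt0 : 0 < T.
Hypothesis P_complete : measure_is_complete P.
Hypothesis W_bm : independent_brownians P T W.
Variables (A C0 Gam Gam0 Q G R0 : 'M[R]_n).
Local Notation mu := (@lebesgue_measure R).
Local Notation TS := (timespace P).
Local Notation L2F := (L2F P T W).
Local Notation L2p := (L2p P T W).
Local Notation hom := (hom_state P T W A C0).
Local Notation J := (J_hom P T W A C0 Gam Gam0 Q G R0).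

(** Isolates the form of [K + R0] at [c]. Young's inequality splits the mixed term: its share in [c]
    is small with [rho], its share in [z] is charged to the state, which is of smaller order during
    a pulse. *)
Lemma running_cost_le (K X : 'M[R]_n) (z c : 'cV[R]_n) (B1 B2 rho : R) : K^T = K -> 0 < rho ->
  (forall i j, `|(C0^T *m K) i j| <= B1) -> (forall i j, `|(X + C0^T *m K *m C0) i j| <= B2) ->
  qform X z + qform K (C0 *m z + c) + qform R0 c <=
  (2 * n%:R * B1 * (4 * rho)^-1 + n%:R * B2) * sqnorm z + 2 * n%:R * B1 * rho * sqnorm c +
  qform (K + R0) c.
Proof.
move=> sK r0 h1 h2; rewrite (qformDv _ _ sK) qformD.
have e1 : bform K (C0 *m z) c = bform (C0^T *m K) z c by rewrite !bformE trmx_mul !mulmxA.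
have e2 : qform X z + qform K (C0 *m z) = qform (X + C0^T *m K *m C0) z.
  by rewrite qformD qform_mul.
have b1 := le_trans (ler_norm _) (bform_le z c h1 r0).
have b2 := le_trans (ler_norm _) (qform_le z h2).
rewrite e1; move: e2 b1 b2.
move: (bform _ z c) (qform X z) (qform K (C0 *m z)) (qform _ z) (qform K c) (qform R0 c).
move=> u1 u2 u3 u4 u5 u6 e2 b1 b2; lra.
Qed.

Variables K Kd Lm : R -> 'M[R]_n.
Hypothesis cK : mxwc 0 T K.
Hypothesis cKd : mxwc 0 T Kd.
Hypothesis cL : mxwc 0 T Lm.
Hypothesis KE : forall i j t, 0 <= t <= T ->
  K t i j = K 0 i j + \int[mu]_(s in `[0, t]) Kd s i j.
Hypothesis KT : K T = Xi Gam0 G - G.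
Hypothesis K_sym : forall t, 0 <= t <= T -> (K t)^T = K t.
Variable delta : R.
Hypothesis delta_gt0 : 0 < delta.
Hypothesis J_ge : forall c, L2F c -> delta * fine (L2norm2 P T c) <= J c.

(* The test control is a pulse v on [s - eps, s], followed by the optimal
   feedback on ]s, T], where the running cost then vanishes; since the state is
   of order sqrt eps on the pulse, the cost is eps * qform (K s + R0) v + o(eps). *)
Lemma coercive_at (s : R) : 0 < s <= T ->
  (forall t (z c : 'cV[R]_n), s < t <= T -> c + Lm t *m z = 0 ->
     qform (Kd t + A^T *m K t + K t *m A + (Xi Gam Q - Q)) z + qform (K t) (C0 *m z + c) +
     qform R0 c = 0) ->
  forall v, 3 / 4 * delta * sqnorm v <= qform (K s + R0) v.
Proof.
move=> /andP[s0 sT] closing v.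
have sT' : 0 <= s <= T by rewrite ltW.
have [->|v0] := eqVneq v 0.
  by rewrite /qform trmx0 !mul0mx mxE /sqnorm big1 ?mulr0// => i _; rewrite mxE expr0n.
have nv0 := sqnorm_gt0 v0; set nv := sqnorm v in nv0 *.
pose X t := Kd t + A^T *m K t + K t *m A + (Xi Gam Q - Q).
have cc (F : 'M[R]_n) : mxwc 0 T (fun=> F) := @mxwc_cst R 0 T n n F.
have cN1 : mxwc 0 T (fun t => C0^T *m K t) by apply: mxwcM.
have cN2 : mxwc 0 T (fun t => X t + C0^T *m K t *m C0).
  apply: mxwcD; last exact: mxwcM.
  apply: mxwcD; last exact: cc.
  by apply: mxwcD; [apply: mxwcD => //; exact: mxwcM|exact: mxwcM].
have [B1 B10 hB1] := mxwc_bounded cN1; have [B2 B20 hB2] := mxwc_bounded cN2.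
have nB1 : 0 <= n%:R * B1 by exact: mulr_ge0.
(* The loss allowed is delta / 4. Young's inequality, the variation of [K] on the pulse and the cost
   of the state each take delta / 16, which leaves 13/16 of delta. *)
pose rho := delta / (32 * (n%:R * B1 + 1)).
have rho0 : 0 < rho by rewrite divr_gt0// mulr_gt0// ltr_wpDl.
have rhoE : 2 * n%:R * B1 * rho <= delta / 16.
  rewrite (_ : _ * rho = n%:R * B1 / (n%:R * B1 + 1) * (delta / 16)); last first.
    by rewrite /rho; field; rewrite gt_eqF// ltr_wpDl.
  rewrite ler_piMl ?divr_ge0 ?(ltW delta_gt0)//.
  by rewrite ler_pdivrMr ?mul1r ?lerDl// ltr_wpDl.
pose c2 := 2 * n%:R * B1 * (4 * rho)^-1 + n%:R * B2.
have c20 : 0 <= c2.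
  apply: addr_ge0; last exact: mulr_ge0.
  by rewrite -mulrA -mulrA mulr_ge0// mulrA mulr_ge0// invr_ge0 mulr_ge0// ltW.
(* The feedback is switched on after [s] only. Before that the control is the pulse itself, and
   [closing] says nothing there about the gain [Lm]. *)
pose L j i t := cut 0 T (fun t => Lm t j i) t * \1_(`]s, T]%classic) t.
have [ML ML0 hML] := mxwc_bounded cL.
have mL i j : measurable_fun setT (L i j : measurableTypeR R -> R).
  apply: measurable_funM; first exact: (measurable_cut (@cL i j)).
  by apply: measurable_indic; exact: measurable_itv.
have LM i j t : `|L i j t| <= ML.
  rewrite /L indicE; case: (_ \in _); last by rewrite mulr0 normr0.
  by rewrite mulr1; apply: cut_le => // r rT; exact: hML.
have L0 i j t : t <= s -> L i j t = 0.
  by move=> ts; rewrite /L indicE memNset ?mulr0//= in_itv/= ltNge ts.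
have [k0 k00 hk] := loop_le T_gt0 P_complete W_bm A C0 mL LM.
have cq : {within `[0, T], continuous (fun t => qform (K t + R0) v)}.
  rewrite (_ : (fun t => _) = fun t => \sum_j \sum_i (K t + R0) j i * (v j 0 * v i 0)); last first.
    by apply/funext => t; rewrite qformE.
  apply: within_continuous_sum => j; apply: within_continuous_sum => i.
  by apply: wcM; [apply: mxwcD|exact: wc_cst].
have d16 : 0 < delta / 16 * nv by rewrite mulr_gt0// divr_gt0.
have [dl dl0 hdl] := (within_itv_continuousP _ _ _).1 cq s sT' _ d16.
have ck : 0 < c2 * k0 + 1 by rewrite ltr_wpDl// mulr_ge0.
(* Three constraints: the pulse fits into [[0, s]], the form of [K + R0] at [v] varies little on it,
   and the cost of the state, quadratic in [eps], stays below delta / 16 times the energy of the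
   pulse. *)
pose eps := Num.min s (Num.min (dl / 2) (delta / (16 * (c2 * k0 + 1)))).
have e0 : 0 < eps by rewrite !lt_min s0 !divr_gt0// mulr_gt0.
have es : eps <= s by rewrite ge_min lexx.
have edl : eps < dl.
  by rewrite /eps !gt_min; apply/orP; right; apply/orP; left; rewrite ltr_pdivrMr// ltr_pMr// ltr1n.
have ek : c2 * k0 * eps <= delta / 16.
  have h : eps <= delta / (16 * (c2 * k0 + 1)) by rewrite /eps !ge_min lexx !orbT.
  apply: (@le_trans _ _ ((c2 * k0 + 1) * eps)); first by rewrite [leRHS]mulrDl lerDl mul1r ltW.
  rewrite -ler_pdivlMl//; apply: le_trans h _; rewrite le_eqVlt; apply/orP; left; apply/eqP.
  by field; rewrite gt_eqF.
pose chi := pulse s eps; pose u t (_ : Om) := chi t.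
have lu : L2p u := pulse_L2p P T W s eps.
pose vx : process R Om n := fun t w => chi t *: v.
have vxE j : comp vx j = fun t w => v j 0 * u t w.
  by apply/funext => t; apply/funext => w; rewrite /comp /vx mxE mulrC.
have lvx : L2F vx.
  by apply: (comp_L2F T_gt0 P_complete W_bm) => j; rewrite vxE; exact: L2pZ.
have wv t : 0 <= t <= T -> \sum_j wnorm P t (comp vx j) = nv * wnorm P t u.
  move=> /andP[_ tT]; rewrite /nv /sqnorm mulr_suml; apply: eq_bigr => j _.
  have st : sq TS (win t u) := L2p_win lu tT.
  rewrite /wnorm vxE (_ : win t _ = fun y => v j 0 * win t u y); last first.
    by apply/funext => y; rewrite /win mulrA.
  by rewrite ipZl ?ipZr//; [ring|exact: sqZ].
have [z [c [lz lc pz cE zh]]] := feedback_state T_gt0 P_complete W_bm A C0 mL LM lvx.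
have cz := L2F_comp T_gt0 P_complete W_bm lz.
have ccomp := L2F_comp T_gt0 P_complete W_bm lc.
have hom_z := proj1 (hom_stateP T_gt0 P_complete W_bm A C0 lc).
have chom := L2F_comp T_gt0 P_complete W_bm hom_z.
(* One factor [eps] comes from the energy of the pulse, the other from the length of time during
   which the state has been away from 0. *)
have wz : \sum_j wnorm P s (comp z j) <= k0 * nv * eps * eps.
  rewrite -lee_fin; apply: le_trans (sum_wnorm_le (k := fun t => k0 * nv * eps * chi t) sT' cz _ _ _) _.
  - move=> t /andP[t0 ts] j; have tT : 0 <= t <= T by rewrite t0 (le_trans ts).
    exact: (sproc_sq T_gt0 P_complete W_bm (pz j) tT).
  - by apply: measurable_funM => //; exact: measurable_pulse.
  - move=> t /andP[t0 ts]; have tT : 0 <= t <= T by rewrite t0 (le_trans ts).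
    apply: le_trans (hk _ _ lvx lz pz t tT) _; rewrite wv// -!mulrA.
    apply: ler_wpM2l => //; apply: ler_wpM2l; first exact: ltW.
    by apply: (wnorm_pulse_le P W e0 es sT); rewrite t0.
  - have kn : 0 <= k0 * nv * eps by rewrite !mulr_ge0// ltW.
    under eq_integral do rewrite EFinM.
    rewrite ge0_integralZl//=.
    + by rewrite (integral_pulse e0 es) -EFinM.
    + by apply/measurable_EFinP; apply: measurable_funTS; exact: measurable_pulse.
    + by move=> t _; rewrite lee_fin /chi /pulse indicE.
have lo : nv * eps <= fine (L2norm2 P T c).
  rewrite (L2norm2_wnorm T_gt0 P_complete W_bm ccomp)/=.
  rewrite -(wnorm_pulse P W e0 es sT) -wv//; apply: ler_sum => j _.
  apply: (@le_trans _ _ (wnorm P s (comp c j))); last first.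
    by apply: wnorm_mono => //; case: (ccomp j).
  rewrite /wnorm (_ : win s (comp c j) = win s (comp vx j))//.
  apply/funext => -[t w]; rewrite /win /=; have [ts|ts] := boolP (0 <= t <= s); last first.
    by rewrite indicE memNset ?mulr0//= in_itv/=; exact/negP.
  rewrite /comp cE big1 ?subr0// => i _; rewrite L0 ?mul0r//; by case/andP: ts.
(* The running cost during the pulse apart from the state terms: delta / 16 pays for replacing [K t]
   by [K s], another delta / 16 for the share of [c] in the mixed term. *)
pose q1 := qform (K s + R0) v + delta / 8 * nv.
pose Gf (y : measurableTypeR R * Om) := q1 * chi y.1 +
  c2 * \sum_j win s (comp z j) y * win s (comp z j) y.
have sz j : sq TS (win s (comp z j)) := L2p_win (cz j) sT.
have izz j := integrable_mulsq (sz j) (sz j).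
have [is1 es1] := Rintegral_sum (index_enum _) izz.
have [ip1 ep1] := pulse_integrable P W e0 es sT.
have i1 := integrableRZ q1 ip1; have i2 := integrableRZ c2 is1.
have iG : TS.-integrable setT (EFin \o Gf) := integrableRD i1 i2.
have GE : \int[TS]_y Gf y = q1 * eps + c2 * \sum_j wnorm P s (comp z j).
  by rewrite /Gf RintegralD// !RintegralZl// es1 ep1.
have [iF JE] := J_hom_lyapunov T_gt0 P_complete W_bm A C0 Gam Q R0 cK cKd KE KT lc.
have zae : {ae TS, forall y, forall j, win T (comp (hom c) j) y = win T (comp z j) y}.
  apply: ae_foralln_fin => j; apply: (L2p_ae_win P_complete W_bm (chom j) (cz j)) => t tT.
  by apply: filterS (zh t tT) => w h; rewrite /comp h.
have up : J c <= \int[TS]_y Gf y.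
  rewrite JE; apply: ae_le_Rintegral => //.
  apply: (@filterS _ _ (ae_filter_ringOfSetsType TS) _ _ _ zae) => -[t w] zw.
  have sq0 : 0 <= c2 * \sum_j win s (comp z j) (t, w) * win s (comp z j) (t, w).
    by apply: mulr_ge0 => //; apply: sumr_ge0 => j _; rewrite -expr2 sqr_ge0.
  rewrite /Gf /win /=; have [tT|tT] := boolP (0 <= t <= T); last first.
    rewrite [X in X <= _](_ : _ = 0); last first.
      by rewrite indicE memNset ?mulr0//= in_itv/=; exact/negP.
    rewrite /chi pulse0 ?mulr0 ?add0r//; apply: contra tT => /andP[h1 h2].
    by rewrite (le_trans _ h1) ?subr_ge0// (le_trans h2).
  have -> : hom c t w = z t w.
    apply/matrixP => j i; rewrite (ord1 i); have := zw j.
    by rewrite /win /comp /= indicE mem_set/= ?in_itv// !mulr1.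
  rewrite [\1_(`[0, T]) t]indicE mem_set/= ?in_itv// mulr1.
  have [ts|st] := leP t s; last first.
    rewrite closing ?st; [|by case/andP: tT|]; last first.
      apply/matrixP => j i; rewrite (ord1 i) !mxE cE /vx /chi pulse0; last first.
        by rewrite negb_and -!ltNge st orbT.
      rewrite scale0r mxE sub0r addrC; apply/eqP; rewrite subr_eq0; apply/eqP.
      apply: eq_bigr => l _; rewrite /L cutE// indicE mem_set ?mulr1//= in_itv/= st.
      by case/andP: tT.
    rewrite /chi pulse0 ?mulr0 ?add0r//.
    by rewrite negb_and -!ltNge st orbT.
  have cv : c t w = chi t *: v.
    apply/matrixP => j i; rewrite (ord1 i) cE big1 ?subr0// => l _.
    by rewrite L0 ?mul0r.
  have t0s : 0 <= t <= s by rewrite ts andbT; case/andP: tT.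
  have zs : \sum_j comp z j t w * \1_(`[0, s]%classic) t * (comp z j t w * \1_(`[0, s]%classic) t) =
      sqnorm (z t w).
    by apply: eq_bigr => j _; rewrite indicE mem_set/= ?in_itv// !mulr1 -expr2.
  rewrite zs; have := running_cost_le (z t w) (c t w) (K_sym tT) rho0 (hB1 t tT) (hB2 t tT).
  move=> h; apply: le_trans h _; rewrite -/c2 -[leLHS]addrA [leLHS]addrC lerD2r cv.
  have [h|h] := boolP (s - eps <= t <= s); last first.
    by rewrite /chi pulse0// scale0r mulr0 /qform trmx0 !mul0mx mxE /sqnorm big1 ?mulr0 ?addr0// => i _; rewrite mxE expr0n.
  rewrite /chi pulseE// scale1r mulr1 -/nv /q1.
  have tsd : `|s - t| < dl.
    have [h1 h2] := andP h; rewrite ger0_norm ?subr_ge0//; apply: le_lt_trans edl; lra.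
  have := hdl t tT tsd; rewrite ltr_norml => /andP[h1 h2].
  have h3 := ler_wpM2r (ltW nv0) rhoE; lra.
have main := le_trans (ler_wpM2l (ltW delta_gt0) lo) (le_trans (J_ge lc) up).
rewrite GE in main.
have m1 := ler_wpM2l c20 wz.
have m2 := ler_wpM2r (ltW (mulr_gt0 nv0 e0)) ek.
have m3 : (delta * nv) * eps <= (q1 + delta / 16 * nv) * eps by lra.
rewrite ler_pM2r// in m3; move: m3; rewrite /q1; lra.
Qed.

End RiccatiNecessary.

Section RiccatiExistence.
Context {R : realType} {d : measure_display} {Om : measurableType d}.
Context {N n : nat}.
Variables (P : probability Om R) (T : R) (W : 'I_N.+1 -> R -> Om -> R).
Hypothesis T_gt0 : 0 < T.
Hypothesis P_complete : measure_is_complete P.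
Hypothesis W_bm : independent_brownians P T W.
Variables (A C0 Gam Gam0 Q G R0 : 'M[R]_n).
Hypothesis Q_sym : Q^T = Q.
Hypothesis G_sym : G^T = G.
Hypothesis R0_sym : R0^T = R0.

Lemma Xi_sym (F M : 'M[R]_n) : M^T = M -> (Xi F M - M)^T = Xi F M - M.
Proof. by move=> sM; rewrite XiE linearN/= !trmx_mul trmxK sM !mulmxA. Qed.

(* Hence the Riccati equation is affine in K up to a bounded function of the
   resolvent (K + R0)^-1. *)
Lemma riccati_resolvent (K : 'M[R]_n) : K + R0 \in unitmx ->
  C0^T *m R0 *m C0 - (R0 *m C0)^T *m invmx (K + R0) *m (R0 *m C0) =
  C0^T *m K *m C0 - C0^T *m K *m invmx (K + R0) *m K *m C0.
Proof.
move=> uM; set M := K + R0 in uM *.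
have KE : K = M - R0 by rewrite /M addrK.
have e : K *m invmx M *m K = K - R0 + R0 *m invmx M *m R0.
  rewrite {1 2}KE mulmxBl mulmxV// mulmxBl mul1mx mulmxBr -[R0 *m _ *m M]mulmxA mulVmx// mulmx1.
  by rewrite -KE opprB addrA addrAC.
rewrite trmx_mul R0_sym.
have -> : C0^T *m K *m invmx M *m K *m C0 = C0^T *m (K *m invmx M *m K) *m C0 by rewrite !mulmxA.
rewrite e !mulmxDr !mulmxDl mulmxN mulNmx !mulmxA.
move: (C0^T *m K *m C0) (C0^T *m R0 *m C0) (C0^T *m R0 *m invmx M *m R0 *m C0) => X Y Z.
by apply/matrixP => i j; rewrite !mxE; ring.
Qed.

Lemma riccati_necessary (delta : R) : 0 < delta ->
  (forall c, L2F P T W c ->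
    delta * fine (L2norm2 P T c) <= J_hom P T W A C0 Gam Gam0 Q G R0 c) ->
  exists2 K : R -> 'M[R]_n, riccati_solution T A C0 Gam Gam0 Q G R0 K &
    forall t, 0 <= t <= T -> pdef (K t + R0).
Proof.
move=> d0 hJ; have d2 : 0 < delta / 2 by rewrite divr_gt0.
pose S := C0^T *m R0 *m C0 + (Xi Gam Q - Q).
have sS : S^T = S.
  by rewrite linearD/= Xi_sym// !trmx_mul trmxK R0_sym mulmxA.
(* The levels of truncation are the bounds of [coercive_det] and [coercive_inv_le] for a form
   bounded below by delta / 2, so that at [ok] times the truncated inverse is the true one. *)
have c00 : 0 < (delta / 2) ^+ n / n`!%:R :> R.
  by rewrite divr_gt0 ?exprn_gt0// ltr0n fact_gt0.
have B0 : 0 <= (delta / 2)^-1 :> R by rewrite invr_ge0 ltW.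
have [K [Kd [I [[cK cKd cI] KT [K_sym dK KE] KdE IE]]]] :=
  truncated_riccati A C0 T_gt0 c00 B0 (Xi_sym Gam0 G_sym) sS R0_sym.
(* The gap between the two notions drives the continuation: [ok] keeps the truncation inactive,
   [strong] is what the pulse proves, and the difference delta / 4 absorbs a small change of
   time. *)
pose ok t := forall x, delta / 2 * sqnorm x <= qform (K t + R0) x.
pose strong t := forall x, 3 / 4 * delta * sqnorm x <= qform (K t + R0) x.
have ok_unit t : ok t -> K t + R0 \in unitmx := fun h => coercive_unit d2 h.
have ok_inv t : 0 <= t <= T -> ok t -> I t = invmx (K t + R0).
  by move=> tT h; apply: IE => // [|i j]; [exact: coercive_det|exact: coercive_inv_le].
have ok_riccati t : 0 <= t <= T -> ok t ->
    Kd t + A^T *m K t + K t *m A + (Xi Gam Q - Q) + C0^T *m K t *m C0 -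
    C0^T *m K t *m invmx (K t + R0) *m K t *m C0 = 0.
  move=> tT h; rewrite -addrA -(riccati_resolvent (ok_unit _ h)) KdE// (ok_inv _ tT h) /S.
  move: (K t *m A) (A^T *m K t) (Xi Gam Q - Q) (C0^T *m R0 *m C0) => X1 X2 X3 X4.
  by move: (_ *m _) => X5; apply/matrixP => i j; rewrite !mxE; ring.
have cL : mxwc 0 T (fun t => I t *m K t *m C0).
  by apply: mxwcM; [exact: mxwcM|exact: mxwc_cst].
have strong_at s : 0 < s <= T -> (forall t, s < t <= T -> ok t) -> strong s.
  move=> sT h; have [s0 _] := andP sT.
  apply: (coercive_at T_gt0 P_complete W_bm cK cKd cL KE KT K_sym d0 hJ sT) => t z c st cz.
  have tT : 0 <= t <= T.
    by case/andP: st => st ->; rewrite andbT ltW// (lt_trans s0).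
  have hok := h t st.
  rewrite (completed_square (X := Kd t + A^T *m K t + K t *m A + (Xi Gam Q - Q)) z c
    (K_sym t tT) R0_sym (ok_unit _ hok) (ok_riccati _ tT hok)).
  by rewrite -(ok_inv _ tT hok) cz /qform trmx0 !mul0mx mxE.
(* Both implications are used: the first at the supremum of the bad times, to reach earlier times,
   and the second at [s = 0], from a later time. *)
have near s : 0 <= s <= T -> exists2 dl, 0 < dl & forall t, 0 <= t <= T -> `|s - t| < dl ->
    (strong s -> ok t) /\ (strong t -> ok s).
  move=> sT; pose e := delta / (4 * (n%:R + 1)).
  have n1 : 0 < n%:R + 1 :> R by rewrite ltr_wpDl.
  have e0 : 0 < e by rewrite divr_gt0// mulr_gt0.
  have cm : {within `[0, T], continuous (fun t => mnorm (K s - K t))}.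
    by apply: wc_mnorm; apply: mxwcD; [exact: mxwc_cst|exact: mxwcN].
  have [dl dl0 h] := (within_itv_continuousP _ _ _).1 cm s sT e e0.
  exists dl => // t tT st; have := h t tT st.
  have -> : mnorm (K s - K s) = 0.
    by rewrite subrr /mnorm big1// => p _; rewrite mxE normr0.
  rewrite sub0r normrN ger0_norm ?mnorm_ge0// => m1.
  have hq x : `|qform (K s - K t) x| <= delta / 4 * sqnorm x.
    apply: le_trans (qform_le x (le_mnorm _)) _; apply: ler_wpM2r; first exact: sqnorm_ge0.
    apply: (@le_trans _ _ ((n%:R + 1) * e)).
      by apply: ler_pM => //; [exact: mnorm_ge0|rewrite lerDl|exact: ltW].
    by rewrite le_eqVlt; apply/orP; left; apply/eqP; rewrite /e; field; rewrite gt_eqF.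
  have qE x : qform (K s + R0) x = qform (K t + R0) x + qform (K s - K t) x.
    rewrite -qformD; congr qform; rewrite addrACA.
    by apply/matrixP => i j; rewrite !mxE; ring.
  split=> hs x; have := hs x; have := hq x; rewrite ler_norml => /andP[h1 h2]; have := qE x; lra.
have ok_pos t : 0 < t <= T -> ok t.
  move=> tT; apply: contrapT => nok; have [t0 t_T] := andP tT.
  (* All times after the supremum [s] of the bad times are [ok], hence [s] is [strong] and the times
     near it are [ok]; yet some bad time lies arbitrarily close to [s]. *)
  pose E := [set r | 0 <= r <= T /\ ~ ok r].
  have Et : E t by split => //; rewrite ltW.
  have hE : has_sup E by split; [exists t|exists T => r [/andP[]]].
  pose s := sup E.
  have ts : t <= s by exact: (ub_le_sup hE.2 Et).
  have sT : s <= T by apply: ge_sup; [exists t|move=> r [/andP[]]].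
  have s0 : 0 < s by exact: lt_le_trans ts.
  have ss : 0 < s <= T by rewrite s0.
  have ss' : 0 <= s <= T by rewrite ltW.
  have st : strong s.
    apply: strong_at => // r /andP[sr rT]; apply: contrapT => nr.
    have rE : E r by split => //; rewrite rT andbT ltW// (lt_trans s0).
    have : r <= s by exact: (ub_le_sup hE.2 rE).
    by rewrite leNgt sr.
  have [dl dl0 hdl] := near s ss'.
  have [r [rT nr] sr] := sup_adherent dl0 hE.
  have rs : r <= s by exact: (ub_le_sup hE.2 (conj rT nr)).
  apply: nr; apply: (hdl r rT _).1 => //.
  by rewrite ger0_norm ?subr_ge0// ltrBlDr addrC -ltrBlDr.
(* No pulse fits before time 0, so this end point is reached from [strong] at a small positive
   time. *)
have ok0 : ok 0.
  have z0 : 0 <= (0 : R) <= T by rewrite lexx ltW.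
  have [dl dl0 hdl] := near 0 z0.
  pose t := Num.min (dl / 2) T.
  have t0 : 0 < t by rewrite lt_min T_gt0 divr_gt0.
  have tT : t <= T by rewrite ge_min lexx orbT.
  have tdl : t < dl by rewrite gt_min ltr_pdivrMr// ltr_pMr// ltr1n.
  have tT' : 0 <= t <= T by rewrite ltW.
  apply: (hdl t tT' _).2; first by rewrite sub0r normrN gtr0_norm.
  apply: strong_at; first by rewrite t0.
  by move=> r /andP[tr rT]; apply: ok_pos; rewrite rT (lt_trans t0).
have ok_all t : 0 <= t <= T -> ok t.
  by move=> /andP[]; rewrite le_eqVlt => /predU1P[<-//|t0 tT]; apply: ok_pos; rewrite t0.
exists K; last first.
  move=> t tT; split; first by rewrite linearD/= K_sym// R0_sym.
  by move=> x x0; apply: lt_le_trans (ok_all t tT x); rewrite mulr_gt0// sqnorm_gt0.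
split => //; first by move=> t tT i j; case: (dK t tT i j).
move=> t tT; have tT' : 0 <= t <= T by case/andP: tT => h1 h2; rewrite !ltW.
have -> : \matrix_(i, j) (fun s => K s i j)^`()%classic t = Kd t.
  by apply/matrixP => i j; rewrite mxE; case: (dK t tT i j).
have := ok_riccati t tT' (ok_all t tT').
move: (K t *m A) (A^T *m K t) (C0^T *m K t *m C0) (Xi Gam Q) => X1 X2 X3 X4.
move: (C0^T *m _ *m _ *m _ *m _) => X5 <-.
by apply/matrixP => i j; rewrite !mxE; ring.
Qed.

End RiccatiExistence.

Theorem proposition2 (R : realType) (d : measure_display)
  (Om : measurableType d) (P : probability Om R)
  (complete : measure_is_complete P)
  (T : R) (T_gt0 : 0 < T)
  (n r N : nat) (n_gt0 : (0 < n)%N) (r_gt0 : (0 < r)%N) (N_gt0 : (0 < N)%N)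
  (W : 'I_N.+1 -> R -> Om -> R) (W_bm : independent_brownians P T W)
  (A C0 Gam Gam0 : 'M[R]_n) (B D D0 : 'M[R]_(n, r))
  (Q G : 'M[R]_n) (Rw : 'M[R]_r) (R0 : 'M[R]_n)
  (Q_ge0 : psdef Q) (G_ge0 : psdef G) (Rw_gt0 : pdef Rw) (R0_gt0 : pdef R0)
  (f sigma eta : process R Om n)
  (f_L2 : L2F P T W f) (sigma_L2 : L2F P T W sigma) (eta_L2 : L2F P T W eta)
  (eta0 : Om -> 'cV[R]_n) (eta0_L2 : L2_FT P T W eta0)
  (x0 : 'cV[R]_n)
  (u : 'I_N -> process R Om r) (u_L2 : forall i, L2F P T W (u i)) :
  let stmt_i :=
    uniformly_convex P T W
      (J_soc P T W A C0 Gam Gam0 B D D0 Q G R0 f sigma eta eta0 x0 u) in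
  let stmt_ii :=
    uniformly_convex P T W (J_hom P T W A C0 Gam Gam0 Q G R0) in
  let stmt_iii :=
    exists2 K : R -> 'M[R]_n,
      riccati_solution T A C0 Gam Gam0 Q G R0 K &
      forall t, 0 <= t <= T -> pdef (K t + R0) in
  (stmt_i <-> stmt_ii) /\ (stmt_ii <-> stmt_iii).
Proof.
move=> stmt_i stmt_ii stmt_iii.
pose J := J_hom P T W A C0 Gam Gam0 Q G R0.
pose coercive := exists2 delta, 0 < delta &
  forall c, L2F P T W c -> delta * fine (L2norm2 P T c) <= J c.
have iE : stmt_i <-> coercive.
  apply: (uniformly_convexE T_gt0 complete W_bm (kappa := 2^-1 * N%:R)).
    by rewrite mulr_gt0 ?invr_gt0 ?ltr0n.
  move=> a b lam la lb; exact: (J_soc_mix T_gt0 complete W_bm A C0 Gam Gam0 B D D0 Q G R0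
    x0 N_gt0 f_L2 sigma_L2 eta_L2 eta0_L2 u_L2 lam la lb).
have iiE : stmt_ii <-> coercive.
  apply: (uniformly_convexE T_gt0 complete W_bm ltr01) => a b lam la lb.
  exact: (J_hom_mix T_gt0 complete W_bm A C0 Gam Gam0 Q G R0 lam la lb).
have [Q_sym _] := Q_ge0; have [G_sym _] := G_ge0; have [R0_sym _] := R0_gt0.
split; first by rewrite iE iiE.
rewrite iiE; split=> [[delta d0 hJ]|[K hK pK]].
  exact: (riccati_necessary T_gt0 complete W_bm Q_sym G_sym R0_sym d0 hJ).
exact: (riccati_sufficient T_gt0 complete W_bm n_gt0 R0_sym hK pK).
Qed.
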